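(* Let $\gamma_a,\gamma_s,\kappa_a,\kappa_s,\sigma_B,\varepsilon_a>0$, $\lambda\ge 0$. Let $\beta_a,\beta_s\in W^{1,\infty}(\mathbb R)$ be nondecreasing. Let $q\in C^{\theta_0}(I)\cap L^\infty(I)$ for some $\theta_0\in(0,1)$, $q\ge0$, and let $r$ be positive, bounded and globally Lipschitz on $(0,+\infty)$. For every initial value $\mathbf T^0\in\mathbf V$, the problem $\mathbf T'(t)=\mathbf A\mathbf T(t)+\mathbf G(t,\mathbf T(t))$, $\mathbf T(0)=\mathbf T^0$, has a unique maximal (mild) solution $\mathbf T$, defined on an interval $[0,\mathcal T^*(\mathbf T^0))$. Moreover, the following alternative holds: $$\mathcal T^*(\mathbf T^0)=+\infty\quad\text{or}\quad\Big[\mathcal T^*(\mathbf T^0)<+\infty\ \text{ and }\ \limsup_{t\to\mathcal T^*(\mathbf T^0)}\|\mathbf T(t)\|_{\mathbf V}=+\infty\Big].$$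
   Context: Let $I=(-1,1)$, $\rho(x)=1-x^2$, $H=L^2(I)$, $V=\{u\in H: u \text{ locally absolutely continuous in } I,\ \sqrt{\rho}\,u'\in L^2(I)\}$ with norm $\|u\|_V^2=\|u\|_{L^2(I)}^2+\|\sqrt\rho\,u'\|_{L^2(I)}^2$, and $D(A)=\{u\in H: u\text{ locally absolutely continuous in } I,\ \rho u'\in H^1_0(I)\}$, $Au=(\rho u')'$. The operator $A$ is self-adjoint and dissipative on $H$ and generates an analytic semigroup of contractions. Set $\mathbf H=H\times H$, $\mathbf V=V\times V$, $\mathbf D(\mathbf A)=D(A)\times D(A)$, $\mathbf A(u_a,u_s)=(\kappa_aAu_a,\kappa_sAu_s)$. The map $\mathbf G:[0,+\infty)\times\mathbf V\to\mathbf H$ is $$\mathbf G(t,(u_a,u_s))=\begin{pmatrix}\frac1{\gamma_a}\left[-\lambda(u_a-u_s)+\varepsilon_a\sigma_B|u_s|^3u_s-2\varepsilon_a\sigma_B|u_a|^3u_a+r(t)\,q\,\beta_a(u_a)\right]\\ \frac1{\gamma_s}\left[-\lambda(u_s-u_a)-\sigma_B|u_s|^3u_s+\varepsilon_a\sigma_B|u_a|^3u_a+r(t)\,q\,\beta_s(u_s)\right]\end{pmatrix}$$ (with $r(0)$ the continuous extension of $r$). A mild solution on $[0,\mathcal T]$ is a function $\mathbf T\in C([0,\mathcal T];\mathbf V)$ with $\mathbf T(t)=e^{t\mathbf A}\mathbf T^0+\int_0^te^{(t-s)\mathbf A}\mathbf G(s,\mathbf T(s))\,ds$. A maximal solution is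 a function on an interval $[0,\mathcal T^* )$ whose restriction to each $[0,\mathcal T]$, $\mathcal T<\mathcal T^*$, is a mild solution, and which cannot be extended to a larger interval with this property. *)

(* Defs.v *)
From HB Require Import structures.
From mathcomp Require Import all_boot all_order all_algebra.
From mathcomp Require Import all_classical all_reals all_analysis.
Import Order.TTheory GRing.Theory Num.Theory.
Import numFieldNormedType.Exports.

Set Implicit Arguments.
Unset Strict Implicit.
Unset Printing Implicit Defensive.

Local Open Scope ring_scope.
Local Open Scope classical_set_scope.

(* Elements of function spaces are represented by functions on the whole line,
   of which only the values on I = (-1, 1), [Iset] below, matter: an element of L^2(I) is a function
   whose extension by zero from I lies in the library's [Lfun _ 2], equality in
   L^2(I) being equality almost everywhere in I. An element of V or D(A) is
   given by its (locally absolutely continuous) representative. L^p uses Borel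
   representatives, since the library's Lebesgue measure is on the Borel
   sets. *)

Section FunctionSpaces.
Context {R : realType}.
Implicit Types (f g u v z phi : R -> R) (J : set R).

Local Notation mu := (@lebesgue_measure R).

Definition Iset : set R := `]-1, 1[.

Definition rho (x : R) : R := 1 - x ^+ 2.

Definition in_L2 f : Prop := f \_ Iset \in Lfun mu 2%:E.

Definition eq_L2 f g : Prop := f = g %[ae mu in Iset].

(* On functions outside L^2(I), [fine] may turn an infinite norm into 0; every
   use below comes with membership. *)
Definition norm_L2 f : R := fine ('N[mu]_2%:E[EFin \o (f \_ Iset)]).

Definition in_Linfty J f : Prop := f \_ J \in Lfun mu +oo%E.

Definition abs_continuous (a b : R) u : Prop :=
  forall e : R, 0 < e -> exists2 d : R, 0 < d &
    forall (n : nat) (s t : 'I_n -> R),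
      (forall i, [/\ a <= s i, s i <= t i & t i <= b]) ->
      trivIset setT (fun i => `]s i, t i[%classic) ->
      \sum_(i < n) (t i - s i) < d ->
      \sum_(i < n) `|u (t i) - u (s i)| < e.

Definition loc_abs_continuous u : Prop :=
  forall a b : R, -1 < a -> a <= b -> b < 1 -> abs_continuous a b u.

(* An absolutely continuous function is differentiable almost everywhere, so
   the total function [derive1 u] represents the a.e. defined derivative u'. *)
Definition in_V u : Prop :=
  [/\ in_L2 u, loc_abs_continuous u &
      in_L2 (fun x => Num.sqrt (rho x) * derive1 u x)].

Definition norm_V u : R :=
  Num.sqrt (norm_L2 u ^+ 2 +
            norm_L2 (fun x => Num.sqrt (rho x) * derive1 u x) ^+ 2).

Definition C1_compact J phi : Prop :=
  [/\ forall x : R, derivable phi x 1, continuous (derive1 phi) &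
      exists2 K : set R, compact K /\ K `<=` J & forall x, ~ K x -> phi x = 0].

(* z is in H^1_0(I), the closure of C^1_c(I) in H^1(I), and g is its weak
   derivative. *)
Definition H10_deriv z g : Prop :=
  [/\ in_L2 z, in_L2 g &
      exists phi : nat -> R -> R,
        [/\ forall n, C1_compact Iset (phi n),
            norm_L2 (phi n - z) @[n --> \oo] --> 0 &
            norm_L2 (derive1 (phi n) - g) @[n --> \oo] --> 0]].

(* The graph of A in L^2(I) x L^2(I): the class of u contains an element v of
   D(A), and g = (rho v')'. *)
Definition A_graph u g : Prop :=
  exists2 v, eq_L2 u v &
    [/\ in_L2 v, loc_abs_continuous v &
        H10_deriv (fun x => rho x * derive1 v x) g].

Definition in_W1infty (beta : R -> R) : Prop :=
  in_Linfty setT beta /\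
  exists2 g : R -> R, in_Linfty setT g &
    forall phi, C1_compact setT phi ->
      \int[mu]_x (beta x * derive1 phi x) = - \int[mu]_x (g x * phi x).

(* C^theta of the open interval: Hölder continuity on its compact
   subintervals. *)
Definition loc_holder (theta : R) (q : R -> R) : Prop :=
  forall a b : R, -1 < a -> a <= b -> b < 1 ->
    exists C : R, forall x y : R, a <= x <= b -> a <= y <= b ->
      `|q x - q y| <= C * `|x - y| `^ theta.

End FunctionSpaces.

Notation state R := ((R -> R) * (R -> R))%type.

Section ProductSpaces.
Context {R : realType}.

Implicit Types (u v w z : state R) (T : R -> state R).

Local Notation mu := (@lebesgue_measure R).

Definition in_H2 u : Prop := in_L2 u.1 /\ in_L2 u.2.
Definition eq_H2 u v : Prop := eq_L2 u.1 v.1 /\ eq_L2 u.2 v.2.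
Definition norm_H2 u : R := Num.sqrt (norm_L2 u.1 ^+ 2 + norm_L2 u.2 ^+ 2).

Definition in_V2 u : Prop := in_V u.1 /\ in_V u.2.
Definition norm_V2 u : R := Num.sqrt (norm_V u.1 ^+ 2 + norm_V u.2 ^+ 2).

Definition A2_graph (kappa_a kappa_s : R) u w : Prop :=
  exists z : state R, [/\ A_graph u.1 z.1, A_graph u.2 z.2 &
    eq_H2 w (kappa_a *: z.1, kappa_s *: z.2)].

(* [S] is the strongly continuous semigroup of bounded linear operators on
   H x H whose infinitesimal generator has the given graph. *)
Definition semigroup_generated_by (graph : state R -> state R -> Prop)
    (S : R -> state R -> state R) : Prop :=
  [/\ (forall t u, 0 <= t -> in_H2 u -> in_H2 (S t u)) /\
      (forall t (c : R) u v, 0 <= t -> in_H2 u -> in_H2 v ->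
         eq_H2 (S t (c *: u + v)) (c *: S t u + S t v)),
      (forall t, 0 <= t -> exists M : R,
         forall u, in_H2 u -> norm_H2 (S t u) <= M * norm_H2 u),
      (forall u, in_H2 u -> eq_H2 (S 0 u) u) /\
      (forall s t u, 0 <= s -> 0 <= t -> in_H2 u ->
         eq_H2 (S (s + t) u) (S s (S t u))),
      (forall u, in_H2 u -> norm_H2 (S t u - u) @[t --> 0^'+] --> 0) &
      (forall u w, in_H2 u -> in_H2 w ->
         (norm_H2 (h^-1 *: (S h u - u) - w) @[h --> 0^'+] --> 0)
         <-> graph u w)].

(* [w] is the Bochner integral over [0, t] of [f] with values in H x H: there
   are simple functions [sum_i 1_(A n i) h_(n, i)] converging to [f] a.e. and
   in mean, whose integrals converge to [w]. *)
Definition is_bochner_integral (t : R) (f : R -> state R) w : Prop :=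
  [/\ forall s, 0 <= s <= t -> in_H2 (f s), in_H2 w &
    exists (k : nat -> nat) (A : forall n, 'I_(k n) -> set R)
           (h : forall n, 'I_(k n) -> state R),
      let simple n s : state R := \sum_(i < k n) (\1_(A n i) s : R) *: h n i in
      [/\ forall n i, [/\ measurable (A n i), A n i `<=` `[0, t]
                        & in_H2 (h n i)],
          {ae mu, forall s, 0 <= s <= t ->
            norm_H2 (f s - simple n s) @[n --> \oo] --> 0},
          (\int[mu]_(s in `[0%R, t]) (norm_H2 (f s - simple n s))%:E)%E
            @[n --> \oo] --> 0%E &
          norm_H2 (\sum_(i < k n) fine (mu (A n i)) *: h n i - w)
            @[n --> \oo] --> 0]].

(* [T] belongs to C([0, tau]; V x V) and satisfies the variation of constants
   formula, where [S] is the semigroup and [G] the nonlinearity. *)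
Definition mild_solution (S G : R -> state R -> state R) (u0 : state R)
    (tau : R) T : Prop :=
  [/\ forall t, 0 <= t <= tau -> in_V2 (T t),
      forall t, 0 <= t <= tau ->
        norm_V2 (T s - T t) @[s --> within `[0, tau] (nbhs t)] --> 0 &
      forall t, 0 <= t <= tau ->
        exists2 w, is_bochner_integral t (fun s => S (t - s) (G s (T s))) w
                 & eq_H2 (T t) (S t u0 + w)].

(* Only the values of [T] on [0, tau) matter. *)
Definition local_solution S G u0 (tau : \bar R) T : Prop :=
  forall tau0 : R, 0 < tau0 -> (tau0%:E < tau)%E -> mild_solution S G u0 tau0 T.

Definition agree_on (tau : \bar R) T T' : Prop :=
  forall t : R, 0 <= t -> (t%:E < tau)%E -> eq_H2 (T t) (T' t).

Definition maximal_solution S G u0 (tau : \bar R) T : Prop :=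
  [/\ (0 < tau)%E, local_solution S G u0 tau T &
      forall (tau' : \bar R) T', (tau < tau')%E -> agree_on tau T T' ->
        ~ local_solution S G u0 tau' T'].

(* [r], extended to 0 by continuity. *)
Definition ext0 (r : R -> R) (t : R) : R :=
  if t == 0 then lim (r s @[s --> 0^'+]) else r t.

Definition reaction (gamma_a gamma_s lambda sigma_B eps_a : R)
    (beta_a beta_s q r : R -> R) (t : R) (u : state R) : state R :=
  let ua := u.1 in let us := u.2 in
  (fun x => gamma_a^-1 *
     (- lambda * (ua x - us x) + eps_a * sigma_B * `|us x| ^+ 3 * us x
      - 2 * eps_a * sigma_B * `|ua x| ^+ 3 * ua x
      + ext0 r t * q x * beta_a (ua x)),
   fun x => gamma_s^-1 *
     (- lambda * (us x - ua x) - sigma_B * `|us x| ^+ 3 * us x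
      + eps_a * sigma_B * `|ua x| ^+ 3 * ua x
      + ext0 r t * q x * beta_s (us x))).

End ProductSpaces.

(* Main.v *)
From HB Require Import structures.
From mathcomp Require Import all_boot all_order all_algebra.
From mathcomp Require Import all_classical all_reals all_analysis.
From mathcomp Require Import measurable_realfun.
From mathcomp Require Import ring lra.
Require Import Defs.
Import Order.TTheory GRing.Theory Num.Theory.
Import numFieldNormedType.Exports.

Set Implicit Arguments.
Unset Strict Implicit.
Unset Printing Implicit Defensive.

Local Open Scope ring_scope.
Local Open Scope classical_set_scope.

(** The operator (u_a, u_s) |-> (kappa_a A u_a, kappa_s A u_s) is represented by the closed form
<Du, Dv>, where D u = (sqrt kappa_a sqrt rho u_a', sqrt kappa_s sqrt rho u_s') has domain V x V.
Two facts then make the equation a locally Lipschitz perturbation of a linear flow.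

Smoothing ([duhamel_energy]): the Duhamel integral over a time interval of length d of a forcing
bounded by M in H lies in V, with |D w|^2 <= d M^2. Hence its norm in V is at most
(d + sqrt d) M. Orbits of elements of V stay in V, with nonincreasing norm, and are continuous
there ([sg_V], [sg_V_cvg0]).

Local Lipschitz continuity ([quart_lipschitz], [reaction_lipschitz]): an element u of V satisfies
u(x)^2 <= C (1 + |artanh x|) |u|_V^2 ([V_embedding]), because 1/rho is the derivative of artanh.
Since (1 + |artanh x|)^2 is square integrable, |u|^3 u is in L^2 and is Lipschitz from the balls
of V to L^2. A monotone function with bounded weak derivative is Lipschitz
([W1infty_lipschitz]), and so is the extension of r to time 0 ([ext0_lipschitz]).

Picard iteration in C([a, a + d]; V) therefore converges for some d that depends only on a bound
for the initial norm and on the time horizon ([mild_local]). Uniqueness on short intervals spreads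
to common intervals of existence ([mild_unique]), solutions can be glued ([mild_glue]), and the
supremum of the existence times is the maximal time ([mild_maximal]): if it is finite and the norm
stayed bounded near it, one more step of length d would cross it.

The semigroup is known only through the graph of its generator. What is extracted from the graph
is one implication: if (x, y) belongs to it, then x is in V and <y, v> = - <D x, D v> for all v in
V ([A_graph_green]); this rests on a Hardy inequality for functions in H^1_0 and on the
fundamental theorem of calculus for absolutely continuous functions ([lac_FTC]). The generator is
densely defined, so contractivity, self-adjointness and, through the convexity of the
autocorrelation t |-> <S(t) x, x>, all the estimates in V follow without spectral theory.

The abstract argument takes place in a Hilbert space of classes of pairs of functions
([hspace]), where integrals are defined by testing against vectors ([wint]); a Bochner integral of
a continuous path is such a weak integral and conversely ([wint_bochner], [bochner_wint]), and
mild solutions correspond under passage to classes ([mild_cls]). *)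

(** * Real-valued integrals on intervals *)

Section RealIntegrals.
Context {R : realType}.
Local Notation mu := (@lebesgue_measure R).
Lemma integrable_addr (D : set R) (f g : R -> R) : measurable D ->
  mu.-integrable D (EFin \o f) -> mu.-integrable D (EFin \o g) ->
  mu.-integrable D (EFin \o (fun x => f x + g x)).
Proof. by move=> mD fi gi; exact: (integrableD _ fi gi). Qed.

Lemma integrable_subr (D : set R) (f g : R -> R) : measurable D ->
  mu.-integrable D (EFin \o f) -> mu.-integrable D (EFin \o g) ->
  mu.-integrable D (EFin \o (fun x => f x - g x)).
Proof. by move=> mD fi gi; exact: (integrableB _ fi gi). Qed.

Lemma integrable_mulr (D : set R) k (f : R -> R) : measurable D ->
  mu.-integrable D (EFin \o f) -> mu.-integrable D (EFin \o (fun x => k * f x)).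
Proof. by move=> mD fi; exact: (integrableZl _ k fi). Qed.

Lemma integrable_bounded (D : set R) (f g : R -> R) : measurable D ->
  measurable_fun D f -> mu.-integrable D (EFin \o g) ->
  (forall x, D x -> `|f x| <= g x) ->
  mu.-integrable D (EFin \o f).
Proof.
move=> mD mf gi fg; apply: (le_integrable _ _ _ gi) => //.
  exact/measurable_EFinP.
by move=> x Dx /=; rewrite lee_fin; apply: le_trans (fg _ Dx) (ler_norm _).
Qed.

Lemma integrable_itv_cst (a b k : R) : mu.-integrable `[a, b] (EFin \o cst k).
Proof.
apply/integrableP; split; first exact/measurable_EFinP.
rewrite /= integral_cst//= lebesgue_measure_itv/= lte_fin.
by case: ifP => _; rewrite -?EFinB -?EFinM ?mule0 ?ltry.
Qed.

Lemma Rintegral_itv_cst (a b k : R) : a <= b ->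
  \int[mu]_(x in `[a, b]) (cst k x) = k * (b - a).
Proof.
move=> ab; rewrite Rintegral_cst//; congr (_ * _).
rewrite -[RHS]/(fine (b - a)%:E); congr fine.
apply: etrans (lebesgue_measure_itv _) _; rewrite /= lte_fin.
by move: ab; rewrite le_eqVlt => /predU1P[->|->]; rewrite ?ltxx ?subrr -?EFinB.
Qed.

Lemma integrable_itv_bounded (a b M : R) (f : R -> R) :
  measurable_fun `[a, b] f -> (forall x, a <= x <= b -> `|f x| <= M) ->
  mu.-integrable `[a, b] (EFin \o f).
Proof.
move=> mf fM; apply: (@integrable_bounded _ f (cst M)) => //.
exact: integrable_itv_cst.
Qed.

Lemma integrable_normr (D : set R) (f : R -> R) : measurable D ->
  mu.-integrable D (EFin \o f) -> mu.-integrable D (EFin \o (fun x => `|f x|)).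
Proof. by move=> mD fi; exact: (integrable_abse fi). Qed.

Lemma within_continuous_integrable (a b : R) (f : R -> R) :
  {within `[a, b], continuous f} -> mu.-integrable `[a, b] (EFin \o f).
Proof.
move=> cf; have [ab|ba] := leP a b.
  by apply: continuous_compact_integrable => //; exact: segment_compact.
by rewrite set_itv_ge; [exact: integrable_set0 | rewrite bnd_simp -ltNge].
Qed.
Lemma integrable_itv_cat a b c (f : R -> R) : a <= c <= b ->
  mu.-integrable `[a, c] (EFin \o f) -> mu.-integrable `[c, b] (EFin \o f) ->
  mu.-integrable `[a, b] (EFin \o f).
Proof.
move=> /andP[ac cb] f1 f2.
have U : `[a, b]%classic = `[a, c[%classic `|` `[c, b]%classic :> set R.
  by rewrite -itv_bndbnd_setU// bnd_simp.
have f1' : mu.-integrable `[a, c[ (EFin \o f).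
  by apply: integrableS f1 => //; apply: subset_itvl; rewrite bnd_simp.
have /integrableP[m1 i1] := f1'; have /integrableP[m2 i2] := f2.
have mU : measurable_fun (`[a, c[%classic `|` `[c, b]%classic) (EFin \o f).
  by apply/measurable_funU.
rewrite U; apply/integrableP; split => //.
rewrite ge0_integral_setU//; first exact: lte_add_pinfty.
  exact: measurableT_comp.
apply/disj_setPS => x []/=; rewrite !in_itv/= => /andP[_ xc] /andP[cx _].
by move: xc; rewrite ltNge cx.
Qed.

Lemma Rintegral_itv_cat a b c (f : R -> R) : a <= c <= b ->
  mu.-integrable `[a, b] (EFin \o f) ->
  \int[mu]_(x in `[a, b]) f x =
    \int[mu]_(x in `[a, c]) f x + \int[mu]_(x in `[c, b]) f x.
Proof.
move=> /andP[ac cb] fi; have := @Rintegral_itvB R f (BLeft a) (BRight b) c fi.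
rewrite !bnd_simp => /(_ ac cb) E.
rewrite -(@Rintegral_itv_obnd_cbnd _ c) -?E; first by rewrite addrCA subrr addr0.
by apply: integrableS fi => //; apply: subset_itvr; rewrite bnd_simp.
Qed.

Lemma Rintegral_shift (a b c : R) (f : R -> R) : a <= b -> continuous f ->
  \int[mu]_(x in `[a + c, b + c]) f x = \int[mu]_(x in `[a, b]) f (x + c).
Proof.
move=> ab fc; rewrite /Rintegral; congr fine.
have dF x : is_derive (x : R^o) 1 (fun x : R^o => x + c : R^o) 1.
  by apply: is_derive_eq; rewrite addr0.
have dE : (fun x : R => x + c)^`() = cst 1.
  by apply/funext => x; rewrite derive1E; have /(@derive_val _ _ _ _ _ _ _) := dF x.
have -> : (\int[mu]_(x in `[(a + c)%R, (b + c)%R]) (f x)%:E =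
    \int[mu]_(x in `[a, b]) (((f \o (fun x => x + c)) * derive1 (fun x => x + c)) x)%R%:E)%E.
  apply: (@integration_by_substitution_increasing _ (fun x => x + c) f a b ab) => //.
  - by move=> x y _ _; rewrite ltrD2r.
  - by rewrite dE => x _; exact: cst_continuous.
  - by rewrite dE; exact: is_cvg_cst.
  - by rewrite dE; exact: is_cvg_cst.
  - have Fc : continuous (fun x : R => x + c).
      by move=> x; apply: cvgD; [exact: cvg_id|exact: cvg_cst].
    split.
    + by move=> x _; exact: ex_derive.
    + exact/cvg_at_right_filter/Fc.
    + exact/cvg_at_left_filter/Fc.
  - exact: continuous_subspaceT.
by apply: eq_integral => x _; rewrite dE /= mulr1.
Qed.

End RealIntegrals.
(** * Inner products and weak integrals *)

Record inner_product (R : realType) (H : normedModType R) (ip : H -> H -> R) :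
    Prop := InnerProduct {
  ipC : forall x y, ip x y = ip y x;
  ipDl : forall x y z, ip (x + y) z = ip x z + ip y z;
  ipZl : forall (k : R) x y, ip (k *: x) y = k * ip x y;
  ipxx : forall x, ip x x = `|x| ^+ 2 }.

Section InnerProduct.
Context {R : realType} {H : normedModType R} {ip : H -> H -> R}.
Context (HI : inner_product ip).
Implicit Types (x y z : H) (k : R).

Lemma ipDr x y z : ip z (x + y) = ip z x + ip z y.
Proof. by rewrite !(ipC HI z) (ipDl HI). Qed.

Lemma ipZr k x y : ip y (k *: x) = k * ip y x.
Proof. by rewrite !(ipC HI y) (ipZl HI). Qed.

Lemma ipNl x y : ip (- x) y = - ip x y.
Proof. by rewrite -scaleN1r (ipZl HI) mulN1r. Qed.

Lemma ipNr x y : ip y (- x) = - ip y x.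
Proof. by rewrite !(ipC HI y) ipNl. Qed.

Lemma ipBl x y z : ip (x - y) z = ip x z - ip y z.
Proof. by rewrite (ipDl HI) ipNl. Qed.

Lemma ipBr x y z : ip z (x - y) = ip z x - ip z y.
Proof. by rewrite ipDr ipNr. Qed.

Lemma ip0l y : ip 0 y = 0.
Proof. by rewrite -(scale0r 0) (ipZl HI) mul0r. Qed.

Lemma ip0r y : ip y 0 = 0.
Proof. by rewrite (ipC HI) ip0l. Qed.

Lemma ip_suml (I : Type) (s : seq I) (P : pred I) (F : I -> H) y :
  ip (\sum_(i <- s | P i) F i) y = \sum_(i <- s | P i) ip (F i) y.
Proof.
apply: (big_morph (ip ^~ y)); first by move=> a b; exact: (ipDl HI).
exact: ip0l.
Qed.

Lemma cauchy_schwarz x y : `|ip x y| <= `|x| * `|y|.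
Proof.
have [->|y0] := eqVneq y 0; first by rewrite ip0r !normr0 mulr0.
have ny : 0 < `|y| ^+ 2 by rewrite exprn_gt0 ?normr_gt0.
have : 0 <= `|x - (ip x y / `|y| ^+ 2) *: y| ^+ 2 by exact: sqr_ge0.
rewrite -(ipxx HI) !(ipBl, ipBr, ipZl HI, ipZr) !(ipxx HI) (ipC HI y x) => Q.
have : 0 <= `|x| ^+ 2 - ip x y ^+ 2 / `|y| ^+ 2.
  apply: le_trans Q _; rewrite le_eqVlt; apply/orP; left; apply/eqP.
  by field; rewrite normr_eq0.
rewrite subr_ge0 ler_pdivrMr// -exprMn => h.
by rewrite -(@ler_pXn2r _ 2) ?nnegrE ?mulr_ge0// real_normK ?num_real.
Qed.

Lemma ip_le x y : ip x y <= `|x| * `|y|.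
Proof. exact: le_trans (ler_norm _) (cauchy_schwarz x y). Qed.

Lemma ip_ge0 x : 0 <= ip x x.
Proof. by rewrite (ipxx HI) sqr_ge0. Qed.

Lemma ip_sqrD k x y :
  ip (x + k *: y) (x + k *: y) = ip x x + 2 * k * ip y x + k ^+ 2 * ip y y.
Proof. by rewrite ipDr !(ipDl HI) !ipZr !(ipZl HI) (ipC HI x y); ring. Qed.

Lemma ip_inj x y : (forall v, ip x v = ip y v) -> x = y.
Proof.
move=> xy; apply/eqP; rewrite -subr_eq0 -normr_eq0 -sqrf_eq0 -(ipxx HI).
by rewrite ipBl xy subrr.
Qed.

Lemma cvg_ip {T : Type} (F : set_system T) {FF : Filter F} (f g : T -> H) x y :
  f @ F --> x -> g @ F --> y -> (fun t => ip (f t) (g t)) @ F --> ip x y.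
Proof.
move=> fx gy; idtac.
have E t : ip (f t) (g t) - ip x y = ip (f t - x) (g t - y) + ip x (g t - y)
    + ip (f t - x) y.
  by rewrite !(ipBl, ipBr); ring.
apply/subr_cvg0/norm_cvg0P.
have : (fun t => `|f t - x| * `|g t - y| + `|x| * `|g t - y| + `|f t - x| * `|y|)
    @ F --> (0 * 0 + `|x| * 0 + 0 * `|y| : R).
  have fx0 : (fun t => `|f t - x|) @ F --> (0 : R) by apply/norm_cvg0P/subr_cvg0.
  have gy0 : (fun t => `|g t - y|) @ F --> (0 : R) by apply/norm_cvg0P/subr_cvg0.
  apply: cvgD; first apply: cvgD.
  - exact: cvgM.
  - by apply: cvgM => //; exact: cvg_cst.
  - by apply: cvgM => //; exact: cvg_cst.
rewrite !mulr0 mul0r !addr0 => h.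
apply: (squeeze_cvgr _ (cvg_cst 0) h); apply: nearW => t; rewrite normr_ge0/= E.
apply: le_trans (ler_normD _ _) _; apply: lerD; last exact: cauchy_schwarz.
by apply: le_trans (ler_normD _ _) _; apply: lerD; exact: cauchy_schwarz.
Qed.

End InnerProduct.

Section Heine.
Context {R : realType} {H : normedModType R}.
Implicit Types (f : R -> H) (a b : R).

Lemma heine_cantor f a b : {within `[a, b], continuous f} ->
  forall e : R, 0 < e -> exists2 d : R, 0 < d & forall s t, a <= s <= b ->
    a <= t <= b -> `|s - t| < d -> `|f s - f t| < e.
Proof.
move=> /subspace_continuousP fc e e0.
have /compact_near_coveringP := @segment_compact R a b.
move=> /(_ R (0^'+) (fun d s => forall t, a <= s <= b -> a <= t <= b ->
   `|s - t| < d -> `|f s - f t| < e)) [].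
  move=> x xab; have e2 : 0 < e / 2 by rewrite divr_gt0.
  have /cvgrPdist_lt/(_ _ e2) := fc x xab.
  rewrite near_withinE => -[r /= r0 hr].
  have r2 : 0 < r / 2 by rewrite divr_gt0.
  exists (ball x (r / 2), [set d | d < r / 2]) => /=.
    split; first exact: nbhsx_ballx.
    exact: nbhs_right_lt.
  move=> -[s d] /= [xs dr] t sab tab st.
  have sx : `|f x - f s| < e / 2.
    by apply: hr; [rewrite /ball_/=; move: xs; rewrite /ball/=; lra | rewrite in_itv].
  have tx : `|f x - f t| < e / 2.
    apply: hr; last by rewrite in_itv.
    move: xs; rewrite /ball /ball_/= => xs.
    have -> : x - t = (x - s) + (s - t) by ring.
    by apply: le_lt_trans (ler_normD _ _) _; lra.
  have -> : f s - f t = (f x - f t) - (f x - f s).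
    by rewrite opprB addrCA addrAC subrr add0r.
  by apply: le_lt_trans (ler_normB _ _) _; lra.
move=> d /= d0 hd; exists (d / 2); first by rewrite divr_gt0.
move=> s t sab tab st; apply: (hd (d / 2)) => //=.
- by rewrite sub0r normrN gtr0_norm ?divr_gt0//; lra.
- by rewrite divr_gt0.
Qed.

(** The partition intervals are half open so that exactly one indicator
function is nonzero at each point. *)
Lemma step_approximation f a b (e : R) : a <= b ->
  {within `[a, b], continuous f} -> 0 < e ->
  exists k (A : 'I_k -> set R) (c : 'I_k -> R),
    [/\ forall i, measurable (A i) /\ A i `<=` `[a, b],
        forall i, a <= c i <= b &
        forall s, a <= s <= b ->
          `|f s - \sum_(i < k) (\1_(A i) s : R) *: f (c i)| <= e].
Proof.
move=> ab fc e0; have [d d0 hd] := heine_cantor fc e0.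
pose n := (Num.truncn ((b - a) / (d / 2))).+1.
have d2 : 0 < d / 2 by rewrite divr_gt0.
pose A (i : 'I_n) := `[a, b] `&` `[a + i%:R * (d / 2), a + i.+1%:R * (d / 2)[%classic.
pose c (i : 'I_n) := Num.min (a + i%:R * (d / 2)) b.
have cab i : a <= c i <= b.
  rewrite /c le_min ab ge_min lexx orbT !andbT lerDl mulr_ge0//; exact: ltW.
exists n, A, c; split => //.
  move=> i; split; last by move=> x [].
  by apply: measurableI; exact: measurable_itv.
move=> s sab; have sa0 : 0 <= (s - a) / (d / 2).
  by rewrite divr_ge0 ?(ltW d2)//; lra.
have jn : (Num.truncn ((s - a) / (d / 2)) < n)%N.
  by rewrite ltnS le_truncn// ler_pM2r ?invr_gt0//; lra.
pose j := Ordinal jn.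
have /andP[j1 j2] := truncn_itv sa0.
rewrite ler_pdivlMr// in j1; rewrite ltr_pdivrMr// in j2.
have Aj : A j s.
  split; first by rewrite /= in_itv.
  rewrite /= in_itv/=; apply/andP; split; lra.
rewrite (bigD1 j)//= big1 ?addr0.
  rewrite indicE mem_set// scale1r; apply/ltW/hd => //.
  have -> : c j = a + j%:R * (d / 2) by rewrite /c min_l//; lra.
  rewrite ger0_norm/=; last lra.
  move: j2; rewrite -[X in _ < X * _]natr1 mulrDl mul1r; lra.
move=> i ij; rewrite indicE memNset ?scale0r//.
move=> -[_ /=]; rewrite in_itv/= => /andP[i1 i2].
have : (i : nat) = j.
  apply/eqP; rewrite eqn_leq; apply/andP; split; rewrite -ltnS -(@ltr_nat R).
    by rewrite -(ltr_pM2r d2); apply: le_lt_trans j2; lra.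
  by rewrite -(ltr_pM2r d2); apply: le_lt_trans j1 _; lra.
by move=> /val_inj /eqP; rewrite (negbTE ij).
Qed.

End Heine.

Section WeakIntegral.
Context {R : realType} {H : completeNormedModType R} {ip : H -> H -> R}.
Context (HI : inner_product ip).
Implicit Types (f g : R -> H) (w : H) (a b : R).
Local Notation mu := (@lebesgue_measure R).

(** Testing against vectors reduces integration in a Hilbert space to scalar
Lebesgue integrals, so that additivity and passage to the limit are inherited. *)
Definition wint (ip' : H -> H -> R) a b f w := forall v,
  mu.-integrable `[a, b] (EFin \o (fun s => ip' (f s) v)) /\
  ip' w v = \int[mu]_(s in `[a, b]) ip' (f s) v.

Lemma wint_uniq a b f w w' : wint ip a b f w -> wint ip a b f w' -> w = w'.
Proof. by move=> fw fw'; apply: (ip_inj HI) => v; rewrite (fw v).2 (fw' v).2. Qed.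

Lemma eq_wint a b f g w : (forall s, a <= s <= b -> f s = g s) ->
  wint ip a b f w -> wint ip a b g w.
Proof.
move=> fg fw v; have [fi ->] := fw v; split.
  apply: eq_integrable fi => // s; rewrite inE /= in_itv/= => sab.
  by rewrite fg.
by apply: eq_Rintegral => s; rewrite inE /= in_itv/= => sab; rewrite fg.
Qed.

Lemma wintD a b f g w w' : wint ip a b f w -> wint ip a b g w' ->
  wint ip a b (f \+ g) (w + w').
Proof.
move=> fw gw v; have [fi fE] := fw v; have [gi gE] := gw v.
have E : (fun s => ip ((f \+ g) s) v) = (fun s => ip (f s) v + ip (g s) v).
  by apply/funext => s /=; rewrite (ipDl HI).
rewrite E; split; first exact: integrable_addr.
by rewrite RintegralD// (ipDl HI) fE gE.
Qed.

Lemma wintZ a b f w k : wint ip a b f w -> wint ip a b (k \*: f) (k *: w).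
Proof.
move=> fw v; have [fi fE] := fw v.
have E : (fun s => ip ((k \*: f) s) v) = (fun s => k * ip (f s) v).
  by apply/funext => s /=; rewrite (ipZl HI).
rewrite E; split; first exact: integrable_mulr.
by rewrite RintegralZl// (ipZl HI) fE.
Qed.

Lemma wintB a b f g w w' : wint ip a b f w -> wint ip a b g w' ->
  wint ip a b (f \- g) (w - w').
Proof.
move=> fw /(wintZ (-1)) gw; have := wintD fw gw; rewrite scaleN1r.
by apply: eq_wint => s _ /=; rewrite scaleN1r.
Qed.

Lemma wint_sum a b (I : Type) (r : seq I) (F : I -> R -> H) (W : I -> H) :
  (forall i, wint ip a b (F i) (W i)) ->
  wint ip a b (fun s => \sum_(i <- r) F i s) (\sum_(i <- r) W i).
Proof.
move=> FW; elim: r => [|i r IH].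
  rewrite big_nil; apply: (@eq_wint _ _ (0 \*: cst 0)).
    by move=> s _; rewrite big_nil/= scale0r.
  rewrite -[X in wint _ _ _ _ X](scale0r (0 : H)); apply: wintZ => v.
  have -> : (fun s => ip (cst 0 s) v) = cst 0 :> (R -> R).
    by apply/funext => s; rewrite /= (ip0l HI).
  split; first exact: integrable0.
  by rewrite (ip0l HI) Rintegral_cst// mul0r.
rewrite big_cons; apply: eq_wint (wintD (FW i) IH) => s _ /=.
by rewrite big_cons.
Qed.

Lemma wint_indic a b (A : set R) x : measurable A -> A `<=` `[a, b] ->
  wint ip a b (fun s => (\1_A s : R) *: x) (fine (mu A) *: x).
Proof.
move=> mA Aab v.
have E : (fun s => ip ((\1_A s : R) *: x) v) = (fun s => ip x v * \1_A s).
  by apply/funext => s; rewrite (ipZl HI) mulrC.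
have iA : mu.-integrable `[a, b] (EFin \o (\1_A : R -> R)).
  apply: (@integrable_itv_bounded _ _ _ 1); first exact: measurable_indic.
  by move=> x' _; rewrite ger0_norm// indicE; case: (_ \in _).
rewrite E; split; first exact: integrable_mulr.
rewrite RintegralZl//= (ipZl HI) mulrC; congr (_ * _).
rewrite /Rintegral integral_indic//; congr (fine (mu _)).
by apply/esym/setIidl.
Qed.

Lemma wint_simple a b k (A : 'I_k -> set R) (h : 'I_k -> H) :
  (forall i, measurable (A i) /\ A i `<=` `[a, b]) ->
  wint ip a b (fun s => \sum_(i < k) (\1_(A i) s : R) *: h i)
    (\sum_(i < k) fine (mu (A i)) *: h i).
Proof.
by move=> mA; apply: wint_sum => i; have [] := mA i; exact: wint_indic.
Qed.

(** Testing against w itself. *)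
Lemma wint_bound a b f w (M : R) : a <= b -> wint ip a b f w ->
  (forall s, a <= s <= b -> `|f s| <= M) -> `|w| <= (b - a) * M.
Proof.
move=> ab fw fM; have [fi fE] := fw w.
have M0 : 0 <= M by apply: le_trans (fM a _); rewrite ?lexx.
have [->|w0] := eqVneq w 0; first by rewrite normr0 mulr_ge0// subr_ge0.
have : ip w w <= (b - a) * M * `|w|.
  rewrite fE; apply: (@le_trans _ _ (\int[mu]_(s in `[a, b]) (cst (M * `|w|) s))).
    apply: le_Rintegral => //; first exact: integrable_itv_cst.
    move=> s sab /=; apply: le_trans (ip_le HI _ _) _.
    by apply: ler_wpM2r => //; apply: fM; move: sab; rewrite /= in_itv.
  by rewrite Rintegral_itv_cst// mulrC mulrA.
by rewrite (ipxx HI) expr2 ler_pM2r// normr_gt0.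
Qed.

Lemma wint_le a b f g w w' (M : R) : a <= b -> wint ip a b f w ->
  wint ip a b g w' -> (forall s, a <= s <= b -> `|f s - g s| <= M) ->
  `|w - w'| <= (b - a) * M.
Proof. by move=> ab fw gw fg; exact: wint_bound ab (wintB fw gw) fg. Qed.

Lemma wint_cat a b c f w w' : a <= c <= b ->
  wint ip a c f w -> wint ip c b f w' -> wint ip a b f (w + w').
Proof.
move=> /andP[ac cb] fw fw' v; have [fi fE] := fw v; have [gi gE] := fw' v.
have acb : a <= c <= b by rewrite ac.
have I := integrable_itv_cat acb fi gi; split => //.
by rewrite (Rintegral_itv_cat acb)// (ipDl HI) fE gE.
Qed.

(** Uniform convergence of the integrands; continuity of the limit gives its integrability. *)
Lemma wint_lim a b f w (f_ : nat -> R -> H) (w_ : nat -> H) (e : nat -> R) :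
  a <= b -> {within `[a, b], continuous f} ->
  (forall n, wint ip a b (f_ n) (w_ n)) ->
  (forall n s, a <= s <= b -> `|f_ n s - f s| <= e n) ->
  e @ \oo --> 0 -> w_ @ \oo --> w -> wint ip a b f w.
Proof.
move=> ab fc fw fe e0 w_w v.
have fi : mu.-integrable `[a, b] (EFin \o (fun s => ip (f s) v)).
  apply: within_continuous_integrable => s; apply: (cvg_ip HI); first exact: fc.
  exact: cvg_cst.
split => //.
have C1 : (fun n => ip (w_ n) v) @ \oo --> ip w v.
  by apply: (cvg_ip HI) => //; exact: cvg_cst.
have : (fun n => ip (w_ n) v) @ \oo --> \int[mu]_(s in `[a, b]) ip (f s) v.
  apply/subr_cvg0/norm_cvg0P.
  have h : (fun n => (e n * `|v|) * (b - a)) @ \oo --> (0 : R).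
    have -> : 0 = 0 * `|v| * (b - a) by rewrite !mul0r.
    by apply: cvgMl; apply: cvgMl.
  apply: (squeeze_cvgr _ (cvg_cst 0) h); apply: nearW => n; rewrite normr_ge0/=.
  have [fni ->] := fw n v.
  rewrite -RintegralB//; apply: le_trans (le_normr_Rintegral _ _) _ => //.
    exact: integrable_subr.
  rewrite -(Rintegral_itv_cst _ ab); apply: le_Rintegral => //.
  - by apply: integrable_normr => //; exact: integrable_subr.
  - exact: integrable_itv_cst.
  - move=> s; rewrite /= in_itv/= => sab; rewrite -(ipBl HI).
    apply: le_trans (cauchy_schwarz HI _ _) _; apply: ler_wpM2r => //.
    exact: fe.
by move=> C2; rewrite -(cvg_lim _ C1)// (cvg_lim _ C2).
Qed.

Lemma cauchy_seq_cvg (w_ : nat -> H) :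
  (forall e : R, 0 < e -> exists N, forall n m, (N <= n)%N -> (N <= m)%N ->
    `|w_ n - w_ m| <= e) -> exists w, w_ @ \oo --> w.
Proof.
move=> h; suff : cvg (w_ @ \oo) by move=> /cvg_ex.
apply/cauchy_cvgP/cauchy_exP => e e0.
have e2 : 0 < e / 2 by rewrite divr_gt0.
have [N hN] := h _ e2; exists (w_ N); exists N => // n /= Nn.
rewrite -ball_normE /ball_/=; apply: le_lt_trans (hN _ _ (leqnn N) Nn) _; lra.
Qed.

Lemma wint_approx a b f (e : R) : a <= b -> {within `[a, b], continuous f} ->
  0 < e -> exists k (A : 'I_k -> set R) (c : 'I_k -> R),
    [/\ forall i, measurable (A i) /\ A i `<=` `[a, b],
        forall i, a <= c i <= b &
        forall s, a <= s <= b ->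
          `|\sum_(i < k) (\1_(A i) s : R) *: f (c i) - f s| <= e].
Proof.
move=> ab fc e0; have [k [A [c [mA cab h]]]] := step_approximation ab fc e0.
by exists k, A, c; split => // s sab; rewrite distrC; exact: h.
Qed.

Lemma wint_exists a b f : a <= b -> {within `[a, b], continuous f} ->
  exists w, wint ip a b f w.
Proof.
move=> ab fc.
have e0 n : 0 < (n.+1%:R)^-1 :> R by rewrite invr_gt0.
have H1 n : exists gw : (R -> H) * H, wint ip a b gw.1 gw.2 /\
    forall s, a <= s <= b -> `|gw.1 s - f s| <= n.+1%:R^-1.
  have [k [A [c [mA cab h]]]] := wint_approx ab fc (e0 n).
  by exists (fun s => \sum_(i < k) (\1_(A i) s : R) *: f (c i),
    \sum_(i < k) fine (mu (A i)) *: f (c i)); split => //; exact: wint_simple.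
have [gw hgw] := choice H1.
have [w ww] : exists w, (fun n => (gw n).2) @ \oo --> w.
  apply: cauchy_seq_cvg => e e_gt0.
  have : (fun n => n.+1%:R^-1 : R) @ \oo --> 0 by exact: cvg_harmonic.
  have d0 : 0 < e / (2 * (b - a + 1)).
    by rewrite divr_gt0// mulr_gt0//; lra.
  move=> /cvgrPdist_lt/(_ _ d0) [N _ hN]; exists N => n m Nn Nm.
  apply: le_trans (wint_le ab (hgw n).1 (hgw m).1 (M := e / (b - a + 1)) _) _.
    move=> s sab.
    have -> : (gw n).1 s - (gw m).1 s = ((gw n).1 s - f s) - ((gw m).1 s - f s).
      by rewrite opprB addrA subrK.
    apply: le_trans (ler_normB _ _) _.
    have -> : e / (b - a + 1) = e / (2 * (b - a + 1)) + e / (2 * (b - a + 1)).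
      by field; lra.
    apply: lerD; [apply: le_trans ((hgw n).2 _ sab) _|apply: le_trans ((hgw m).2 _ sab) _].
    - by have := hN _ Nn; rewrite sub0r normrN /= gtr0_norm// => /ltW.
    - by have := hN _ Nm; rewrite sub0r normrN /= gtr0_norm// => /ltW.
  rewrite mulrC -mulrA ger_pMr// mulrC ler_pdivrMr; lra.
exists w; apply: (wint_lim ab fc (fun n => (hgw n).1) (fun n => (hgw n).2) _ ww).
exact: cvg_harmonic.
Qed.

Lemma cvg_bounded_linear {T : Type} (F : set_system T) {FF : Filter F}
    (B : {linear H -> H}) (K : R) (f : T -> H) x :
  (forall x, `|B x| <= K * `|x|) -> f @ F --> x -> (B \o f) @ F --> B x.
Proof.
move=> BK fx; apply/subr_cvg0/norm_cvg0P.
have : (fun t => K * `|f t - x|) @ F --> (K * 0 : R).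
  by apply: cvgMr; apply/norm_cvg0P/subr_cvg0.
rewrite mulr0 => h; apply: (squeeze_cvgr _ (cvg_cst 0) h); apply: nearW => t.
by rewrite normr_ge0/= -linearB BK.
Qed.

(** Simple functions commute with B; both sides are uniformly approximated by them. *)
Lemma wint_linear a b f w (B : {linear H -> H}) (K : R) : a <= b ->
  {within `[a, b], continuous f} -> (forall x, `|B x| <= K * `|x|) ->
  wint ip a b f w -> wint ip a b (B \o f) (B w).
Proof.
move=> ab fc BK fw.
have Bfc : {within `[a, b], continuous (B \o f)}.
  by move=> s; apply: cvg_bounded_linear BK _; exact: fc.
have [w' Bw] := wint_exists ab Bfc; suff -> : B w = w' by [].
have K0 : 0 <= `|K| by [].
apply/eqP; rewrite -subr_eq0 -normr_le0; apply/ler_addgt0Pl => e e0; rewrite addr0.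
have d0 : 0 < e / (2 * (b - a + 1) * (`|K| + 1)).
  by rewrite divr_gt0// !mulr_gt0//; lra.
set d := e / _ in d0.
have [k [A [c [mA cab h]]]] := wint_approx ab fc d0.
have wk := wint_simple (fun i => f (c i)) mA.
have Bwk : wint ip a b (fun s => B (\sum_(i < k) (\1_(A i) s : R) *: f (c i)))
    (B (\sum_(i < k) fine (mu (A i)) *: f (c i))).
  rewrite linear_sum; under eq_bigr do rewrite linearZ.
  apply: eq_wint (wint_simple (fun i => B (f (c i))) mA) => s _.
  by rewrite linear_sum; apply: eq_bigr => i _; rewrite linearZ.
have BK' x : `|B x| <= `|K| * `|x|.
  by apply: le_trans (BK x) _; apply: ler_wpM2r => //; exact: ler_norm.
have E1 := wint_le ab wk fw h.
have E2 : `|B (\sum_(i < k) fine (mu (A i)) *: f (c i)) - w'| <= (b - a) * (`|K| * d).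
  apply: wint_le ab Bwk Bw _ => s sab /=; rewrite -linearB.
  by apply: le_trans (BK' _) _; apply: ler_wpM2l => //; exact: h.
have E3 := le_trans (BK' _) (ler_wpM2l K0 E1).
rewrite linearB in E3.
move: E2 E3; set x := B (\sum_(i < k) _) => E2 E3.
have -> : B w - w' = (x - w') - (x - B w) by rewrite opprB addrCA addrAC subrr add0r.
apply: le_trans (ler_normB _ _) _.
apply: le_trans (lerD E2 E3) _.
have -> : (b - a) * (`|K| * d) + `|K| * ((b - a) * d) =
   e * ((b - a) / (b - a + 1)) * (`|K| / (`|K| + 1)).
  by rewrite /d; field; rewrite !gt_eqF//; lra.
rewrite -mulrA ger_pMr//.
by rewrite mulr_ile1// ?divr_ge0// ?ler_pdivrMr ?mul1r//; lra.
Qed.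

Lemma wint_cst a b x : a <= b -> wint ip a b (cst x) ((b - a) *: x).
Proof.
move=> ab v; split; first exact: (integrable_itv_cst a b (ip x v)).
by rewrite (ipZl HI) mulrC -(Rintegral_itv_cst _ ab).
Qed.

Lemma wint_shift a b c f w : a <= b -> continuous f ->
  wint ip a b (fun s => f (s + c)) w -> wint ip (a + c) (b + c) f w.
Proof.
move=> ab fc fw v.
have cc : continuous (fun s => ip (f s) v).
  by move=> s; apply: (cvg_ip HI); [exact: fc | exact: cvg_cst].
split; first by apply: within_continuous_integrable; exact: continuous_subspaceT.
by rewrite (fw v).2 (Rintegral_shift _ ab cc).
Qed.

End WeakIntegral.

(** * Semigroups on a Hilbert space *)

(** One-sided derivatives suffice: continuity lets the supremum of the good
set be reached and then passed. *)
Lemma dini_nonincreasing (R : realType) (phi : R -> R) (a b : R) : a <= b ->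
  {within `[a, b], continuous phi} ->
  (forall t, a <= t < b -> forall e, 0 < e ->
    \forall h \near 0^'+, phi (t + h) <= phi t + e * h) ->
  phi b <= phi a.
Proof.
move=> ab pc D; apply/ler_addgt0Pr => e e0.
(* The good set consists of the times up to which phi grows at slope at most e1. *)
pose e1 := e / (b - a + 1).
have e10 : 0 < e1 by rewrite divr_gt0//; lra.
suff : phi b <= phi a + e1 * (b - a).
  move/le_trans; apply; rewrite lerD2l /e1 -mulrA ger_pMr// mulrC ler_pdivrMr; lra.
pose E := [set t | a <= t <= b /\ phi t <= phi a + e1 * (t - a)].
have Ea : E a by split; rewrite ?lexx ?ab// subrr mulr0 addr0.
have hE : has_sup E by split; [exists a | exists b => t [/andP[]]].
pose c := sup E.
have cab : a <= c <= b.
  apply/andP; split; first exact: (ub_le_sup hE.2 Ea).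
  by apply: ge_sup; [exists a | move=> t [/andP[]]].
have Ec : phi c <= phi a + e1 * (c - a).
  apply/ler_addgt0Pr => d d0.
  have /subspace_continuousP/(_ c) := pc; rewrite /= in_itv/= => /(_ cab).
  have d2 : 0 < d / 2 by rewrite divr_gt0.
  move=> /cvgrPdist_lt/(_ _ d2); rewrite near_withinE => -[r /= r0 hr].
  have m0 : 0 < Num.min r 1 by rewrite lt_min r0/=.
  have [t [tab Et] ct] := sup_adherent m0 hE.
  have tc : t <= c by apply: (ub_le_sup hE.2).
  have := hr t; rewrite /ball_/= in_itv/= => /(_ _ tab).
  rewrite -/c in ct *.
  have ctr : c - t < r.
    have : Num.min r 1 <= r by rewrite ge_min lexx.
    by lra.
  rewrite ger0_norm; last lra.
  move=> /(_ ctr); rewrite ltr_norml => /andP[_].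
  rewrite -[X in X < _]/(phi c - phi t) => h2.
  have : e1 * (t - a) <= e1 * (c - a) by rewrite ler_pM2l//; lra.
  lra.
have [cb|cb] : c = b \/ c < b.
  by case/andP: cab => _; rewrite le_eqVlt => /predU1P[]; [left|right].
  by rewrite -cb.
exfalso; have ac : a <= c < b by rewrite cb andbT; case/andP: cab.
have := D c ac e1 e10 => Dc.
have bc0 : 0 < b - c by lra.
near (0 : R)^'+ => h.
have h0 : 0 < h by near: h; exact: nbhs_right_gt.
have hbc : h < b - c by near: h; exact: nbhs_right_lt.
have Dh : phi (c + h) <= phi c + e1 * h by near: h.
have : E (c + h) by split; [apply/andP; split; lra | lra].
by move=> /(ub_le_sup hE.2); rewrite -/c; lra.
Unshelve. all: by end_near. Qed.

Lemma dini_constant (R : realType) (g : R -> R) (t : R) : 0 <= t ->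
  continuous g ->
  (forall s, 0 <= s < t -> h^-1 * (g (s + h) - g s) @[h --> 0^'+] --> 0) ->
  g t = g 0.
Proof.
move=> t0 gc gd; apply/eqP; rewrite eq_le -[X in _ && X]lerN2.
have D s e : 0 <= s < t -> 0 < e ->
    \forall h \near 0^'+, `|g (s + h) - g s| <= e * h.
  move=> st e0; move/cvgrPdist_lt : (gd s st) => /(_ _ e0).
  apply: filterS2 (nbhs_right_gt 0) => h h0; rewrite sub0r normrN normrM.
  by rewrite gtr0_norm ?invr_gt0// mulrC ltr_pdivrMr// => /ltW.
apply/andP; split.
  apply: dini_nonincreasing => //; first exact: continuous_subspaceT.
  move=> s st e e0; apply: filterS (D s e st e0) => h; rewrite ler_norml => /andP[_]; lra.
apply: (@dini_nonincreasing _ (fun s => - g s)) => //.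
  by apply: continuous_subspaceT => s; apply: cvgN; exact: gc.
move=> s st e e0; apply: filterS (D s e st e0) => h; rewrite ler_norml => /andP[]; lra.
Qed.

Lemma harmonic_at_right (R : realType) : (fun n => n.+1%:R^-1 : R) @ \oo --> 0^'+.
Proof.
move=> P [r /= r0 hr]; have := @cvg_harmonic R.
move=> /cvgrPdist_lt/(_ _ r0) [N _ hN]; exists N => // n Nn /=.
by apply: hr; [exact: hN | rewrite invr_gt0].
Qed.

(** The orbit maps are extended by the identity to negative times, so that they are
continuous on the whole line. *)
Record semigroup (R : realType) (H : normedModType R)
    (S : R -> {linear H -> H}) : Prop := Semigroup {
  sg_bounded : forall t, exists K, forall x, `|S t x| <= K * `|x|;
  sg_neg : forall t x, t <= 0 -> S t x = x;
  sg_add : forall s t x, 0 <= s -> 0 <= t -> S (s + t) x = S s (S t x);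
  sg_cvg0 : forall x, S t x @[t --> 0^'+] --> x }.

Definition generator (R : realType) (H : normedModType R)
    (S : R -> {linear H -> H}) (x y : H) : Prop :=
  h^-1 *: (S h x - x) @[h --> 0^'+] --> y.

Section SemigroupTheory.
Context {R : realType} {H : completeNormedModType R} {ip : H -> H -> R}.
Context (HI : inner_product ip).
Context {S : R -> {linear H -> H}} (HS : semigroup S).
Implicit Types (x y u v w : H) (s t h : R).
Local Notation mu := (@lebesgue_measure R).

Let sg0 x : S 0 x = x. Proof. exact: (sg_neg HS). Qed.

(** The uniform boundedness principle: otherwise there are times t_n <= 1/n and operators
S(t_n) of norm at least n, which strong continuity at 0 makes pointwise bounded. *)
Lemma sg_bounded_near0 : exists d K, [/\ 0 < d, 1 <= K &
  forall t x, t <= d -> `|S t x| <= K * `|x|].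
Proof.
apply: contrapT => N.
have H1 n : exists tx : R * H, tx.1 <= n.+1%:R^-1 /\ n.+1%:R * `|tx.2| < `|S tx.1 tx.2|.
  apply: contrapT => N1; apply: N; exists n.+1%:R^-1, n.+1%:R; split => //.
    by rewrite ler1n.
  move=> t x td; rewrite leNgt; apply/negP => h; apply: N1; exists (t, x).
  by split.
have [tx htx] := choice H1.
pose F := [set f : H -> H | exists n, f = S (tx n).1].
have F1 f : F f -> bounded_fun_norm f /\ linear f.
  move=> [n ->]; split; last by move=> k x y; rewrite linearP.
  move=> r; have [K hK] := sg_bounded HS (tx n).1; exists (`|K| * `|r|) => x xr.
  apply: le_trans (hK x) _; apply: le_trans (ler_wpM2r _ (ler_norm K)) _ => //.
  by apply: ler_wpM2l => //; apply: le_trans xr (ler_norm _).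
have F2 : pointwise_bounded F.
  move=> x; have /cvgrPdist_lt/(_ _ ltr01) [r /= r0 hr] := sg_cvg0 HS (x := x).
  have : (fun n => n.+1%:R^-1 : R) @ \oo --> 0 by exact: cvg_harmonic.
  move=> /cvgrPdist_lt/(_ _ r0) [N0 _ hN].
  exists (`|x| + 1 + \sum_(i < N0) `|S (tx i).1 x|) => f [n ->].
  have s0 : 0 <= \sum_(i < N0) `|S (tx i).1 x| by rewrite sumr_ge0.
  have [nN|Nn] := ltnP n N0.
    rewrite (bigD1 (Ordinal nN))//=.
    have := @sumr_ge0 R _ (index_enum 'I_N0) (fun i => i != Ordinal nN)
      (fun i => `|S (tx i).1 x|) (fun i _ => normr_ge0 _).
    by have := normr_ge0 x; lra.
  have [t0|t0] := leP (tx n).1 0.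
    by rewrite (sg_neg HS)//; lra.
  have : `|x - S (tx n).1 x| < 1.
    apply: hr => //=; rewrite sub0r normrN gtr0_norm//.
    apply: le_lt_trans (htx n).1 _.
    by have := hN n Nn; rewrite sub0r normrN /= gtr0_norm.
  rewrite -normrN opprB => h.
  have -> : S (tx n).1 x = x + (S (tx n).1 x - x) by rewrite addrCA subrr addr0.
  by apply: le_trans (ler_normD _ _) _; lra.
have [M hM] := Banach_Steinhauss F1 F2 1.
pose n := Num.truncn (`|M|).
have [_ h] := htx n; set x := (tx n).2 in h; set t := (tx n).1 in h.
have x0 : 0 < `|x|.
  rewrite normr_gt0; apply/eqP => x0; move: h.
  by rewrite x0 linear0 normr0 mulr0 ltxx.
have E1 : `|S t (`|x|^-1 *: x)| <= M.
  apply: hM; first by exists n.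
  by rewrite normrZ normfV normr_id mulVf// gt_eqF.
move: E1; rewrite linearZ normrZ normfV normr_id mulrC ler_pdivrMr//.
move=> E1; have := lt_le_trans h E1; rewrite ltr_pM2r// => nM.
have : n.+1%:R <= `|M| :> R by apply: le_trans (ltW nM) (ler_norm _).
by rewrite -truncn_ge_nat// ltnn.
Qed.

Lemma sg_bounded_on (T : R) : exists2 K, 1 <= K &
  forall t x, t <= T -> `|S t x| <= K * `|x|.
Proof.
have [d [K [d0 K1 hK]]] := sg_bounded_near0.
have K0 : 0 <= K by lra.
have B n t x : t <= n.+1%:R * d -> `|S t x| <= K ^+ n.+1 * `|x|.
  elim: n t x => [|n IH] t x tn; first by rewrite expr1; apply: hK; lra.
  have [td|dt] := leP t d.
    apply: le_trans (hK _ _ td) _; rewrite ler_wpM2r// exprS ler_peMr//.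
    exact: exprn_ege1.
  have -> : t = d + (t - d) by ring.
  rewrite (sg_add HS); [|lra|lra].
  apply: le_trans (hK _ _ (lexx d)) _; rewrite exprS -mulrA ler_wpM2l//.
  apply: IH; move: tn; rewrite -[n.+2%:R]natr1 mulrDl; lra.
exists (K ^+ (Num.truncn (`|T| / d)).+1); first exact: exprn_ege1.
move=> t x tT; apply: B; apply: le_trans tT _; apply: le_trans (ler_norm _) _.
rewrite -ler_pdivrMr//; apply/ltW.
have /truncn_itv/andP[] // : 0 <= `|T| / d by rewrite divr_ge0// ltW.
Qed.

Lemma sg_max0 t x : S (Num.max 0 t) x = S t x.
Proof. by have [t0|t0] := leP t 0; rewrite ?sg0// (sg_neg HS). Qed.

Lemma sg_continuous x : continuous (fun t => S t x).
Proof.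
suff main t : S s x @[s --> t] --> S t x by exact: main.
have [K K1 hK] := sg_bounded_on (`|t| + 1).
apply/cvgrPdist_lt => e e0.
have eK : 0 < e / K by rewrite divr_gt0//; lra.
have /cvgrPdist_lt/(_ _ eK) [r /= r0 hr] := sg_cvg0 HS (x := x).
have r0' h : 0 <= h < r -> `|x - S h x| < e / K.
  rewrite le_eqVlt => /andP[/predU1P[<- _|h0 hr']].
    by rewrite sg0 subrr normr0.
  by apply: hr => //=; rewrite sub0r normrN gtr0_norm.
have main s s' : 0 <= s -> s <= s' -> s' <= `|t| + 1 -> s' - s < r ->
    `|S s x - S s' x| < e.
  move=> s0 ss st sr.
  have -> : s' = s + (s' - s) by ring.
  rewrite (sg_add HS)//; last lra.
  rewrite -linearB; apply: le_lt_trans (hK _ _ _) _; first lra.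
  rewrite mulrC -ltr_pdivlMr; last lra.
  by apply: r0'; apply/andP; split; lra.
exists (Num.min r 1); first by rewrite /= lt_min r0/=.
move=> s /=; rewrite lt_min => /andP[sr s1].
rewrite -(sg_max0 t) -(sg_max0 s).
have m1 : 0 <= Num.max 0 t by rewrite le_max lexx.
have m2 : 0 <= Num.max 0 s by rewrite le_max lexx.
have tt : t <= `|t| by exact: ler_norm.
move: s1; rewrite ltr_norml => /andP[s1 s1'].
have m3 : Num.max 0 t <= `|t| + 1 
  by rewrite ge_max; apply/andP; split; have := normr_ge0 t; lra.
have m4 : Num.max 0 s <= `|t| + 1.
  by rewrite ge_max; apply/andP; split; have := normr_ge0 t; lra.
have [ts|st] := leP t s.
  apply: main => //; first by rewrite ge_max m2/= le_max ts orbT.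
  move: sr; rewrite distrC ger0_norm; last lra.
  by case: (leP 0 t) => ?; case: (leP 0 s) => ?; lra.
rewrite distrC; apply: main => //.
  by rewrite ge_max m1/= le_max (ltW st) orbT.
move: sr; rewrite ger0_norm; last lra.
by case: (leP 0 t) => ?; case: (leP 0 s) => ?; lra.
Qed.

(** The difference S(k) w - w is the integral of the orbit over the window from h to h + k
minus the integral over the window from 0 to k; divided by k, these tend to S(h) u and to u. *)
Lemma generator_average h u w : 0 < h -> wint ip 0 h (S ^~ u) w ->
  generator S w (S h u - u).
Proof.
move=> h0 hw.
have Sc : continuous (fun s => S s u) by exact: sg_continuous.
have Scw a b : {within `[a, b], continuous (fun s => S s u)}.
  exact: continuous_subspaceT.
apply/cvgrPdist_le => e e0.
have e2 : 0 < e / 2 by rewrite divr_gt0.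
have /cvgrPdist_lt/(_ _ e2)[r1 /= r10 hr1] := Sc 0.
have /cvgrPdist_lt/(_ _ e2)[r2 /= r20 hr2] := Sc h.
near=> k.
have k0 : 0 < k by near: k; exact: nbhs_right_gt.
have kh : k < h by near: k; exact: nbhs_right_lt.
have kr1 : k < r1 by near: k; exact: nbhs_right_lt.
have kr2 : k < r2 by near: k; exact: nbhs_right_lt.
have [K1 hK1] := sg_bounded HS k.
have Skw : wint ip k (h + k) (S ^~ u) (S k w).
  rewrite -{1}(add0r k); apply: (wint_shift HI) => //; first exact: ltW.
  apply: eq_wint (wint_linear HI (ltW h0) (Scw _ _) hK1 hw) => s /andP[s0 _] /=.
  by rewrite addrC (sg_add HS)//; exact: ltW.
have [wa wah] := wint_exists HI (ltW k0) (Scw 0 k).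
have [wb wbh] := wint_exists HI (ltW kh) (Scw k h).
have hk : h <= h + k by lra.
have [wc wch] := wint_exists HI hk (Scw h (h + k)).
have E1 : w = wa + wb.
  by apply: (wint_uniq HI hw); apply: (wint_cat HI _ wah wbh); apply/andP; split; lra.
have E2 : S k w = wb + wc.
  by apply: (wint_uniq HI Skw); apply: (wint_cat HI _ wbh wch); apply/andP; split; lra.
have E3 : S k w - w = wc - wa.
  rewrite E2 E1 [wa + wb]addrC opprD addrA; congr (_ - _).
  by rewrite addrC addKr.
have B1 : `|k *: u - wa| <= k * (e / 2).
  have := @wint_le _ _ _ HI 0 k _ _ _ _ (e / 2) (ltW k0) (wint_cst HI u (ltW k0)) wah.
  rewrite !subr0; apply => s /andP[s0 sk] /=.
  by apply/ltW; rewrite -[X in X - _]sg0; apply: hr1; rewrite /= sub0r normrN ger0_norm//; lra.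
have B2 : `|k *: S h u - wc| <= k * (e / 2).
  have := @wint_le _ _ _ HI h (h + k) _ _ _ _ (e / 2) hk (wint_cst HI (S h u) hk) wch.
  have -> : h + k - h = k by ring.
  apply => s /andP[s0 sk] /=.
  by apply/ltW; apply: hr2; rewrite /= distrC ger0_norm; lra.
have -> : S h u - u - k^-1 *: (S k w - w) =
    k^-1 *: ((k *: S h u - wc) - (k *: u - wa)).
  rewrite E3 -[X in X - _ = _](scalerK (lt0r_neq0 k0)) -scalerBr; congr (_ *: _).
  by rewrite scalerBr !opprB addrACA [RHS]addrACA; congr (_ + _); rewrite addrC.
rewrite normrZ gtr0_norm ?invr_gt0// mulrC ler_pdivrMr//.
by apply: le_trans (ler_normB _ _) _; lra.
Unshelve. all: by end_near. Qed.

Lemma average_cvg u (w_ : R -> H) : (forall h, 0 < h -> wint ip 0 h (S ^~ u) (w_ h)) ->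
  h^-1 *: w_ h @[h --> 0^'+] --> u.
Proof.
move=> hw; apply/cvgrPdist_le => e e0.
have /cvgrPdist_lt/(_ _ e0)[r1 /= r10 hr1] := @sg_continuous u 0.
near=> h.
have h0 : 0 < h by near: h; exact: nbhs_right_gt.
have kr1 : h < r1 by near: h; exact: nbhs_right_lt.
have cst_int := wint_cst HI u (ltW h0); rewrite subr0 in cst_int.
have := wint_le HI (ltW h0) cst_int (hw _ h0) (M := e).
have -> : u - h^-1 *: w_ h = h^-1 *: (h *: u - w_ h).
  by rewrite scalerBr scalerK// gt_eqF.
rewrite subr0 => W; rewrite normrZ gtr0_norm ?invr_gt0// mulrC ler_pdivrMr//.
rewrite (mulrC e); apply: W.
move=> s /andP[s0 sh] /=; apply/ltW; rewrite -[X in X - _]sg0.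
by apply: hr1; rewrite /= sub0r normrN ger0_norm//; lra.
Unshelve. all: by end_near. Qed.

Lemma averages u : exists w_ : R -> H,
  forall h, 0 < h -> wint ip 0 h (S ^~ u) (w_ h).
Proof.
have P h : exists w, 0 < h -> wint ip 0 h (S ^~ u) w.
  have [h0|h0] := leP h 0; first by exists 0.
  have [|w hw] := @wint_exists _ _ _ HI 0 h (S ^~ u) (ltW h0); last by exists w.
  exact/continuous_subspaceT/sg_continuous.
by have [w_ hw] := choice P; exists w_.
Qed.

Lemma generator_orbit t x y : 0 <= t -> generator S x y ->
  generator S (S t x) (S t y).
Proof.
move=> t0 xy; have [K hK] := sg_bounded HS t.
apply: (cvg_trans _ (cvg_bounded_linear hK xy)); apply: near_eq_cvg.
near=> h; rewrite /= linearZ linearB; congr (_ *: (_ - _)).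
have h0 : 0 <= h by apply: ltW; near: h; exact: nbhs_right_gt.
by rewrite -!(sg_add HS)// addrC.
Unshelve. all: by end_near. Qed.

End SemigroupTheory.

(** * Semigroups generated by a closed form *)

(** [V] is the form domain and the form is <D x, D y>; the last field says that the
generator is a restriction of the operator associated with the form. *)
Record form_semigroup (R : realType) (H : normedModType R) (ip : H -> H -> R)
    (S : R -> {linear H -> H}) (V : H -> Prop) (D : H -> H) : Prop :=
  FormSemigroup {
  fs_semigroup : semigroup S;
  fs_linV : forall k x y, V x -> V y -> V (k *: x + y);
  fs_linD : forall k x y, V x -> V y -> D (k *: x + y) = k *: D x + D y;
  fs_closed : forall (x_ : nat -> H) x z, (forall n, V (x_ n)) ->
    x_ @ \oo --> x -> (D \o x_) @ \oo --> z -> V x /\ D x = z;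
  fs_green : forall x y, generator S x y ->
    V x /\ forall v, V v -> ip y v = - ip (D x) (D v) }.

Section FormSemigroupTheory.
Context {R : realType} {H : completeNormedModType R} {ip : H -> H -> R}.
Context (HI : inner_product ip).
Context {S : R -> {linear H -> H}} {V : H -> Prop} {D : H -> H}.
Context (FS : form_semigroup ip S V D).
Implicit Types (x y u v w : H) (s t h : R).
Local Notation mu := (@lebesgue_measure R).

Let HS := fs_semigroup FS.
Let sg0 x : S 0 x = x. Proof. exact: (sg_neg HS). Qed.

Let SB t x y : S t (x - y) = S t x - S t y. Proof. exact: linearB. Qed.
Let SZ t k x : S t (k *: x) = k *: S t x. Proof. exact: linearZ. Qed.

Lemma V0 : V 0.
Proof.
have G0 : generator S 0 0.
  rewrite /generator.
  have -> : (fun h => h^-1 *: (S h 0 - 0)) = cst 0.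
    by apply/funext => h; rewrite linear0 subrr scaler0.
  exact: cvg_cst.
by have [] := fs_green FS G0.
Qed.

Lemma VZ k x : V x -> V (k *: x).
Proof. by move=> Vx; have := fs_linV FS k Vx V0; rewrite addr0. Qed.

Lemma VD x y : V x -> V y -> V (x + y).
Proof. by move=> Vx Vy; have := fs_linV FS 1 Vx Vy; rewrite scale1r. Qed.

Lemma VB x y : V x -> V y -> V (x - y).
Proof. by move=> Vx Vy; apply: VD => //; rewrite -scaleN1r; exact: VZ. Qed.

Lemma D_D x y : V x -> V y -> D (x + y) = D x + D y.
Proof. by move=> Vx Vy; have := fs_linD FS 1 Vx Vy; rewrite !scale1r. Qed.

Lemma D_0 : D 0 = 0.
Proof. by have /eqP := D_D V0 V0; rewrite addr0 -subr_eq subrr => /eqP. Qed.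

Lemma D_Z k x : V x -> D (k *: x) = k *: D x.
Proof. by move=> Vx; have := fs_linD FS k Vx V0; rewrite D_0 !addr0. Qed.

Lemma D_B x y : V x -> V y -> D (x - y) = D x - D y.
Proof.
by move=> Vx Vy; rewrite -(scaleN1r y) (D_D Vx (VZ (-1) Vy)) (D_Z _ Vy) scaleN1r.
Qed.

(** A closed property that holds on the domain of the generator holds everywhere, since
averages of orbits belong to this domain. *)
Lemma generator_dense (P : H -> Prop) :
  (forall (x_ : nat -> H) x, (forall n, P (x_ n)) -> x_ @ \oo --> x -> P x) ->
  (forall x y, generator S x y -> P x) -> forall x, P x.
Proof.
move=> Pcl PG x; have [w_ hw] := averages HI HS x.
pose h n : R := n.+1%:R^-1.
have h0 n : 0 < h n by rewrite invr_gt0.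
apply: (Pcl (fun n => (h n)^-1 *: w_ (h n))); last first.
  have C := average_cvg HI HS hw.
  apply: (cvg_comp h (fun k => k^-1 *: w_ k) _ C).
  by move=> A hA; exact: (harmonic_at_right hA).
move=> n; apply: (PG _ ((h n)^-1 *: (S (h n) x - x))).
have G := generator_average HI HS (h0 n) (hw _ (h0 n)).
have : (fun k => (h n)^-1 *: (k^-1 *: (S k (w_ (h n)) - w_ (h n)))) @ 0^'+ -->
    (h n)^-1 *: (S (h n) x - x) by apply: cvgZl_tmp.
apply: cvg_trans; apply: near_eq_cvg; apply: nearW => k /=.
by rewrite SZ -scalerBr !scalerA mulrC.
Qed.

Lemma generator_right x y t : 0 <= t -> generator S x y ->
  h^-1 *: (S (t + h) x - S t x) @[h --> 0^'+] --> S t y.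
Proof.
move=> t0 xy; apply: cvg_trans (generator_orbit HS t0 xy).
apply: near_eq_cvg; near=> h; congr (_ *: (_ - _)).
have h0 : 0 <= h by apply: ltW; near: h; exact: nbhs_right_gt.
by rewrite addrC (sg_add HS).
Unshelve. all: by end_near. Qed.

(** The right derivative of |S(t) x|^2 is - 2 |D S(t) x|^2 on the domain of the
generator. *)
Lemma sg_contraction t x : `|S t x| <= `|x|.
Proof.
have [t0|t0] := leP t 0; first by rewrite (sg_neg HS).
move: x; apply: generator_dense.
  move=> x_ x Px cx; have [K hK] := sg_bounded HS t.
  apply: (ler_cvg_to (cvg_norm (cvg_bounded_linear hK cx)) (cvg_norm cx)).
  by apply: nearW => n /=; exact: Px.
move=> x y xy; rewrite -(@ler_pXn2r _ 2)// ?nnegrE// -!(ipxx HI).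
rewrite -{3 4}(sg0 x).
apply: (@dini_nonincreasing R (fun t => ip (S t x) (S t x)) 0 t (ltW t0)).
  apply: continuous_subspaceT => s.
  by apply: (cvg_ip HI); exact: sg_continuous.
move=> s /andP[s0 _] e e0.
have G := generator_right s0 xy.
have [VS green] := fs_green FS (generator_orbit HS s0 xy).
pose r h := h^-1 *: (S (s + h) x - S s x).
have rc : (fun h => 2 * ip (r h - S s y) (S s x) + h * ip (r h) (r h)) @ 0^'+ -->
    2 * ip (S s y - S s y) (S s x) + 0 * ip (S s y) (S s y).
  apply: cvgD.
    apply: cvgMr; apply: (cvg_ip HI); last exact: cvg_cst.
    by apply: cvgB => //; exact: cvg_cst.
  by apply: cvgM; [exact: cvg_at_right_filter (cvg_id) | exact: (cvg_ip HI)].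
rewrite subrr (ip0l HI) mulr0 mul0r addr0 in rc.
move/cvgrPdist_lt : rc => /(_ _ e0); apply: filterS2 (nbhs_right_gt 0) => h h0.
rewrite sub0r normrN ltr_norml => /andP[_ he].
have -> : S (s + h) x = S s x + h *: r h.
  by rewrite /r scalerA divff ?gt_eqF// scale1r addrCA subrr addr0.
move: he; rewrite (ipBl HI) (green _ VS).
have := ip_ge0 HI (D (S s x)); have := ip_ge0 HI (r h).
rewrite (ip_sqrD HI); move: (ip (D _) _) (ip (r h) (S s x)) (ip (S s x) (S s x)) (ip (r h) (r h)).
move=> dd rs ss rr rr0 dd0 he; rewrite -addrA lerD2l -subr_ge0.
have -> : e * h - (2 * h * rs + h ^+ 2 * rr) =
  h * (e - (2 * (rs - - dd) + h * rr)) + 2 * h * dd by ring.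
by apply: addr_ge0; apply: mulr_ge0 => //; [lra|lra|apply: mulr_ge0 => //; lra].
Qed.

Lemma sg_cvg_joint {T : Type} (F : set_system T) {FF : Filter F} (s_ : T -> R)
    (x_ : T -> H) s x :
  s_ @ F --> s -> x_ @ F --> x -> (fun a => S (s_ a) (x_ a)) @ F --> S s x.
Proof.
move=> ss xx; apply/subr_cvg0/norm_cvg0P.
have C : (fun a => `|x_ a - x| + `|S (s_ a) x - S s x|) @ F --> (0 + 0 : R).
  apply: cvgD; apply/norm_cvg0P/subr_cvg0 => //.
  by apply: (@cvg_comp _ _ _ s_ (fun s => S s x) _ _ _ ss); exact: sg_continuous.
rewrite addr0 in C; apply: (squeeze_cvgr _ (cvg_cst 0) C).
apply: nearW => a; rewrite normr_ge0/=.
have -> : S (s_ a) (x_ a) - S s x = S (s_ a) (x_ a - x) + (S (s_ a) x - S s x).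
  by rewrite SB addrA subrK.
by apply: le_trans (ler_normD _ _) _; rewrite lerD2r sg_contraction.
Qed.

Lemma generator_sym x x' y y' : generator S x x' -> generator S y y' ->
  ip x' y = ip x y'.
Proof.
move=> /(fs_green FS)[Vx gx] /(fs_green FS)[Vy gy].
by rewrite gx// (ipC HI x) gy// (ipC HI (D y)).
Qed.

(** The derivative of <S(t - s) x, S(s) y> in s vanishes on the domain of the generator. *)
Lemma sg_selfadjoint t x y : ip (S t x) y = ip x (S t y).
Proof.
have [t0|t0] := leP t 0; first by rewrite !(sg_neg HS).
have cl (x_ : nat -> H) x0 z : (forall n, ip (S t (x_ n)) z = ip (x_ n) (S t z)) ->
    x_ @ \oo --> x0 -> ip (S t x0) z = ip x0 (S t z).
  move=> Pn cx; have [K hK] := sg_bounded HS t.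
  have C1 : (fun n => ip (S t (x_ n)) z) @ \oo --> ip (S t x0) z.
    by apply: (cvg_ip HI); [exact: cvg_bounded_linear hK cx|exact: cvg_cst].
  have C2 : (fun n => ip (S t (x_ n)) z) @ \oo --> ip x0 (S t z).
    by under eq_fun do rewrite Pn; apply: (cvg_ip HI) => //; exact: cvg_cst.
  by rewrite -(cvg_lim _ C1)// (cvg_lim _ C2).
move: x; apply: generator_dense => [x_ x|x x' xx']; first exact: cl.
move: y; apply: generator_dense => [y_ y Pn cy|y y' yy'].
  rewrite (ipC HI) (ipC HI x); apply/esym; apply: cl cy => n.
  by rewrite (ipC HI) (ipC HI _ (S t x)) Pn.
pose g s := ip (S (t - s) x) (S s y).
have gc : continuous g.
  move=> s; apply: (cvg_ip HI); last exact: sg_continuous.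
  apply: (cvg_comp (fun s => t - s) (fun s => S s x)); last exact: sg_continuous.
  by apply: cvgB; [exact: cvg_cst|exact: cvg_id].
have gd s : 0 <= s < t -> (fun h => h^-1 * (g (s + h) - g s)) @ 0^'+ --> 0.
  move=> /andP[s0 st].
  have E : ip (S (t - s) x) (S s y') - ip (S (t - s) x') (S s y) = 0.
    have ts : 0 <= t - s by lra.
    rewrite (generator_sym (generator_orbit HS ts xx') (generator_orbit HS s0 yy')).
    by rewrite subrr.
  have th : (fun h => t - s - h) @ 0^'+ --> t - s.
    rewrite -[X in _ --> X]subr0; apply: cvgB; first exact: cvg_cst.
    exact: cvg_at_right_filter cvg_id.
  have L : (fun h =>
      ip (S (t - s - h) x) (h^-1 *: (S (s + h) y - S s y)) -
      ip (S (t - s - h) (h^-1 *: (S h x - x))) (S s y)) @ 0^'+ --> (0 : R).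
    rewrite -{2}E; apply: cvgB; apply: (cvg_ip HI).
    - by apply: (@cvg_comp _ _ _ _ (fun s => S s x) _ _ _ th); exact: sg_continuous.
    - exact: generator_right yy'.
    - exact: sg_cvg_joint.
    - exact: cvg_cst.
  apply: cvg_trans L; apply: near_eq_cvg; near=> h.
  have h0 : 0 < h by near: h; exact: nbhs_right_gt.
  have hts : h < t - s by near: h; apply: nbhs_right_lt; lra.
  rewrite /g SZ SB -(sg_add HS); [|lra|lra].
  rewrite subrK -(addrA t) -opprD (ipZl HI) (ipZr HI) (ipBl HI) (ipBr HI).
  by ring.
have := dini_constant (ltW t0) gc gd.
by rewrite /g subrr subr0 !sg0.
Unshelve. all: by end_near. Qed.

(** ** Convexity of the autocorrelation *)

Local Notation psi x t := (ip (S t x) x).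

Lemma psi_split x s t : 0 <= s -> 0 <= t -> psi x (s + t) = ip (S s x) (S t x).
Proof. move=> s0 t0.
rewrite [s + t]addrC (sg_add HS _ t0 s0).
exact: sg_selfadjoint. Qed.

Lemma psi_continuous x : continuous (fun t => psi x t).
Proof.
by move=> t; apply: (cvg_ip HI); [exact: sg_continuous|exact: cvg_cst].
Qed.

(** Second differences of the autocorrelation are squared norms, by self-adjointness: this
is its midpoint convexity. *)
Lemma psi_second x s h : 0 <= s -> 0 <= h ->
  `|S s (x - S h x)| ^+ 2 =
    psi x (s + s) - 2 * psi x (s + s + h) + psi x (s + s + h + h).
Proof.
move=> s0 h0; rewrite -(ipxx HI) SB -(sg_add HS)// !(ipBl HI, ipBr HI).
rewrite -!psi_split ?addr_ge0//.
have -> : s + (s + h) = s + s + h by ring.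
have -> : s + h + s = s + s + h by ring.
have -> : s + h + (s + h) = s + s + h + h by ring.
by ring.
Qed.

Lemma psi_midpoint x s h : 0 <= s -> 0 <= h ->
  psi x (s + h) - psi x (s + h + h) <= psi x s - psi x (s + h).
Proof.
move=> s0 h0; have s2 : 0 <= s / 2 by rewrite divr_ge0.
have := psi_second x s2 h0; have -> : s / 2 + s / 2 = s by field.
by have := sqr_ge0 `|S (s / 2) (x - S h x)|; lra.
Qed.

Lemma psi_midpoint_iter x s h n : 0 <= s -> 0 <= h ->
  psi x (s + n%:R * h) - psi x (s + n%:R * h + h) <= psi x s - psi x (s + h).
Proof.
move=> s0 h0; elim: n => [|n IH]; first by rewrite mul0r addr0.
apply: le_trans IH; have -> : s + n.+1%:R * h = s + n%:R * h + h.
  by rewrite -natr1; ring.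
by apply: psi_midpoint => //; rewrite addr_ge0// mulr_ge0.
Qed.

(** Telescoping of the midpoint inequality. *)
Lemma psi_grid x s h m n : 0 <= s -> 0 <= h ->
  psi x (s + n%:R * h) - psi x (s + n%:R * h + m%:R * h) <=
    psi x s - psi x (s + m%:R * h).
Proof.
move=> s0 h0; elim: m => [|m IH]; first by rewrite !mul0r !addr0 !subrr.
have := @psi_midpoint_iter x (s + m%:R * h) h n (addr_ge0 s0 (mulr_ge0 (ler0n _ m) h0)) h0.
rewrite -[m.+1%:R]natr1 mulrDl mul1r !addrA.
have -> : s + m%:R * h + n%:R * h = s + n%:R * h + m%:R * h by ring.
lra.
Qed.

(** Continuity upgrades midpoint convexity to monotonicity of all increments:
the base point is approximated from the left along a grid of mesh h/m. *)
Lemma psi_increment x s t h : 0 <= s -> s <= t -> 0 <= h ->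
  psi x t - psi x (t + h) <= psi x s - psi x (s + h).
Proof.
move=> s0 st h0; have [->|hn0] := eqVneq h 0; first by rewrite !addr0 !subrr.
have {hn0}h0' : 0 < h by rewrite lt_def hn0.
(* The mesh divides h, so that the increment over h is an increment over m + 1 steps. *)
pose k (m : nat) := h / m.+1%:R.
have k0 m : 0 < k m by rewrite divr_gt0.
pose b m := s + (Num.truncn ((t - s) / k m))%:R * k m.
have kc : k @ \oo --> 0.
  rewrite -(mulr0 h); apply: cvgMr; exact: cvg_harmonic.
have bc : b @ \oo --> t.
  apply/subr_cvg0/norm_cvg0P; apply: (squeeze_cvgr _ (cvg_cst 0) kc).
  apply: nearW => m; rewrite normr_ge0/=.
  have : 0 <= (t - s) / k m by rewrite divr_ge0 ?subr_ge0// ltW.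
  move=> /truncn_itv/andP[]; rewrite ler_pdivlMr// ltr_pdivrMr// -natr1 /b.
  move: (Num.truncn _)%:R => j; rewrite mulrDl mul1r.
  by rewrite ler_norml => ? ?; apply/andP; split; lra.
have C : (fun m => psi x (b m) - psi x (b m + h)) @ \oo --> psi x t - psi x (t + h).
  apply: cvgB; first exact: (cvg_comp b (fun t => psi x t) bc (@psi_continuous x t)).
  apply: (cvg_comp (fun m => b m + h) (fun t => psi x t) _ (@psi_continuous x (t + h))).
  by apply: cvgD => //; exact: cvg_cst.
apply: (ler_cvg_to C (cvg_cst _)); apply: nearW => m /=.
have := @psi_grid x s (k m) m.+1 (Num.truncn ((t - s) / k m)) s0 (ltW (k0 m)).
by have -> : m.+1%:R * k m = h by rewrite /k mulrCA divff// mulr1.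
Qed.

Lemma psi_decreasing x s t : 0 <= s -> s <= t -> psi x t <= psi x s.
Proof.
move=> s0 st.
have E r : 0 <= r -> psi x r = `|S (r / 2) x| ^+ 2.
  move=> r0; rewrite -(ipxx HI) -psi_split ?divr_ge0//.
  by have -> : r / 2 + r / 2 = r by field.
rewrite !E//; last exact: le_trans st.
rewrite ler_pXn2r ?nnegrE//.
have -> : t / 2 = (t - s) / 2 + s / 2 by field.
rewrite (sg_add HS) ?divr_ge0//; last lra.
exact: sg_contraction.
Qed.

(** ** The form domain from the semigroup *)

(** The form value of x, computed from the semigroup: these quotients increase with n, and
x is in V exactly when they are bounded ([energy_bounded], [energy_le]). *)
Definition energy n x : R := 2 ^+ n * (psi x 0 - psi x (2 ^- n)).

Lemma dyadic_gt0 n : 0 < 2 ^- n :> R.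
Proof. by rewrite invr_gt0 exprn_gt0. Qed.
Let dy0 := dyadic_gt0.

Lemma energyE n x : energy n x = 2 ^+ n * ip (x - S (2 ^- n) x) x.
Proof. by rewrite /energy (ipBl HI) sg0. Qed.

Lemma energy_ge0 n x : 0 <= energy n x.
Proof.
by rewrite mulr_ge0// ?exprn_ge0// subr_ge0; apply: psi_decreasing.
Qed.

Lemma psi_slope x s : 0 <= s -> nondecreasing_seq
  (fun n => 2 ^+ n * (psi x s - psi x (s + 2 ^- n))).
Proof.
move=> s0; apply/nondecreasing_seqP => n; have d0 := ltW (dy0 n.+1).
have E : 2 ^- n = 2 ^- n.+1 + 2 ^- n.+1 :> R by rewrite exprS; field; rewrite expf_neq0.
have := psi_midpoint x s0 d0; rewrite E addrA; move: (2 ^- n.+1) => d m.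
by rewrite [2 ^+ n.+1]exprSr -mulrA ler_wpM2l ?exprn_ge0//; lra.
Qed.

Lemma energy_nondecreasing x : nondecreasing_seq (energy ^~ x).
Proof. by have := psi_slope x (lexx 0); rewrite /energy; under eq_fun do rewrite add0r. Qed.

Lemma energyZ n k x : energy n (k *: x) = k ^+ 2 * energy n x.
Proof.
by rewrite /energy !SZ !(ipZl HI, ipZr HI); ring.
Qed.

(** The vectors are u_n, the means of the orbit of x over [0, 2^-n]. They belong to the
domain of the generator, which turns the form values <D u_n, D u_m> into means over [0, 2^-m] of
increments of the autocorrelation; monotonicity of the increments encloses these means. *)
Lemma dyadic_averages x : exists u : nat -> H, [/\ u @ \oo --> x,
  forall n, V (u n),
  forall n v, V v -> ip (D (u n)) (D v) = 2 ^+ n * ip (x - S (2 ^- n) x) v &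
  forall n m, 2 ^+ n * (psi x (2 ^- m) - psi x (2 ^- m + 2 ^- n)) <=
    ip (D (u n)) (D (u m)) <= energy n x].
Proof.
have [w_ hw] := averages HI HS x.
pose h n : R := 2 ^- n.
have h0 n : 0 < h n := dy0 n.
pose u n := (h n)^-1 *: w_ (h n).
have hc : h @ \oo --> 0^'+.
  move=> P [r /= r0 hr].
  have : (fun n => 2^-1 ^+ n : R) @ \oo --> 0.
    by apply: cvg_expr; rewrite gtr0_norm ?invf_lt1 ?ltr1n.
  move=> /cvgrPdist_lt/(_ _ r0) [N _ hN]; exists N => // n Nn /=.
  by apply: hr; [rewrite /= /h -exprVn; exact: hN | exact: h0].
have uc : u @ \oo --> x.
  apply: (cvg_comp h (fun k => k^-1 *: w_ k) _ (average_cvg HI HS hw)).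
  by move=> A hA; exact: hc hA.
have Gu n : generator S (u n) ((h n)^-1 *: (S (h n) x - x)).
  have G := generator_average HI HS (h0 n) (hw _ (h0 n)).
  have : (fun k => (h n)^-1 *: (k^-1 *: (S k (w_ (h n)) - w_ (h n)))) @ 0^'+ -->
      (h n)^-1 *: (S (h n) x - x) by apply: cvgZl_tmp.
  apply: cvg_trans; apply: near_eq_cvg; apply: nearW => k /=.
  by rewrite SZ -scalerBr !scalerA mulrC.
have Vu n : V (u n) by have [] := fs_green FS (Gu n).
have gu n v : V v -> ip (D (u n)) (D v) = 2 ^+ n * ip (x - S (h n) x) v.
  move=> Vv; have [_ /(_ _ Vv)] := fs_green FS (Gu n).
  rewrite (ipZl HI) /h invrK -opprB (ipNl HI) mulrN => /eqP.
  by rewrite eqr_opp => /eqP.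
exists u; split => // n m; rewrite gu// -/(h n).
have E : ip (x - S (h n) x) (u m) = (h m)^-1 * ip (w_ (h m)) (x - S (h n) x).
  by rewrite (ipC HI) /u (ipZl HI).
have [I IE] := hw _ (h0 m) (x - S (h n) x).
have F s : 0 <= s -> ip (S s x) (x - S (h n) x) = psi x s - psi x (s + h n).
  by move=> s0; rewrite (ipBr HI) psi_split// ltW.
rewrite E /energy -/(h n) -/(h m) sg0.
apply/andP; split; (apply: ler_wpM2l; first by rewrite exprn_ge0).
  rewrite mulrC ler_pdivlMr// IE -[X in _ * X]subr0 -(Rintegral_itv_cst _ (ltW (h0 m))).
  apply: le_Rintegral => //; first exact: integrable_itv_cst.
  move=> s; rewrite /= in_itv/= => /andP[s0 sm]; rewrite F//.
  by apply: psi_increment => //; exact: ltW.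
rewrite mulrC ler_pdivrMr// IE -[X in _ * X]subr0 -(Rintegral_itv_cst _ (ltW (h0 m))).
apply: le_Rintegral => //; first exact: integrable_itv_cst.
move=> s; rewrite /= in_itv/= => /andP[s0 sm]; rewrite F//.
have := psi_increment x (lexx 0) s0 (ltW (h0 n)).
by rewrite add0r sg0.
Qed.

(** The vectors D u_n for the means u_n of the orbit form a Cauchy sequence, because
<D u_n, D u_m> is at least nearly the supremum of the energies while |D u_n|^2 is at most that
supremum; then D is closed. *)
Lemma energy_bounded x M : (forall n, energy n x <= M) ->
  V x /\ ip (D x) (D x) <= M.
Proof.
move=> EM; have [u [uc Vu _ ub]] := dyadic_averages x.
have Ec : (energy ^~ x) @ \oo --> sup (range (energy ^~ x)).
  apply: nondecreasing_cvgn; first exact: energy_nondecreasing.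
  by exists M => _ [n _ <-].
set L := sup _ in Ec.
have EL n : energy n x <= L.
  by apply: ub_le_sup; [exists M => _ [m _ <-] | exists n].
have [|z Dz] := @cauchy_seq_cvg _ _ (D \o u).
  move=> e e0; have e4 : 0 < e ^+ 2 / 4 by rewrite divr_gt0 ?exprn_gt0.
  have /cvgrPdist_lt/(_ _ e4) [N _ hN] := Ec.
  have EN : L - e ^+ 2 / 4 < energy N x.
    by have := hN N (leqnn N); rewrite /= ltr_norml => /andP[]; lra.
  have C : (fun m => 2 ^+ N * (psi x (2 ^- m) - psi x (2 ^- m + 2 ^- N))) @ \oo
      --> energy N x.
    have dc : (fun m => 2 ^- m : R) @ \oo --> 0.
      under eq_fun do rewrite -exprVn.
      by apply: cvg_expr; rewrite gtr0_norm ?invf_lt1 ?ltr1n.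
    apply: cvgMr; apply: cvgB.
      exact: (cvg_comp (fun m => 2 ^- m) (fun t => psi x t) dc (@psi_continuous x 0)).
    rewrite -[X in psi x X]add0r.
    apply: (cvg_comp (fun m => 2 ^- m + 2 ^- N) (fun t => psi x t) _ (@psi_continuous x _)).
    by apply: cvgD => //; exact: cvg_cst.
  have /cvgrPdist_lt/(_ _ e4) [N' _ hN'] := C.
  exists (maxn N N') => n m; rewrite !geq_max => /andP[nN nN'] /andP[mN mN'].
  rewrite -(@ler_pXn2r _ 2) ?nnegrE//; last exact: ltW.
  rewrite -(ipxx HI) /= !(ipBl HI, ipBr HI) (ipC HI (D (u m)) (D (u n))).
  have /andP[_ a1] := ub n n; have /andP[_ a2] := ub m m; have /andP[a3 _] := ub n m.
  have a4 := psi_slope x (ltW (dy0 m)) nN.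
  have := hN' m mN'; rewrite /= ltr_norml => /andP[_ a5].
  have := EL n; have := EL m; lra.
have [Vx DE] := fs_closed FS Vu uc Dz; split => //.
have C : (fun n => ip (D (u n)) (D (u n))) @ \oo --> ip (D x) (D x).
  by rewrite DE; apply: (cvg_ip HI).
apply: (ler_cvg_to C (cvg_cst M)); apply: nearW => n.
by have /andP[_ a] := ub n n; exact: le_trans a (EM n).
Qed.

(** Cauchy-Schwarz for <D u_n, D x> = energy n x, where |D u_n|^2 <= energy n x. *)
Lemma energy_le x n : V x -> energy n x <= ip (D x) (D x).
Proof.
move=> Vx; have [u [_ Vu gu ub]] := dyadic_averages x.
have E0 := energy_ge0 n x.
have E1 : energy n x = ip (D (u n)) (D x) by rewrite gu// energyE.
have /andP[_ E2] := ub n n.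
have [->|En0] := eqVneq (energy n x) 0; first exact: ip_ge0.
have {}E0 : 0 < energy n x by rewrite lt_def En0.
have : energy n x ^+ 2 <= energy n x * ip (D x) (D x).
  rewrite {1}E1; apply: (@le_trans _ _ (ip (D (u n)) (D (u n)) * ip (D x) (D x))).
    rewrite !(ipxx HI) -exprMn -[X in X <= _]real_normK ?num_real//.
    by rewrite ler_pXn2r ?nnegrE ?mulr_ge0//; exact: cauchy_schwarz.
  by apply: ler_wpM2r => //; exact: ip_ge0.
by rewrite expr2 ler_pM2l.
Qed.

(** ** Regularity of orbits and of Duhamel integrals *)

(** The increments of the autocorrelation decrease, so the energies of S(t) x are at most
those of x. *)
Lemma sg_V t x : V x -> V (S t x) /\ ip (D (S t x)) (D (S t x)) <= ip (D x) (D x).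
Proof.
move=> Vx; apply: energy_bounded => n; apply: le_trans (energy_le n Vx).
have [t0|t0] := leP t 0; first by rewrite (sg_neg HS).
rewrite /energy ler_wpM2l ?exprn_ge0// !sg0; have t0' := ltW t0.
have t2 : 0 <= t + t by rewrite addr_ge0.
have d0 := ltW (dy0 n).
have := psi_increment x (lexx 0) t2 d0; rewrite add0r sg0.
rewrite -(sg_add HS)// -psi_split// -psi_split ?addr_ge0//.
by have -> : 2 ^- n + t + t = t + t + 2 ^- n by ring.
Qed.

(** Parallelogram identity: |D(S(t) x - x)|^2 + |D(S(t) x + x)|^2 <= 4 |D x|^2, and the
second term is bounded below by an energy of fixed index, which is continuous in H. *)
Lemma sg_V_cvg0 x : V x ->
  ip (D (S t x - x)) (D (S t x - x)) @[t --> 0^'+] --> 0.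
Proof.
move=> Vx; apply/cvgrPdist_lt => e e0.
have e8 : 0 < e / 8 by rewrite divr_gt0.
have [n En] : exists n, ip (D x) (D x) - e / 8 < energy n x.
  apply: contrapT => N.
  have EM n : energy n x <= ip (D x) (D x) - e / 8.
    by rewrite leNgt; apply/negP => h; apply: N; exists n.
  by have [_] := energy_bounded EM; lra.
have C : (fun t => energy n (S t x + x)) @ 0^'+ --> energy n (x + x).
  have Sx : (fun t => S t x + x) @ 0^'+ --> x + x.
    by apply: cvgD; [exact: sg_cvg0|exact: cvg_cst].
  have [K hK] := sg_bounded HS (2 ^- n).
  under eq_fun do rewrite energyE; rewrite energyE; apply: cvgMr.
  by apply: (cvg_ip HI) => //; apply: cvgB => //; exact: cvg_bounded_linear hK Sx.
rewrite -mulr2n -scaler_nat energyZ in C.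
have /cvgrPdist_lt : (fun t => energy n (S t x + x)) @ 0^'+ --> 2 ^+ 2 * energy n x by [].
have e2 : 0 < e / 2 by rewrite divr_gt0.
move=> /(_ _ e2); apply: filterS => t.
rewrite ltr_norml => /andP[_ h]; rewrite sub0r normrN ger0_norm ?ip_ge0//.
have [VS DS] := sg_V t Vx.
have := energy_le n (VD VS Vx).
rewrite (D_B VS Vx) (D_D VS Vx) !(ipBl HI, ipBr HI, ipDl HI, ipDr HI).
by rewrite (ipC HI (D x) (D (S t x))); lra.
Qed.

Lemma energy_difference n x t : 0 <= t ->
  `|S t (2 ^+ n *: (x - S (2 ^- n) x))| ^+ 2 =
  2 ^+ n * 2 ^+ n * (psi x (t + t) - psi x (t + t + 2 ^- n)) -
  2 ^+ n * 2 ^+ n * (psi x (t + t + 2 ^- n) - psi x (t + t + 2 ^- n + 2 ^- n)).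
Proof.
move=> t0; rewrite SZ normrZ exprMn real_normK ?num_real// psi_second ?(ltW (dy0 n))//.
by ring.
Qed.

(** Maximal regularity. The energy of w is paired with the forcing by self-adjointness:
with b = 2^n (w - S(2^-n) w) it equals the integral of <f(s), S(t - s) b>. The squared norms of
S(t - s) b are differences of a nonnegative function at two times at distance 2^-n / 2, so their
integral telescopes to at most half of the energy, and this is absorbed. *)
Lemma duhamel_energy a t f w M : a <= t -> {within `[a, t], continuous f} ->
  (forall s, a <= s <= t -> `|f s| <= M) ->
  wint ip a t (fun s => S (t - s) (f s)) w ->
  V w /\ ip (D w) (D w) <= (t - a) * M ^+ 2.
Proof.
move=> at0 fc fM fw; apply: energy_bounded => n.
pose b := 2 ^+ n *: (w - S (2 ^- n) w); pose d : R := 2 ^- n.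
have d0 : 0 < d := dy0 n.
have bc : continuous (fun s => `|S (t - s) b| ^+ 2).
  have -> : (fun s => `|S (t - s) b| ^+ 2) = (fun s => ip (S (t - s) b) (S (t - s) b)).
    by apply/funext => s; rewrite (ipxx HI).
  move=> s; have C : (fun s => S (t - s) b) @ s --> S (t - s) b.
    apply: (cvg_comp (fun s => t - s) (fun s => S s b)); last exact: sg_continuous.
    by apply: cvgB; [exact: cvg_cst|exact: cvg_id].
  exact: (cvg_ip HI).
have [fi fE] := fw b.
have E1 : energy n w = \int[mu]_(s in `[a, t]) ip (S (t - s) (f s)) b.
  by rewrite -fE /b (ipZr HI) energyE (ipC HI).
(* The arguments of [psi] advance twice as fast as s; a step d there is a step d / 2 in s. *)
pose chi s := 2 ^+ n * 2 ^+ n * (psi w (t - s + (t - s)) - psi w (t - s + (t - s) + d)).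
have chic : continuous chi.
  move=> s; rewrite /chi; apply: cvgMr.
  have C : (fun s => t - s + (t - s)) @ s --> t - s + (t - s).
    by apply: cvgD; apply: cvgB; (exact: cvg_cst || exact: cvg_id).
  apply: cvgB.
    exact: (cvg_comp (fun s => t - s + (t - s)) (fun t => psi w t) C (@psi_continuous w _)).
  apply: (cvg_comp (fun s => t - s + (t - s) + d) (fun t => psi w t) _ (@psi_continuous w _)).
  by apply: cvgD => //; exact: cvg_cst.
have chii p q : mu.-integrable `[p, q] (EFin \o chi).
  by apply: within_continuous_integrable; exact: continuous_subspaceT.
have chis s : s <= t -> `|S (t - s) b| ^+ 2 = chi s - chi (s + - (d / 2)).
  move=> st; rewrite energy_difference ?subr_ge0// /chi -/d.
  by have -> : t - (s + - (d / 2)) + (t - (s + - (d / 2))) = t - s + (t - s) + d by field.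
have chi0 s : s <= t -> 0 <= chi s.
  move=> st; rewrite /chi mulr_ge0 ?mulr_ge0 ?exprn_ge0// subr_ge0.
  by apply: psi_decreasing; [lra | rewrite lerDl ltW].
have chid s : s <= t -> chi s <= 2 ^+ n * energy n w.
  move=> st; rewrite /chi /energy mulrA ler_wpM2l ?mulr_ge0 ?exprn_ge0//.
  have := @psi_increment w 0 (t - s + (t - s)) d (lexx 0).
  by rewrite add0r; apply; [lra|exact: ltW].
have E2 : \int[mu]_(s in `[a, t]) `|S (t - s) b| ^+ 2 <= energy n w / 2.
  have -> : \int[mu]_(s in `[a, t]) `|S (t - s) b| ^+ 2 =
      \int[mu]_(s in `[a, t]) (chi s - chi (s + - (d / 2))).
    by apply: eq_Rintegral => s; rewrite inE/= in_itv/= => /andP[_ st]; exact: chis.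
  have chi2c : continuous (fun s => chi (s + - (d / 2))).
    move=> s; apply: (cvg_comp (fun s => s + - (d / 2)) chi); last exact: chic.
    by apply: cvgD; [exact: cvg_id|exact: cvg_cst].
  rewrite RintegralB//; last first.
    by apply: within_continuous_integrable; exact: continuous_subspaceT.
  rewrite -(Rintegral_shift _ at0 chic).
  have h1 : a + - (d / 2) <= a <= t by apply/andP; split; lra.
  have h2 : a + - (d / 2) <= t + - (d / 2) <= t by apply/andP; split; lra.
  have F := Rintegral_itv_cat h1 (chii _ _).
  rewrite (Rintegral_itv_cat h2 (chii _ _)) in F.
  have G1 : 0 <= \int[mu]_(x in `[a + - (d / 2), a]) chi x.
    apply: Rintegral_ge0 => s; rewrite /= in_itv/= => /andP[_ sa].
    by apply: chi0; exact: le_trans at0.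
  have G2 : \int[mu]_(x in `[t + - (d / 2), t]) chi x <=
      2 ^+ n * energy n w * (t - (t + - (d / 2))).
    have /andP[_ h3] := h2.
    rewrite -(Rintegral_itv_cst _ h3).
    apply: le_Rintegral => //; first exact: integrable_itv_cst.
    by move=> s; rewrite /= in_itv/= => /andP[_ st]; exact: chid.
  have G3 : 2 ^+ n * energy n w * (t - (t + - (d / 2))) = energy n w / 2.
    by rewrite /d; field; rewrite expf_neq0.
  rewrite G3 in G2; move: F G1 G2; do 3 move: (\int[_]_(_ in _) _).
  by move=> x1 x2 x3; move: (\int[_]_(_ in _) _) => x4 F G1 G2; lra.
have E3 : energy n w <= (t - a) * (M ^+ 2 / 2) +
    \int[mu]_(s in `[a, t]) (2^-1 * `|S (t - s) b| ^+ 2).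
  have I2 : mu.-integrable `[a, t] (EFin \o (fun s => 2^-1 * `|S (t - s) b| ^+ 2)).
    apply: integrable_mulr => //.
    by apply: within_continuous_integrable; exact: continuous_subspaceT.
  rewrite mulrC -(Rintegral_itv_cst _ at0) -RintegralD//; last exact: integrable_itv_cst.
  rewrite E1; apply: le_Rintegral => //.
    by apply: integrable_addr => //; exact: integrable_itv_cst.
  move=> s; rewrite /= in_itv/= => sat.
  rewrite sg_selfadjoint; apply: le_trans (ip_le HI _ _) _.
  have := fM s sat; have := normr_ge0 (f s); have := normr_ge0 (S (t - s) b).
  move: (`|f s|) (`|S (t - s) b|) => p q p0 q0 pM.
  have := sqr_ge0 (M - q); nra.
rewrite RintegralZl// in E3; last first.
  by apply: within_continuous_integrable; exact: continuous_subspaceT.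
have := energy_ge0 n w; have : 0 <= (t - a) * M ^+ 2.
  by rewrite mulr_ge0 ?sqr_ge0 ?subr_ge0.
lra.
Qed.

End FormSemigroupTheory.

(** * Mild solutions of semilinear equations *)

Section Mild.
Context {R : realType} {H : completeNormedModType R} {ip : H -> H -> R}.
Context (HI : inner_product ip).
Context {S : R -> {linear H -> H}} {V : H -> Prop} {D : H -> H}.
Context (FS : form_semigroup ip S V D).
Implicit Types (x y u v w : H) (s t a b c : R).

Let HS := fs_semigroup FS.
Let sg0 x : S 0 x = x. Proof. exact: (sg_neg HS). Qed.
Let SB t x y : S t (x - y) = S t x - S t y. Proof. exact: linearB. Qed.

(** [V] with this norm is complete because D is closed. *)
Definition formnorm (D' : H -> H) x : R := `|x| + `|D' x|.
Local Notation nV := (formnorm D).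

Lemma formnorm_ge0 x : 0 <= nV x. Proof. by rewrite addr_ge0. Qed.

Lemma formnormD x y : V x -> V y -> nV (x + y) <= nV x + nV y.
Proof.
move=> Vx Vy; rewrite /formnorm (D_D FS)// addrACA.
by apply: lerD; exact: ler_normD.
Qed.

Lemma formnormB x y : V x -> V y -> nV (x - y) <= nV x + nV y.
Proof.
move=> Vx Vy; rewrite /formnorm (D_B FS)// addrACA.
by apply: lerD; exact: ler_normB.
Qed.

Lemma formnorm_sym x y : V x -> V y -> nV (x - y) = nV (y - x).
Proof. by move=> Vx Vy; rewrite /formnorm !(D_B FS)// distrC [`|D x - _|]distrC. Qed.

Lemma formnorm0 : nV 0 = 0.
Proof. by rewrite /formnorm (D_0 FS) !normr0 addr0. Qed.

Lemma sg_formnorm t x : V x -> nV (S t x) <= nV x.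
Proof.
move=> Vx; apply: lerD; first exact: (sg_contraction HI FS).
have [_] := sg_V HI FS t Vx; rewrite !(ipxx HI) ler_pXn2r ?nnegrE//.
Qed.

Lemma sg_formnorm_cvg0 x : V x -> nV (S t x - x) @[t --> 0^'+] --> 0.
Proof.
move=> Vx; rewrite -[X in _ --> X]addr0; apply: cvgD.
  have C : S t x @[t --> 0^'+] --> x by exact: sg_cvg0.
  by apply/norm_cvg0P/subr_cvg0.
have : Num.sqrt (ip (D (S t x - x)) (D (S t x - x))) @[t --> 0^'+] --> Num.sqrt 0.
  by apply: (cvg_comp _ _ (sg_V_cvg0 HI FS Vx)); exact: sqrt_continuous.
rewrite sqrtr0; apply: cvg_trans; apply: near_eq_cvg; apply: nearW => t.
by rewrite (ipxx HI) sqrtr_sqr normr_id.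
Qed.

(** The form norm of a Duhamel integral over an interval of length d is at most
[modulus d] times the supremum of the forcing. *)
Definition modulus (d : R) : R := d + Num.sqrt d.

Lemma modulus_ge0 d : 0 <= d -> 0 <= modulus d.
Proof. by move=> d0; rewrite addr_ge0// sqrtr_ge0. Qed.

Lemma modulus_le d d' : 0 <= d -> d <= d' -> modulus d <= modulus d'.
Proof. by move=> d0 dd; apply: lerD => //; rewrite ler_sqrt// (le_trans d0). Qed.

Lemma modulus_small (e : R) : 0 < e -> exists2 d : R, 0 < d <= 1 & modulus d <= e.
Proof.
move=> e0; pose d := (Num.min 1 (e / 2)) ^+ 2.
have m0 : 0 < Num.min 1 (e / 2) by rewrite lt_min ltr01 divr_gt0.
have m1 : Num.min 1 (e / 2) <= 1 by rewrite ge_min lexx.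
have m2 : Num.min 1 (e / 2) <= e / 2 by rewrite ge_min lexx orbT.
exists d; first by rewrite exprn_gt0//= exprn_ile1// ltW.
rewrite /modulus /d sqrtr_sqr gtr0_norm// expr2.
have : Num.min 1 (e / 2) * Num.min 1 (e / 2) <= Num.min 1 (e / 2).
  by rewrite ger_pMl.
lra.
Qed.

Lemma duhamel_formnorm a t f w M : a <= t -> 0 <= M ->
  {within `[a, t], continuous f} -> (forall s, a <= s <= t -> `|f s| <= M) ->
  wint ip a t (fun s => S (t - s) (f s)) w ->
  V w /\ nV w <= modulus (t - a) * M.
Proof.
move=> at0 M0 fc fM fw; have [Vw Dw] := duhamel_energy HI FS at0 fc fM fw.
split => //; rewrite /modulus mulrDl; apply: lerD.
  apply: (wint_bound HI at0 fw) => s sat.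
  by apply: le_trans (fM s sat); exact: (sg_contraction HI FS).
rewrite -(@ler_pXn2r _ 2) ?nnegrE ?mulr_ge0 ?sqrtr_ge0// -(ipxx HI).
by rewrite exprMn sqr_sqrtr ?subr_ge0.
Qed.

Lemma within_itv_cvgP (f : R -> R) a b t : a <= t <= b ->
  (forall e, 0 < e -> exists2 d, 0 < d & forall s, a <= s <= b -> `|s - t| < d ->
     f s < e) -> (forall s, 0 <= f s) ->
  f s @[s --> within `[a, b] (nbhs t)] --> 0.
Proof.
move=> tab h f0; apply/cvgrPdist_lt => e e0; rewrite near_withinE.
have [d d0 hd] := h e e0; exists d => // s; rewrite /ball_/= => st sab.
rewrite sub0r normrN ger0_norm//; apply: hd; last by rewrite distrC.
by move: sab; rewrite in_itv.
Qed.

Definition V_continuous (D' : H -> H) a b (T : R -> H) := forall t, a <= t <= b ->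
  formnorm D' (T s - T t) @[s --> within `[a, b] (nbhs t)] --> 0.

(** A path that follows the semigroup up to a uniformly small error is continuous in the
form norm. To the right of t this is strong continuity at T t. To the left one compares with the
orbit started at an earlier time r, since the orbit of T s for varying s is not under control. *)
Lemma flow_continuous a b (T : R -> H) (C : R) : 0 <= C ->
  (forall t, a <= t <= b -> V (T t)) ->
  (forall t t', a <= t -> t <= t' -> t' <= b ->
    nV (T t' - S (t' - t) (T t)) <= C * modulus (t' - t)) ->
  V_continuous D a b T.
Proof.
move=> C0 VT flow t /andP[at0 tb].
have small (e : R) : 0 < e -> exists2 d, 0 < d <= 1 & C * modulus d < e.
  move=> e0; have e1 : 0 < e / (2 * (C + 1)) by rewrite divr_gt0//; lra.
  have [d d01 dm] := modulus_small e1; exists d => //.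
  apply: le_lt_trans (ler_wpM2l C0 dm) _.
  rewrite mulrA ltr_pdivrMr; last by lra.
  by nra.
apply: within_itv_cvgP => [|e e0|s]; last exact: formnorm_ge0; first by rewrite at0.
have e3 : 0 < e / 4 by rewrite divr_gt0.
have [d /andP[d0 d1] dC] := small _ e3.
have Vt : V (T t) by apply: VT; rewrite at0.
have sgd x : V x -> exists2 d', 0 < d' & forall h, 0 <= h < d' -> nV (S h x - x) < e / 4.
  move=> Vx; have /cvgrPdist_lt/(_ _ e3)[d' /= d'0 hd'] := sg_formnorm_cvg0 Vx.
  exists d' => // h /andP[]; rewrite le_eqVlt => /predU1P[<- _|h0 hd].
    by rewrite sg0 subrr formnorm0.
  have := hd' h; rewrite /= sub0r normrN gtr0_norm// => /(_ hd h0).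
  by rewrite sub0r normrN ger0_norm// formnorm_ge0.
pose r := Num.max a (t - d).
have ar : a <= r by rewrite le_max lexx.
have rt : r <= t by rewrite ge_max at0/=; lra.
have tr : t - r <= d by rewrite /r; case: (leP a) => ?; lra.
have Vr : V (T r) by apply: VT; rewrite ar (le_trans rt).
have [d2 d20 hd2] := sgd _ Vt; have [d3 d30 hd3] := sgd _ Vr.
exists (Num.min d (Num.min d2 d3)); first by rewrite !lt_min d0 d20.
move=> s /andP[as0 sb]; rewrite !lt_min => /and3P[sd sd2 sd3].
have Vs : V (T s) by apply: VT; rewrite as0.
have [ts|st] := leP t s.
  have st0 : 0 <= s - t by rewrite subr_ge0.
  rewrite ger0_norm// in sd sd2 sd3.
  have VSt := (sg_V HI FS (s - t) Vt).1.
  have -> : T s - T t = (T s - S (s - t) (T t)) + (S (s - t) (T t) - T t).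
    by rewrite addrA subrK.
  apply: le_lt_trans (formnormD (VB FS Vs VSt) (VB FS VSt Vt)) _.
  have h1 := flow t s at0 ts sb.
  have h2 : C * modulus (s - t) <= C * modulus d.
    by apply: ler_wpM2l => //; apply: modulus_le => //; exact: ltW.
  have := hd2 (s - t); rewrite st0 => /(_ sd2); lra.
rewrite ltr0_norm ?subr_lt0// opprB in sd sd2 sd3.
have rs : r <= s by rewrite /r ge_max as0/=; lra.
have Vst := (sg_V HI FS (t - r) Vr).1.
have Vss := (sg_V HI FS (s - r) Vr).1.
have E : S (t - r) (T r) - S (s - r) (T r) = S (s - r) (S (t - s) (T r) - T r).
  rewrite SB -(sg_add HS)//; [|lra|lra].
  by have -> : s - r + (t - s) = t - r by ring.
have -> : T s - T t = (T s - S (s - r) (T r)) - (T t - S (t - r) (T r)) -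
    (S (t - r) (T r) - S (s - r) (T r)).
  apply: (ip_inj HI) => v; rewrite !(ipBl HI).
  by ring.
rewrite E.
have Vts := (sg_V HI FS (t - s) Vr).1.
have VSS := (sg_V HI FS (s - r) (VB FS Vts Vr)).1.
apply: le_lt_trans (formnormB (VB FS (VB FS Vs Vss) (VB FS Vt Vst)) VSS) _.
have h1 := formnormB (VB FS Vs Vss) (VB FS Vt Vst).
have h2 := sg_formnorm (s - r) (VB FS Vts Vr).
have h3 := flow r s ar rs sb.
have h4 := flow r t ar rt tb.
have h5 : C * modulus (s - r) <= C * modulus d.
  by apply: ler_wpM2l => //; apply: modulus_le => //; lra.
have h6 : C * modulus (t - r) <= C * modulus d.
  by apply: ler_wpM2l => //; apply: modulus_le => //; lra.
have := hd3 (t - s); rewrite subr_ge0 (ltW st) => /(_ sd3); lra.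
Qed.

Lemma V_continuous_bounded a b (T : R -> H) : a <= b ->
  (forall t, a <= t <= b -> V (T t)) -> V_continuous D a b T ->
  exists2 M, 0 <= M & forall t, a <= t <= b -> nV (T t) <= M.
Proof.
move=> ab VT Tc.
have c : {within `[a, b], continuous (fun t => nV (T t))}.
  apply/subspace_continuousP => t; rewrite /= in_itv/= => tab.
  apply/subr_cvg0/norm_cvg0P; apply: (squeeze_cvgr _ (cvg_cst 0) (Tc t tab)).
  rewrite near_withinE; apply: nearW => s sab.
  have {}sab : a <= s <= b by move: sab; rewrite /= in_itv.
  rewrite normr_ge0 /= /from_subspace ler_norml; apply/andP; split.
    have := formnormB (VT s sab) (VB FS (VT s sab) (VT t tab)).
    have -> : T s - (T s - T t) = T t by rewrite opprB addrCA subrr addr0.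
    by lra.
  have := formnormD (VB FS (VT s sab) (VT t tab)) (VT t tab).
  by rewrite subrK; lra.
have [m _ hm] := EVT_max ab c; exists (nV (T m)); first exact: formnorm_ge0.
by move=> t tab; apply: hm; rewrite in_itv.
Qed.

Context {F : R -> H -> H}.
Hypothesis F_lipschitz : forall K M : R, exists2 L : R, 0 <= L &
  forall s t x y, 0 <= s <= K -> 0 <= t <= K -> V x -> V y ->
    nV x <= M -> nV y <= M -> `|F s x - F t y| <= L * (`|s - t| + nV (x - y)).

Lemma forcing_continuous a b (T : R -> H) : 0 <= a ->
  (forall t, a <= t <= b -> V (T t)) -> V_continuous D a b T ->
  {within `[a, b], continuous (fun s => F s (T s))}.
Proof.
move=> a0 VT Tc; apply/subspace_continuousP => t; rewrite /= in_itv/= => tab.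
have [L L0 hL] := F_lipschitz b (nV (T t) + 1).
have C : (fun s => L * (`|s - t| + nV (T s - T t))) @ within `[a, b] (nbhs t) --> 0.
  rewrite -[X in _ --> X](mulr0 L) -[X in L * X]addr0; apply: cvgMr; apply: cvgD; last exact: Tc.
  apply/norm_cvg0P/subr_cvg0; apply: cvg_within_filter; exact: cvg_id.
apply/subr_cvg0/norm_cvg0P; apply: (squeeze_cvgr _ (cvg_cst 0) C).
have := Tc t tab => /cvgrPdist_lt/(_ _ ltr01); rewrite !near_withinE.
apply: filterS => s h sab; have := h sab; rewrite normr_ge0/=.
have {}sab : a <= s <= b by move: sab; rewrite /= in_itv.
rewrite sub0r normrN ger0_norm ?formnorm_ge0// => n1.
have [Vs Vt] := (VT s sab, VT t tab).
apply: hL => //; first by lra.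
- by lra.
- have := formnormD (VB FS Vs Vt) Vt; rewrite subrK; lra.
- lra.
Qed.

Lemma sg_path_continuous a t f : {within `[a, t], continuous f} ->
  {within `[a, t], continuous (fun s => S (t - s) (f s))}.
Proof.
move=> /subspace_continuousP fc; apply/subspace_continuousP => s sat.
apply: (sg_cvg_joint HI FS); last exact: fc.
by apply: cvgB; [exact: cvg_cst|apply: cvg_within_filter; exact: cvg_id].
Qed.

Lemma V_continuousS a b a' b' (T : R -> H) : a <= a' -> b' <= b ->
  V_continuous D a b T -> V_continuous D a' b' T.
Proof.
move=> aa bb Tc t tab; have tab' : a <= t <= b by lra.
apply: cvg_trans (Tc t tab'); apply: cvg_app; apply: within_subset.
by move=> s; rewrite /= !in_itv/=; lra.
Qed.

(** Solutions on [a, b] with value x at time a, so that they can be restarted and glued. *)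
Definition mild (F' : R -> H -> H) a b x (T : R -> H) := [/\
  forall t, a <= t <= b -> V (T t), V_continuous D a b T &
  forall t, a <= t <= b ->
    wint ip a t (fun s => S (t - s) (F' s (T s))) (T t - S (t - a) x)].

Lemma wint_point a f w : wint ip a a f w -> w = 0.
Proof.
move=> fw; apply: (ip_inj HI) => v; rewrite (fw v).2 (ip0l HI).
by rewrite set_itv1 Rintegral_set1.
Qed.

Lemma mild_start a b x (T : R -> H) : a <= b -> mild F a b x T -> T a = x.
Proof.
move=> ab [_ _ Tw]; have := Tw a; rewrite lexx ab => /(_ isT)/wint_point.
by rewrite subrr sg0 => /eqP; rewrite subr_eq0 => /eqP.
Qed.

(** Apply S(t' - t) to the formula at time t and subtract it from the formula at t'. *)
Lemma duhamel_restart a b x f (T : R -> H) t t' : {within `[a, b], continuous f} ->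
  (forall t, a <= t <= b ->
    wint ip a t (fun s => S (t - s) (f s)) (T t - S (t - a) x)) ->
  a <= t -> t <= t' -> t' <= b ->
  wint ip t t' (fun s => S (t' - s) (f s)) (T t' - S (t' - t) (T t)).
Proof.
move=> fc Tw at0 tt' tb.
have c1 : {within `[a, t], continuous (fun s => S (t - s) (f s))}.
  apply: sg_path_continuous; apply: continuous_subspaceW fc.
  by apply: subset_itvl; rewrite bnd_simp; lra.
have c2 : {within `[t, t'], continuous (fun s => S (t' - s) (f s))}.
  apply: sg_path_continuous; apply: continuous_subspaceW fc.
  by apply: subset_itv; rewrite bnd_simp; lra.
have [w hw] := wint_exists HI tt' c2.
have [K hK] := sg_bounded HS (t' - t).
have t1 : a <= t <= b by lra.
have t2 : a <= t' <= b by lra.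
have h1 := wint_linear HI at0 c1 hK (Tw t t1).
have h2 : wint ip a t (fun s => S (t' - s) (f s)) (S (t' - t) (T t - S (t - a) x)).
  apply: eq_wint h1 => s /andP[as0 st] /=; rewrite -(sg_add HS); [|lra|lra].
  by have -> : t' - t + (t - s) = t' - s by ring.
have t3 : a <= t <= t' by lra.
have h3 := wint_uniq HI (wint_cat HI t3 h2 hw) (Tw t' t2).
suff -> : T t' - S (t' - t) (T t) = w by [].
apply: (addrI (S (t' - t) (T t - S (t - a) x))); rewrite h3 SB -(sg_add HS); [|lra|lra].
have -> : t' - t + (t - a) = t' - a by ring.
by rewrite addrC addrA subrK.
Qed.

(** The part of the Duhamel integral after t is the deviation from the orbit of T t. *)
Lemma duhamel_flow a b x f (T : R -> H) (N : R) : 0 <= N ->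
  {within `[a, b], continuous f} -> (forall s, a <= s <= b -> `|f s| <= N) ->
  (forall t, a <= t <= b ->
    wint ip a t (fun s => S (t - s) (f s)) (T t - S (t - a) x)) ->
  forall t t', a <= t -> t <= t' -> t' <= b ->
    V (T t' - S (t' - t) (T t)) /\ nV (T t' - S (t' - t) (T t)) <= N * modulus (t' - t).
Proof.
move=> N0 fc fN Tw t t' at0 tt tb.
have fc2 : {within `[t, t'], continuous f}.
  by apply: continuous_subspaceW fc; apply: subset_itv; rewrite bnd_simp; lra.
rewrite mulrC; apply: (duhamel_formnorm tt N0 fc2); last exact: duhamel_restart Tw at0 tt tb.
by move=> s sat; apply: fN; lra.
Qed.

Lemma forcing_bounded a b (T : R -> H) : 0 <= a -> a <= b ->
  (forall t, a <= t <= b -> V (T t)) -> V_continuous D a b T ->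
  exists2 N, 0 <= N & forall t, a <= t <= b -> `|F t (T t)| <= N.
Proof.
move=> a0 ab VT Tc; have [M M0 hM] := V_continuous_bounded ab VT Tc.
have [L L0 hL] := F_lipschitz b M.
exists (L * (b - a + (M + M)) + `|F a (T a)|).
  by rewrite addr_ge0// mulr_ge0//; lra.
move=> t tab; have aab : a <= a <= b by rewrite lexx.
have -> : F t (T t) = (F t (T t) - F a (T a)) + F a (T a) by rewrite subrK.
apply: le_trans (ler_normD _ _) _; rewrite lerD2r.
have t0 : 0 <= t <= b by lra.
have a0' : 0 <= a <= b by lra.
apply: le_trans (hL _ _ _ _ t0 a0' (VT _ tab) (VT _ aab) (hM _ tab) (hM _ aab)) _.
apply: ler_wpM2l => //; apply: lerD; first by rewrite ger0_norm; lra.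
apply: le_trans (formnormB (VT _ tab) (VT _ aab)) _.
by apply: lerD; exact: hM.
Qed.

Lemma mild_flow a b x T : 0 <= a -> a <= b -> mild F a b x T ->
  exists2 N, 0 <= N & forall t t', a <= t -> t <= t' -> t' <= b ->
    nV (T t' - S (t' - t) (T t)) <= N * modulus (t' - t).
Proof.
move=> a0 ab [VT Tc Tw]; have [N N0 hN] := forcing_bounded a0 ab VT Tc.
exists N => // t t' at0 tt tb.
exact: (duhamel_flow N0 (forcing_continuous a0 VT Tc) hN Tw at0 tt tb).2.
Qed.

Lemma mildS a b c x T : 0 <= a -> a <= c -> c <= b -> mild F a b x T ->
  mild F c b (T c) T.
Proof.
move=> a0 ac cb Tm; have [VT Tc Tw] := Tm; split.
- by move=> t tcb; apply: VT; lra.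
- exact: V_continuousS Tc.
- by move=> t /andP[ct tb]; exact: (duhamel_restart (forcing_continuous a0 VT Tc) Tw).
Qed.

Lemma mild_prefix a b c x T : c <= b -> mild F a b x T -> mild F a c x T.
Proof.
move=> cb [VT Tc Tw]; split.
- by move=> t tcb; apply: VT; lra.
- exact: V_continuousS Tc.
- by move=> t tac; apply: Tw; lra.
Qed.

Lemma mild_glue a b c x T1 T2 : 0 <= a -> a <= c -> c <= b ->
  mild F a c x T1 -> mild F c b (T1 c) T2 ->
  mild F a b x (fun t => if t <= c then T1 t else T2 t).
Proof.
move=> a0 ac cb T1m T2m; set T := fun t => _.
have c0 : 0 <= c by exact: le_trans ac.
have T2c : T2 c = T1 c by exact: mild_start T2m.
have E1 t : t <= c -> T t = T1 t by move=> tc; rewrite /T tc.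
have E2 t : c <= t -> T t = T2 t.
  move=> ct; rewrite /T; case: leP => // tc.
  by have -> : t = c by apply/eqP; rewrite eq_le tc.
have [VT1 T1c T1w] := T1m; have [VT2 T2c' T2w] := T2m.
have [N1 N10 f1] := mild_flow a0 ac T1m; have [N2 N20 f2] := mild_flow c0 cb T2m.
have VT t : a <= t <= b -> V (T t).
  by move=> tab; rewrite /T; case: leP => tc; [apply: VT1|apply: VT2]; lra.
split => //.
  apply: (@flow_continuous a b T (N1 + N2) (addr_ge0 N10 N20) VT) => t t' at0 tt tb.
  have m0 : 0 <= modulus (t' - t) by apply: modulus_ge0; lra.
  have [tc|ct] := leP t' c.
    rewrite (E1 t' tc) (E1 t (le_trans tt tc)); apply: le_trans (f1 _ _ at0 tt tc) _.
    by apply: ler_wpM2r m0 _ _ _; rewrite lerDl.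
  have [tc|{}ct'] := leP c t.
    rewrite (E2 t' (ltW ct)) (E2 t tc); apply: le_trans (f2 _ _ tc tt tb) _.
    by apply: ler_wpM2r m0 _ _ _; rewrite lerDr.
  rewrite (E1 t) ?(ltW ct')// (E2 t') ?(ltW ct)//.
  have V1 : V (T1 t) by apply: VT1; lra.
  have V1c : V (T1 c) by apply: VT1; lra.
  have V2 : V (T2 t') by apply: VT2; lra.
  have W1 := (sg_V HI FS (c - t) V1).1.
  have W2 := (sg_V HI FS (t' - c) V1c).1.
  have -> : T2 t' - S (t' - t) (T1 t) =
      (T2 t' - S (t' - c) (T2 c)) + S (t' - c) (T1 c - S (c - t) (T1 t)).
    rewrite SB -(sg_add HS); [|lra|lra].
    have -> : t' - c + (c - t) = t' - t by ring.
    by rewrite T2c addrA subrK.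
  have W3 := VB FS V1c W1; have W4 := (sg_V HI FS (t' - c) W3).1.
  rewrite T2c; apply: le_trans (formnormD (VB FS V2 W2) W4) _.
  have h1 := f2 c t' (lexx c) (ltW ct) tb; rewrite T2c in h1.
  have h2 := f1 t c at0 (ltW ct') (lexx c).
  have h3 := sg_formnorm (t' - c) W3.
  have h4 : N2 * modulus (t' - c) <= N2 * modulus (t' - t).
    by apply: ler_wpM2l => //; apply: modulus_le; lra.
  have h5 : N1 * modulus (c - t) <= N1 * modulus (t' - t).
    by apply: ler_wpM2l => //; apply: modulus_le; lra.
  by rewrite mulrDl; lra.
move=> t tab; have [tc|ct] := leP t c.
  rewrite E1//; apply: eq_wint (T1w t _) => [s sat|]; last by lra.
  by rewrite E1//; lra.
rewrite E2 ?(ltW ct)//.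
have tcb : c <= t <= b by lra.
have w2 : wint ip c t (fun s => S (t - s) (F s (T s))) (T2 t - S (t - c) (T1 c)).
  by apply: eq_wint (T2w t tcb) => s sct; rewrite E2//; lra.
have Fc := sg_path_continuous (forcing_continuous a0 VT1 T1c).
have [K hK] := sg_bounded HS (t - c).
have acc : a <= c <= c by lra.
have w1 : wint ip a c (fun s => S (t - s) (F s (T s))) (S (t - c) (T1 c - S (c - a) x)).
  apply: eq_wint (wint_linear HI ac Fc hK (T1w c acc)) => s sac /=.
  rewrite -(sg_add HS); [|lra|lra].
  have -> : t - c + (c - s) = t - s by ring.
  by rewrite E1//; lra.
have act : a <= c <= t by lra.
have := wint_cat HI act w1 w2; rewrite SB -(sg_add HS); [|lra|lra].
have -> : t - c + (c - a) = t - a by ring.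
by rewrite addrC addrA subrK.
Qed.

(** The contraction estimate behind both uniqueness and existence: the forcing terms differ
by at most L B, and d is chosen with modulus d <= 1 / (2 (L + 1)). It is stated for values of
the Duhamel integrals, because Picard iterates are not solutions. *)
Lemma mild_contract K M : exists d : R, 0 < d <= 1 /\
  forall a b (T T' : R -> H) w w' B t, 0 <= a -> b <= K -> a <= b ->
  (forall s, a <= s <= b -> [/\ V (T s), V (T' s), nV (T s) <= M & nV (T' s) <= M]) ->
  V_continuous D a b T -> V_continuous D a b T' ->
  (forall s, a <= s <= b -> nV (T s - T' s) <= B) ->
  a <= t <= b -> t <= a + d ->
  wint ip a t (fun s => S (t - s) (F s (T s))) w ->
  wint ip a t (fun s => S (t - s) (F s (T' s))) w' ->
  V (w - w') /\ nV (w - w') <= B / 2.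
Proof.
have [L L0 hL] := F_lipschitz K M.
have e0 : 0 < (2 * (L + 1))^-1 by rewrite invr_gt0; lra.
have [d /andP[d0 d1] dm] := modulus_small e0.
exists d; split; first by rewrite d0.
move=> a b T T' w w' B t a0 bK ab TV Tc T'c TB tab td hw hw'.
have B0 : 0 <= B by apply: le_trans (TB a _); rewrite ?formnorm_ge0// lexx.
have cT (T0 : R -> H) : (forall s, a <= s <= b -> V (T0 s)) ->
    V_continuous D a b T0 -> {within `[a, t], continuous (fun s => F s (T0 s))}.
  move=> V0' c0; apply: continuous_subspaceW (forcing_continuous a0 V0' c0).
  by apply: subset_itvl; rewrite bnd_simp; lra.
have c1 := cT T (fun s sab => let: And4 h _ _ _ := TV s sab in h) Tc.
have c2 := cT T' (fun s sab => let: And4 _ h _ _ := TV s sab in h) T'c.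
have cB : {within `[a, t], continuous (fun s => F s (T s) - F s (T' s))}.
  by move=> s; apply: cvgB; [exact: c1|exact: c2].
have wB : wint ip a t (fun s => S (t - s) (F s (T s) - F s (T' s))) (w - w').
  by apply: eq_wint (wintB HI hw hw') => s _ /=; rewrite SB.
have at0 : a <= t by lra.
have LB : 0 <= L * B by exact: mulr_ge0.
have bnd s : a <= s <= t -> `|F s (T s) - F s (T' s)| <= L * B.
  move=> sat; have sab : a <= s <= b by lra.
  have [V1 V2 n1 n2] := TV s sab.
  have s0 : 0 <= s <= K by lra.
  apply: le_trans (hL _ _ _ _ s0 s0 V1 V2 n1 n2) _.
  by rewrite subrr normr0 add0r; apply: ler_wpM2l => //; exact: TB.
have [Vw nw] := duhamel_formnorm at0 LB cB bnd wB; split => //.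
apply: le_trans nw _; have md : modulus (t - a) <= (2 * (L + 1))^-1.
  by apply: le_trans dm; apply: modulus_le; lra.
apply: le_trans (ler_wpM2r LB md) _; rewrite mulrC ler_pdivrMr; last lra.
by nra.
Qed.

Lemma mild_unique_short K M : exists2 d : R, 0 < d &
  forall a b x T T', 0 <= a -> b <= K -> a <= b -> b <= a + d ->
  mild F a b x T -> mild F a b x T' ->
  (forall s, a <= s <= b -> nV (T s) <= M /\ nV (T' s) <= M) ->
  forall t, a <= t <= b -> T t = T' t.
Proof.
have [d [/andP[d0 d1] hd]] := mild_contract K M; exists d => //.
move=> a b x T T' a0 bK ab bd [VT Tc Tw] [VT' T'c T'w] TM.
have TV s : a <= s <= b -> [/\ V (T s), V (T' s), nV (T s) <= M & nV (T' s) <= M].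
  by move=> sab; have [] := TM s sab; split => //; [exact: VT|exact: VT'].
have step B : (forall s, a <= s <= b -> nV (T s - T' s) <= B) ->
    forall s, a <= s <= b -> nV (T s - T' s) <= B / 2.
  move=> hB s sab; have sd : s <= a + d by lra.
  have [_] := hd _ _ _ _ _ _ _ _ a0 bK ab TV Tc T'c hB sab sd (Tw s sab) (T'w s sab).
  by rewrite opprB addrA subrK.
have iter n s : a <= s <= b -> nV (T s - T' s) <= (M + M) * 2^-1 ^+ n.
  elim: n s => [|n IH] s sab.
    have [V1 V2 n1 n2] := TV s sab; rewrite expr0 mulr1.
    by apply: le_trans (formnormB V1 V2) _; exact: lerD.
  by rewrite exprSr mulrA; exact: step.
move=> t tab; apply/eqP; rewrite -subr_eq0 -normr_le0.
apply: (@le_trans _ _ (nV (T t - T' t))); first by rewrite lerDl.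
have C : (fun n => (M + M) * 2^-1 ^+ n) @ \oo --> (M + M) * 0.
  by apply: cvgMr; apply: cvg_expr; rewrite gtr0_norm ?invf_lt1 ?ltr1n.
rewrite mulr0 in C; apply: (ler_cvg_to (cvg_cst _) C).
by apply: nearW => n; exact: iter.
Qed.

(** Steps of the length given by a common bound on both solutions. *)
Lemma mild_unique b x T T' : 0 <= b -> mild F 0 b x T -> mild F 0 b x T' ->
  forall t, 0 <= t <= b -> T t = T' t.
Proof.
move=> b0 Tm T'm; have [VT Tc _] := Tm; have [VT' T'c _] := T'm.
have [M1 _ hM1] := V_continuous_bounded b0 VT Tc.
have [M2 _ hM2] := V_continuous_bounded b0 VT' T'c.
have [d d0 hd] := mild_unique_short b (Num.max M1 M2).
have main n t : 0 <= t <= b -> t <= n%:R * d -> T t = T' t.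
  elim: n t => [|n IH] t tb tn.
    have -> : t = 0 by move: tn; rewrite mul0r; lra.
    by rewrite (mild_start b0 Tm) (mild_start b0 T'm).
  have nd0 : 0 <= n%:R * d by apply: mulr_ge0 => //; exact: ltW.
  have [tnd|ndt] := leP t (n%:R * d); first exact: IH.
  pose c := n%:R * d; have c0 : 0 <= c := nd0.
  have cb : c <= b by rewrite /c; lra.
  have Tc' : T c = T' c by apply: IH => //; rewrite c0.
  have m1 := mild_prefix (_ : t <= b) (mildS (lexx 0) c0 cb Tm).
  have m2 := mild_prefix (_ : t <= b) (mildS (lexx 0) c0 cb T'm).
  rewrite -Tc' in m2.
  have tb' : t <= b by lra.
  have ct : c <= t by exact: ltW.
  have tcd : t <= c + d by move: tn; rewrite -natr1 mulrDl mul1r /c.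
  apply: (hd _ _ _ _ _ c0 tb' ct tcd (m1 tb') (m2 tb')); last by rewrite ct lexx.
  move=> s sct; split; rewrite le_max; apply/orP; [left; apply: hM1|right; apply: hM2]; lra.
move=> t tb; apply: (main (Num.truncn (t / d)).+1) => //.
rewrite -ler_pdivrMr//; apply/ltW.
have /truncn_itv/andP[] // : 0 <= t / d by rewrite divr_ge0 ?(ltW d0)//; lra.
Qed.

(** The rate is that of the Picard iterates. *)
Lemma form_cauchy_cvg (x_ : nat -> H) : (forall n, V (x_ n)) ->
  (forall n, nV (x_ n.+1 - x_ n) <= 2^-1 ^+ n) ->
  exists y, [/\ V y, x_ @ \oo --> y & forall n, nV (x_ n - y) <= 2 * 2^-1 ^+ n].
Proof.
move=> Vx xd.
have tail n k : nV (x_ (n + k)%N - x_ n) <= 2 * 2^-1 ^+ n.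
  apply: (@le_trans _ _ (2 * (2^-1 ^+ n - 2^-1 ^+ (n + k)))); last first.
    by rewrite ler_pM2l// gerBl exprn_ge0.
  elim: k => [|k IH]; first by rewrite addn0 !subrr formnorm0 mulr0.
  have -> : x_ (n + k.+1)%N - x_ n = (x_ (n + k.+1)%N - x_ (n + k)%N) + (x_ (n + k)%N - x_ n).
    by rewrite addrA subrK.
  apply: le_trans (formnormD (VB FS (Vx _) (Vx _)) (VB FS (Vx _) (Vx _))) _.
  have := xd (n + k)%N; rewrite -addnS addnS exprS; lra.
have small e : 0 < e -> exists n0, forall n, (n0 <= n)%N -> 2 * 2^-1 ^+ n <= e :> R.
  move=> e0; have : (fun n => 2 * 2^-1 ^+ n : R) @ \oo --> (2 * 0 : R).
    by apply: cvgMr; apply: cvg_expr; rewrite gtr0_norm ?invf_lt1 ?ltr1n.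
  rewrite mulr0 => /cvgrPdist_lt/(_ _ e0) [n0 _ hn0]; exists n0 => n nn.
  by have := hn0 n nn; rewrite sub0r normrN ger0_norm ?mulr_ge0 ?exprn_ge0// => /ltW.
have cau e : 0 < e -> exists n0, forall n m, (n0 <= n)%N -> (n0 <= m)%N ->
    nV (x_ n - x_ m) <= e.
  move=> e0; have [n0 hn0] := small _ e0; exists n0 => n m n0n n0m.
  wlog nm : n m n0n n0m / (m <= n)%N.
    move=> h; have [mn|/ltnW nm] := leqP m n; first exact: h.
    by rewrite formnorm_sym//; exact: h.
  by rewrite -(subnKC nm); apply: le_trans (tail _ _) (hn0 _ n0m).
have [|y hy] := @cauchy_seq_cvg _ _ x_.
  move=> e e0; have [n0 hn0] := cau _ e0; exists n0 => n m n0n n0m.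
  by apply: le_trans (hn0 n m n0n n0m); rewrite lerDl.
have [|z hz] := @cauchy_seq_cvg _ _ (D \o x_).
  move=> e e0; have [n0 hn0] := cau _ e0; exists n0 => n m n0n n0m.
  by apply: le_trans (hn0 n m n0n n0m); rewrite -(D_B FS)// lerDr.
have [Vy Dy] := fs_closed FS Vx hy hz.
exists y; split => // n.
have C : (fun k => nV (x_ k - x_ n)) @ \oo --> nV (y - x_ n).
  apply: cvgD; apply: cvg_norm; first by apply: cvgB => //; exact: cvg_cst.
  rewrite (D_B FS)//; under eq_fun do rewrite (D_B FS)//.
  by apply: cvgB; [rewrite Dy|exact: cvg_cst].
rewrite formnorm_sym//; apply: (ler_cvg_to C (cvg_cst _)).
by exists n => // k /= nk; rewrite -(subnKC nk); exact: tail.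
Qed.

Let halving_cvg (c k : R) : (fun n => c + k * 2^-1 ^+ n) @ \oo --> c.
Proof.
rewrite -[X in _ --> X]addr0 -(mulr0 k); apply: cvgD; first exact: cvg_cst.
by apply: cvgMr; apply: cvg_expr; rewrite gtr0_norm ?invf_lt1 ?ltr1n.
Qed.

(** The limit of Picard iterates inherits the estimate of [duhamel_flow]. *)
Lemma flow_limit (T_ : nat -> R -> H) (T : R -> H) (N : R) t t' :
  V (T t) -> V (T t') -> (forall n, V (T_ n t)) -> (forall n, V (T_ n t')) ->
  (forall n, nV (T_ n t - T t) <= 2 * 2^-1 ^+ n) ->
  (forall n, nV (T_ n t' - T t') <= 2 * 2^-1 ^+ n) ->
  (forall n, V (T_ n.+1 t' - S (t' - t) (T_ n.+1 t)) /\
    nV (T_ n.+1 t' - S (t' - t) (T_ n.+1 t)) <= N) ->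
  nV (T t' - S (t' - t) (T t)) <= N.
Proof.
move=> Vt Vt' gt gt' n1 n2 fl; have C := @halving_cvg N 4.
apply: (ler_cvg_to (cvg_cst _) C).
exists 1%N => // -[//|n] _; have [V1 n3] := fl n.
have Wt := VB FS Vt' (gt' n.+1); have Ws := VB FS (gt n.+1) Vt.
have Wss := (sg_V HI FS (t' - t) Ws).1.
have -> : T t' - S (t' - t) (T t) = (T t' - T_ n.+1 t') +
    (T_ n.+1 t' - S (t' - t) (T_ n.+1 t)) + S (t' - t) (T_ n.+1 t - T t).
  by rewrite SB; apply: (ip_inj HI) => v; rewrite !(ipBl HI, ipDl HI); ring.
apply: le_trans (formnormD (VD FS Wt V1) Wss) _.
have h1 := formnormD Wt V1; have h2 := sg_formnorm (t' - t) Ws.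
have h3 := n1 n.+1; have h4 := n2 n.+1; rewrite formnorm_sym// in h4.
lra.
Qed.

(** Picard iteration. The step d is small enough for the iterates to stay in the ball of
radius M + 1 and for the iteration to contract, and these conditions involve only K and M. *)
Lemma mild_local K M : exists2 d : R, 0 < d &
  forall a x, 0 <= a -> a <= K -> V x -> nV x <= M ->
  exists T, mild F a (a + d) x T.
Proof.
have [d1 [/andP[d10 d11] hd]] := mild_contract (K + 1) (M + 1).
have [L L0 hL] := F_lipschitz (K + 1) (M + 1).
pose N := L * (K + 1 + (M + 1)) + `|F 0 0|.
have [M0|M0] := leP 0 M; last first.
  by exists 1 => // a x _ _ _ xM; have := formnorm_ge0 x; lra.
have [K0|K0] := leP 0 K; last by exists 1 => // a x a0 aK; lra.
have N0 : 0 <= N by rewrite addr_ge0// mulr_ge0//; lra.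
have NF s y : 0 <= s <= K + 1 -> V y -> nV y <= M + 1 -> `|F s y| <= N.
  move=> sK Vy yM; have -> : F s y = (F s y - F 0 0) + F 0 0 by rewrite subrK.
  apply: le_trans (ler_normD _ _) _; rewrite lerD2r.
  have z0 : 0 <= (0 : R) <= K + 1 by rewrite lexx/=; lra.
  apply: le_trans (hL _ _ _ _ sK z0 Vy (V0 FS) yM _) _; first by rewrite formnorm0; lra.
  apply: ler_wpM2l => //; rewrite !subr0 ger0_norm; lra.
have e0 : 0 < (N + 1)^-1 by rewrite invr_gt0; lra.
have [d2 /andP[d20 d21] d2m] := modulus_small e0.
pose d := Num.min d1 d2.
have dd1 : d <= d1 by rewrite ge_min lexx.
have dd2 : d <= d2 by rewrite ge_min lexx orbT.
have d0 : 0 < d by rewrite lt_min d10.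
have mN : N * modulus d <= 1.
  have h : modulus d <= (N + 1)^-1.
    by apply: le_trans d2m; apply: modulus_le => //; exact: ltW.
  apply: le_trans (ler_wpM2l N0 h) _; rewrite ler_pdivrMr; lra.
exists d => // a x a0 aK Vx xM; set b := a + d.
have bK : b <= K + 1 by rewrite /b; lra.
have ab : a <= b by rewrite lerDl ltW.
have bd1 : b <= a + d1 by rewrite lerD2l.
have bad t : t <= b -> t - a <= d by rewrite /b lerBlDl.
have sK s : a <= s <= b -> 0 <= s <= K + 1.
  by move=> /andP[as0 sb]; rewrite (le_trans a0 as0) (le_trans sb bK).
have MM : M <= M + 1 by rewrite lerDl.
move: b bK ab bd1 bad sK {aK K0 dd1 dd2 d20 d21 d2m e0} => b bK ab bd1 bad sK.
(* [next] relates an iterate to the following one; it is a relation, as [wint] is. *)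
pose good (T : R -> H) := [/\ forall s, a <= s <= b -> V (T s),
  V_continuous D a b T & forall s, a <= s <= b -> nV (T s) <= M + 1].
pose next (T T' : R -> H) := forall t, a <= t <= b ->
  wint ip a t (fun s => S (t - s) (F s (T s))) (T' t - S (t - a) x).
have goodF T : good T -> {within `[a, b], continuous (fun s => F s (T s))}.
  by move=> [VT Tc _]; exact: forcing_continuous.
have goodN T : good T -> forall s, a <= s <= b -> `|F s (T s)| <= N.
  by move=> [VT _ TM] s sab; apply: NF; [exact: sK|exact: VT|exact: TM].
have goodFt T t : good T -> a <= t <= b ->
    {within `[a, t], continuous (fun s => F s (T s))}.
  move=> gT /andP[_ tb]; apply: continuous_subspaceW (goodF T gT).
  by apply: subset_itvl; rewrite bnd_simp.
have VS t : V (S t x) by exact: (sg_V HI FS t Vx).1.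
have next_flow T T' (gT : good T) (TT' : next T T') :=
  duhamel_flow N0 (goodF T gT) (goodN T gT) TT'.
have next_start T T' : next T T' -> T' a = x.
  move=> /(_ a); rewrite lexx ab => /(_ isT)/wint_point.
  by rewrite subrr sg0 => /eqP; rewrite subr_eq0 => /eqP.
have next_near T T' t : good T -> next T T' -> a <= t <= b ->
    V (T' t - S (t - a) x) /\ nV (T' t - S (t - a) x) <= 1.
  move=> gT TT' /andP[at0 tb]; have := next_flow T T' gT TT' a t (lexx a) at0 tb.
  rewrite (next_start T T' TT') => -[V1 n1]; split => //.
  apply: le_trans n1 (le_trans _ mN); apply: ler_wpM2l => //.
  by apply: modulus_le; [rewrite subr_ge0|exact: bad].
have next_good T T' : good T -> next T T' -> good T'.
  move=> gT TT'; have E t : T' t = (T' t - S (t - a) x) + S (t - a) x by rewrite subrK.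
  have VT' t : a <= t <= b -> V (T' t).
    by move=> tab; rewrite E; apply: (VD FS) => //; exact: (next_near _ _ t gT TT' tab).1.
  split => //.
    apply: (flow_continuous N0 VT') => t t' h1 h2 h3.
    exact: (next_flow T T' gT TT' t t' h1 h2 h3).2.
  move=> t tab; have [V1 n1] := next_near T T' t gT TT' tab.
  rewrite E addrC; apply: le_trans (formnormD (VS _) V1) _.
  by apply: lerD n1; exact: le_trans (sg_formnorm _ Vx) xM.
have next_ex T : good T -> exists T', next T T'.
  move=> gT; have P t : exists y, a <= t <= b ->
      wint ip a t (fun s => S (t - s) (F s (T s))) (y - S (t - a) x).
    have [tab|tab] := boolP (a <= t <= b); last by exists 0 => /negP; case; exact/negP.
    have [at0 _] := andP tab.
    have [w hw] := wint_exists HI at0 (sg_path_continuous (goodFt T t gT tab)).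
    by exists (w + S (t - a) x); rewrite addrK.
  by have [T' hT'] := choice P; exists T'.
pose T0 t := S (t - a) x.
have T0g : good T0.
  have V0' t : a <= t <= b -> V (T0 t) by move=> _; exact: VS.
  split => //; last by move=> s _; exact: le_trans (sg_formnorm _ Vx) (le_trans xM MM).
  apply: (flow_continuous (lexx 0) V0') => t t' h1 h2 h3.
  rewrite /T0 -(sg_add HS) ?subr_ge0//.
  have -> : t' - t + (t - a) = t' - a by ring.
  by rewrite subrr formnorm0 mul0r.
have [Phi hPhi] : exists Phi : (R -> H) -> (R -> H), forall T, good T -> next T (Phi T).
  have P T : exists T', good T -> next T T'.
    by have [gT|gT] := pselect (good T); [have [T' h] := next_ex T gT; exists T'|exists T].
  by have [Phi h] := choice P; exists Phi.
pose T_ n := iter n Phi T0.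
have Tg n : good (T_ n).
  by elim: n => [//|n IH] /=; exact: next_good (hPhi _ IH).
have Tn n : next (T_ n) (T_ n.+1) by exact: hPhi.
have Vn n t : a <= t <= b -> V (T_ n t) by have [+ _ _] := Tg n; exact.
have Td n t : a <= t <= b -> nV (T_ n.+1 t - T_ n t) <= 2^-1 ^+ n.
  elim: n t => [|n IH] t tab.
    by rewrite expr0; exact: (next_near _ _ t (Tg 0%N) (Tn 0%N) tab).2.
  have [g1 c1 m1] := Tg n.+1; have [g0 c0 m0] := Tg n.
  have TV s : a <= s <= b -> [/\ V (T_ n.+1 s), V (T_ n s),
      nV (T_ n.+1 s) <= M + 1 & nV (T_ n s) <= M + 1].
    by move=> sab; split; [exact: g1|exact: g0|exact: m1|exact: m0].
  have td1 : t <= a + d1 by case/andP: tab => _ tb; exact: le_trans tb bd1.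
  have [_] := hd _ _ _ _ _ _ _ _ a0 bK ab TV c1 c0 IH tab td1
    (Tn n.+1 t tab) (Tn n t tab).
  by rewrite exprSr opprB addrA subrK.
have lim t : exists y, a <= t <= b -> [/\ V y, (T_ ^~ t) @ \oo --> y &
    forall n, nV (T_ n t - y) <= 2 * 2^-1 ^+ n].
  have [tab|tab] := boolP (a <= t <= b); last by exists 0 => /negP; case; exact/negP.
  have [y hy] := form_cauchy_cvg (fun n => Vn n t tab) (fun n => Td n t tab).
  by exists y => _.
have [T hT] := choice lim.
have VT t : a <= t <= b -> V (T t) by move=> tab; have [] := hT t tab.
have Tc : V_continuous D a b T.
  apply: (flow_continuous N0 VT) => t t' at0 tt tb.
  have t1 : a <= t <= b by rewrite at0 (le_trans tt).
  have t2 : a <= t' <= b by rewrite tb (le_trans at0).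
  have [_ _ n1] := hT t t1; have [_ _ n2] := hT t' t2.
  apply: (flow_limit (VT t t1) (VT t' t2) (fun n => Vn n t t1) (fun n => Vn n t' t2) n1 n2).
  by move=> n; exact: (next_flow _ _ (Tg n) (Tn n) t t' at0 tt tb).
have TM s : a <= s <= b -> nV (T s) <= M + 1.
  move=> sab; have [_ _ n1] := hT s sab.
  have C := @halving_cvg (M + 1) 2; apply: (ler_cvg_to (cvg_cst _) C).
  apply: nearW => n; have [_ _ m] := Tg n.
  have -> : T s = T_ n s - (T_ n s - T s) by rewrite opprB addrCA subrr addr0.
  apply: le_trans (formnormB (Vn n s sab) (VB FS (Vn n s sab) (VT s sab))) _.
  by apply: lerD; [exact: m|exact: n1].
exists T; split => // t tab; have [at0 tb] := andP tab.
have Fc : {within `[a, t], continuous (fun s => F s (T s))} by exact: goodFt.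
have tends0 : (fun n => L * (2 * 2^-1 ^+ n)) @ \oo --> 0.
  rewrite -(mulr0 L); apply: cvgMr.
  by have := @halving_cvg 0 2; under eq_fun do rewrite add0r.
have Fn n s : a <= s <= t ->
    `|S (t - s) (F s (T_ n s)) - S (t - s) (F s (T s))| <= L * (2 * 2^-1 ^+ n).
  move=> /andP[as0 st]; rewrite -SB; apply: le_trans (sg_contraction HI FS _ _) _.
  have sab : a <= s <= b by rewrite as0 (le_trans st).
  have [_ _ m] := Tg n; have [_ _ n1] := hT s sab.
  apply: le_trans (hL _ _ _ _ (sK s sab) (sK s sab) (Vn n s sab) (VT s sab) (m s sab) (TM s sab)) _.
  by rewrite subrr normr0 add0r; apply: ler_wpM2l => //; exact: n1.
apply: (@wint_lim _ _ _ HI _ _ _ _ (fun n s => S (t - s) (F s (T_ n s)))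
  (fun n => T_ n.+1 t - S (t - a) x) _ at0 (sg_path_continuous Fc) _ Fn tends0).
  by move=> n; exact: Tn.
apply: cvgB; last exact: cvg_cst.
have [_ c _] := hT t tab.
by rewrite (cvg_shiftS (T_ ^~ t)).
Qed.

(** ** Maximal solutions *)

Lemma mild_extend K M : exists2 d : R, 0 < d & forall b x T, 0 <= b -> b <= K ->
  mild F 0 b x T -> nV (T b) <= M -> exists T', mild F 0 (b + d) x T'.
Proof.
have [d d0 hd] := mild_local K M; exists d => // b x T b0 bK Tm TM.
have Vb : V (T b) by have [VT _ _] := Tm; apply: VT; rewrite b0 lexx.
have [T' T'm] := hd b (T b) b0 bK Vb TM.
exists (fun t => if t <= b then T t else T' t); apply: mild_glue => //.
by rewrite lerDl ltW.
Qed.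

Definition mild_on (tau : \bar R) x T := forall b, 0 < b -> (b%:E < tau)%E ->
  mild F 0 b x T.

(** The supremum of the existence times: a solution there exists by uniqueness,
and boundedness of the form norm near a finite supremum would allow one more
step of fixed length. *)
Lemma mild_maximal x : V x -> exists (tau : \bar R) T, [/\ (0 < tau)%E,
  mild_on tau x T,
  forall b T', 0 <= b -> mild F 0 b x T' -> (b%:E < tau)%E &
  (tau < +oo)%E -> forall M b, (b%:E < tau)%E -> exists t,
    [/\ b < t, 0 < t, (t%:E < tau)%E & M < nV (T t)]].
Proof.
move=> Vx; pose J := [set b : R | 0 <= b /\ exists T, mild F 0 b x T].
have [d0 d00 hd0] := mild_local 0 (nV x).
have Jd0 : J d0.
  split; first exact: ltW.
  by have [T] := hd0 0 x (lexx 0) (lexx 0) Vx (lexx _); rewrite add0r; exists T.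
pose tau := ereal_sup [set b%:E | b in J].
have Jle b : J b -> (b%:E <= tau)%E by move=> Jb; apply: ereal_sup_ubound; exists b.
have Jlt b : J b -> (b%:E < tau)%E.
  move=> [b0 [T Tm]]; have [d d_gt0 hd] := mild_extend b (nV (T b)).
  have [T' T'm] := hd b x T b0 (lexx b) Tm (lexx _).
  have : J (b + d) by split; [rewrite addr_ge0// ltW|exists T'].
  by move=> /Jle; apply: lt_le_trans; rewrite lte_fin ltrDl.
have Jdown b : (b%:E < tau)%E -> exists c, b < c /\ J c.
  by move=> /ereal_sup_gt[_ [c Jc <-]]; rewrite lte_fin => bc; exists c.
have ex b : exists T, (b%:E < tau)%E -> mild F 0 b x T.
  have [bt|bt] := pselect (b%:E < tau)%E; last by exists (cst 0).
  have [c [bc [_ [T Tm]]]] := Jdown b bt; exists T => _.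
  by apply: mild_prefix Tm; exact: ltW.
have [T_ hT] := choice ex.
pose T t := T_ t t.
have TE b t : (b%:E < tau)%E -> 0 <= t <= b -> T t = T_ b t.
  move=> bt /andP[t0 tb]; have tt : (t%:E < tau)%E by apply: le_lt_trans bt; rewrite lee_fin.
  apply: (mild_unique t0 (hT t tt) (mild_prefix tb (hT b bt))).
  by rewrite t0 lexx.
exists tau, T; split.
- by apply: lt_trans (Jlt _ Jd0); rewrite lte_fin.
- move=> b b0 bt; have [VT Tc Tw] := hT b bt; split.
  + by move=> t tb; rewrite (TE b)//; exact: VT.
  + move=> t tb; apply: cvg_trans (Tc t tb); apply: near_eq_cvg.
    rewrite near_withinE; apply: nearW => s sb.
    have {}sb : 0 <= s <= b by move: sb; rewrite /= in_itv.
    by rewrite !(TE b).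
  + move=> t tb; rewrite (TE b)//; apply: eq_wint (Tw t tb) => s st.
    by rewrite (TE b)//; lra.
- by move=> b T' b0 T'm; apply: Jlt; split => //; exists T'.
- move=> tauy M b bt; apply: contrapT => N.
  have tau0 : (0 < tau)%E by apply: lt_trans (Jlt _ Jd0); rewrite lte_fin.
  have tauf : tau \is a fin_num by rewrite ge0_fin_numE// ltW.
  pose k := fine tau; have kE : tau = k%:E by rewrite fineK.
  rewrite kE in Jlt Jdown hT tau0 bt N.
  rewrite !lte_fin in tau0 bt.
  have [d d_gt0 hd] := mild_extend k M.
  (* A time after b, so close to k that a step d crosses k. *)
  pose t := Num.max (Num.max (k / 2) ((b + k) / 2)) (k - d / 2).
  have tk : t < k by rewrite !gt_max; apply/andP; split; [apply/andP; split|]; lra.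
  have t1 : k / 2 <= t by rewrite !le_max lexx.
  have t2 : (b + k) / 2 <= t by rewrite !le_max lexx orbT.
  have t3 : k - d / 2 <= t by rewrite le_max lexx orbT.
  have tt : (t%:E < tau)%E by rewrite kE lte_fin.
  have t0 : 0 <= t by lra.
  have TM : nV (T_ t t) <= M.
    rewrite leNgt; apply/negP => h; apply: N; exists t; split => //; lra.
  have [T' T'm] := hd t x (T_ t) t0 (ltW tk) (hT t tk) TM.
  have : ((t + d)%:E < k%:E)%E by apply: Jlt; split; [lra|exists T'].
  by rewrite lte_fin; lra.
Qed.

End Mild.
(** * Absolutely continuous functions *)

Section AlmostEverywhere.
Context {R : realType}.
Local Notation mu := (@lebesgue_measure R).

Lemma ae_imp (P Q : R -> Prop) : (\forall x \ae mu, P x) ->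
  (forall x, P x -> Q x) -> \forall x \ae mu, Q x.
Proof.
move=> aP PQ; apply: filterS aP; first exact: (ae_filter_ringOfSetsType mu).
exact: PQ.
Qed.

Lemma ae_imp2 (P P' Q : R -> Prop) : (\forall x \ae mu, P x) ->
  (\forall x \ae mu, P' x) ->
  (forall x, P x -> P' x -> Q x) -> \forall x \ae mu, Q x.
Proof.
move=> aP aP' PQ; apply: filterS2 aP aP'; first exact: (ae_filter_ringOfSetsType mu).
exact: PQ.
Qed.

Lemma ae_all (Q : R -> Prop) : (forall x, Q x) -> \forall x \ae mu, Q x.
Proof. by move=> H; apply: filterE; first exact: (ae_filter_ringOfSetsType mu). Qed.

Lemma ae_bigcap (Q : nat -> R -> Prop) : (forall n, \forall x \ae mu, Q n x) ->
  \forall x \ae mu, forall n, Q n x.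
Proof.
exact: ae_foralln.
Qed.

Lemma ae_neq (a : R) : \forall x \ae mu, x != a.
Proof.
exists [set a]; split => //; first exact: lebesgue_measure_set1.
by move=> x /= /negP/negPn/eqP.
Qed.

Lemma ae_eq_integrable (D : set R) (f g : R -> R) : measurable D ->
  measurable_fun D g -> mu.-integrable D (EFin \o f) ->
  (\forall x \ae mu, D x -> f x = g x) -> mu.-integrable D (EFin \o g).
Proof.
move=> mD mg /integrableP[mf fi] fg; apply/integrableP; split; first exact/measurable_EFinP.
have E : ae_eq mu D (abse \o (EFin \o f)) (abse \o (EFin \o g)).
  by apply: (ae_imp fg) => x H Dx /=; rewrite H.
rewrite -(@ae_eq_integral _ _ _ mu D (abse \o (EFin \o g)) (abse \o (EFin \o f)) _ _ _ E)//.
  by apply: measurableT_comp.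
by apply: measurableT_comp => //; exact/measurable_EFinP.
Qed.

Lemma ae_eq_Rintegral (D : set R) (f g : R -> R) : measurable D ->
  measurable_fun D f -> measurable_fun D g ->
  (\forall x \ae mu, D x -> f x = g x) ->
  \int[mu]_(x in D) f x = \int[mu]_(x in D) g x.
Proof.
move=> mD mf mg fg; rewrite /Rintegral; congr fine.
have E : ae_eq mu D (EFin \o f) (EFin \o g).
  by apply: (ae_imp fg) => x H Dx /=; rewrite H.
by apply: (@ae_eq_integral _ _ _ mu D (EFin \o g) (EFin \o f) _ _ _ E) => //; exact/measurable_EFinP.
Qed.

End AlmostEverywhere.

Section TotalVariation.
Context {R : realType}.
Implicit Types (u : R -> R) (a b : R).
Local Notation TV := total_variation.

(** Families obtained by refinement are indexed by dependent pairs. *)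
Lemma abs_continuous_fin a b u : abs_continuous a b u ->
  forall e, 0 < e -> exists2 d : R, 0 < d & forall (I : finType) (s t : I -> R),
    (forall i, [/\ a <= s i, s i <= t i & t i <= b]) ->
    trivIset setT (fun i => `]s i, t i[%classic) ->
    \sum_i (t i - s i) < d -> \sum_i `|u (t i) - u (s i)| < e.
Proof.
move=> ac e e0; have [d d0 dP] := ac e e0; exists d => // I s t st tr sd.
have reE (F : I -> R) : \sum_i F i = \sum_(i < #|I|) F (enum_val i).
  by rewrite (eq_bigl (fun i => i \in predT))// big_enum_val.
rewrite reE; apply: (dP _ (s \o enum_val) (t \o enum_val)).
- by move=> i; exact: st.
- move=> i j _ _ [x [xi xj]]; apply: enum_val_inj; apply: tr => //.
  by exists x.
- by rewrite /= -(reE (fun i => t i - s i)).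
Qed.

Lemma monotone_trivIset (p : nat -> R) : (forall n, p n <= p n.+1) ->
  trivIset setT (fun i => `]p i, p i.+1[%classic).
Proof.
move=> p_le; have mono : {homo p : i j / (i <= j)%N >-> i <= j}.
  exact/nondecreasing_seqP.
suff lt i j : (i < j)%N -> `]p i, p i.+1[ `&` `]p j, p j.+1[ = set0.
  move=> i j _ _ [x xij]; have [/lt ij|/lt ij|//] := ltngtP i j.
    by have : set0 x by rewrite -ij.
  by have : set0 x by rewrite -ij setIC.
move=> ij; rewrite -subset0 => x /= [].
rewrite !in_itv/= => /andP[_ xi] /andP[jx _].
by have := mono _ _ ij; rewrite leNgt (lt_trans jx xi).
Qed.

Lemma itv_partition_nth_nd x y (l : seq R) : itv_partition x y l ->
  forall n, nth y (x :: l) n <= nth y (x :: l) n.+1.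
Proof.
move=> pl n; have [nl|ln] := ltnP n (size l).
  by case: pl => /(pathP y)/(_ _ nl)/ltW.
have E m : (size l <= m)%N -> nth y (x :: l) m = y.
  rewrite leq_eqVlt => /predU1P[<-|lm]; first exact: itv_partition_nth_size.
  by rewrite nth_default.
by rewrite !E// leqW.
Qed.

Lemma itv_partition_total x y (l : seq R) : itv_partition x y l ->
  \sum_(i < size l) (nth y (x :: l) i.+1 - nth y (x :: l) i) = y - x.
Proof.
move=> pl; rewrite -(big_mkord predT (fun i => nth y (x :: l) i.+1 - nth y (x :: l) i)).
by rewrite telescope_sumr// (itv_partition_nth_size y pl).
Qed.

Lemma variation_ord x y u (l : seq R) : variation x y u l =
  \sum_(i < size l) `|u (nth y (x :: l) i.+1) - u (nth y (x :: l) i)|.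
Proof. by rewrite /variation big_mkord. Qed.

Lemma abs_continuousS a b c d u : a <= c -> d <= b ->
  abs_continuous a b u -> abs_continuous c d u.
Proof.
move=> ac db H e e0; have [k k0 kP] := H e e0; exists k => // n s t st.
apply: kP => i; have [h1 h2 h3] := st i.
by split => //; [exact: le_trans h1|exact: le_trans db].
Qed.

Lemma abs_continuous_TV a b u : a <= b -> abs_continuous a b u ->
  TV a b u \is a fin_num.
Proof.
move=> ab ac; have [d d0 dP] := abs_continuous_fin ac ltr01.
have short x y : a <= x -> x <= y -> y <= b -> y - x < d -> TV x y u \is a fin_num.
  move=> ax xy yb yxd; rewrite ge0_fin_numE ?total_variation_ge0//.
  apply: (@le_lt_trans _ _ 1%:E); last exact: ltry.
  apply: ge_ereal_sup => _ [_ [l pl <-] <-]; rewrite lee_fin variation_ord.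
  apply/ltW/dP.
  - move=> i; split.
    + by apply: (le_trans ax); apply: (itv_partition_nth_ge _ pl); rewrite ltnS ltnW.
    + exact: itv_partition_nth_nd.
    + by apply: (le_trans _ yb); apply: (itv_partition_nth_le _ pl); rewrite ltnS.
  - move=> i j _ _ ij; apply: ord_inj.
    exact: (@monotone_trivIset (nth y (x :: l)) (itv_partition_nth_nd pl)).
  - by rewrite itv_partition_total.
have step n : forall x, a <= x -> x <= b -> x - a <= d / 2 *+ n ->
    TV a x u \is a fin_num.
  elim: n => [|n IH] x ax xb xn.
    have -> : x = a by apply/eqP; rewrite eq_le ax andbT -subr_le0.
    by rewrite total_variationxx.
  have [xd|xd] := leP (x - a) (d / 2).
    by apply: short => //; move: d0 xd; lra.
  have ac' : a <= x - d / 2 by move: xd; lra.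
  have cx : x - d / 2 <= x by move: d0; lra.
  rewrite (total_variationD u ac' cx) fin_numD IH//=.
  - by apply: short => //; move: d0; lra.
  - exact: le_trans xb.
  - by move: xn; rewrite mulrSr; lra.
have [n nP] : exists n : nat, b - a <= d / 2 *+ n.
  have d20 : 0 < d / 2 by rewrite divr_gt0.
  exists (Num.trunc ((b - a) / (d / 2))).+1; rewrite -mulr_natl -ler_pdivrMr//.
  exact/ltW/truncnS_gt.
exact: (step n).
Qed.

Lemma abs_continuous_TVaux a b u : a <= b -> abs_continuous a b u ->
  forall x y, a <= x -> x <= y -> y <= b ->
  fine (TV a y u) - fine (TV a x u) = fine (TV x y u).
Proof.
move=> ab ac x y ax xy yb.
have f1 : TV a x u \is a fin_num.
  by apply: abs_continuous_TV => //; apply: abs_continuousS ac => //; exact: le_trans yb.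
have f2 : TV x y u \is a fin_num.
  by apply: abs_continuous_TV => //; exact: abs_continuousS ac.
by rewrite (total_variationD u ax xy) fineD// [LHS]addrAC subrr add0r.
Qed.

Lemma TV_approx x y u (e : R) : x <= y -> TV x y u \is a fin_num -> 0 < e ->
  exists2 l, itv_partition x y l & fine (TV x y u) - e < variation x y u l.
Proof.
move=> xy fTV e0.
have [_ [_ [l pl <-] <-] lt] := ub_ereal_sup_adherent e0 fTV.
by exists l => //; rewrite -lte_fin EFinB fineK.
Qed.

(** Refining each interval of a family by a partition that almost realises its
variation gives a family with the same total length, so the variation inherits the modulus of
absolute continuity. *)
Lemma abs_continuous_fine_TV a b u : a <= b -> abs_continuous a b u ->
  abs_continuous a b (fun x => fine (TV a x u)).
Proof.
move=> ab ac e e0.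
have e20 : 0 < e / 2 by rewrite divr_gt0.
have [d d0 dP] := abs_continuous_fin ac e20; exists d => // n s t st tr sd.
pose e' := e / 2 / n.+1%:R.
have e'0 : 0 < e' by rewrite divr_gt0.
have H i : exists l, itv_partition (s i) (t i) l /\
    fine (TV (s i) (t i) u) - e' < variation (s i) (t i) u l.
  have [h1 h2 h3] := st i.
  have [|l pl lP] := @TV_approx (s i) (t i) u e' h2 _ e'0; last by exists l.
  by apply: abs_continuous_TV => //; exact: abs_continuousS ac.
have [l lP] := choice H.
pose s' (k : {i : 'I_n & 'I_(size (l i))}) : R :=
  nth (t (tag k)) (s (tag k) :: l (tag k)) (tagged k).
pose t' (k : {i : 'I_n & 'I_(size (l i))}) : R :=
  nth (t (tag k)) (s (tag k) :: l (tag k)) (tagged k).+1.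
have small : \sum_k `|u (t' k) - u (s' k)| < e / 2.
  apply: dP.
  - move=> k; have [h1 h2 h3] := st (tag k); have [pk _] := lP (tag k); split.
    + by apply: (le_trans h1); apply: (itv_partition_nth_ge _ pk); rewrite ltnS ltnW.
    + exact: (itv_partition_nth_nd pk).
    + by apply: (le_trans _ h3); apply: (itv_partition_nth_le _ pk); rewrite ltnS.
  - move=> [i k] [j k'] _ _ [x []]; rewrite /s' /t' /= => xi xj.
    have sub i0 (k0 : 'I_(size (l i0))) :
        `]nth (t i0) (s i0 :: l i0) k0, nth (t i0) (s i0 :: l i0) k0.+1[ `<=`
        `]s i0, t i0[.
      have [pk _] := lP i0 => z /=; rewrite !in_itv/= => /andP[z1 z2].
      rewrite (le_lt_trans _ z1)//=; last by apply: (itv_partition_nth_ge _ pk); rewrite ltnS ltnW.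
      exact: (lt_le_trans z2 (itv_partition_nth_le (ltn_ord k0 : (k0.+1 < (size (l i0)).+1)%N) pk)).
    have ij : i = j by apply: tr => //; exists x; split; [exact: sub xi|exact: sub xj].
    move: ij k' xj => <- k' xj.
    suff -> : k = k' by [].
    apply: ord_inj; have [pk _] := lP i.
    apply: (@monotone_trivIset (nth (t i) (s i :: l i)) (itv_partition_nth_nd pk)) => //.
    by exists x.
  - rewrite (eq_bigr (fun k => t' (Tagged (fun i => 'I_(size (l i))) (tagged k)) -
      s' (Tagged (fun i => 'I_(size (l i))) (tagged k)))); last by case.
    rewrite -(sig_big_dep (fun _ => true) (fun _ _ => true)
      (fun i (k : 'I_(size (l i))) => t' (Tagged (fun i => 'I_(size (l i))) k) -
         s' (Tagged (fun i => 'I_(size (l i))) k)))/=.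
    apply: le_lt_trans sd; apply: ler_sum => i _; have [pi _] := lP i.
    by rewrite -(itv_partition_total pi).
apply: (@le_lt_trans _ _ (\sum_(i < n) (variation (s i) (t i) u (l i) + e'))).
  apply: ler_sum => i _; have [h1 h2 h3] := st i.
  rewrite (abs_continuous_TVaux ab ac h1 h2 h3) ger0_norm; last first.
    by apply: fine_ge0; exact: total_variation_ge0.
  by rewrite -lerBlDr; apply/ltW; have [] := lP i.
rewrite big_split/= sumr_const card_ord.
have -> : \sum_(i < n) variation (s i) (t i) u (l i) = \sum_k `|u (t' k) - u (s' k)|.
  rewrite (eq_bigr (fun i => \sum_(k < size (l i))
     `|u (t' (Tagged (fun i => 'I_(size (l i))) k)) -
       u (s' (Tagged (fun i => 'I_(size (l i))) k))|)); last first.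
    by move=> i _; rewrite variation_ord.
  rewrite (sig_big_dep (fun _ => true) (fun _ _ => true)
      (fun i (k : 'I_(size (l i))) => `|u (t' (Tagged (fun i => 'I_(size (l i))) k)) -
         u (s' (Tagged (fun i => 'I_(size (l i))) k))|))/=.
  by apply: eq_bigr; case.
have : e' *+ n <= e / 2.
  rewrite /e' -mulr_natr -mulrA ler_piMr ?(ltW e20)// mulrC ler_pdivrMr//.
  by rewrite mul1r ler_nat.
by move: small; lra.
Qed.

Lemma abs_continuousN a b u : abs_continuous a b u ->
  abs_continuous a b (fun x => - u x).
Proof.
move=> ac e e0; have [d d0 dP] := ac e e0; exists d => // n s t st tr sd.
under eq_bigr do rewrite -opprD normrN; exact: dP.
Qed.

Lemma abs_continuousD a b u v : abs_continuous a b u -> abs_continuous a b v ->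
  abs_continuous a b (fun x => u x + v x).
Proof.
move=> acu acv e e0; have e20 : 0 < e / 2 by rewrite divr_gt0.
have [d d0 dP] := acu _ e20; have [d' d'0 d'P] := acv _ e20.
exists (Num.min d d'); first by rewrite lt_min d0.
move=> n s t st tr; rewrite lt_min => /andP[/(dP _ _ _ st tr) h /(d'P _ _ _ st tr) h'].
apply: le_lt_trans (_ : _ <= \sum_(i < n) (`|u (t i) - u (s i)| + `|v (t i) - v (s i)|)) _.
  by apply: ler_sum => i _; rewrite opprD addrACA ler_normD.
by rewrite big_split/=; move: h h'; lra.
Qed.

(** Increments of products and of Lipschitz functions are dominated by combinations of increments. *)
Lemma abs_continuous_bounded_mul a b u v (f : R -> R) (M N : R) :
  (forall x y, a <= x -> x <= y -> y <= b ->
     `|f y - f x| <= M * `|u y - u x| + N * `|v y - v x|) ->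
  abs_continuous a b u -> abs_continuous a b v -> abs_continuous a b f.
Proof.
move=> H acu acv e e0.
pose K := 1 + `|M| + `|N|.
have K0 : 0 < K by rewrite /K; have := normr_ge0 M; have := normr_ge0 N; lra.
have e20 : 0 < e / (2 * K) by rewrite divr_gt0// mulr_gt0.
have [d d0 dP] := acu _ e20; have [d' d'0 d'P] := acv _ e20.
exists (Num.min d d'); first by rewrite lt_min d0.
move=> n s t st tr; rewrite lt_min => /andP[/(dP _ _ _ st tr) h /(d'P _ _ _ st tr) h'].
apply: le_lt_trans (_ : _ <= \sum_(i < n) K * (`|u (t i) - u (s i)| + `|v (t i) - v (s i)|)) _.
  apply: ler_sum => i _; have [h1 h2 h3] := st i; apply: (le_trans (H _ _ h1 h2 h3)).
  rewrite mulrDr lerD// ler_wpM2r// /K.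
    by have := ler_norm M; have := normr_ge0 N; lra.
  by have := ler_norm N; have := normr_ge0 M; lra.
rewrite -mulr_sumr big_split/= -ltr_pdivlMl//.
have -> : K^-1 * e = e / (2 * K) + e / (2 * K) by field; rewrite gt_eqF.
exact: ltrD.
Qed.

Lemma abs_continuous_within a b u : a <= b -> abs_continuous a b u ->
  {within `[a, b], continuous u}.
Proof.
move=> ab ac; apply/subspace_continuousP => x /=; rewrite in_itv/= => /andP[ax xb].
apply/cvgrPdist_lt => e e0; have [d d0 dP] := ac e e0.
rewrite near_withinE; near=> y; rewrite /= in_itv/= => /andP[ay yb].
have yx : `|x - y| < d.
  by near: y; apply: (@cvgr_dist_lt _ _ _ _ _ id x) => //; exact: cvg_id.
have one p q : a <= p -> p <= q -> q <= b -> q - p < d -> `|u q - u p| < e.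
  move=> ap pq qb pqd; have := dP 1%N (fun=> p) (fun=> q).
  rewrite !big_ord1; apply => //.
  by move=> i j _ _ _; rewrite !ord1.
have [xy|/ltW yx'] := leP x y.
  by rewrite distrC; apply: one => //; rewrite -(ger0_norm (_ : 0 <= y - x)) ?subr_ge0// distrC.
by apply: one => //; rewrite -(ger0_norm (_ : 0 <= x - y)) ?subr_ge0.
Unshelve. all: by end_near. Qed.

Lemma lipschitz_abs_continuous a b u (L : R) :
  (forall x y, a <= x -> x <= y -> y <= b -> `|u y - u x| <= L * (y - x)) ->
  abs_continuous a b u.
Proof.
move=> H; have acid : abs_continuous a b idfun.
  move=> e e0; exists e => // n s t st _; congr (_ < _).
  by apply: eq_bigr => i _; rewrite ger0_norm// subr_ge0; have [] := st i.
apply: (@abs_continuous_bounded_mul a b idfun idfun u L 0 _ acid acid) => x y ax xy yb.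
by rewrite mul0r addr0 [X in _ * X]ger0_norm ?subr_ge0// H.
Qed.

Lemma abs_continuousM a b u v : a <= b -> abs_continuous a b u ->
  abs_continuous a b v -> abs_continuous a b (fun x => u x * v x).
Proof.
move=> ab acu acv.
have bd w : abs_continuous a b w -> exists2 M, 0 <= M & forall x, a <= x <= b -> `|w x| <= M.
  move=> /(abs_continuous_within ab) cw.
  have cn : {within `[a, b], continuous (fun x => `|w x|)}.
    by move=> x; apply: cvg_norm; exact: cw.
  have [c _ cP] := EVT_max ab cn; exists `|w c|; [exact: normr_ge0|move=> x xab].
  exact: cP.
have [M M0 MP] := bd _ acu; have [N N0 NP] := bd _ acv.
apply: (abs_continuous_bounded_mul (M := N) (N := M) _ acu acv) => x y ax xy yb.
have -> : u y * v y - u x * v x = v y * (u y - u x) + u x * (v y - v x) by ring.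
apply: (le_trans (ler_normD _ _)); rewrite !normrM lerD// ler_wpM2r//.
  by apply: NP; rewrite yb (le_trans ax).
by apply: MP; rewrite ax (le_trans xy).
Qed.

End TotalVariation.

Section MonotoneDensity.
Context {R : realType}.
Implicit Types (F : R -> R) (a b : R).
Local Notation mu := (@lebesgue_measure R).

(** Precomposition with [clamp] extends a function on [a, b] to the line by its boundary values. *)
Definition clamp a b (x : R) := Num.max a (Num.min b x).

Lemma clamp_itv a b x : a <= b -> a <= clamp a b x <= b.
Proof.
by move=> ab; rewrite /clamp le_max lexx/= ge_max ab ge_min lexx.
Qed.

Lemma clamp_id a b x : a <= x <= b -> clamp a b x = x.
Proof. by move=> /andP[ax xb]; rewrite /clamp min_r// max_r. Qed.

Lemma clamp_le a b x y : x <= y -> clamp a b x <= clamp a b y.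
Proof.
move=> xy; rewrite /clamp ge_max le_max lexx/= le_max; apply/orP; right.
by rewrite le_min !ge_min lexx/= xy orbT.
Qed.

Lemma clamp_lipschitz a b x y : x <= y -> clamp a b y - clamp a b x <= y - x.
Proof.
move=> xy; rewrite /clamp.
by case: (leP b x) => ?; case: (leP b y) => ?;
  repeat (match goal with |- context [Num.max ?u ?v] => case: (leP u v) => ? end); lra.
Qed.

Lemma clamp_itvoo a b x y z : clamp a b x < z < clamp a b y -> x < z < y.
Proof.
rewrite /clamp => /andP[h1 h2].
move: h1 h2; rewrite gt_max => /andP[az]; rewrite gt_min => h1.
rewrite lt_max (ltNge z a) (ltW az)/= lt_min => /andP[zb zy]; rewrite zy andbT.
by move: h1; rewrite (ltNge b) (ltW zb).
Qed.

Lemma abs_continuous_clamp a b F : a <= b -> abs_continuous a b F ->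
  forall c d, abs_continuous c d (F \o clamp a b).
Proof.
move=> ab ac c d e e0; have [k k0 kP] := ac e e0; exists k => // n s t st tr sk.
apply: (kP _ (clamp a b \o s) (clamp a b \o t)).
- move=> i; have [_ h _] := st i.
  have /andP[h1 _] := clamp_itv (s i) ab; have /andP[_ h2] := clamp_itv (t i) ab.
  by split => //=; exact: clamp_le.
- move=> i j _ _ [x [/=]]; rewrite !in_itv/= => xi xj; apply: tr => //; exists x.
  by split; rewrite /= in_itv/=; [exact: clamp_itvoo xi|exact: clamp_itvoo xj].
- apply: le_lt_trans sk; apply: ler_sum => i _; have [_ h _] := st i.
  exact: clamp_lipschitz.
Qed.

Lemma abs_continuous_continuous F : (forall c d, abs_continuous c d F) ->
  continuous F.
Proof.
move=> ac x; have l : x - 1 < x + 1 by lra.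
have := abs_continuous_within (ltW l) (ac (x - 1) (x + 1)).
move/(continuous_within_itvP _ l) => [+ _ _]; apply; rewrite in_itv/=; lra.
Qed.

Lemma abs_continuous_cvg_right F : (forall c d, abs_continuous c d F) ->
  right_continuous F.
Proof.
by move=> ac x; apply: cvg_at_right_filter; exact: abs_continuous_continuous.
Qed.

End MonotoneDensity.

Section StieltjesDensity.
Context {R : realType} (F : cumulative R R).
Local Notation mu := (@lebesgue_measure R).
Local Notation nu := (lebesgue_stieltjes_measure F).

Lemma stieltjes_itvoc x y : x <= y -> nu `]x, y] = (F y - F x)%:E.
Proof.
move=> xy; rewrite /lebesgue_stieltjes_measure /measure_extension/=.
by rewrite measurable_mu_extE/= ?wlength_itv_bnd//; exact: is_ocitv.
Qed.

Lemma stieltjes_setT m M : (forall x, m <= F x <= M) -> (nu setT <= (M - m)%:E)%E.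
Proof.
move=> FM; have -> : [set: R] = \bigcup_n `]-n%:R, n%:R]%classic.
  apply/esym; rewrite -subTset => x _; exists (Num.trunc `|x|).+1 => //=.
  have : `|x| < (Num.trunc `|x|).+1%:R by exact: truncnS_gt.
  by rewrite ltr_norml in_itv/= => /andP[-> /ltW].
have h : nu `]- n%:R, n%:R] @[n --> \oo] --> nu (\bigcup_n `]-n%:R, n%:R]%classic).
  apply: nondecreasing_cvg_mu => //; first exact: bigcup_measurable.
  by move=> p q pq; apply/subsetPset/subset_itv; rewrite leBSide//= ?lerN2 ler_nat.
rewrite -(cvg_lim _ h)//; apply: lime_le; first by apply/cvg_ex; eexists; exact: h.
near=> n; rewrite stieltjes_itvoc; last by rewrite (@le_trans _ _ 0)// oppr_le0.
by rewrite lee_fin; have := FM n%:R; have := FM (- n%:R); lra.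
Unshelve. all: by end_near. Qed.

(** An open bounded set is a countable union of disjoint open intervals; finitely many of
them form a family to which absolute continuity applies. *)
Lemma stieltjes_open_small c d e : (forall c d, abs_continuous c d F) -> c <= d -> 0 < e ->
  exists2 k : R, 0 < k & forall U, open U -> U `<=` `]c, d[ ->
    (mu U < k%:E)%E -> (nu U <= e%:E)%E.
Proof.
move=> ac cd e0; have [k k0 kP] := ac c d e e0; exists k => // U oU Ucd Uk.
pose I := open_disjoint_itv oU.
have oI q : open (I q) by exact: open_disjoint_itv_open.
have mI q : measurable (I q) by exact: open_measurable.
have tI : trivIset setT I by exact: open_disjoint_itv_trivIset.
have UI : U = \bigcup_q I q by exact: open_disjoint_itv_bigcup.
have subI q : I q `<=` `]c, d[ by move=> x xq; apply: Ucd; rewrite UI; exists q.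
have H q : exists st : R * R, [/\ c <= st.1, st.1 <= st.2 & st.2 <= d] /\
    (`]st.1, st.2[ `<=` I q /\ I q `<=` `]st.1, st.2]).
  have [I0|/set0P I0] := eqVneq (I q) set0.
    exists (c, c); rewrite /= set_itvoo0 I0; split; first by split.
    by split; exact: sub0set.
  have hub : has_ubound (I q) by exists d => x /subI /=; rewrite in_itv/= => /andP[_ /ltW].
  have hlb : has_lbound (I q) by exists c => x /subI /=; rewrite in_itv/= => /andP[/ltW].
  have II : is_interval (I q) by exact: open_disjoint_itv_is_interval.
  have [p Ip] := I0.
  have ip := ge_inf hlb Ip; have ps := ub_le_sup hub Ip.
  exists (inf (I q), sup (I q)); split; first split => /=.
  - apply: lb_le_inf => // x /subI /=.
    by rewrite in_itv/= => /andP[/ltW].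
  - exact: le_trans ps.
  - apply: ge_sup => // x /subI /=.
    by rewrite in_itv/= => /andP[_ /ltW].
  split => x /=; rewrite in_itv/=.
  - move=> /andP[ix xs].
    have xi0 : 0 < x - inf (I q) by rewrite subr_gt0.
    have xs0 : 0 < sup (I q) - x by rewrite subr_gt0.
    have [y Iy yx] := inf_adherent xi0 (conj I0 hlb).
    have [z Iz xz] := sup_adherent xs0 (conj I0 hub).
    apply: (II y z) => //; move: yx xz; lra.
  - move=> Ix; rewrite (ub_le_sup hub Ix) andbT lt_neqAle (ge_inf hlb Ix) andbT.
    apply/eqP => ix; have /nbhs_ballP[r /= r0 rI] := open_nbhs_nbhs (conj (oI q) Ix).
    have : I q (x - r / 2).
      by apply: rI; rewrite /ball/= opprB addrC subrK gtr0_norm; lra.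
    by move/(ge_inf hlb); rewrite ix; lra.
have [st stP] := choice H.
have fin n : (\sum_(0 <= q < n) nu (I q) <= e%:E)%E.
  apply: (@le_trans _ _ (\sum_(0 <= q < n) (F (st q).2 - F (st q).1)%:E)%E).
    apply: lee_sum => q _; have [[h1 h2 h3] [h4 h5]] := stP q.
    rewrite -stieltjes_itvoc//; apply: le_measure => //; rewrite inE; first exact: mI.
    exact: measurable_itv.
  rewrite sumEFin lee_fin big_mkord.
  apply: (@le_trans _ _ (\sum_(i < n) `|F (st i).2 - F (st i).1|)).
    by apply: ler_sum => i _; exact: ler_norm.
  apply/ltW/(kP _ (fun i => (st i).1) (fun i => (st i).2)).
  - by move=> i; have [] := stP i.
  - move=> i j _ _ [x [xi xj]]; apply: ord_inj; apply: tI => //; exists x.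
    by have [_ [hi _]] := stP i; have [_ [hj _]] := stP j; split; [exact: hi|exact: hj].
  - rewrite -lte_fin; apply: le_lt_trans Uk; rewrite -sumEFin.
    apply: (@le_trans _ _ (\sum_(i < n) mu (I i))%E).
      apply: lee_sum => i _; have [[h1 h2 h3] [h4 h5]] := stP i.
      have <- : mu `](st i).1, (st i).2[ = ((st i).2 - (st i).1)%:E.
        apply: etrans (lebesgue_measure_itv _) _; rewrite /= lte_fin.
        by move: h2; rewrite le_eqVlt => /predU1P[->|->]; rewrite ?ltxx ?subrr -?EFinB.
      by apply: le_measure => //; rewrite inE; [exact: measurable_itv|exact: mI].
    rewrite -(big_mkord predT (fun i => mu (I i))) UI.
    have cm := @measure_semi_sigma_additive _ _ _ mu I mI tI (bigcup_measurable (fun k _ => mI k)).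
    rewrite -(cvg_lim _ cm)//; exact: nneseries_lim_ge.
have cm := @measure_semi_sigma_additive _ _ _ nu I mI tI (bigcup_measurable (fun k _ => mI k)).
rewrite UI -(cvg_lim _ cm)//.
by apply: lime_le; [exact: is_cvg_nneseries|exact: nearW].
Qed.

(** Outer regularity puts a bounded null set into an open set of small length. *)
Lemma stieltjes_dominated : (forall c d, abs_continuous c d F) -> nu `<< mu.
Proof.
move=> ac; apply/null_content_dominatesP => A mA A0.
have bounded n : nu (A `&` `]-n%:R, n%:R[) = 0%E.
  have mAn : measurable (A `&` `]-n%:R, n%:R[) by exact: measurableI.
  have An0 : mu (A `&` `]-n%:R, n%:R[) = 0%E.
    by apply: (subset_measure0 _ _ _ A0) => //; exact: subIsetl.
  apply/eqP; rewrite eq_le measure_ge0 andbT; apply/lee_addgt0Pr => e e0; rewrite add0e.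
  have nn : - n%:R <= n%:R :> R by rewrite (@le_trans _ _ 0)// oppr_le0.
  have [k k0 kP] := stieltjes_open_small ac nn e0.
  have [|U [oU AU Uk]] := lebesgue_regularity_outer mAn _ k0.
    by apply: (@le_lt_trans _ _ (mu (A `&` `]-n%:R, n%:R[)));
      [exact: lexx|rewrite An0 ltry].
  have mU : measurable U by exact: open_measurable.
  pose U' := U `&` `]-n%:R, n%:R[.
  have oU' : open U' by apply: openI => //; exact: itv_open.
  apply: (@le_trans _ _ (nu U')).
    apply: le_measure; rewrite ?inE//; first exact: open_measurable.
    by move=> x Ax; split; [exact: AU|exact: (proj2 Ax)].
  apply: kP => //; first exact: subIsetr.
  apply: le_lt_trans Uk; apply: (@le_trans _ _ (mu U)).
    by apply: le_measure; rewrite ?inE//; [exact: open_measurable|exact: subIsetl].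
  rewrite (measureDI mu mU mAn) [X in (_ + X <= _)%E](subset_measure0 _ _ _ An0) ?adde0//.
  exact: measurableI.
have -> : A = \bigcup_n (A `&` `]-n%:R, n%:R[).
  rewrite -setI_bigcupr -[LHS]setIT; congr (_ `&` _).
  apply/esym; rewrite -subTset => x _; exists (Num.trunc `|x|).+1 => //=.
  have : `|x| < (Num.trunc `|x|).+1%:R by exact: truncnS_gt.
  by rewrite ltr_norml in_itv/=.
have mI n : measurable (A `&` `]-n%:R, n%:R[) by exact: measurableI.
have h : nu (A `&` `]- n%:R, n%:R[) @[n --> \oo] -->
    nu (\bigcup_n (A `&` `]-n%:R, n%:R[)).
  apply: nondecreasing_cvg_mu => //; first exact: bigcup_measurable.
  move=> p q pq; apply/subsetPset; apply: setIS; apply: subset_itv;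
    by rewrite bnd_simp ?lerN2 ler_nat.
rewrite -(cvg_lim _ h)//; apply: lim_near_cst => //.
by apply: nearW => n; exact: bounded.
Qed.

End StieltjesDensity.

Section FundamentalTheorem.
Context {R : realType}.
Implicit Types (u F : R -> R) (a b : R).
Local Notation mu := (@lebesgue_measure R).

(** The Stieltjes measure is dominated by Lebesgue measure, hence has a Radon-Nikodym
density. *)
Lemma cumulative_density (F : cumulative R R) m M :
  (forall c d, abs_continuous c d F) -> (forall x, m <= F x <= M) ->
  exists2 f : R -> R, mu.-integrable setT (EFin \o f) &
    forall x y, x <= y -> F y - F x = \int[mu]_(t in `[x, y]) f t.
Proof.
move=> ac FM.
have nufin : fin_num_fun (lebesgue_stieltjes_measure F).
  move=> A mA; rewrite ge0_fin_numE ?measure_ge0//.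
  apply: (@le_lt_trans _ _ (lebesgue_stieltjes_measure F setT)).
    by apply: le_measure; rewrite ?inE.
  exact: le_lt_trans (stieltjes_setT FM) (ltry _).
pose fnu : {finite_measure set _ -> \bar R} :=
  HB.pack (lebesgue_stieltjes_measure F) (isFinite.Build _ _ _ (lebesgue_stieltjes_measure F) nufin).
have dom : fnu `<< mu := stieltjes_dominated ac.
have [f [f0 ffin fi fE]] := radon_nikodym_sigma_finite dom.
have fi' : mu.-integrable setT (EFin \o (fine \o f)).
  by apply: eq_integrable fi => // x _ /=; rewrite fineK.
exists (fine \o f) => // x y xy.
rewrite -Rintegral_itv_obnd_cbnd; last first.
  by apply: integrableS fi' => //; exact: measurable_itv.
rewrite /Rintegral.
have -> : (\int[mu]_(t in `]x, y]) ((fine \o f) t)%:E = \int[mu]_(t in `]x, y]) f t)%E.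
  by apply: eq_integral => t _ /=; rewrite fineK.
rewrite -fE; last exact: measurable_itv.
by rewrite [X in fine X](stieltjes_itvoc F xy).
Qed.

Lemma nondecreasing_density a b F : a <= b -> abs_continuous a b F ->
  (forall x y, a <= x -> x <= y -> y <= b -> F x <= F y) ->
  exists2 f : R -> R, mu.-integrable setT (EFin \o f) &
    forall x y, a <= x -> x <= y -> y <= b -> F y - F x = \int[mu]_(t in `[x, y]) f t.
Proof.
move=> ab ac Fnd; pose G := F \o clamp a b.
have acG c d : abs_continuous c d G by exact: abs_continuous_clamp.
have Gnd : nondecreasing G.
  move=> x y xy; apply: Fnd; last by have /andP[] := clamp_itv y ab.
    by have /andP[] := clamp_itv x ab.
  exact: clamp_le.
pose cG : cumulative R R := HB.pack G
  (isCumulative.Build R _ R G Gnd (abs_continuous_cvg_right acG)).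
have GM x : F a <= cG x <= F b.
  have /andP[h1 h2] := clamp_itv x ab.
  by rewrite /= /G/= !Fnd.
have [f fi fE] := cumulative_density (F := cG) acG GM.
exists f => // x y ax xy yb; rewrite -fE//= /G /= !clamp_id//.
  by rewrite ax (le_trans xy).
by rewrite yb (le_trans ax).
Qed.

(** A function is the difference of its variation and of the variation minus itself, and both
are nondecreasing. *)
Lemma abs_continuous_density a b u : a <= b -> abs_continuous a b u ->
  exists2 f : R -> R, mu.-integrable setT (EFin \o f) &
    forall x y, a <= x -> x <= y -> y <= b -> u y - u x = \int[mu]_(t in `[x, y]) f t.
Proof.
move=> ab ac; pose v x := fine (total_variation a x u).
have acv : abs_continuous a b v by exact: abs_continuous_fine_TV.
have vE := abs_continuous_TVaux ab ac.
have TVfin x y : a <= x -> x <= y -> y <= b -> total_variation x y u \is a fin_num.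
  by move=> ax xy yb; apply: abs_continuous_TV => //; exact: abs_continuousS ac.
have uv x y : a <= x -> x <= y -> y <= b -> `|u y - u x| <= v y - v x.
  move=> ax xy yb; rewrite /v vE// -lee_fin fineK; last exact: TVfin.
  exact: total_variation_ge.
have [f fi fE] : exists2 f : R -> R, mu.-integrable setT (EFin \o f) &
    forall x y, a <= x -> x <= y -> y <= b -> v y - v x = \int[mu]_(t in `[x, y]) f t.
  apply: nondecreasing_density => // x y ax xy yb.
  by rewrite -subr_ge0; apply: le_trans (uv _ _ ax xy yb).
have [g gi gE] : exists2 g : R -> R, mu.-integrable setT (EFin \o g) &
    forall x y, a <= x -> x <= y -> y <= b ->
    (v y - u y) - (v x - u x) = \int[mu]_(t in `[x, y]) g t.
  apply: (nondecreasing_density (F := fun x => v x - u x)) => //.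
    exact: abs_continuousD acv (abs_continuousN ac).
  move=> x y ax xy yb; have := uv _ _ ax xy yb; have := ler_norm (u y - u x).
  by move=> h1 h2; have := le_trans h1 h2; lra.
exists (fun x => f x - g x); first exact: integrable_subr.
move=> x y ax xy yb; rewrite RintegralB ?measurable_itv//.
- by rewrite -fE// -gE//; ring.
- by apply: integrableS fi => //; exact: measurable_itv.
- by apply: integrableS gi => //; exact: measurable_itv.
Qed.

Definition diff_quot u (x h : R) : R := h^-1 * (u (h + x) - u x).

Lemma derivable_diff_quot u x : derivable u x 1 <->
  cvg (diff_quot u x h @[h --> 0^']).
Proof.
rewrite /derivable; suff -> : (fun h : R => h^-1 *: ((u \o shift x) (h *: 1) - u x)) =
  diff_quot u x by [].
by apply/funext => h; rewrite /diff_quot /= /shift /= [_ *: 1]mulr1.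
Qed.

Lemma derive1_diff_quot u x : derive1 u x = lim (diff_quot u x h @[h --> 0^']).
Proof. by []. Qed.

Lemma derive1_addl (k : R) (g : R -> R) x : derivable g x 1 ->
  derivable (fun y => k + g y) x 1 /\ derive1 (fun y => k + g y) x = derive1 g x.
Proof.
have E : diff_quot (fun y => k + g y) x = diff_quot g x.
  by apply/funext => h; rewrite /diff_quot; congr (_ * _); ring.
by rewrite !derivable_diff_quot !derive1_diff_quot E.
Qed.

Lemma near_eq_derivable1 (f g : R -> R) x : {near x, f =1 g} ->
  derivable f x 1 -> derivable g x 1 /\ derive1 g x = derive1 f x.
Proof.
move=> fg df; split; first exact: near_eq_derivable fg df.
by rewrite !derive1E; apply/esym/near_eq_derive.
Qed.

(** The differentiation theorem for locally integrable functions, localised: near an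
interior point the function is a constant plus a primitive on the line. *)
Lemma primitive_derive a b (f u : R -> R) : mu.-integrable setT (EFin \o f) ->
  (forall x y, a <= x -> x <= y -> y <= b -> u y - u x = \int[mu]_(t in `[x, y]) f t) ->
  {ae mu, forall x, a < x < b -> derivable u x 1 /\ derive1 u x = f x}.
Proof.
move=> fi fE.
have locf : locally_integrable setT f.
  by apply: open_integrable_locally => //; exact: openT.
have fiy y : mu.-integrable `]-oo, y] (EFin \o f).
  by apply: integrableS fi => //; exact: measurable_itv.
apply: (ae_imp (FTC1Ny fiy locf)) => x [dx dE] /andP[ax xb].
set G := fun y => \int[mu]_(t in `]-oo, y]) f t in dx dE.
have E : {near x, (fun y => (u a - G a) + G y) =1 u}.
  near=> y.
  have ay : a <= y by apply: ltW; near: y; exact: lt_nbhsr.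
  have yb : y <= b by apply: ltW; near: y; exact: lt_nbhsl.
  have -> : u y = u a + \int[mu]_(t in `[a, y]) f t by rewrite -fE// addrC subrK.
  rewrite -Rintegral_itv_obnd_cbnd; last first.
    by apply: integrableS fi => //; exact: measurable_itv.
  by rewrite -(Rintegral_itvB (fiy y)) ?bnd_simp// /G; ring.
have [d' dE'] := derive1_addl (u a - G a) dx.
by have [du ->] := near_eq_derivable1 E d'; rewrite dE'.
Unshelve. all: by end_near. Qed.

Lemma abs_continuous_derive a b u : a <= b -> abs_continuous a b u ->
  exists f : R -> R, [/\ mu.-integrable setT (EFin \o f),
    forall x y, a <= x -> x <= y -> y <= b -> u y - u x = \int[mu]_(t in `[x, y]) f t &
    {ae mu, forall x, a < x < b -> derivable u x 1 /\ derive1 u x = f x}].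
Proof.
move=> ab ac; have [f fi fE] := abs_continuous_density ab ac.
by exists f; split => //; exact: primitive_derive.
Qed.

End FundamentalTheorem.

(** * Measurability of the derivative *)

Section DerivativeMeasurable.
Context {R : realType}.
Implicit Types (u : R -> R).
Local Notation mu := (@lebesgue_measure R).

Lemma cvg_harmonic_punctured : (n.+1%:R^-1 : R) @[n --> \oo] --> (0 : R)^'.
Proof.
move=> A; rewrite /nbhs/= => /nbhs_ballP[e /= e0 eA].
near=> n; apply: eA => /=; last by rewrite invr_eq0 pnatr_eq0.
rewrite /ball/= sub0r normrN gtr0_norm ?invr_gt0//.
by near: n; exact: near_infty_natSinv_lt (PosNum e0).
Unshelve. all: by end_near. Qed.

Definition oscillation_le u (p k m m' : nat) : set R := [set x |
  let h := ratr (odflt 0 (unpickle m)) : R in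
  let h' := ratr (odflt 0 (unpickle m')) : R in
  0 < `|h| < k.+1%:R^-1 -> 0 < `|h'| < k.+1%:R^-1 ->
  `|diff_quot u x h - diff_quot u x h'| <= p.+1%:R^-1].

Lemma diff_quot_measurable u h : measurable_fun setT u ->
  measurable_fun setT (fun x => diff_quot u x h).
Proof.
move=> mu_; apply: measurable_funM => //; apply: measurable_funB => //.
by apply: measurableT_comp => //; exact: measurable_funD.
Qed.

Lemma oscillation_le_measurable u p k m m' : measurable_fun setT u ->
  measurable (oscillation_le u p k m m').
Proof.
move=> mu_; rewrite /oscillation_le /=.
set h := ratr _; set h' := ratr _.
have [hk|hk] := pselect (0 < `|h| < k.+1%:R^-1 /\ 0 < `|h'| < k.+1%:R^-1); last first.
  rewrite (_ : mkset _ = setT) //; apply/seteqP; split => // x _ /= h1 h2.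
  by exfalso; apply: hk.
rewrite (_ : mkset _ = (fun x => `|diff_quot u x h - diff_quot u x h'|) @^-1` `]-oo, p.+1%:R^-1]).
  have mf : measurable_fun setT (fun x => `|diff_quot u x h - diff_quot u x h'|).
    apply: measurableT_comp => //.
    by apply: measurable_funB; exact: diff_quot_measurable.
  by rewrite -[X in measurable X]setTI; exact: mf.
apply/seteqP; split => x /=; rewrite in_itv/=; first by apply; case: hk.
by [].
Qed.

(** The points where the difference quotient has a Cauchy condition at 0 along rational
increments, as a countable combination of measurable sets. *)
Definition cauchy_set u : set R :=
  \bigcap_p \bigcup_k \bigcap_m \bigcap_m' oscillation_le u p k m m'.

Lemma cauchy_set_measurable u : measurable_fun setT u -> measurable (cauchy_set u).
Proof.
move=> mu_; apply: bigcapT_measurable => p; apply: bigcup_measurable => k _.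
by do 2 (apply: bigcapT_measurable => ?); exact: oscillation_le_measurable.
Qed.

Lemma dist_triangle3 (a b c d s e : R) : `|a - b| < e / 3 -> `|c - d| < e / 3 ->
  `|b - d| <= s -> s < e / 3 -> `|a - c| < e.
Proof.
rewrite !ltr_norml ler_norml => /andP[a1 a2] /andP[a3 a4] /andP[a5 a6] a7.
by apply/andP; split; lra.
Qed.

(** The difference quotient is continuous in the increment, so its Cauchy
    condition at 0 may be tested on rational increments. *)
Lemma cauchy_setP u (A : set R) x : open A -> A x ->
  (forall y, A y -> {for y, continuous u}) ->
  cauchy_set u x <-> derivable u x 1.
Proof.
move=> oA Ax uc; rewrite derivable_diff_quot; split; last first.
  move=> /cvg_ex[l /cvgrPdist_lt Hl] p _.
  have e0 : 0 < p.+1%:R^-1 / 2 :> R by rewrite divr_gt0.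
  have /nbhs_ballP[d /= d0 dP] := Hl _ e0.
  have [k kd] : exists k : nat, k.+1%:R^-1 < d.
    by exists (Num.trunc d^-1); rewrite invf_plt ?posrE//; exact: truncnS_gt.
  exists k => // m _ m' _; rewrite /oscillation_le /=; set h := ratr _; set h' := ratr _; move=> /andP[h0 hk] /andP[h'0 h'k].
  have H g : 0 < `|g| -> `|g| < k.+1%:R^-1 -> `|l - diff_quot u x g| < p.+1%:R^-1 / 2.
    move=> g0 gk; apply: dP; last by rewrite -normr_gt0.
    by rewrite /ball/= sub0r normrN (lt_trans gk).
  apply: (le_trans (ler_distD l _ _)); rewrite [leRHS]splitr lerD//.
    by rewrite distrC ltW// H.
  by rewrite ltW// H.
move=> Hx; have /nbhs_ballP[r /= r0 rA] := open_nbhs_nbhs (conj oA Ax).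
have dense h e : 0 < e -> `|h| < r -> h != 0 -> forall k : R, `|h| < k ->
    exists m, let g := ratr (odflt 0 (unpickle m)) : R in
      [/\ 0 < `|g|, `|g| < k & `|diff_quot u x h - diff_quot u x g| < e].
  move=> e0 hr h0 k hk.
  have qc : {for h, continuous (diff_quot u x)}.
    apply: cvgM; first exact: cvgV.
    apply: cvgB; last exact: cvg_cst.
    apply: (@cvg_comp _ _ _ (fun y => y + x) u _ (nbhs (h + x))).
      by apply: cvgD; [exact: cvg_id|exact: cvg_cst].
    by apply: uc; apply: rA; rewrite /ball/= opprD addrC -addrA addNr addr0 normrN.
  have near1 : \forall g \near h, `|diff_quot u x h - diff_quot u x g| < e.
    by move/cvgrPdist_lt: qc => /(_ _ e0).
  have near2 : \forall g \near h, `|g| < k.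
    have cn : `|g| @[g --> h] --> `|h| by apply: cvg_norm; exact: cvg_id.
    by move/cvgr_lt : cn => /(_ _ hk).
  have near3 : \forall g \near h, 0 < `|g|.
    have cn : `|g| @[g --> h] --> `|h| by apply: cvg_norm; exact: cvg_id.
    by move/cvgr_gt : cn => /(_ 0); rewrite normr_gt0 => /(_ h0).
  have /nbhs_ballP[c /= c0 cP] : \forall g \near h,
      [/\ 0 < `|g|, `|g| < k & `|diff_quot u x h - diff_quot u x g| < e].
    by near=> g; split; near: g.
  have hc : h - c < h + c by rewrite ltrD2l; move: c0; lra.
  have [q] := rat_in_itvoo hc.
  rewrite in_itv/= => /andP[q1 q2]; exists (pickle q); rewrite pickleK/=.
  have [g0 gk ge] : [/\ 0 < `|ratr q : R|, `|ratr q : R| < k &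
      `|diff_quot u x h - diff_quot u x (ratr q)| < e].
    by apply: cP; rewrite /ball/= ltr_norml; apply/andP; split; move: q1 q2; lra.
  by split.
apply/cauchy_cvgP; apply/cauchy_exP => e e0.
have [p pe] : exists p : nat, p.+1%:R^-1 < e / 3.
  by exists (Num.trunc (e / 3)^-1); rewrite invf_plt ?posrE ?divr_gt0//; exact: truncnS_gt.
have [k _ kP] := Hx p I.
pose d := Num.min r k.+1%:R^-1.
have d0 : 0 < d by rewrite lt_min r0 invr_gt0 ltr0Sn.
have dr : d <= r by rewrite ge_min lexx.
have dk : d <= k.+1%:R^-1 by rewrite ge_min lexx orbT.
have e30 : 0 < e / 3 by rewrite divr_gt0.
have close h h' : h != 0 -> h' != 0 -> `|h| < d -> `|h'| < d ->
    `|diff_quot u x h - diff_quot u x h'| < e.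
  move=> h0 h'0 hd h'd.
  have [m [g0 gk gh]] := dense h (e / 3) e30 (lt_le_trans hd dr) h0 _ (lt_le_trans hd dk).
  have [m' [g'0 g'k g'h]] := dense h' (e / 3) e30 (lt_le_trans h'd dr) h'0 _ (lt_le_trans h'd dk).
  have := kP m I m' I; rewrite /oscillation_le /= g0 gk g'0 g'k => /(_ isT isT) osc.
  exact: dist_triangle3 gh g'h osc pe.
exists (diff_quot u x (d / 2)); rewrite /nbhs/= /within/=.
apply/nbhs_ballP; exists d => //= h; rewrite /ball/= sub0r normrN => hd h0.
apply: close => //; first by rewrite gt_eqF// divr_gt0.
by rewrite gtr0_norm ?divr_gt0// ltr_pdivrMr// ltr_pMr// ltr1n.
Unshelve. all: by end_near. Qed.

(** At points of differentiability the derivative is the limit along increments 1/(n+1).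
At the others [derive1] has the default value of a limit that does not exist, namely 0, so it is
the product of a measurable function and of the indicator function of [cauchy_set]. *)
Lemma derive1_measurable (A : set R) u : open A ->
  (forall y, A y -> {for y, continuous u}) -> measurable_fun A (derive1 u).
Proof.
move=> oA uc; have mA : measurable A by exact: open_measurable.
pose w := u \_ A.
have wu y : A y -> {near y, w =1 u}.
  move=> Ay; near=> z; rewrite /w patchE ifT// inE.
  by near: z; exact: open_nbhs_nbhs.
have wc y : A y -> {for y, continuous w}.
  move=> Ay; have wy : w y = u y by rewrite /w patchE mem_set.
  suff: w z @[z --> y] --> w y by [].
  rewrite wy; apply: cvg_trans (uc y Ay).
  apply: near_eq_cvg; have := wu _ Ay; apply: filterS => z ->//.
have mw : measurable_fun setT w.
  apply/(measurable_restrictT _ _).1 => //.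
  apply: open_continuous_measurable_fun => // y; rewrite inE; exact: uc.
pose v x : R := fine (limn_esup (fun n => (diff_quot w x n.+1%:R^-1)%:E)).
have mv : measurable_fun setT v.
  apply: measurableT_comp => //; apply: measurable_fun_limn_esup => n.
  by apply/measurable_EFinP; exact: diff_quot_measurable.
have E : {in A, (fun x => v x * \1_(cauchy_set w) x) =1 derive1 u}.
  move=> x; rewrite inE => Ax; rewrite indicE.
  have [xE|xE] := pselect (cauchy_set w x).
    rewrite mem_set// mulr1.
    have dw := (cauchy_setP oA Ax wc).1 xE.
    have [_ ->] := near_eq_derivable1 (wu _ Ax) dw.
    have lw : diff_quot w x h @[h --> 0^'] --> derive1 w x.
      exact: (derivable_diff_quot w x).1 dw.
    have lE : (diff_quot w x n.+1%:R^-1)%:E @[n --> \oo] --> (derive1 w x)%:E.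
      apply: cvg_EFin; first exact: nearW.
      exact: (cvg_comp _ _ cvg_harmonic_punctured lw).
    rewrite /v (cvg_limn_einf_sup lE).2.
    by [].
  rewrite memNset// mulr0 derive1_diff_quot dvgP//.
  apply: contra_not xE => cu; apply/(cauchy_setP oA Ax wc).
  have du : derivable u x 1 by apply/derivable_diff_quot.
  have uw : {near x, u =1 w} by near=> z; apply/esym; near: z; exact: wu.
  by have [] := near_eq_derivable1 uw du.
apply: (eq_measurable_fun _ E); apply: measurable_funTS.
apply: measurable_funM => //; apply: measurable_indic.
exact: cauchy_set_measurable.
Unshelve. all: by end_near. Qed.

End DerivativeMeasurable.

(** * Locally absolutely continuous functions on (-1, 1) *)

Section LocallyAbsolutelyContinuous.
Context {R : realType}.
Implicit Types (u v : R -> R).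
Local Notation mu := (@lebesgue_measure R).
Local Notation I := (@Iset R).

Lemma IsetE x : I x <-> -1 < x /\ x < 1.
Proof. by rewrite /Iset /= in_itv/=; split=> [/andP[]|[-> ->]]. Qed.

Lemma open_Iset : open I. Proof. exact: itv_open. Qed.

Lemma measurable_Iset : measurable I. Proof. exact: measurable_itv. Qed.

Lemma Iset_itv a b : -1 < a -> b < 1 -> `[a, b] `<=` I.
Proof.
move=> a1 b1 x /=; rewrite in_itv/= => /andP[ax xb].
by apply/IsetE; split; [exact: lt_le_trans ax|exact: le_lt_trans b1].
Qed.

Lemma Iset_exhaust x : I x -> exists n : nat,
  -1 + n.+2%:R^-1 < x /\ x < 1 - n.+2%:R^-1 :> R.
Proof.
move=> /IsetE[x1 x2].
have [n nd] : exists n : nat, n.+1%:R^-1 < Num.min (1 + x) (1 - x).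
  have d0 : 0 < Num.min (1 + x) (1 - x) by rewrite lt_min; apply/andP; split; lra.
  by exists (Num.trunc (Num.min (1 + x) (1 - x))^-1);
    rewrite invf_plt ?posrE//; exact: truncnS_gt.
have n2 : n.+2%:R^-1 <= n.+1%:R^-1 :> R by rewrite lef_pV2 ?posrE// ler_nat.
move: nd; rewrite lt_min => /andP[h1 h2]; exists n.
by move: (n.+2%:R^-1) (n.+1%:R^-1) h1 h2 n2 => p q h1 h2 n2; split; lra.
Qed.

Lemma loc_abs_continuous_continuous u : loc_abs_continuous u ->
  forall x, I x -> {for x, continuous u}.
Proof.
move=> ac x /IsetE[x1 x2].
have a1 : -1 < (x - 1) / 2 by lra.
have b1 : (x + 1) / 2 < 1 by lra.
have ab : (x - 1) / 2 < (x + 1) / 2 by lra.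
have := abs_continuous_within (ltW ab) (ac _ _ a1 (ltW ab) b1).
move/(continuous_within_itvP _ ab) => [+ _ _]; apply; rewrite in_itv/=; lra.
Qed.

Lemma derive1_measurable_Iset u : loc_abs_continuous u ->
  measurable_fun I (derive1 u).
Proof.
move=> ac; apply: derive1_measurable; first exact: open_Iset.
exact: loc_abs_continuous_continuous.
Qed.

Lemma measurable_Iset_lac u : loc_abs_continuous u -> measurable_fun I u.
Proof.
move=> ac; apply: open_continuous_measurable_fun; first exact: open_Iset.
by move=> x; rewrite inE; exact: loc_abs_continuous_continuous.
Qed.

Lemma lac_derivable u : loc_abs_continuous u ->
  \forall x \ae mu, I x -> derivable u x 1.
Proof.
move=> ac.
have H n : \forall x \ae mu, -1 + n.+2%:R^-1 < x < 1 - n.+2%:R^-1 -> derivable u x 1.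
  have n0 : 0 < n.+2%:R^-1 :> R by rewrite invr_gt0.
  have n1 : n.+2%:R^-1 <= 2^-1 :> R by rewrite lef_pV2 ?posrE// ler_nat.
  have ab : -1 + n.+2%:R^-1 <= 1 - n.+2%:R^-1 :> R.
    by move: (n.+2%:R^-1) n1 => p n1; lra.
  have [|f [_ _ fd]] := @abs_continuous_derive _ (-1 + n.+2%:R^-1) (1 - n.+2%:R^-1) u ab.
    by move: (n.+2%:R^-1) n0 ab => p n0 ab; apply: ac => //; lra.
  by apply: (ae_imp fd) => x h /h[].
apply: (ae_imp (ae_bigcap H)) => x Hx /Iset_exhaust[n [n1 n2]].
by apply: (Hx n); rewrite n1.
Qed.

Lemma lac_FTC u a b : loc_abs_continuous u -> -1 < a -> a <= b -> b < 1 ->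
  mu.-integrable `[a, b] (EFin \o derive1 u) /\
  u b - u a = \int[mu]_(t in `[a, b]) derive1 u t.
Proof.
move=> ac a1 ab b1; have [f [fi fE fd]] := abs_continuous_derive ab (ac _ _ a1 ab b1).
have mab : measurable (`[a, b]%classic : set R) by exact: measurable_itv.
have md : measurable_fun `[a, b] (derive1 u).
  apply: measurable_funS (derive1_measurable_Iset ac); first exact: measurable_Iset.
  exact: Iset_itv.
have fi' : mu.-integrable `[a, b] (EFin \o f) by apply: integrableS fi.
have E : \forall x \ae mu, `[a, b]%classic x -> f x = derive1 u x.
  apply: (ae_imp2 fd (ae_imp2 (ae_neq a) (ae_neq b) (fun x P Q => conj P Q))) => x H [xa xb] /=.
  rewrite in_itv/= => /andP[ax xb'].
  by have [|_ ->] := H; rewrite // !lt_neqAle eq_sym xa ax xb xb'.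
split; first exact: (ae_eq_integrable _ md fi' E).
rewrite (fE a b)//; apply: ae_eq_Rintegral => //.
by move/integrableP: fi' => -[/measurable_EFinP].
Qed.

Lemma lacD u v : loc_abs_continuous u -> loc_abs_continuous v ->
  loc_abs_continuous (fun x => u x + v x).
Proof. by move=> acu acv a b a1 ab b1; apply: abs_continuousD; [exact: acu|exact: acv]. Qed.

Lemma lacM u v : loc_abs_continuous u -> loc_abs_continuous v ->
  loc_abs_continuous (fun x => u x * v x).
Proof. by move=> acu acv a b a1 ab b1; apply: abs_continuousM => //; [exact: acu|exact: acv]. Qed.

Lemma lac_cst c : loc_abs_continuous (cst c : R -> R).
Proof.
move=> a b _ _ _; apply: (@lipschitz_abs_continuous _ _ _ _ 0) => x y _ _ _.
by rewrite /= subrr normr0 mul0r.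
Qed.

Lemma lac_lin k u v : loc_abs_continuous u -> loc_abs_continuous v ->
  loc_abs_continuous (fun x => k * u x + v x).
Proof. by move=> acu acv; apply: lacD => //; apply: lacM => //; exact: lac_cst. Qed.

Lemma derive1_lin k u v x : derivable u x 1 -> derivable v x 1 ->
  derive1 (fun y => k * u y + v y) x = k * derive1 u x + derive1 v x.
Proof.
move=> du dv.
have E : diff_quot (fun y => k * u y + v y) x = (fun h => k * diff_quot u x h + diff_quot v x h).
  by apply/funext => h; rewrite /diff_quot; ring.
rewrite derive1_diff_quot E; apply/cvg_lim; first exact: Rhausdorff.
apply: cvgD; first apply: cvgMr; exact: (derivable_diff_quot _ _).1.
Qed.

Lemma derive1_mul u v x : derivable u x 1 -> derivable v x 1 ->
  derive1 (fun y => u y * v y) x = u x * derive1 v x + v x * derive1 u x.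
Proof.
move=> du dv; rewrite !derive1E.
by have := @deriveM _ _ u v x 1 du dv.
Qed.

Lemma derive1_lin_ae k u v : loc_abs_continuous u -> loc_abs_continuous v ->
  \forall x \ae mu, I x ->
   derive1 (fun y => k * u y + v y) x = k * derive1 u x + derive1 v x.
Proof.
move=> acu acv; apply: (ae_imp2 (lac_derivable acu) (lac_derivable acv)) => x hu hv Ix.
by apply: derive1_lin; [exact: hu|exact: hv].
Qed.

(** An open set of disagreement would have positive length. *)
Lemma continuous_ae_eq (u v : R -> R) :
  (forall x, I x -> {for x, continuous u}) ->
  (forall x, I x -> {for x, continuous v}) ->
  eq_L2 u v -> forall x, I x -> u x = v x.
Proof.
move=> cu cv uv x Ix; apply/eqP; rewrite -subr_eq0; apply/negPn/negP => uvx.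
have cw : {for x, continuous (fun y => `|u y - v y|)}.
  by apply: cvg_norm; apply: cvgB; [exact: cu|exact: cv].
have near1 : \forall y \near x, 0 < `|u y - v y|.
  by move/cvgr_gt : cw => /(_ 0); rewrite normr_gt0 => /(_ uvx).
have near2 : \forall y \near x, I y by apply: open_nbhs_nbhs; split => //; exact: open_Iset.
have /nbhs_ballP[c /= c0 cP] : \forall y \near x, I y /\ 0 < `|u y - v y|.
  by near=> y; split; near: y.
have [A [mA A0 AP]] := uv.
have : (mu (ball x c) <= mu A)%E.
  apply: le_measure; rewrite ?inE//; first exact: measurable_ball.
  move=> y /cP[Iy uvy]; apply: AP => /=; move/(_ Iy) => E.
  by move: uvy; rewrite E subrr normr0 ltxx.
rewrite [X in (_ <= X)%E]A0 lebesgue_measure_ball ?(ltW c0)// lee_fin.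
by rewrite leNgt pmulrn_lgt0// c0.
Unshelve. all: by end_near. Qed.

Lemma derive1_eq_Iset u v : (forall x, I x -> u x = v x) ->
  forall x, I x -> derive1 u x = derive1 v x.
Proof.
move=> uv x Ix; rewrite !derive1E; apply: near_eq_derive.
near=> y; apply: uv; near: y.
by apply: open_nbhs_nbhs; split => //; exact: open_Iset.
Unshelve. all: by end_near. Qed.

Lemma itv_family_integral (a b : R) (n : nat) (s t : 'I_n -> R) (f : R -> R) :
  (forall i, [/\ a <= s i, s i <= t i & t i <= b]) ->
  trivIset setT (fun i => `]s i, t i[%classic) ->
  mu.-integrable `[a, b] (EFin \o f) -> (forall x, 0 <= f x) ->
  \sum_(i < n) \int[mu]_(x in `[s i, t i]) f x <= \int[mu]_(x in `[a, b]) f x.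
Proof.
move=> st tr fi f0.
have sub i : `]s i, t i[ `<=` `[a, b].
  have [h1 h2 h3] := st i; move=> x /=; rewrite !in_itv/= => /andP[x1 x2].
  by rewrite (ltW (le_lt_trans h1 x1)) (ltW (lt_le_trans x2 h3)).
have fii i : mu.-integrable `]s i, t i[ (EFin \o f).
  by apply: integrableS fi => //; exact: measurable_itv.
have E i : \int[mu]_(x in `[s i, t i]) f x = fine (\int[mu]_(x in `]s i, t i[) (f x)%:E)%E.
  rewrite -Rintegral_itv_obnd_cbnd; last first.
    apply: integrableS fi => //; have [h1 h2 h3] := st i => x /=.
    by rewrite !in_itv/= => /andP[x1 x2]; rewrite (ltW (le_lt_trans h1 x1)) (le_trans x2 h3).
  by rewrite -Rintegral_itv_bndo_bndc.
have subU : \big[setU/set0]_(i < n) `]s i, t i[%classic `<=` `[a, b].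
  by apply: (big_ind (fun X => X `<=` `[a, b])) => [//|X Y hX hY|i _]; rewrite ?subUset.
have mU : measurable (\big[setU/set0]_(i < n) `]s i, t i[%classic : set R).
  by apply: bigsetU_measurable => i _; exact: measurable_itv.
under eq_bigr do rewrite E.
have fin i : (\int[mu]_(x in `]s i, t i[) (f x)%:E)%E \is a fin_num.
  by apply: integrable_fin_num => //; exact: measurable_itv.
rewrite -lee_fin -sumEFin /Rintegral fineK; last first.
  by apply: integrable_fin_num => //; exact: measurable_itv.
under eq_bigr do rewrite fineK//.
rewrite -(ge0_integral_bigsetU mu)//=.
- apply: ge0_subset_integral => //.
  + by move/integrableP: fi => -[].
  + by move=> x _; rewrite lee_fin.
- exact: index_enum_uniq.
- by move=> i j _ _; exact: tr.
- apply: measurable_funS (_ : measurable_fun `[a, b] (EFin \o f)).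
  + exact: measurable_itv.
  + exact: subU.
  + by move/integrableP: fi => -[].
- by move=> x _; rewrite lee_fin.
Qed.

Lemma Rintegral_le_mean (a b k : R) (z : R -> R) : a <= b -> 0 < k ->
  mu.-integrable `[a, b] (EFin \o z) ->
  mu.-integrable `[a, b] (EFin \o (fun x => z x ^+ 2)) ->
  `|\int[mu]_(x in `[a, b]) z x| <=
    k * (\int[mu]_(x in `[a, b]) z x ^+ 2) + (b - a) / k.
Proof.
move=> ab k0 zi z2i; have mab : measurable (`[a, b]%classic : set R) by exact: measurable_itv.
apply: (le_trans (le_normr_Rintegral _ zi)) => //.
have -> : k * (\int[mu]_(x in `[a, b]) z x ^+ 2) + (b - a) / k =
    \int[mu]_(x in `[a, b]) (k * z x ^+ 2 + k^-1).
  rewrite RintegralD//; last 2 first.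
    exact: integrable_mulr.
    exact: integrable_itv_cst.
  rewrite RintegralZl//; congr (_ + _).
  by rewrite (Rintegral_itv_cst k^-1 ab) mulrC.
apply: le_Rintegral => //.
- exact: integrable_normr.
- by apply: integrable_addr => //; [exact: integrable_mulr|exact: integrable_itv_cst].
move=> x _.
have kk : k * k^-1 = 1 by rewrite mulfV// gt_eqF.
have ki : 0 < k^-1 by rewrite invr_gt0.
rewrite -[z x ^+ 2]real_normK ?num_real//.
move: (`|z x|) (k^-1) kk ki => y i kk ki.
have : 0 <= k * (y - i / 2) ^+ 2 by rewrite mulr_ge0 ?sqr_ge0// ltW.
rewrite (_ : k * (y - i / 2) ^+ 2 = k * y ^+ 2 - (k * i) * y + (k * i) * i / 4); last by field.
by rewrite kk !mul1r; lra.
Qed.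

(** For absolute continuity: by the inequality
between arithmetic and geometric means, an increment over an interval is at most k times the
integral of the square plus the length over k, and k may be chosen small. *)
Lemma lac_primitive (z : R -> R) (c : R) : measurable_fun I z ->
  (forall a b, -1 < a -> b < 1 -> mu.-integrable `[a, b] (EFin \o (fun x => z x ^+ 2))) ->
  exists v, [/\ loc_abs_continuous v, v 0 = c,
    forall a b, -1 < a -> a <= b -> b < 1 -> v b - v a = \int[mu]_(t in `[a, b]) z t &
    \forall x \ae mu, I x -> derive1 v x = z x].
Proof.
move=> mz z2i.
have zi a b : -1 < a -> b < 1 -> mu.-integrable `[a, b] (EFin \o z).
  move=> a1 b1; apply: (@integrable_bounded _ _ z (fun x => 1 + z x ^+ 2)).
  - exact: measurable_itv.
  - by apply: measurable_funS mz; [exact: measurable_Iset|exact: Iset_itv].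
  - apply: integrable_addr; [exact: measurable_itv|exact: integrable_itv_cst|exact: z2i].
  - move=> x _; rewrite -[X in 1 + X]real_normK ?num_real//.
    by move: (`|z x|) => y; nra.
pose v x := c + (if 0 <= x then \int[mu]_(t in `[0, x]) z t
                 else - \int[mu]_(t in `[x, 0]) z t).
have vE a b : -1 < a -> a <= b -> b < 1 -> v b - v a = \int[mu]_(t in `[a, b]) z t.
  move=> a1 ab b1; rewrite /v.
  have [a0|a0] := leP 0 a.
    rewrite (le_trans a0 ab) (Rintegral_itv_cat (a := 0) (b := b) (c := a)) ?a0//.
      by ring.
    by apply: zi => //; lra.
  have [b0|b0] := leP 0 b.
    rewrite (Rintegral_itv_cat (a := a) (b := b) (c := 0)) ?b0 ?(ltW a0)//; first by ring.
    exact: zi.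
  rewrite (Rintegral_itv_cat (a := a) (b := 0) (c := b)) ?ab ?(ltW b0)//; first by ring.
  by apply: zi => //; lra.
have acv : loc_abs_continuous v.
  move=> a b a1 ab b1 e e0.
  pose N := \int[mu]_(x in `[a, b]) z x ^+ 2.
  have N0 : 0 <= N by apply: Rintegral_ge0 => x _; exact: sqr_ge0.
  pose k := e / (2 * (N + 1)).
  have k0 : 0 < k by rewrite divr_gt0// mulr_gt0//; lra.
  have e20 : 0 < e / 2 by rewrite divr_gt0.
  exists (k * (e / 2)); first by rewrite mulr_gt0.
  move=> n s t st tr sd.
  have sti i : [/\ -1 < s i, s i <= t i & t i < 1].
    by have [h1 h2 h3] := st i; split => //; [exact: lt_le_trans h1|exact: le_lt_trans b1].
  apply: (@le_lt_trans _ _ (\sum_(i < n)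
    (k * (\int[mu]_(x in `[s i, t i]) z x ^+ 2) + (t i - s i) / k))).
    apply: ler_sum => i _; have [h1 h2 h3] := sti i; rewrite vE//.
    by apply: Rintegral_le_mean => //; [exact: zi|exact: z2i].
  rewrite big_split/= -mulr_sumr -mulr_suml [e]splitr ler_ltD//.
    have := itv_family_integral st tr (z2i _ _ a1 b1) (fun x => sqr_ge0 (z x)).
    rewrite -/N => h; apply: (@le_trans _ _ (k * N)); first by rewrite ler_wpM2l// ltW.
    rewrite /k mulrAC ler_pdivrMr; last by rewrite mulr_gt0//; lra.
    by move: e0 N0; nra.
  by rewrite ltr_pdivrMr// mulrC.
exists v; split => //.
  by rewrite /v lexx set_itv1 Rintegral_set1 addr0.
have H n : \forall x \ae mu, -1 + n.+2%:R^-1 < x < 1 - n.+2%:R^-1 -> derive1 v x = z x.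
  have n0 : 0 < n.+2%:R^-1 :> R by rewrite invr_gt0.
  set a := -1 + n.+2%:R^-1; set b := 1 - n.+2%:R^-1.
  have a1 : -1 < a by rewrite /a; move: (n.+2%:R^-1) n0 => p; lra.
  have b1 : b < 1 by rewrite /b; move: (n.+2%:R^-1) n0 => p; lra.
  have fi : mu.-integrable setT (EFin \o (z \_ `[a, b])).
    by rewrite -restrict_EFin; apply/integrable_restrict => //; rewrite ?setTI; exact: zi.
  have := primitive_derive (a := a) (b := b) (u := v) fi.
  move=> /(_ _)/wrap[].
    move=> x y ax xy yb; rewrite vE//; [|exact: lt_le_trans ax|exact: le_lt_trans b1].
    apply: eq_Rintegral => t; rewrite inE/= in_itv/= => /andP[xt ty].
    by rewrite patchE mem_set//= in_itv/= (le_trans ax xt) (le_trans ty yb).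
  move=> H; apply: (ae_imp H) => x Hx xab; have [_ ->] := Hx xab.
  by move: xab => /andP[ax xb]; rewrite patchE mem_set//= in_itv/= !ltW.
apply: (ae_imp (ae_bigcap H)) => x Hx /Iset_exhaust[n [n1 n2]].
by apply: (Hx n); rewrite n1.
Qed.

End LocallyAbsolutelyContinuous.

(** * Square integrable functions on (-1, 1) *)

Section SquareIntegrable.
Context {R : realType}.
Implicit Types (f g h : R -> R).
Local Notation mu := (@lebesgue_measure R).
Local Notation I := (@Iset R).

Definition sqint f := measurable_fun I f /\
  mu.-integrable I (EFin \o (fun x => f x ^+ 2)).

Definition dot f g : R := \int[mu]_(x in I) (f x * g x).

Let mI : measurable I := @measurable_Iset R.

Lemma Lnorm2_restrict f : measurable_fun I f ->
  ('N[mu]_2%:E[EFin \o (f \_ I)] `^ 2 = \int[mu]_(x in I) (f x ^+ 2)%:E)%E.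
Proof.
move=> mf; rewrite poweR_Lnorm// [RHS]integral_mkcond; apply: eq_integral => x _.
rewrite /= !patchE; case: ifPn => xI /=.
  by rewrite -[2]/(2%:R) powR_mulrn// real_normK// num_real.
by rewrite normr0 powR0.
Qed.

Lemma in_L2P f : in_L2 f <-> sqint f.
Proof.
split=> [Lf|[mf fi]].
  have mf : measurable_fun I f.
    apply/(measurable_restrictT _ _).2 => //.
    by move: Lf => /sub_Lfun_mfun; rewrite inE.
  split => //; have h := Lfun2_integrable_sqr Lf; move: h.
  rewrite (_ : EFin \o _ = (EFin \o (fun x => f x ^+ 2)) \_ I); last first.
    apply/funext => x /=; rewrite !patchE; case: ifPn => //= _.
    by rewrite expr0n.
  by move/(integrable_restrict _ _ _ _).2; rewrite setTI; apply.
rewrite /in_L2 inE; apply/andP; split; rewrite inE/=.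
  exact/(measurable_restrictT _ _).1.
rewrite /finite_norm (@lty_poweRy _ _ 2)// Lnorm2_restrict//.
move/integrableP : fi => [_]; under eq_integral do rewrite /= ger0_norm ?sqr_ge0//.
by [].
Qed.

Lemma norm_L2_ge0 f : 0 <= norm_L2 f.
Proof. by rewrite fine_ge0// Lnorm_ge0. Qed.

Lemma norm_L2_sqr f : in_L2 f -> norm_L2 f ^+ 2 = dot f f.
Proof.
move=> Lf; have [mf fi] := (in_L2P f).1 Lf.
have -> : dot f f = fine ('N[mu]_2%:E[EFin \o (f \_ I)] `^ 2)%E.
  by rewrite Lnorm2_restrict.
have : ('N[mu]_2%:E[EFin \o (f \_ I)])%E \is a fin_num.
  rewrite ge0_fin_numE ?Lnorm_ge0//.
  by move: Lf; rewrite /in_L2 inE => /andP[_]; rewrite inE.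
rewrite /norm_L2; case: ('N[mu]_2%:E[_])%E (Lnorm_ge0 mu 2%:E (EFin \o (f \_ I))) => //= x x0 _.
by rewrite -[2]/(2%:R) powR_mulrn.
Qed.

Lemma norm_L2E f : in_L2 f -> norm_L2 f = Num.sqrt (dot f f).
Proof. by move=> Lf; rewrite -norm_L2_sqr// sqrtr_sqr ger0_norm// norm_L2_ge0. Qed.

Lemma sqint_mul f g : sqint f -> sqint g ->
  mu.-integrable I (EFin \o (fun x => f x * g x)).
Proof.
move=> [mf fi] [mg gi].
apply: (@integrable_bounded _ _ _ (fun x => f x ^+ 2 + g x ^+ 2)) => //.
- exact: measurable_funM.
- exact: integrable_addr.
move=> x _; rewrite normrM -[f x ^+ 2]real_normK ?num_real// -[g x ^+ 2]real_normK ?num_real//.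
by move: (`|f x|) (`|g x|) => a b; nra.
Qed.

Lemma sqint_lin k f g : sqint f -> sqint g -> sqint (fun x => k * f x + g x).
Proof.
move=> sf sg; have [mf fi] := sf; have [mg gi] := sg; split.
  by apply: measurable_funD => //; apply: measurable_funM.
apply: (@eq_integrable _ _ _ mu _ _ (EFin \o
  (fun x => k ^+ 2 * (f x ^+ 2) + (2 * k * (f x * g x) + g x ^+ 2)))) => //.
  by move=> x _ /=; congr EFin; ring.
apply: integrable_addr => //; first exact: integrable_mulr.
by apply: integrable_addr => //; apply: integrable_mulr => //; exact: sqint_mul.
Qed.

Lemma sqintD f g : sqint f -> sqint g -> sqint (fun x => f x + g x).
Proof.
by move=> sf sg; have := sqint_lin 1 sf sg; under eq_fun do rewrite mul1r.
Qed.

Lemma sqint_cst k : sqint (cst k).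
Proof.
split => //; apply: integrableS (integrable_itv_cst (-1) 1 (k ^+ 2)) => //.
by move=> x /=; rewrite !in_itv/= => /andP[/ltW -> /ltW ->].
Qed.

Lemma sqintZ k f : sqint f -> sqint (fun x => k * f x).
Proof.
move=> sf; have := sqint_lin k sf (sqint_cst 0).
by rewrite (_ : (fun x => _) = (fun x => k * f x))//; apply/funext => x; rewrite addr0.
Qed.

Lemma sqintB f g : sqint f -> sqint g -> sqint (fun x => f x - g x).
Proof.
move=> sf sg; have := sqint_lin (-1) sg sf.
by rewrite (_ : (fun x => _) = (fun x => f x - g x))//; apply/funext => x; rewrite mulN1r addrC.
Qed.

Lemma sqint_bounded f g : measurable_fun I f -> sqint g ->
  (forall x, I x -> `|f x| <= `|g x|) -> sqint f.
Proof.
move=> mf [mg gi] fg; split => //.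
apply: (@integrable_bounded _ _ _ (fun x => g x ^+ 2)) => //.
  exact: measurable_funX.
move=> x Ix; rewrite normrX -[g x ^+ 2]real_normK ?num_real//.
by rewrite ler_pXn2r ?nnegrE// fg.
Qed.

Lemma sqint_bounded_mul (M : R) f g : measurable_fun I g -> sqint f ->
  (forall x, I x -> `|g x| <= M) -> sqint (fun x => g x * f x).
Proof.
move=> mg sf gM; apply: (@sqint_bounded _ (fun x => M * f x)).
- by apply: measurable_funM => //; case: sf.
- exact: sqintZ.
move=> x Ix; rewrite !normrM ler_wpM2r// (le_trans (gM _ Ix))//; exact: ler_norm.
Qed.

Lemma dotC f g : dot f g = dot g f.
Proof. by apply: eq_Rintegral => x _; rewrite mulrC. Qed.

Lemma dot_linl k f g h : sqint f -> sqint g -> sqint h ->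
  dot (fun x => k * f x + g x) h = k * dot f h + dot g h.
Proof.
move=> sf sg sh; rewrite /dot -RintegralZl//; last exact: sqint_mul.
rewrite -RintegralD//.
- by apply: eq_Rintegral => x _; ring.
- by apply: integrable_mulr => //; exact: sqint_mul.
- exact: sqint_mul.
Qed.

Lemma dot_ge0 f : 0 <= dot f f.
Proof. by apply: Rintegral_ge0 => x _; rewrite -expr2 sqr_ge0. Qed.

Lemma eq_dot f f' g g' : sqint f -> sqint f' -> sqint g -> sqint g' ->
  eq_L2 f f' -> eq_L2 g g' -> dot f g = dot f' g'.
Proof.
move=> [mf _] [mf' _] [mg _] [mg' _] ff gg; apply: ae_eq_Rintegral => //.
- exact: measurable_funM.
- exact: measurable_funM.
- by apply: (ae_imp2 ff gg) => x h1 h2 Ix; rewrite h1 ?h2.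
Qed.

Lemma dot_eq0 f : sqint f -> dot f f = 0 -> eq_L2 f (cst 0).
Proof.
move=> sf; have [mf fi] := sf; rewrite /dot /Rintegral => H.
have fin : (\int[mu]_(x in I) (f x * f x)%:E)%E \is a fin_num.
  by apply: integrable_fin_num => //; exact: sqint_mul.
have H0 : (\int[mu]_(x in I) (f x * f x)%:E = 0)%E by rewrite -(fineK fin) H.
have : (\int[mu]_(x in I) `|(f x * f x)%:E| = 0)%E.
  by rewrite -[RHS]H0; apply: eq_integral => x _; rewrite /= ger0_norm// -expr2 sqr_ge0.
have mff : measurable_fun I (EFin \o (fun x => f x * f x)).
  by apply/measurable_EFinP; exact: measurable_funM.
move/(ae_eq_integral_abs mu mI mff).1 => H1; apply: (ae_imp H1) => x h Ix.
by have /eqP := h Ix; rewrite eqe mulf_eq0 orbb => /eqP.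
Qed.

Lemma quadratic_disc (a b c : R) : 0 <= c -> (forall k, 0 <= a + 2 * k * b + k ^+ 2 * c) ->
  b ^+ 2 <= a * c.
Proof.
move=> c0 H; have [c00|cn0] := eqVneq c 0; first rewrite c00 in H *.
  have [->|b0] := eqVneq b 0; first by rewrite expr0n mulr0.
  have := H (- (a + 1) / (2 * b)); rewrite /= mulr0 addr0.
  rewrite (_ : 2 * _ * b = - (a + 1)); last by field.
  by move=> h; exfalso; move: h; lra.
have {}c0 : 0 < c by rewrite lt_neqAle eq_sym cn0.
have := H (- b / c); rewrite (_ : _ + _ = (a * c - b ^+ 2) / c); last by field.
by rewrite pmulr_lge0 ?invr_gt0// subr_ge0.
Qed.

Lemma dot_lin2 k f g : sqint f -> sqint g ->
  dot (fun x => k * f x + g x) (fun x => k * f x + g x) =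
  dot g g + 2 * k * dot f g + k ^+ 2 * dot f f.
Proof.
move=> sf sg; have sh := sqint_lin k sf sg.
rewrite dot_linl// (dotC f) (dotC g) !dot_linl// (dotC g f); ring.
Qed.

Lemma dot_cauchy_schwarz f g : sqint f -> sqint g ->
  dot f g ^+ 2 <= dot f f * dot g g.
Proof.
move=> sf sg; rewrite mulrC; apply: quadratic_disc (dot_ge0 f) _ => k.
by rewrite -dot_lin2// dot_ge0.
Qed.

Lemma dot_le_norm f g : in_L2 f -> in_L2 g -> `|dot f g| <= norm_L2 f * norm_L2 g.
Proof.
move=> Lf Lg; rewrite -(@ler_pXn2r _ 2) ?nnegrE ?mulr_ge0 ?norm_L2_ge0//.
rewrite real_normK ?num_real// exprMn !norm_L2_sqr//.
by apply: dot_cauchy_schwarz; exact/in_L2P.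
Qed.

Lemma in_L2_lin k f g : in_L2 f -> in_L2 g -> in_L2 (k *: f + g).
Proof. by move=> /in_L2P sf /in_L2P sg; apply/in_L2P; exact: sqint_lin. Qed.

Lemma in_L2D f g : in_L2 f -> in_L2 g -> in_L2 (f + g).
Proof. by move=> /in_L2P sf /in_L2P sg; apply/in_L2P; exact: sqintD. Qed.

Lemma in_L2Z k f : in_L2 f -> in_L2 (k *: f).
Proof. by move=> /in_L2P sf; apply/in_L2P; exact: sqintZ. Qed.

Lemma in_L2B f g : in_L2 f -> in_L2 g -> in_L2 (f - g).
Proof. by move=> /in_L2P sf /in_L2P sg; apply/in_L2P; exact: sqintB. Qed.

Lemma in_L2_0 : in_L2 (0 : R -> R).
Proof. by apply/in_L2P; exact: (sqint_cst 0). Qed.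

Lemma eq_norm_L2 f g : in_L2 f -> in_L2 g -> eq_L2 f g -> norm_L2 f = norm_L2 g.
Proof.
move=> Lf Lg fg; rewrite !norm_L2E//; congr Num.sqrt.
by apply: eq_dot => //; exact/in_L2P.
Qed.

Lemma norm_L2D f g : in_L2 f -> in_L2 g -> norm_L2 (f + g) <= norm_L2 f + norm_L2 g.
Proof.
move=> Lf Lg; have Lfg := in_L2D Lf Lg.
rewrite -(@ler_pXn2r _ 2) ?nnegrE ?addr_ge0 ?norm_L2_ge0// norm_L2_sqr//.
have sf := (in_L2P f).1 Lf; have sg := (in_L2P g).1 Lg.
have -> : dot (f + g) (f + g) = dot f f + 2 * dot f g + dot g g.
  have := dot_lin2 1 sf sg; rewrite expr1n !mul1r mulr1.
  rewrite (_ : (fun x => 1 * f x + g x) = f + g); last by apply/funext => x; rewrite mul1r.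
  by move=> ->; ring.
rewrite -!norm_L2_sqr//.
by have := le_trans (ler_norm _) (dot_le_norm Lf Lg); rewrite sqrrD; lra.
Qed.

Lemma norm_L2Z k f : in_L2 f -> norm_L2 (k *: f) = `|k| * norm_L2 f.
Proof.
move=> Lf; have Lkf := in_L2Z k Lf.
rewrite !norm_L2E// -(sqrtr_sqr k) -sqrtrM ?sqr_ge0//.
congr Num.sqrt; rewrite /dot -RintegralZl//; last by apply: sqint_mul; exact/in_L2P.
by apply: eq_Rintegral => x _; rewrite -[(k *: f) x]/(k * f x); ring.
Qed.

Lemma norm_L2N f : in_L2 f -> norm_L2 (- f) = norm_L2 f.
Proof. by move=> Lf; rewrite -scaleN1r norm_L2Z// normrN1 mul1r. Qed.

Lemma norm_L2_dist f g : in_L2 f -> in_L2 g -> norm_L2 (f - g) = norm_L2 (g - f).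
Proof. by move=> Lf Lg; rewrite -norm_L2N ?opprB//; exact: in_L2B. Qed.

Lemma norm_L2_eq0 f : in_L2 f -> norm_L2 f = 0 -> eq_L2 f (cst 0).
Proof.
move=> Lf f0; apply: dot_eq0; first exact/in_L2P.
by rewrite -norm_L2_sqr// f0 expr0n.
Qed.

Lemma norm_L2_le f (M : R) : in_L2 f -> 0 <= M -> dot f f <= M ^+ 2 -> norm_L2 f <= M.
Proof.
by move=> Lf M0; rewrite -norm_L2_sqr// ler_pXn2r ?nnegrE// norm_L2_ge0.
Qed.

Lemma le_norm_L2 f g : in_L2 f -> in_L2 g -> (forall x, I x -> `|f x| <= `|g x|) ->
  norm_L2 f <= norm_L2 g.
Proof.
move=> Lf Lg fg; apply: norm_L2_le => //; rewrite ?norm_L2_ge0// norm_L2_sqr//.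
apply: le_Rintegral => //; [by apply: sqint_mul; exact/in_L2P|by apply: sqint_mul; exact/in_L2P|].
move=> x Ix; rewrite -!expr2 -[f x ^+ 2]real_normK ?num_real// -[g x ^+ 2]real_normK ?num_real//.
by rewrite ler_pXn2r ?nnegrE// fg.
Qed.

Lemma L2_fatou (h : nat -> R -> R) g (M : R) : 0 <= M ->
  (forall n, in_L2 (h n)) -> (forall n, norm_L2 (h n) <= M) ->
  measurable_fun I g -> (\forall x \ae mu, I x -> h n x @[n --> \oo] --> g x) ->
  in_L2 g /\ norm_L2 g <= M.
Proof.
move=> M0 Lh hM mg hg.
pose F n x := (h n x ^+ 2)%:E.
have mF n : measurable_fun I (F n).
  by apply/measurable_EFinP; apply: measurable_funX; have /in_L2P[] := Lh n.
have F0 n x : I x -> (0 <= F n x)%E by move=> _; rewrite lee_fin sqr_ge0.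
have := fatou mu mI mF F0.
have E : ae_eq mu I (fun x => limn_einf (F^~ x)) (fun x => (g x ^+ 2)%:E).
  apply: (ae_imp hg) => x hx Ix.
  have Fc : F n x @[n --> \oo] --> (g x ^+ 2)%:E.
    apply: cvg_EFin; first exact: nearW.
    exact: (cvgM (hx Ix) (hx Ix)).
  by have [-> _] := cvg_limn_einf_sup Fc.
rewrite (@ae_eq_integral _ _ _ mu I (fun x => (g x ^+ 2)%:E) _ mI _ _ E); first last.
- by apply/measurable_EFinP; exact: measurable_funX.
- rewrite (_ : (fun x => _) = (fun x => - limn_esup (fun n => - F n x))%E).
    apply: measurableT_comp => //; apply: measurable_fun_limn_esup => n.
    have mhN : measurable_fun I (EFin \o (fun x => - h n x ^+ 2)).
      apply/measurable_EFinP; apply: measurableT_comp => //.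
      by apply: measurable_funX; have /in_L2P[] := Lh n.
    exact: mhN.
  by [].
have FM : (limn_einf (fun n => \int[mu]_(x in I) F n x) <= (M ^+ 2)%:E)%E.
  rewrite limn_einf_lim; apply: lime_le; first exact: is_cvg_einfs.
  apply: nearW => n; apply: le_trans (_ : _ <= \int[mu]_(x in I) F n x)%E _.
    by apply: ereal_inf_lbound; exists n => //=.
  have /in_L2P[_ fi] := Lh n.
  rewrite -[leLHS]fineK; last exact: integrable_fin_num.
  rewrite lee_fin (_ : fine _ = dot (h n) (h n)); last first.
    by rewrite /dot /Rintegral; congr fine; apply: eq_integral => x _; rewrite /F expr2.
  by rewrite -norm_L2_sqr// ler_pXn2r ?nnegrE ?norm_L2_ge0.
move=> /le_trans/(_ FM) gM.
have Lg : in_L2 g.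
  apply/in_L2P; split => //; apply/integrableP; split.
    by apply/measurable_EFinP; exact: measurable_funX.
  apply: le_lt_trans (ltry (M ^+ 2)).
  by under eq_integral do rewrite /= ger0_norm ?sqr_ge0//.
split => //; apply: norm_L2_le => //; rewrite -lee_fin; apply: le_trans gM.
rewrite /dot /Rintegral fineK; last first.
  by apply: integrable_fin_num => //; by apply: sqint_mul; exact/in_L2P.
by rewrite le_eqVlt; apply/orP; left; apply/eqP/eq_integral => x _; rewrite expr2.
Qed.

(** By Fatou's lemma for the tails of the sequence. *)
Lemma L2_cvg_unique (h : nat -> R -> R) f g :
  (forall n, in_L2 (h n)) -> in_L2 f -> measurable_fun I g ->
  norm_L2 (h n - f) @[n --> \oo] --> 0 ->
  (\forall x \ae mu, I x -> h n x @[n --> \oo] --> g x) -> eq_L2 f g.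
Proof.
move=> Lh Lf mg hf hg.
have mf : measurable_fun I f by have /in_L2P[] := Lf.
have bound (e : R) : 0 < e -> in_L2 (g - f) /\ norm_L2 (g - f) <= e.
  move=> e0; have [N _ NP] : \forall n \near \oo, norm_L2 (h n - f) < e.
    by move/cvgr_lt : hf; apply.
  apply: (@L2_fatou (fun n => h (n + N)%N - f)) => //; first exact: ltW.
  - by move=> n; exact: in_L2B.
  - by move=> n; apply/ltW/NP => /=; rewrite leq_addl.
  - exact: measurable_funB.
  - apply: (ae_imp hg) => x hx Ix; apply: cvgB; last exact: cvg_cst.
    by rewrite (cvg_shiftn N (fun n => h n x)); exact: hx.
have Lgf : in_L2 (g - f) by have [] := bound 1 ltr01.
have : eq_L2 (g - f) (cst 0).
  apply: norm_L2_eq0 => //; apply/eqP; rewrite eq_le norm_L2_ge0 andbT.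
  by apply/ler_addgt0Pl => e e0; rewrite addr0; have [] := bound e e0.
by move=> H; apply: (ae_imp H) => x h0 Ix; apply/esym/eqP; rewrite -subr_eq0 -[_ - _]/((g - f) x) h0.
Qed.

Lemma measure_Iset : mu I = 2%:E.
Proof.
apply: etrans (lebesgue_measure_itv _) _; rewrite /= lte_fin.
by rewrite ifT; [rewrite -EFinB; congr EFin; ring|lra].
Qed.

Lemma L1_le_L2 f : in_L2 f -> (\int[mu]_(x in I) `|f x|%:E <= (2 * norm_L2 f)%:E)%E.
Proof.
move=> Lf; have sf := (in_L2P f).1 Lf.
have Lc : in_L2 (cst 1 : R -> R) by apply/in_L2P; exact: sqint_cst.
have sa : sqint (fun x => `|f x|).
  apply: sqint_bounded (sf) _; last by move=> x _; rewrite normr_id.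
  by apply: measurableT_comp => //; case: sf.
have ai : mu.-integrable I (EFin \o (fun x => `|f x|)).
  by have := sqint_mul sa (sqint_cst 1); under eq_fun do rewrite mulr1.
rewrite -[leLHS]fineK; last exact: integrable_fin_num.
have La : in_L2 (fun x => `|f x|) by apply/in_L2P.
have -> : fine (\int[mu]_(x in I) `|f x|%:E)%E = dot (fun x => `|f x|) (cst 1).
  by apply: eq_Rintegral => x _; rewrite mulr1.
rewrite lee_fin; apply: (le_trans (ler_norm _)); apply: (le_trans (dot_le_norm La Lc)).
rewrite mulrC; apply: ler_pM; rewrite ?norm_L2_ge0//.
  apply: norm_L2_le => //; rewrite /dot /Rintegral.
  rewrite (_ : (fun x => _) = cst 1%:E); last by apply/funext => x /=; rewrite mulr1.
  have -> : (\int[mu]_(x in I) (cst 1%:E x) = 2%:E)%E.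
    by rewrite integral_cst// mul1e; exact: measure_Iset.
  by rewrite /=; lra.
by apply: le_norm_L2 => // x _; rewrite normr_id.
Qed.

(** Riesz-Fischer: a series whose norms decay geometrically converges almost everywhere,
since its sum in L^1 is finite; Fatou's lemma gives the estimate in L^2. *)
Lemma L2_complete (f : nat -> R -> R) (C : R) : 0 <= C ->
  (forall n, in_L2 (f n)) ->
  (forall n, norm_L2 (f n.+1 - f n) <= C / 2 ^+ n) ->
  exists2 g, in_L2 g & forall n, norm_L2 (f n - g) <= 2 * C / 2 ^+ n.
Proof.
move=> C0 Lf fC.
have Ld n : in_L2 (f n.+1 - f n) by exact: in_L2B.
have mfn n : measurable_fun I (f n) by have /in_L2P[] := Lf n.
have p2 n : 0 < 2 ^+ n :> R by rewrite exprn_gt0.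
have mG n : measurable_fun I (fun x => `|f n.+1 x - f n x|%:E).
  apply/measurable_EFinP; apply: measurableT_comp => //.
  exact: measurable_funB.
have geo n : \sum_(0 <= k < n) (2 * (C / 2 ^+ k)) = 4 * C * (1 - (2 ^+ n)^-1).
  elim: n => [|n IH]; first by rewrite big_nil expr0 invr1 subrr mulr0.
  by rewrite big_nat_recr//= IH exprS; field; rewrite gt_eqF.
have sumfin : (\int[mu]_(x in I) (\sum_(0 <= k <oo) `|f k.+1 x - f k x|%:E) < +oo)%E.
  rewrite integral_nneseries//.
  apply: (@le_lt_trans _ _ (4 * C)%:E); last exact: ltry.
  apply: lime_le; first by apply: is_cvg_nneseries => k _ _; exact: integral_ge0.
  apply: nearW => n; apply: (@le_trans _ _ (\sum_(0 <= k < n) (2 * (C / 2 ^+ k))%:E)%E).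
    apply: lee_sum => k _; apply: (le_trans (L1_le_L2 (Ld k))).
    by rewrite lee_fin ler_pM2l.
  by rewrite sumEFin lee_fin geo ler_piMr ?mulr_ge0// gerBl invr_ge0 ltW.
have msum : measurable_fun I (fun x => \sum_(0 <= k <oo) `|f k.+1 x - f k x|%:E)%E.
  by apply: ge0_emeasurable_sum => // k x _ _; rewrite lee_fin.
have aefin : \forall x \ae mu, I x -> (\sum_(0 <= k <oo) `|f k.+1 x - f k x|%:E < +oo)%E.
  have ii : mu.-integrable I (fun x => \sum_(0 <= k <oo) `|f k.+1 x - f k x|%:E)%E.
    apply/integrableP; split => //; under eq_integral => x _.
      rewrite gee0_abs; last by apply: nneseries_ge0.
      over.
    by [].
  have := integrable_ae _ ii => /(_ mI) H; apply: (ae_imp H) => x Hx Ix.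
  by have := Hx Ix; rewrite fin_numElt => /andP[].
have aecvg : \forall x \ae mu, I x -> cvgn (fun n => f n x).
  apply: (ae_imp aefin) => x Hx Ix.
  have cs : cvgn (series (fun k => f k.+1 x - f k x)).
    apply: normed_cvg; rewrite /=.
    have nd : nondecreasing_seq [normed series (fun k => f k.+1 x - f k x)].
      by apply: nondecreasing_series => k _ _; exact: normr_ge0.
    apply: nondecreasing_is_cvgn => //.
    exists (fine (\sum_(0 <= k <oo) `|f k.+1 x - f k x|%:E)%E) => _ [n _ <-].
    rewrite -lee_fin fineK; last first.
      by rewrite ge0_fin_numE; [exact: Hx|exact: nneseries_ge0].
    rewrite /series/= -sumEFin; exact: nneseries_lim_ge.
  have -> : (fun n => f n x) = (fun n => f 0%N x + series (fun k => f k.+1 x - f k x) n).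
    by apply/funext => n; rewrite /series/= telescope_sumr// addrC subrK.
  by apply: is_cvgD => //; exact: is_cvg_cst.
pose g x := fine (limn_esup (fun n => (f n x)%:E)).
have mg : measurable_fun I g.
  apply: measurableT_comp => //; apply: measurable_fun_limn_esup => n.
  exact/measurable_EFinP.
have fg : \forall x \ae mu, I x -> f n x @[n --> \oo] --> g x.
  apply: (ae_imp aecvg) => x cx Ix; have {}cx := cx Ix.
  suff -> : g x = limn (fun n => f n x) by [].
  have cE : (f n x)%:E @[n --> \oo] --> (limn (fun n => f n x))%:E.
    by apply: cvg_EFin => //; exact: nearW.
  by rewrite /g (cvg_limn_einf_sup cE).2.
have tri n j : norm_L2 (f (j + n)%N - f n) <= 2 * C / 2 ^+ n * (1 - (2 ^+ j)^-1).
  elim: j => [|j IH].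
    rewrite add0n subrr expr0 invr1 subrr mulr0 norm_L2E; last exact: in_L2_0.
    by rewrite (_ : dot _ _ = 0) ?sqrtr0//; rewrite /dot; under eq_Rintegral do rewrite mulr0; rewrite Rintegral_cst// mul0r.
  have -> : f (j.+1 + n)%N - f n = (f (j + n).+1 - f (j + n)%N) + (f (j + n)%N - f n).
    by rewrite addrA subrK.
  apply: (le_trans (norm_L2D _ _)) => //; first exact: in_L2B.
  apply: (le_trans (lerD (fC _) IH)).
  by rewrite le_eqVlt; apply/orP; left; apply/eqP; rewrite exprD exprS; field; rewrite !gt_eqF.
have key n : in_L2 (g - f n) /\ norm_L2 (g - f n) <= 2 * C / 2 ^+ n.
  apply: (@L2_fatou (fun j => f (j + n)%N - f n)).
  - by rewrite divr_ge0 ?mulr_ge0// ltW.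
  - by move=> j; exact: in_L2B.
  - move=> j; apply: le_trans (tri n j) _.
    by rewrite ler_piMr ?divr_ge0 ?mulr_ge0 ?(ltW (p2 _))// gerBl invr_ge0 ltW.
  - exact: measurable_funB.
  - apply: (ae_imp fg) => x hx Ix; apply: cvgB; last exact: cvg_cst.
    by rewrite (cvg_shiftn n (fun n => f n x)); exact: hx.
have Lg : in_L2 g.
  by have := in_L2D (key 0%N).1 (Lf 0%N); rewrite subrK.
exists g => // n; rewrite norm_L2_dist//; exact: (key n).2.
Qed.

End SquareIntegrable.

(** * The Hilbert space of pairs *)

Section PairSpace.
Context {R : realType}.
Implicit Types (u v w : state R).
Local Notation mu := (@lebesgue_measure R).
Local Notation I := (@Iset R).

Lemma eq_L2_refl (f : R -> R) : eq_L2 f f. Proof. exact: ae_all. Qed.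

Lemma eq_L2_sym (f g : R -> R) : eq_L2 f g -> eq_L2 g f.
Proof. by move=> fg; apply: (ae_imp fg) => x h Ix; rewrite h. Qed.

Lemma eq_L2_trans (g f h : R -> R) : eq_L2 f g -> eq_L2 g h -> eq_L2 f h.
Proof. by move=> fg gh; apply: (ae_imp2 fg gh) => x h1 h2 Ix; rewrite h1 ?h2. Qed.

Lemma eq_L2_lin k (f f' g g' : R -> R) : eq_L2 f f' -> eq_L2 g g' ->
  eq_L2 (k *: f + g) (k *: f' + g').
Proof.
move=> ff gg; apply: (ae_imp2 ff gg) => x h1 h2 Ix.
by rewrite -[LHS]/(k * f x + g x) h1 ?h2.
Qed.

Lemma eq_L2_Iset (f g : R -> R) : (forall x, I x -> f x = g x) -> eq_L2 f g.
Proof. by move=> fg; apply: ae_all. Qed.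

Lemma eq_H2_refl u : eq_H2 u u.
Proof. by split; exact: eq_L2_refl. Qed.

Lemma eq_H2_sym u v : eq_H2 u v -> eq_H2 v u.
Proof. by case=> h1 h2; split; exact: eq_L2_sym. Qed.

Lemma eq_H2_trans v u w : eq_H2 u v -> eq_H2 v w -> eq_H2 u w.
Proof. by case=> h1 h2 [h3 h4]; split; [exact: eq_L2_trans h3|exact: eq_L2_trans h4]. Qed.

Lemma eq_H2_lin k u u' v v' : eq_H2 u u' -> eq_H2 v v' -> eq_H2 (k *: u + v) (k *: u' + v').
Proof. by case=> h1 h2 [h3 h4]; split; exact: eq_L2_lin. Qed.

Lemma in_H2_lin k u v : in_H2 u -> in_H2 v -> in_H2 (k *: u + v).
Proof. by case=> h1 h2 [h3 h4]; split; exact: in_L2_lin. Qed.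

Lemma in_H2_0 : in_H2 (0 : state R).
Proof. by split; exact: in_L2_0. Qed.

Definition dot2 u v : R := dot u.1 v.1 + dot u.2 v.2.

Lemma dot2C u v : dot2 u v = dot2 v u.
Proof. by rewrite /dot2 dotC (dotC u.2). Qed.

Lemma dot2_linl k u v w : in_H2 u -> in_H2 v -> in_H2 w ->
  dot2 (k *: u + v) w = k * dot2 u w + dot2 v w.
Proof.
case=> /in_L2P u1 /in_L2P u2 [/in_L2P v1 /in_L2P v2] [/in_L2P w1 /in_L2P w2].
rewrite /dot2 [dot (k *: u + v).1 _]dot_linl// [dot (k *: u + v).2 _]dot_linl//; ring.
Qed.

Lemma eq_dot2 u u' v v' : in_H2 u -> in_H2 u' -> in_H2 v -> in_H2 v' ->
  eq_H2 u u' -> eq_H2 v v' -> dot2 u v = dot2 u' v'.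
Proof.
case=> /in_L2P a1 /in_L2P a2 [/in_L2P b1 /in_L2P b2] [/in_L2P c1 /in_L2P c2].
case=> /in_L2P d1 /in_L2P d2 [e1 e2] [f1 f2].
by rewrite /dot2 (eq_dot a1 b1 c1 d1)// (eq_dot a2 b2 c2 d2).
Qed.

Lemma dot2_ge0 u : 0 <= dot2 u u.
Proof. by rewrite addr_ge0// dot_ge0. Qed.

Lemma norm_H2_sqr u : in_H2 u -> norm_H2 u ^+ 2 = dot2 u u.
Proof.
case=> h1 h2; rewrite /norm_H2 sqr_sqrtr ?addr_ge0 ?sqr_ge0//.
by rewrite !norm_L2_sqr.
Qed.

Lemma norm_H2_ge0 u : 0 <= norm_H2 u. Proof. exact: sqrtr_ge0. Qed.

Lemma norm_H2E u : in_H2 u -> norm_H2 u = Num.sqrt (dot2 u u).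
Proof. by move=> hu; rewrite -norm_H2_sqr// sqrtr_sqr ger0_norm// norm_H2_ge0. Qed.

Lemma dot2_eq0 u : in_H2 u -> dot2 u u = 0 -> eq_H2 u 0.
Proof.
case=> /in_L2P h1 /in_L2P h2 /eqP; rewrite paddr_eq0 ?dot_ge0// => /andP[/eqP a /eqP b].
by split; exact: dot_eq0.
Qed.

(** The chosen element of a class depends on the class only, since predicates with the same
elements are equal. *)
Definition hcanon u : state R := xget 0 [set v | in_H2 v /\ eq_H2 u v].

Lemma hcanonP u : in_H2 u -> in_H2 (hcanon u) /\ eq_H2 u (hcanon u).
Proof.
move=> hu; rewrite /hcanon; case: xgetP => [v _ []//|/(_ u) H].
by exfalso; apply: H; split => //; exact: eq_H2_refl.
Qed.

Lemma eq_hcanon u v : eq_H2 u v -> hcanon u = hcanon v.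
Proof.
move=> uv; rewrite /hcanon; congr (xget 0 _); apply/seteqP; split => w /= [hw h]; split => //.
  by apply: eq_H2_trans h; exact: eq_H2_sym.
exact: eq_H2_trans h.
Qed.

End PairSpace.

(** The quotient by almost everywhere equality, as the type of the canonical
representatives: two of its elements are equal as soon as their representatives are. *)
Record hspace (R : realType) := Hspace {
  hrep : state R;
  hrep_canon : `[< in_H2 hrep /\ hcanon hrep = hrep >] }.

Section HilbertSpace.
Context {R : realType}.
Implicit Types (u v w : state R) (x y z : hspace R).

Lemma hrep_inj : injective (@hrep R).
Proof.
move=> [u hu] [v hv] /= uv; move: uv hv => <- hv; congr Hspace.
exact: bool_irrelevance.
Qed.

Lemma hrep_in x : in_H2 (hrep x).
Proof. by have /asboolP[] := hrep_canon x. Qed.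
Hint Resolve hrep_in : core.

Definition hproj u : state R := if `[< in_H2 u >] then hcanon u else hcanon 0.

Lemma hprojE u : in_H2 u -> hproj u = hcanon u.
Proof. by move=> hu; rewrite /hproj asboolT. Qed.

Lemma cls_subproof u : `[< in_H2 (hproj u) /\ hcanon (hproj u) = hproj u >].
Proof.
apply/asboolP; rewrite /hproj; case: asboolP => [hu|_].
  have [h1 h2] := hcanonP hu; split => //.
  by apply: eq_hcanon; exact: eq_H2_sym.
have [h1 h2] := hcanonP (@in_H2_0 R); split => //.
by apply: eq_hcanon; exact: eq_H2_sym.
Qed.

Definition cls u : hspace R := Hspace (cls_subproof u).

Lemma hrep_cls u : in_H2 u -> eq_H2 u (hrep (cls u)).
Proof. by move=> hu; rewrite /cls /= hprojE//; have [] := hcanonP hu. Qed.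

Lemma eq_cls u v : in_H2 u -> in_H2 v -> cls u = cls v <-> eq_H2 u v.
Proof.
move=> hu hv; split=> [uv|uv].
  apply: eq_H2_trans (hrep_cls hu) _; rewrite uv; apply: eq_H2_sym; exact: hrep_cls.
apply: hrep_inj; rewrite /cls /= !hprojE//.
exact: eq_hcanon.
Qed.

Lemma hrepK x : cls (hrep x) = x.
Proof.
apply: hrep_inj; rewrite /cls /= hprojE//.
by have /asboolP[] := hrep_canon x.
Qed.

Lemma cls_eq_hrep u x : in_H2 u -> eq_H2 u (hrep x) -> cls u = x.
Proof. by move=> hu ux; rewrite -(hrepK x); apply/eq_cls. Qed.

HB.instance Definition _ := gen_eqMixin (hspace R).
HB.instance Definition _ := gen_choiceMixin (hspace R).

Definition hadd x y := cls (hrep x + hrep y).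
Definition hscale (k : R) x := cls (k *: hrep x).
Definition hopp x := hscale (-1) x.
Definition hzero := cls (0 : state R).

Lemma in_H2D u v : in_H2 u -> in_H2 v -> in_H2 (u + v).
Proof. by move=> hu hv; rewrite -[u]scale1r; exact: in_H2_lin. Qed.

Lemma in_H2Z k u : in_H2 u -> in_H2 (k *: u).
Proof. by move=> hu; rewrite -[_ *: _]addr0; apply: in_H2_lin => //; exact: in_H2_0. Qed.

Lemma eq_H2D u u' v v' : eq_H2 u u' -> eq_H2 v v' -> eq_H2 (u + v) (u' + v').
Proof. by move=> uu vv; rewrite -[u]scale1r -[u']scale1r; exact: eq_H2_lin. Qed.

Lemma eq_H2Z k u u' : eq_H2 u u' -> eq_H2 (k *: u) (k *: u').
Proof.
move=> uu; rewrite -[k *: u]addr0 -[k *: u']addr0; apply: eq_H2_lin => //.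
exact: eq_H2_refl.
Qed.

Lemma haddE u v : in_H2 u -> in_H2 v -> hadd (cls u) (cls v) = cls (u + v).
Proof.
move=> hu hv; apply/eq_cls; [by apply: in_H2D|exact: in_H2D|].
by apply: eq_H2D; apply: eq_H2_sym; exact: hrep_cls.
Qed.

Lemma hscaleE k u : in_H2 u -> hscale k (cls u) = cls (k *: u).
Proof.
move=> hu; apply/eq_cls; [by apply: in_H2Z|exact: in_H2Z|].
by apply: eq_H2Z; apply: eq_H2_sym; exact: hrep_cls.
Qed.

Lemma haddC : commutative hadd.
Proof. by move=> x y; rewrite /hadd addrC. Qed.

Lemma haddA : associative hadd.
Proof.
move=> x y z; rewrite -(hrepK x) -(hrepK y) -(hrepK z) !haddE ?addrA//; exact: in_H2D.
Qed.

Lemma hadd0 : left_id hzero hadd.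
Proof. by move=> x; rewrite -(hrepK x) haddE ?add0r//; exact: in_H2_0. Qed.

Lemma haddN : left_inverse hzero hopp hadd.
Proof.
move=> x; rewrite -(hrepK x) /hopp hscaleE// haddE//; last exact: in_H2Z.
by rewrite scaleN1r addNr.
Qed.

HB.instance Definition _ := GRing.isZmodule.Build (hspace R) haddA haddC hadd0 haddN.

Lemma clsD u v : in_H2 u -> in_H2 v -> cls (u + v) = cls u + cls v.
Proof. by move=> hu hv; rewrite -haddE. Qed.

Lemma hscaleA k l x : hscale k (hscale l x) = hscale (k * l) x.
Proof. by rewrite -(hrepK x) !hscaleE ?scalerA//; exact: in_H2Z. Qed.

Lemma hscale1 : left_id 1 hscale.
Proof. by move=> x; rewrite -(hrepK x) hscaleE// scale1r. Qed.

Lemma hscaleDr : right_distributive hscale +%R.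
Proof.
move=> k x y; rewrite -(hrepK x) -(hrepK y) -clsD// !hscaleE//; last exact: in_H2D.
by rewrite -clsD; [rewrite scalerDr|exact: in_H2Z|exact: in_H2Z].
Qed.

Lemma hscaleDl x : {morph hscale^~ x : k l / k + l}.
Proof.
move=> k l; rewrite -(hrepK x) !hscaleE// -clsD; [|exact: in_H2Z|exact: in_H2Z].
by rewrite scalerDl.
Qed.

HB.instance Definition _ := GRing.Zmodule_isLmodule.Build R (hspace R)
  hscaleA hscale1 hscaleDr hscaleDl.

Lemma clsZ k u : in_H2 u -> cls (k *: u) = k *: cls u.
Proof. by move=> hu; rewrite -hscaleE. Qed.

Lemma cls0 : cls 0 = 0 :> hspace R. Proof. by []. Qed.

Lemma clsB u v : in_H2 u -> in_H2 v -> cls (u - v) = cls u - cls v.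
Proof.
move=> hu hv; rewrite -scaleN1r -[- cls v]scaleN1r clsD// ?clsZ//; exact: in_H2Z.
Qed.

Lemma hrepD x y : eq_H2 (hrep (x + y)) (hrep x + hrep y).
Proof. by apply: eq_H2_sym; apply: hrep_cls; exact: in_H2D. Qed.

Lemma hrepZ k x : eq_H2 (hrep (k *: x)) (k *: hrep x).
Proof. by apply: eq_H2_sym; apply: hrep_cls; exact: in_H2Z. Qed.

Lemma hrep_lin k x y : eq_H2 (hrep (k *: x + y)) (k *: hrep x + hrep y).
Proof.
apply: eq_H2_trans (hrepD _ _) _; apply: eq_H2D (eq_H2_refl _).
exact: hrepZ.
Qed.

Definition hip x y : R := dot2 (hrep x) (hrep y).

Lemma hipC x y : hip x y = hip y x. Proof. exact: dot2C. Qed.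

Lemma hip_linl k x y z : hip (k *: x + y) z = k * hip x z + hip y z.
Proof.
rewrite /hip -dot2_linl//; apply: eq_dot2 => //; last exact: eq_H2_refl.
  exact: in_H2_lin.
exact: hrep_lin.
Qed.

Lemma hip0l z : hip 0 z = 0.
Proof.
have := hip_linl 1 0 0 z; rewrite scale1r addr0 mul1r => /eqP.
by rewrite -subr_eq0 opprD addrA subrr sub0r oppr_eq0 => /eqP.
Qed.

Lemma hip_linr k x y z : hip z (k *: x + y) = k * hip z x + hip z y.
Proof. by rewrite !(hipC z) hip_linl. Qed.

Lemma hip_cls u v : in_H2 u -> in_H2 v -> hip (cls u) (cls v) = dot2 u v.
Proof. by move=> hu hv; apply: eq_dot2 => //; apply: eq_H2_sym; exact: hrep_cls. Qed.

Definition hnorm x : R := Num.sqrt (hip x x).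

Lemma hip_ge0 x : 0 <= hip x x. Proof. exact: dot2_ge0. Qed.

Lemma hnorm_sqr x : hnorm x ^+ 2 = hip x x.
Proof. by rewrite sqr_sqrtr// hip_ge0. Qed.

Lemma hip_cauchy_schwarz x y : `|hip x y| <= hnorm x * hnorm y.
Proof.
rewrite -(@ler_pXn2r _ 2) ?nnegrE ?mulr_ge0 ?sqrtr_ge0//.
rewrite real_normK ?num_real// exprMn !hnorm_sqr [leRHS]mulrC.
apply: le_trans (_ : hip x y ^+ 2 <= hip y y * hip x x) _; last by rewrite mulrC.
apply: quadratic_disc (hip_ge0 x) _ => k.
have -> : hip y y + 2 * k * hip x y + k ^+ 2 * hip x x = hip (k *: x + y) (k *: x + y).
  by rewrite [RHS]hip_linl !hip_linr (hipC y x); ring.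
exact: hip_ge0.
Qed.

Lemma hnormD x y : hnorm (x + y) <= hnorm x + hnorm y.
Proof.
rewrite -(@ler_pXn2r _ 2) ?nnegrE ?addr_ge0 ?sqrtr_ge0//.
rewrite hnorm_sqr sqrrD !hnorm_sqr.
have -> : hip (x + y) (x + y) = hip x x + hip x y *+ 2 + hip y y.
  by rewrite -[x + y](congr1 (+%R^~ y) (scale1r x)) hip_linl !hip_linr (hipC y x); ring.
by have := le_trans (ler_norm _) (hip_cauchy_schwarz x y); rewrite !mulr2n; lra.
Qed.

Lemma hnormZ k x : hnorm (k *: x) = `|k| * hnorm x.
Proof.
rewrite /hnorm -(sqrtr_sqr k) -sqrtrM ?sqr_ge0//; congr Num.sqrt.
by rewrite -[k *: x]addr0 hip_linl hip_linr !hip0l hipC hip0l; ring.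
Qed.

Lemma hnorm0_eq0 x : hnorm x = 0 -> x = 0.
Proof.
move=> x0; have : hip x x = 0 by rewrite -hnorm_sqr x0 expr0n.
move/(dot2_eq0 (hrep_in x)) => h; rewrite -(hrepK x) -cls0; apply/eq_cls => //.
exact: in_H2_0.
Qed.

HB.instance Definition _ := isPointed.Build (hspace R) 0.
HB.instance Definition _ := Lmodule_isNormed.Build R (hspace R) hnormD hnormZ hnorm0_eq0.

Lemma hnorm_cls u : in_H2 u -> `|cls u| = norm_H2 u.
Proof. by move=> hu; rewrite -[LHS]/(hnorm (cls u)) /hnorm hip_cls// norm_H2E. Qed.

Lemma hnorm_rep x : `|x| = norm_H2 (hrep x).
Proof. by rewrite -{1}(hrepK x) hnorm_cls. Qed.

Lemma hip_inner_product : inner_product hip.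
Proof.
split.
- exact: hipC.
- by move=> x y z; rewrite -[x in x + y]scale1r hip_linl mul1r.
- by move=> k x y; have := hip_linl k x 0 y; rewrite addr0 hip0l addr0.
- by move=> x; rewrite -hnorm_sqr.
Qed.

Lemma norm_L2_le_H2 u : norm_L2 u.1 <= norm_H2 u /\ norm_L2 u.2 <= norm_H2 u.
Proof.
by split; rewrite -(@ler_pXn2r _ 2) ?nnegrE ?norm_L2_ge0 ?norm_H2_ge0//
  sqr_sqrtr ?addr_ge0 ?sqr_ge0// ?lerDl ?lerDr sqr_ge0.
Qed.

Lemma norm_H2_le_L2 u : norm_H2 u <= norm_L2 u.1 + norm_L2 u.2.
Proof.
rewrite -(@ler_pXn2r _ 2) ?nnegrE ?addr_ge0 ?norm_L2_ge0 ?norm_H2_ge0//.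
rewrite sqr_sqrtr ?addr_ge0 ?sqr_ge0// sqrrD.
have := norm_L2_ge0 u.1; have := norm_L2_ge0 u.2.
by move: (norm_L2 u.1) (norm_L2 u.2) => a b; nra.
Qed.

Lemma hspace_complete_seq (x : nat -> hspace R) (C : R) : 0 <= C ->
  (forall n, `|x n.+1 - x n| <= C / 2 ^+ n) ->
  exists y, forall n, `|x n - y| <= 4 * C / 2 ^+ n.
Proof.
move=> C0 xC; pose u n := hrep (x n).
have hu n : in_H2 (u n) by exact: hrep_in.
have hd n : norm_H2 (u n.+1 - u n) <= C / 2 ^+ n.
  rewrite -hnorm_cls ?clsB// ?hrepK//.
  by rewrite -scaleN1r addrC; exact: in_H2_lin.
have [g1 Lg1 g1P] : exists2 g, in_L2 g & forall n, norm_L2 ((u n).1 - g) <= 2 * C / 2 ^+ n.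
  apply: L2_complete => // n; first by have [] := hu n.
  exact: le_trans (norm_L2_le_H2 (u n.+1 - u n)).1 (hd n).
have [g2 Lg2 g2P] : exists2 g, in_L2 g & forall n, norm_L2 ((u n).2 - g) <= 2 * C / 2 ^+ n.
  apply: L2_complete => // n; first by have [] := hu n.
  exact: le_trans (norm_L2_le_H2 (u n.+1 - u n)).2 (hd n).
exists (cls (g1, g2)) => n; have hg : in_H2 (g1, g2) by split.
have -> : x n = cls (u n) by rewrite hrepK.
rewrite -clsB// hnorm_cls; last by rewrite -scaleN1r addrC; exact: in_H2_lin.
apply: (le_trans (norm_H2_le_L2 _)); apply: (le_trans (lerD (g1P n) (g2P n))).
by rewrite le_eqVlt; apply/orP; left; apply/eqP; field; rewrite expf_neq0.
Qed.

(** A Cauchy filter contains balls of radius 2^-n, whose centres form a sequence with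
geometrically decaying increments. *)
Lemma hspace_complete (F : set_system (hspace R)) : ProperFilter F -> cauchy F -> cvg F.
Proof.
move=> FF cF.
have H n : exists y : hspace R, F (ball y (2 ^+ n)^-1).
  by move/cauchyP: cF => /(_ (2 ^+ n)^-1); apply; rewrite invr_gt0 exprn_gt0.
have [x xP] := choice H.
have p2 n : 0 < 2 ^+ n :> R by rewrite exprn_gt0.
have xC n : `|x n.+1 - x n| <= 2 / 2 ^+ n.
  have [z [z1 z2]] := filter_ex (filterI (xP n) (xP n.+1)).
  have -> : x n.+1 - x n = (x n.+1 - z) - (x n - z) by rewrite opprB addrA subrK.
  apply: (le_trans (ler_normB _ _)).
  move: z1 z2; rewrite -ball_normE /ball_/= => z1 z2.
  have : (2 ^+ n.+1)^-1 <= (2 ^+ n)^-1 :> R by rewrite lef_pV2 ?posrE// ler_weXn2l// ler1n.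
  move=> h; have -> : 2 / 2 ^+ n = (2 ^+ n)^-1 + (2 ^+ n)^-1 :> R by rewrite mulr_natl mulr2n.
  by apply: lerD; [exact: le_trans (ltW z2) h|exact: ltW].
have [y yP] := hspace_complete_seq (ler0n R 2) xC.
apply/cvg_ex; exists y; apply/cvgrPdist_lt => e e0.
(* The centre x_n is within 2^-n of the small set and within 8 * 2^-n of the limit. *)
have [n ne] : exists n : nat, 9 / 2 ^+ n < e.
  exists (Num.trunc (9 / e)).+1; rewrite ltr_pdivrMr// mulrC -ltr_pdivrMr//.
  apply: lt_trans (truncnS_gt _) _; rewrite -natrX ltr_nat; exact: ltn_expl.
apply: filterS (xP n) => z; rewrite -ball_normE /ball_/= => zn.
apply: (le_lt_trans (ler_distD (x n) _ _)); apply: le_lt_trans ne.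
have -> : 9 / 2 ^+ n = (2 ^+ n)^-1 + 4 * 2 / 2 ^+ n :> R by field; rewrite expf_neq0.
rewrite [leRHS]addrC; apply: lerD; last exact: ltW zn.
by rewrite distrC; exact: yP.
Qed.

HB.instance Definition _ := Uniform_isComplete.Build (hspace R) hspace_complete.

End HilbertSpace.


(** * The weighted space V *)

Section WeightedSpace.
Context {R : realType}.
Implicit Types (u v w : R -> R).
Local Notation mu := (@lebesgue_measure R).
Local Notation I := (@Iset R).

Let mI : measurable I := @measurable_Iset R.

Definition wder u x : R := Num.sqrt (rho x) * derive1 u x.

Lemma rho_gt0 x : I x -> 0 < rho x :> R.
Proof. by move=> /IsetE[h1 h2]; rewrite /rho subr_gt0; nra. Qed.

Lemma rho_le1 x : rho x <= 1 :> R.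
Proof. by rewrite /rho gerBl sqr_ge0. Qed.

Lemma sqrt_rho_gt0 x : I x -> 0 < Num.sqrt (rho x) :> R.
Proof. by move=> Ix; rewrite sqrtr_gt0 rho_gt0. Qed.

Lemma sqrt_rho_le1 x : Num.sqrt (rho x) <= 1 :> R.
Proof. by rewrite -[leRHS]sqrtr1 ler_wsqrtr// rho_le1. Qed.

Lemma rho_continuous : continuous (@rho R).
Proof.
move=> x; apply: cvgB; first exact: cvg_cst.
exact: exprn_continuous.
Qed.

Lemma sqrt_rho_continuous : continuous (fun x : R => Num.sqrt (rho x)).
Proof.
move=> x; apply: (@continuous_comp _ _ _ (@rho R) Num.sqrt); first exact: rho_continuous.
exact: sqrt_continuous.
Qed.

Lemma measurable_sqrt_rho (D : set R) : measurable_fun D (fun x : R => Num.sqrt (rho x)).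
Proof.
apply: measurable_funTS; apply: continuous_measurable_fun.
exact: sqrt_rho_continuous.
Qed.

Lemma inv_sqrt_rho_continuous (x : R) : I x -> {for x, continuous (fun x : R => (Num.sqrt (rho x))^-1)}.
Proof.
move=> Ix; apply: cvgV; first by rewrite gt_eqF// sqrt_rho_gt0.
exact: sqrt_rho_continuous.
Qed.

Lemma measurable_inv_sqrt_rho : measurable_fun I (fun x : R => (Num.sqrt (rho x))^-1).
Proof.
apply: open_continuous_measurable_fun; first exact: open_Iset.
by move=> x; rewrite inE; exact: inv_sqrt_rho_continuous.
Qed.

(** The primitive of 1/rho on (-1, 1) that vanishes at 0; its growth at the end points is
logarithmic. *)
Definition artanh (x : R) : R := 2^-1 * (ln (1 + x) - ln (1 - x)).

Lemma artanh_derive (x : R) : I x -> is_derive x 1 artanh (rho x)^-1.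
Proof.
move=> /IsetE[x1 x2].
have h1 : 0 < 1 + x by lra.
have h2 : 0 < 1 - x by lra.
have d1 : is_derive x (1 : R) (fun y : R => ln (1 + y)) ((1 + x)^-1 * 1).
  apply: (@is_derive1_comp _ (@ln R) (fun y => 1 + y)); first exact: is_derive1_ln.
  by have := is_deriveD (is_derive_cst (1 : R) x (1 : R)) (is_derive_id x (1 : R)); rewrite add0r.
have d2 : is_derive x (1 : R) (fun y : R => ln (1 - y)) ((1 - x)^-1 * (- 1)).
  apply: (@is_derive1_comp _ (@ln R) (fun y => 1 - y)); first exact: is_derive1_ln.
  by have := is_deriveB (is_derive_cst (1 : R) x (1 : R)) (is_derive_id x (1 : R)); rewrite sub0r.
have := is_deriveZ (2^-1 : R) (is_deriveB d1 d2).
rewrite (_ : 2^-1 *: _ = (rho x)^-1)//.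
rewrite -[LHS]/(2^-1 * _) /rho; field.
by rewrite !gt_eqF// subr_gt0; nra.
Qed.

Lemma artanh_continuous x : I x -> {for x, continuous artanh}.
Proof.
by move=> Ix; apply: differentiable_continuous; apply/derivable1_diffP; have [] := artanh_derive Ix.
Qed.

Lemma artanh0 : artanh 0 = 0.
Proof. by rewrite /artanh addr0 subr0 subrr mulr0. Qed.

Lemma artanhN x : artanh (- x) = - artanh x.
Proof. by rewrite /artanh opprK -mulrN opprB. Qed.

Lemma artanh_le x y : -1 < x -> x <= y -> y < 1 -> artanh x <= artanh y.
Proof.
move=> x1 xy y1; rewrite /artanh ler_pM2l// lerB//.
  by rewrite ler_ln ?posrE ?lerD2l//; lra.
by rewrite ler_ln ?posrE ?lerD2l ?lerN2//; lra.
Qed.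

Lemma integral_inv_rho x y : -1 < x -> x <= y -> y < 1 ->
  \int[mu]_(t in `[x, y]) (rho t)^-1 = artanh y - artanh x.
Proof.
move=> x1; rewrite le_eqVlt => /predU1P[<- y1|xy y1].
  by rewrite set_itv1 Rintegral_set1 subrr.
have sub : forall t, x <= t <= y -> I t.
  by move=> t /andP[h1 h2]; apply/IsetE; split; [exact: lt_le_trans h1|exact: le_lt_trans y1].
have rc t : x <= t <= y -> {for t, continuous (fun t : R => (rho t)^-1)}.
  move=> /sub It; apply: cvgV; last exact: rho_continuous.
  by rewrite gt_eqF// rho_gt0.
rewrite /Rintegral (@continuous_FTC2 _ (fun t => (rho t)^-1) artanh x y)//.
- apply/continuous_within_itvP => //; split.
  + by move=> t; rewrite in_itv/= => /andP[h1 h2]; apply: rc; rewrite !ltW.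
  + by apply: cvg_at_right_filter; apply: rc; rewrite lexx ltW.
  + by apply: cvg_at_left_filter; apply: rc; rewrite lexx ltW.
- split.
  + move=> t; rewrite in_itv/= => /andP[h1 h2].
    by have [] : is_derive t 1 artanh (rho t)^-1 by apply: artanh_derive; apply: sub; rewrite !ltW.
  + apply: cvg_at_right_filter; apply: artanh_continuous; apply: sub.
    by rewrite lexx ltW.
  + apply: cvg_at_left_filter; apply: artanh_continuous; apply: sub.
    by rewrite lexx ltW.
- move=> t; rewrite in_itv/= => /andP[h1 h2]; rewrite derive1E.
  by apply: derive_val; apply: artanh_derive; apply: sub; rewrite !ltW.
Qed.

Lemma itv_indic_dot a b (f g : R -> R) : -1 < a -> b < 1 ->
  \int[mu]_(t in `[a, b]) (f t * g t) = dot f (fun t => g t * (\1_(`[a, b]%classic) t : R)).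
Proof.
move=> a1 b1; rewrite /dot /Rintegral; congr fine.
rewrite integral_mkcond [RHS]integral_mkcond; apply: eq_integral => t _.
rewrite !patchE indicE; case: ifPn => [tab|tab].
  rewrite ifT ?mulr1//; apply/mem_set; apply: Iset_itv a1 b1 _ _.
  by move/set_mem: tab.
by case: ifPn => // _; rewrite !mulr0.
Qed.

Lemma integrable_itv_inv_rho a b : -1 < a -> b < 1 ->
  mu.-integrable `[a, b] (EFin \o (fun t : R => (rho t)^-1)).
Proof.
move=> a1 b1; wlog ab : a b a1 b1 / a < b => [H|].
  have [ab|ba|ab] := ltgtP a b; first exact: H.
    have h0 : -1 < 0 :> R by lra.
    have h1 : 2^-1 < 1 :> R by lra.
    have h2 : 0 < 2^-1 :> R by lra.
    apply: integrableS (H _ _ h0 h1 h2) => //.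
    by move=> x /=; rewrite !in_itv/= => /andP[? ?]; lra.
  have h1 : (a + 1) / 2 < 1 by move: b1; rewrite -ab; lra.
  have h2 : a < (a + 1) / 2 by move: b1; rewrite -ab; lra.
  apply: integrableS (H _ _ a1 h1 h2) => //.
  by move=> x /=; rewrite !in_itv/= -ab => /andP[? ?]; lra.
apply: within_continuous_integrable; apply/continuous_within_itvP => //.
have sub t : a <= t <= b -> {for t, continuous (fun t : R => (rho t)^-1)}.
  move=> /andP[h1 h2]; apply: cvgV; last exact: rho_continuous.
  by rewrite gt_eqF// rho_gt0//; apply/IsetE; split; [exact: lt_le_trans h1|exact: le_lt_trans b1].
split.
- by move=> t; rewrite in_itv/= => /andP[h1 h2]; apply: sub; rewrite !ltW.
- by apply: cvg_at_right_filter; apply: sub; rewrite lexx ltW.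
- by apply: cvg_at_left_filter; apply: sub; rewrite lexx ltW.
Qed.


Lemma inv_sqrt_rho_sqr (t : R) : I t -> (Num.sqrt (rho t))^-1 ^+ 2 = (rho t)^-1.
Proof. by move=> It; rewrite exprVn sqr_sqrtr// ltW// rho_gt0. Qed.

Lemma sqint_inv_sqrt_rho_itv a b : -1 < a -> b < 1 ->
  sqint (fun t : R => (Num.sqrt (rho t))^-1 * (\1_(`[a, b]%classic) t : R)).
Proof.
move=> a1 b1; split.
  apply: measurable_funM; first exact: measurable_inv_sqrt_rho.
  by apply: measurable_funTS; apply: measurable_indic; exact: measurable_itv.
have := integrable_itv_inv_rho a1 b1 => H.
have Hr : mu.-integrable setT ((EFin \o (fun t : R => (rho t)^-1)) \_ `[a, b]).
  by apply/integrable_restrict => //; rewrite setTI.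
apply: (@eq_integrable _ _ _ mu I mI ((EFin \o (fun t : R => (rho t)^-1)) \_ `[a, b])).
  move=> x; rewrite inE => Ix; rewrite patchE /= indicE.
  by case: ifPn => xab; rewrite ?mulr1 ?mulr0 ?expr0n//= inv_sqrt_rho_sqr.
by apply: integrableS Hr.
Qed.

(** The weight 1/sqrt(rho) has the square 1/rho, with integral the increment of [artanh]. *)
Lemma weighted_cauchy_schwarz (z : R -> R) x y : sqint z -> -1 < x -> x <= y -> y < 1 ->
  (\int[mu]_(t in `[x, y]) (z t * (Num.sqrt (rho t))^-1)) ^+ 2 <=
    (artanh y - artanh x) * dot z z.
Proof.
move=> sz x1 xy y1; rewrite itv_indic_dot//.
have si := sqint_inv_sqrt_rho_itv x1 y1.
apply: (le_trans (dot_cauchy_schwarz sz si)); rewrite mulrC ler_wpM2r ?dot_ge0//.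
rewrite le_eqVlt; apply/orP; left; apply/eqP.
rewrite -integral_inv_rho// /dot /Rintegral; congr fine.
rewrite integral_mkcond [RHS]integral_mkcond; apply: eq_integral => t _.
rewrite !patchE indicE.
have [tab|tab] := boolP (t \in `[x, y]%classic).
  have It : I t by apply: Iset_itv x1 y1 _ _; move/set_mem: tab.
  by rewrite mem_set// !mulr1 -expr2 inv_sqrt_rho_sqr.
by case: ifPn => // _; rewrite !mulr0.
Qed.

Lemma weighted_increment (w z : R -> R) : sqint z ->
  (forall a b, -1 < a -> a <= b -> b < 1 ->
    w b - w a = \int[mu]_(t in `[a, b]) (z t * (Num.sqrt (rho t))^-1)) ->
  forall x y, I x -> I y -> (w y - w x) ^+ 2 <= `|artanh y - artanh x| * dot z z.
Proof.
move=> sz wE x y /IsetE[x1 x2] /IsetE[y1 y2]; have [xy|/ltW yx] := leP x y.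
  rewrite wE// ger0_norm ?subr_ge0 ?artanh_le//; exact: weighted_cauchy_schwarz.
rewrite -[X in X ^+ 2]opprB sqrrN wE// distrC ger0_norm ?subr_ge0 ?artanh_le//.
exact: weighted_cauchy_schwarz.
Qed.

Lemma wder_measurable u : loc_abs_continuous u -> measurable_fun I (wder u).
Proof.
move=> ac; apply: measurable_funM; first exact: measurable_sqrt_rho.
exact: derive1_measurable_Iset.
Qed.

Lemma lac_increment u : loc_abs_continuous u -> forall a b, -1 < a -> a <= b -> b < 1 ->
    u b - u a = \int[mu]_(t in `[a, b]) (wder u t * (Num.sqrt (rho t))^-1).
Proof.
move=> ac a b a1 ab b1; have [_ ->] := lac_FTC ac a1 ab b1.
apply: eq_Rintegral => t; rewrite inE => /(Iset_itv a1 b1) It.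
by rewrite /wder mulrAC mulfV ?mul1r// gt_eqF// sqrt_rho_gt0.
Qed.

Lemma V_increment u : in_V u -> forall x y, I x -> I y ->
  (u y - u x) ^+ 2 <= `|artanh y - artanh x| * norm_L2 (wder u) ^+ 2.
Proof.
move=> [_ ac Lw] x y Ix Iy; rewrite norm_L2_sqr//.
by apply: weighted_increment => //; [exact/in_L2P|exact: lac_increment].
Qed.

Lemma norm_V_sqr u : norm_V u ^+ 2 = norm_L2 u ^+ 2 + norm_L2 (wder u) ^+ 2.
Proof. by rewrite sqr_sqrtr ?addr_ge0 ?sqr_ge0. Qed.

Lemma norm_V_ge0 u : 0 <= norm_V u. Proof. exact: sqrtr_ge0. Qed.

Definition embedding_cst : R := 2 * (1 + artanh 2^-1).

Lemma artanh_half_ge0 : 0 <= artanh 2^-1.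
Proof. by rewrite -artanh0 artanh_le//; lra. Qed.

Lemma embedding_cst_ge0 : 0 <= embedding_cst.
Proof. by rewrite mulr_ge0// addr_ge0// artanh_half_ge0. Qed.

Lemma averaging_arith (A a n N i : R) : 0 <= A -> 0 <= a -> 0 <= n -> 0 <= N -> i <= n ->
  2 * i + 2 * (A + a) * N <= 2 * (1 + a) * (1 + A) * (n + N).
Proof.
move=> A0 a0 n0 N0 hi.
have h3 : 0 <= A * n by exact: mulr_ge0.
have h4 : 0 <= a * n by exact: mulr_ge0.
have h5 : 0 <= A * (a * n) by exact: mulr_ge0.
have h6 : 0 <= A * (a * N) by apply: mulr_ge0 => //; exact: mulr_ge0.
have h7 : 0 <= A * N by exact: mulr_ge0.
have h8 : 0 <= a * N by exact: mulr_ge0.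
by nra.
Qed.

(** The increment of u between x and y is at most the square root of
|artanh x - artanh y| times the norm of sqrt(rho) u'. Averaging over y in the middle half of the
interval replaces u(y) by the norm of u in L^2. *)
Lemma V_embedding u : in_V u -> forall x, I x ->
  u x ^+ 2 <= embedding_cst * (1 + `|artanh x|) * norm_V u ^+ 2.
Proof.
move=> uV x Ix; have [Lu ac Lw] := uV.
have [mu_ ui] := (in_L2P u).1 Lu.
have h1 : -1 < - 2^-1 :> R by lra.
have h2 : 2^-1 < 1 :> R by lra.
pose N := norm_L2 (wder u) ^+ 2.
have N0 : 0 <= N by exact: sqr_ge0.
have bound y : - 2^-1 <= y <= 2^-1 ->
    u x ^+ 2 <= 2 * u y ^+ 2 + 2 * (`|artanh x| + artanh 2^-1) * N.
  move=> /andP[y1 y2]; have Iy : I y by apply/IsetE; split; lra.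
  have := V_increment uV Iy Ix; rewrite -/N => H.
  have : `|artanh x - artanh y| <= `|artanh x| + artanh 2^-1.
    apply: (le_trans (ler_normB _ _)); rewrite lerD2l ler_norml -artanhN.
    by rewrite !artanh_le//; lra.
  move=> /(ler_wpM2r N0)/(le_trans H).
  have := sqr_ge0 (u x - 2 * u y); rewrite -mulrA.
  by move: (u x) (u y) ((`|artanh x| + artanh 2^-1) * N) => a b c; nra.
have sub : `[- 2^-1, 2^-1] `<=` I by exact: Iset_itv.
have i2 : mu.-integrable `[- 2^-1, 2^-1] (EFin \o (fun y => u y ^+ 2)).
  by apply: integrableS ui => //; exact: sub.
have l12 : - 2^-1 <= 2^-1 :> R by lra.
have : \int[mu]_(y in `[- 2^-1, 2^-1]) (cst (u x ^+ 2) y) <=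
    \int[mu]_(y in `[- 2^-1, 2^-1]) (2 * u y ^+ 2 + cst (2 * (`|artanh x| + artanh 2^-1) * N) y).
  apply: le_Rintegral => //; first exact: integrable_itv_cst.
    apply: integrable_addr => //; last exact: integrable_itv_cst.
    exact: integrable_mulr.
rewrite Rintegral_itv_cst// RintegralD//; last 2 first.
  exact: integrable_mulr.
  exact: integrable_itv_cst.
rewrite Rintegral_itv_cst// RintegralZl//.
rewrite (_ : 2^-1 - - 2^-1 = 1 :> R); last by field.
rewrite !mulr1 => H; apply: (le_trans H).
have : \int[mu]_(y in `[- 2^-1, 2^-1]) (u y ^+ 2) <= norm_L2 u ^+ 2.
  rewrite norm_L2_sqr// /dot /Rintegral fine_le//.
  - exact: integrable_fin_num.
  - by apply: integrable_fin_num => //; apply: sqint_mul; exact/in_L2P.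
  - have -> : (\int[mu]_(y in I) (u y * u y)%:E = \int[mu]_(y in I) (u y ^+ 2)%:E)%E.
      by apply: eq_integral => y _; rewrite expr2.
    apply: ge0_subset_integral => //.
    + by move/integrableP: ui => -[].
    + by move=> y _; rewrite lee_fin sqr_ge0.
rewrite norm_V_sqr -/N /embedding_cst.
exact: averaging_arith (normr_ge0 _) artanh_half_ge0 (sqr_ge0 _) N0.
Qed.

Lemma in_V_unique u v : in_V u -> in_V v -> eq_L2 u v ->
  (forall x, I x -> u x = v x) /\ (forall x, I x -> derive1 u x = derive1 v x).
Proof.
move=> [_ acu _] [_ acv _] uv.
have E : forall x, I x -> u x = v x.
  by apply: continuous_ae_eq => //; exact: loc_abs_continuous_continuous.
by split => //; exact: derive1_eq_Iset.
Qed.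

Lemma wder_lin k u v : loc_abs_continuous u -> loc_abs_continuous v ->
  eq_L2 (wder (k *: u + v)) (k *: wder u + wder v).
Proof.
move=> acu acv; apply: (ae_imp (derive1_lin_ae k acu acv)) => x H Ix.
rewrite -[RHS]/(k * wder u x + wder v x) /wder.
rewrite (_ : derive1 (k *: u + v) x = k * derive1 u x + derive1 v x); last exact: H.
by ring.
Qed.

Lemma eq_in_L2 (f g : R -> R) : measurable_fun I g -> eq_L2 f g -> in_L2 f -> in_L2 g.
Proof.
move=> mg fg /in_L2P[mf fi]; apply/in_L2P; split => //.
apply: ae_eq_integrable fi _ => //; first exact: measurable_funX.
by apply: (ae_imp fg) => x h Ix; rewrite h.
Qed.

Lemma in_V_lin k u v : in_V u -> in_V v -> in_V (k *: u + v).
Proof.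
move=> [Lu acu Lwu] [Lv acv Lwv].
have ac : loc_abs_continuous (k *: u + v) by exact: lac_lin.
split; [exact: in_L2_lin|exact: ac|].
apply: (@eq_in_L2 (k *: wder u + wder v)); last exact: (in_L2_lin k Lwu Lwv).
  exact: wder_measurable.
by apply: eq_L2_sym; exact: wder_lin.
Qed.

Lemma norm_L2_le_V u : norm_L2 u <= norm_V u /\ norm_L2 (wder u) <= norm_V u.
Proof.
by split; rewrite -(@ler_pXn2r _ 2) ?nnegrE ?norm_L2_ge0 ?norm_V_ge0//
  norm_V_sqr ?lerDl ?lerDr sqr_ge0.
Qed.

Lemma norm_V_le u : norm_V u <= norm_L2 u + norm_L2 (wder u).
Proof.
rewrite -(@ler_pXn2r _ 2) ?nnegrE ?addr_ge0 ?norm_L2_ge0 ?norm_V_ge0//.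
rewrite norm_V_sqr sqrrD.
have := norm_L2_ge0 u; have := norm_L2_ge0 (wder u).
by move: (norm_L2 u) (norm_L2 (wder u)) => a b; nra.
Qed.

Lemma sqint_over_sqrt_rho_itv (z : R -> R) a b : sqint z -> -1 < a -> b < 1 ->
  mu.-integrable `[a, b] (EFin \o (fun t => (z t * (Num.sqrt (rho t))^-1) ^+ 2)).
Proof.
move=> [mz zi] a1 b1.
have mab : measurable (`[a, b]%classic : set R) by exact: measurable_itv.
have sub := Iset_itv a1 b1.
have [ab|ba] := leP a b; last first.
  rewrite set_itv_ge; first exact: integrable_set0.
  by rewrite bnd_simp -ltNge.
have cr : {within `[a, b], continuous (fun t : R => (Num.sqrt (rho t))^-1)}.
  apply/subspace_continuousP => t /= tab.
  by apply: cvg_within_filter; apply: inv_sqrt_rho_continuous; exact: sub.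
have [c _ cP] := EVT_max ab cr.
have zi' : mu.-integrable `[a, b] (EFin \o (fun t => z t ^+ 2)) by apply: integrableS zi.
apply: (@integrable_bounded _ _ _ (fun t => (Num.sqrt (rho c))^-1 ^+ 2 * z t ^+ 2)) => //.
- apply: measurable_funX; apply: measurable_funM.
    by apply: measurable_funS mz => //; exact: measurable_Iset.
  by apply: measurable_funS measurable_inv_sqrt_rho => //; exact: measurable_Iset.
- exact: integrable_mulr.
move=> t tab; rewrite ger0_norm ?sqr_ge0// exprMn mulrC ler_wpM2r ?sqr_ge0//.
have h0 : 0 <= (Num.sqrt (rho t))^-1 by rewrite invr_ge0 sqrtr_ge0.
by rewrite ler_pXn2r ?nnegrE ?invr_ge0 ?sqrtr_ge0// cP.
Qed.

Lemma quarter_bound (C e N : R) : 0 <= C -> 0 < e ->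
  N < e / (4 * (C + 1)) + e / (4 * (C + 1)) + (e / (4 * (C + 1)) + e / (4 * (C + 1))) ->
  C * N < e.
Proof.
move=> C0 e0; have C1 : 0 < C + 1 by lra.
rewrite (_ : _ + _ + _ = e / (C + 1)); last by field; rewrite gt_eqF.
rewrite ltr_pdivlMr// => H; apply: le_lt_trans (_ : e * (C / (C + 1)) < e).
  rewrite mulrA ler_pdivlMr//; nra.
by rewrite gtr_pMr// ltr_pdivrMr// mul1r ltrDl.
Qed.

(** Closedness of the weighted derivative: the limit is rebuilt as a primitive of
z / sqrt(rho), and the values at 0, hence at all points, converge by the pointwise bound. *)
Lemma wder_closed (v : nat -> R -> R) u z : (forall n, in_V (v n)) -> in_L2 u -> in_L2 z ->
  norm_L2 (v n - u) @[n --> \oo] --> 0 -> norm_L2 (wder (v n) - z) @[n --> \oo] --> 0 ->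
  exists2 w, in_V w & eq_L2 u w /\ eq_L2 (wder w) z.
Proof.
move=> vV Lu Lz vu vz; have sz := (in_L2P z).1 Lz; have [mz _] := sz.
have Lv n : in_L2 (v n) by have [] := vV n.
have Lw n : in_L2 (wder (v n)) by have [] := vV n.
have ac n : loc_abs_continuous (v n) by have [] := vV n.
have I0 : I 0 by apply/IsetE; split; lra.
pose C := Num.sqrt embedding_cst.
have at0 f : in_V f -> `|f 0| <= C * norm_V f.
  move=> fV; have := V_embedding fV I0; rewrite artanh0 normr0 addr0 mulr1 => H.
  rewrite -(@ler_pXn2r _ 2) ?nnegrE ?mulr_ge0 ?norm_V_ge0 ?sqrtr_ge0//.
  by rewrite exprMn sqr_sqrtr ?embedding_cst_ge0// real_normK ?num_real.
have subV n m : in_V (v n - v m).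
  have -> : v n - v m = (-1) *: v m + v n by rewrite scaleN1r addrC.
  exact: in_V_lin.
have wsub n m : norm_L2 (wder (v n - v m)) = norm_L2 (wder (v n) - wder (v m)).
  apply: eq_norm_L2; [by have [] := subV n m|exact: in_L2B|].
  have -> : v n - v m = (-1) *: v m + v n by rewrite scaleN1r addrC.
  have -> : wder (v n) - wder (v m) = (-1) *: wder (v m) + wder (v n) by rewrite scaleN1r addrC.
  exact: wder_lin.
have C0 : 0 <= C by exact: sqrtr_ge0.
have cv0 : cvgn (fun n => v n 0).
  apply/cauchy_cvgP; apply/cauchy_exP => e e0.
  have e4 : 0 < e / (4 * (C + 1)) by rewrite divr_gt0// mulr_gt0//; lra.
  have near1 : \forall n \near \oo, norm_L2 (v n - u) < e / (4 * (C + 1)).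
    by move/cvgr_lt : vu; apply.
  have near2 : \forall n \near \oo, norm_L2 (wder (v n) - z) < e / (4 * (C + 1)).
    by move/cvgr_lt : vz; apply.
  have [N _ NP] := filterI near1 near2.
  exists (v N 0); exists N => // n /= Nn.
  have [a1 a2] := NP N (leqnn N); have [b1 b2] := NP n Nn.
  rewrite /ball/=; apply: (le_lt_trans (at0 _ (subV N n))).
  have : norm_V (v N - v n) <= norm_L2 (v N - v n) + norm_L2 (wder (v N - v n)) by exact: norm_V_le.
  rewrite wsub.
  have : norm_L2 (v N - v n) <= norm_L2 (v N - u) + norm_L2 (v n - u).
    have -> : v N - v n = (v N - u) + (u - v n) by rewrite addrA subrK.
    by apply: (le_trans (norm_L2D _ _)); rewrite ?(norm_L2_dist Lu)//; exact: in_L2B.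
  have : norm_L2 (wder (v N) - wder (v n)) <= norm_L2 (wder (v N) - z) + norm_L2 (wder (v n) - z).
    have -> : wder (v N) - wder (v n) = (wder (v N) - z) + (z - wder (v n)) by rewrite addrA subrK.
    by apply: (le_trans (norm_L2D _ _)); rewrite ?(norm_L2_dist Lz)//; exact: in_L2B.
  move=> h1 h2 h3; have h4 := le_trans h3 (lerD h2 h1).
  apply: (quarter_bound C0 e0); apply: (le_lt_trans h4); apply: ltrD; exact: ltrD.
have [w [acw w0 wE wd]] := @lac_primitive _ (fun t => z t * (Num.sqrt (rho t))^-1)
  (limn (fun n => v n 0)) (measurable_funM mz measurable_inv_sqrt_rho)
  (fun a b a1 b1 => sqint_over_sqrt_rho_itv sz a1 b1).
have wz : eq_L2 (wder w) z.
  apply: (ae_imp wd) => x H Ix; rewrite /wder H// mulrCA mulfV ?mulr1// gt_eqF//.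
  exact: sqrt_rho_gt0.
have Lww : in_L2 (wder w).
  by apply: (@eq_in_L2 z) => //; [exact: wder_measurable|exact: eq_L2_sym].
have vw x : I x -> v n x @[n --> \oo] --> w x.
  move=> Ix; pose d n := norm_L2 (wder (v n) - z).
  have dn n : (v n x - w x - (v n 0 - w 0)) ^+ 2 <= `|artanh x - artanh 0| * d n ^+ 2.
    have Ld : in_L2 (wder (v n) - z) by exact: in_L2B.
    rewrite /d norm_L2_sqr//; apply: (@weighted_increment (fun t => v n t - w t) (wder (v n) - z)) => //.
      exact/in_L2P.
    move=> a b a1 ab b1; rewrite -[_ - _]/((v n b - w b) - (v n a - w a)).
    rewrite (_ : _ - _ = (v n b - v n a) - (w b - w a)); last by ring.
    rewrite wE// (lac_increment (ac n))// -RintegralB//.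
    - by apply: eq_Rintegral => t _; rewrite -[(wder (v n) - z) t]/(wder (v n) t - z t); ring.
    - have [fi _] := lac_FTC (ac n) a1 ab b1.
      apply: (@eq_integrable _ _ _ mu _ _ (EFin \o derive1 (v n))) => // t.
      rewrite inE => /(Iset_itv a1 b1) It; rewrite /= /wder mulrAC mulfV ?mul1r//.
      by rewrite gt_eqF// sqrt_rho_gt0.
    - apply: (@integrable_bounded _ _ _ (fun t => 1 + (z t * (Num.sqrt (rho t))^-1) ^+ 2)) => //.
      + apply: measurable_funS (measurable_funM mz measurable_inv_sqrt_rho) => //.
        exact: Iset_itv.
      + apply: integrable_addr => //; first exact: integrable_itv_cst.
        exact: sqint_over_sqrt_rho_itv.
      + move=> t _; rewrite -[X in 1 + X]real_normK ?num_real//.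
        by move: (`|_|) => y; nra.
  have dc : Num.sqrt `|artanh x| * d n @[n --> \oo] --> 0.
    by rewrite -(mulr0 (Num.sqrt `|artanh x|)); apply: cvgMr; exact: vz.
  have diff : v n x - w x - (v n 0 - w 0) @[n --> \oo] --> 0.
    apply/cvgr0Pnorm_le => e e0.
    have : \forall n \near \oo, Num.sqrt `|artanh x| * d n <= e.
      by move/cvgr_le : dc; apply.
    apply: filterS => n; apply: le_trans.
    rewrite -(@ler_pXn2r _ 2) ?nnegrE ?mulr_ge0 ?norm_L2_ge0 ?sqrtr_ge0//.
    rewrite exprMn sqr_sqrtr// real_normK ?num_real//.
    by have := dn n; rewrite artanh0 subr0.
  have v0w : v n 0 - w 0 @[n --> \oo] --> 0.
    have cv0' : v n 0 @[n --> \oo] --> w 0 by rewrite w0.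
    have h : v n 0 - w 0 @[n --> \oo] --> w 0 - w 0 by apply: cvgB cv0' _; exact: cvg_cst.
    by rewrite subrr in h.
  have -> : (fun n => v n x) = (fun n => (v n x - w x - (v n 0 - w 0)) + (v n 0 - w 0) + w x).
    by apply/funext => n; rewrite !subrK.
  rewrite -[X in _ --> X]add0r; apply: cvgD; last exact: cvg_cst.
  have h : v n x - w x - (v n 0 - w 0) + (v n 0 - w 0) @[n --> \oo] --> (0 + 0 : R) by apply: cvgD.
  by rewrite addr0 in h.
have uw : eq_L2 u w.
  apply: (L2_cvg_unique Lv Lu) => //; first exact: measurable_Iset_lac.
  by apply: ae_all => x; exact: vw.
exists w => //; split => //.
by apply: (@eq_in_L2 u) => //; exact: measurable_Iset_lac.
Qed.

End WeightedSpace.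

(** * Integration by parts for the degenerate operator *)

Section GreenFormula.
Context {R : realType}.
Implicit Types (u v w : R -> R).
Local Notation mu := (@lebesgue_measure R).
Local Notation I := (@Iset R).

Let mI : measurable I := @measurable_Iset R.

Lemma C1_continuous (J : set R) phi : C1_compact J phi -> continuous phi.
Proof.
by move=> [d _ _] x; apply: differentiable_continuous; apply/derivable1_diffP; exact: d.
Qed.

Lemma C1_support phi : C1_compact I phi ->
  exists a b : R, [/\ -1 < a, a < b, b < 1 & forall x, ~ (a < x < b) -> phi x = 0].
Proof.
move=> [d cd [K [cK KI] K0]].
have [KE|/set0P K00] := eqVneq K set0.
  by exists (- 2^-1), 2^-1; split; [lra|lra|lra|move=> x _; apply: K0; rewrite KE].
have cid : {within K, continuous (fun x : R => x)} by apply: continuous_subspaceT => x; exact: cvg_id.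
have [M KM MP] := compact_EVT_max K00 cK cid.
have [m Km mP] := compact_EVT_min K00 cK cid.
have /IsetE[M1 M2] := KI _ (set_mem KM); have /IsetE[m1 m2] := KI _ (set_mem Km).
have mM : m <= M by exact: MP.
exists ((m - 1) / 2), ((M + 1) / 2); split; [lra|lra|lra|].
move=> x xn; apply: K0 => Kx; apply: xn.
by have := MP x (mem_set Kx); have := mP x (mem_set Kx); lra.
Qed.

Lemma derive1_zero_outside (phi : R -> R) a b x : (forall x, ~ (a < x < b) -> phi x = 0) ->
  (forall x, derivable phi x 1) -> continuous (derive1 phi) ->
  ~ (a < x < b) -> derive1 phi x = 0.
Proof.
move=> p0 dp cp.
have out y : y < a \/ b < y -> derive1 phi y = 0.
  move=> yab; have E : {near y, cst 0 =1 phi}.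
    case: yab => [ya|yb].
      near=> z; apply/esym/p0 => /andP[za _].
      have : z < a by near: z; exact: lt_nbhsl.
      by rewrite ltNge ltW.
    near=> z; apply/esym/p0 => /andP[_ zb].
    have : b < z by near: z; exact: lt_nbhsr.
    by rewrite ltNge ltW.
  by rewrite derive1E -(near_eq_derive _ E) derive_cst.
move=> xab.
have [xa|ax] := leP x a.
  have c0 : (fun=> 0 : R) y @[y --> x^'-] --> derive1 phi x.
    apply: cvg_trans (cvg_at_left_filter (cp x)); apply: near_eq_cvg.
    by near=> y; rewrite -[LHS]/(derive1 phi y) out//; left; apply: lt_le_trans xa; near: y; exact: nbhs_left_lt.
  by have := cvg_unique _ c0 (cvg_cst _) => ->//; exact: Rhausdorff.
have bx : b <= x by rewrite leNgt; apply/negP => xb; apply: xab; rewrite ax.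
have c0 : (fun=> 0 : R) y @[y --> x^'+] --> derive1 phi x.
  apply: cvg_trans (cvg_at_right_filter (cp x)); apply: near_eq_cvg.
  by near=> y; rewrite -[LHS]/(derive1 phi y) out//; right; apply: le_lt_trans bx _; near: y; exact: nbhs_right_gt.
by have := cvg_unique _ c0 (cvg_cst _) => ->//; exact: Rhausdorff.
Unshelve. all: by end_near. Qed.

Lemma continuous_sqint (f : R -> R) : continuous f -> sqint f.
Proof.
move=> cf; split; first by apply: measurable_funTS; exact: continuous_measurable_fun.
have : mu.-integrable `[-1, 1] (EFin \o (fun x => f x ^+ 2)).
  apply: within_continuous_integrable; apply: continuous_subspaceT => x.
  by apply: (@continuous_comp _ _ _ f (fun y : R => y ^+ 2)); [exact: cf|exact: exprn_continuous].
apply: integrableS => //.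
by move=> x /=; rewrite !in_itv/= => /andP[/ltW -> /ltW ->].
Qed.

Lemma C1_lac phi (J : set R) : C1_compact J phi -> loc_abs_continuous phi.
Proof.
move=> hp; have [dp cp _] := hp; have cphi := C1_continuous hp => a b a1 ab b1.
have cn : {within `[a, b], continuous (fun x => `|derive1 phi x|)}.
  by apply: continuous_subspaceT => x; apply: cvg_norm; exact: cp.
have [c _ cP] := EVT_max ab cn.
apply: (@lipschitz_abs_continuous _ _ _ _ `|derive1 phi c|) => x y ax xy yb.
have [z zxy ->] : exists2 z, z \in `[x, y]%R & phi y - phi x = derive1 phi z * (y - x).
  have [||z zxy E] := @MVT_segment _ phi (derive1 phi) x y xy.
  - by move=> z _; rewrite derive1E; apply: DeriveDef; [exact: dp|].
  - by apply: continuous_subspaceT.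
  by exists z.
rewrite normrM [X in _ * X]ger0_norm ?subr_ge0// ler_wpM2r ?subr_ge0// cP//.
move: zxy; rewrite !in_itv/= => /andP[z1 z2].
by rewrite (le_trans ax z1) (le_trans z2 yb).
Qed.

Lemma Rintegral_support a b (f : R -> R) : -1 < a -> b < 1 ->
  (forall x, I x -> ~ (a < x < b) -> f x = 0) ->
  \int[mu]_(x in I) f x = \int[mu]_(x in `[a, b]) f x.
Proof.
move=> a1 b1 f0; rewrite /Rintegral; congr fine.
rewrite integral_mkcond [RHS]integral_mkcond; apply: eq_integral => x _.
rewrite !patchE; have [xab|xab] := boolP (x \in `[a, b]%classic).
  by rewrite ifT//; apply/mem_set; apply: Iset_itv a1 b1 _ _; move/set_mem: xab.
case: ifPn => // /set_mem xI; rewrite f0// => /andP[h1 h2].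
by move/negP: xab; apply; apply/mem_set; rewrite /= in_itv/= !ltW.
Qed.

Lemma C1_by_parts phi w : C1_compact I phi -> loc_abs_continuous w ->
  \int[mu]_(x in I) (derive1 phi x * w x) = - \int[mu]_(x in I) (phi x * derive1 w x).
Proof.
move=> hp acw; have [a [b [a1 ab b1 p0]]] := C1_support hp.
have [dp cp _] := hp; have acp := C1_lac hp.
have dp0 x : ~ (a < x < b) -> derive1 phi x = 0 by exact: (derive1_zero_outside p0 dp cp).
rewrite (@Rintegral_support a b)//; last by move=> x _ xab; rewrite dp0 ?mul0r.
rewrite [X in - X](@Rintegral_support a b)//; last by move=> x _ xab; rewrite p0 ?mul0r.
have acpw := lacM acp acw.
have [fi fE] := lac_FTC acpw a1 (ltW ab) b1.
have pa : phi a = 0 by apply: p0; rewrite ltxx.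
have pb : phi b = 0 by apply: p0; rewrite ltxx andbF.
rewrite pa pb !mul0r subrr in fE.
have sub := Iset_itv a1 b1.
have [wi _] := lac_FTC acw a1 (ltW ab) b1.
have mw : measurable_fun `[a, b] w.
  by apply: measurable_funS (measurable_Iset_lac acw).
have mdp : measurable_fun `[a, b] (derive1 phi).
  by apply: measurable_funTS; exact: continuous_measurable_fun.
have mp : measurable_fun `[a, b] phi.
  by apply: measurable_funTS; apply: continuous_measurable_fun; exact: (C1_continuous hp).
have mdw : measurable_fun `[a, b] (derive1 w).
  by apply: measurable_funS (derive1_measurable_Iset acw).
have bd (g : R -> R) : {within `[a, b], continuous g} -> exists M, forall x, a <= x <= b -> `|g x| <= M.
  move=> cg; have cn : {within `[a, b], continuous (fun x => `|g x|)}.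
    by move=> x; apply: cvg_norm; exact: cg.
  by have [c _ cP] := EVT_max (ltW ab) cn; exists `|g c| => x xab; exact: cP.
have [M1 M1P] : exists M, forall x, a <= x <= b -> `|phi x| <= M.
  by apply: bd; apply: continuous_subspaceT; exact: (C1_continuous hp).
have [M2 M2P] : exists M, forall x, a <= x <= b -> `|derive1 phi x| <= M.
  by apply: bd; exact: continuous_subspaceT.
have [M3 M3P] : exists M, forall x, a <= x <= b -> `|w x| <= M.
  by apply: bd; apply: abs_continuous_within (ltW ab) (acw _ _ a1 (ltW ab) b1).
have i1 : mu.-integrable `[a, b] (EFin \o (fun x => derive1 phi x * w x)).
  apply: (@integrable_itv_bounded _ _ _ (M2 * M3)); first exact: measurable_funM.
  by move=> x xab; rewrite normrM ler_pM// ?M2P ?M3P.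
have i2 : mu.-integrable `[a, b] (EFin \o (fun x => phi x * derive1 w x)).
  apply: (@integrable_bounded _ _ _ (fun x => M1 * `|derive1 w x|)) => //.
  - exact: measurable_funM.
  - by apply: integrable_mulr => //; exact: integrable_normr.
  - by move=> x xab; rewrite normrM ler_wpM2r// M1P.
apply/eqP; rewrite -addr_eq0 -RintegralD//; apply/eqP; rewrite [RHS]fE.
apply: ae_eq_Rintegral => //.
- by apply: measurable_funD; exact: measurable_funM.
- by apply: measurable_funS (derive1_measurable_Iset acpw).
apply: (ae_imp (lac_derivable acw)) => x dw xab.
rewrite (derive1_mul (dp x) (dw (sub _ xab))); ring.
Qed.

(** Hardy's inequality in pointwise form: phi vanishes at both ends, so Cauchy-Schwarz from
the nearer end bounds phi(x)^2 by the distance to it, which is at most rho. *)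
Lemma C1_pointwise phi : C1_compact I phi -> forall x, I x ->
  phi x ^+ 2 <= rho x * norm_L2 (derive1 phi) ^+ 2.
Proof.
move=> hp x Ix; have [a [b [a1 ab b1 p0]]] := C1_support hp.
have [dp cp _] := hp; have acp := C1_lac hp.
have sd : sqint (derive1 phi) by exact: continuous_sqint.
rewrite norm_L2_sqr; last exact/in_L2P.
have [xab|xab] := pselect (a < x < b); last first.
  by rewrite p0// expr0n/= mulr_ge0 ?dot_ge0// ltW// rho_gt0.
have [ax xb] := andP xab.
have cs y z : -1 < y -> y <= z -> z < 1 ->
    (\int[mu]_(t in `[y, z]) derive1 phi t) ^+ 2 <= (z - y) * dot (derive1 phi) (derive1 phi).
  move=> y1 yz z1.
  have -> : \int[mu]_(t in `[y, z]) derive1 phi t =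
      dot (derive1 phi) (fun t => cst 1 t * (\1_(`[y, z]%classic) t : R)).
    by rewrite -itv_indic_dot//; apply: eq_Rintegral => t _; rewrite mulr1.
  have si : sqint (fun t : R => cst 1 t * (\1_(`[y, z]%classic) t : R)).
    apply: sqint_bounded (sqint_cst 1) _.
      have mind : measurable_fun setT (\1_(`[y, z]%classic) : R -> R).
        by apply: measurable_indic; exact: measurable_itv.
      by apply: measurable_funM => //; exact: measurable_funTS.
    by move=> t _; rewrite mul1r indicE; case: (_ \in _); rewrite ?normr0.
  apply: (le_trans (dot_cauchy_schwarz sd si)); rewrite mulrC ler_wpM2r ?dot_ge0//.
  rewrite -(itv_indic_dot (fun t => cst 1 t * (\1_(`[y, z]%classic) t : R)) (cst 1) y1 z1).
  have -> : \int[mu]_(t in `[y, z]) (cst 1 t * (\1_(`[y, z]%classic) t : R) * cst 1 t) =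
      \int[mu]_(t in `[y, z]) (cst 1 t).
    by apply: eq_Rintegral => t tyz; rewrite indicE tyz /= !mulr1.
  by rewrite Rintegral_itv_cst// mul1r.
have /IsetE[x1 x2] := Ix.
have pa : phi a = 0 by apply: p0; rewrite ltxx.
have pb : phi b = 0 by apply: p0; rewrite ltxx andbF.
have D0 := dot_ge0 (derive1 phi).
have L : phi x ^+ 2 <= (x - a) * dot (derive1 phi) (derive1 phi).
  have [_ E] := lac_FTC acp a1 (ltW ax) x2.
  by rewrite pa subr0 in E; rewrite E; exact: cs (ltW ax) x2.
have Rr : phi x ^+ 2 <= (b - x) * dot (derive1 phi) (derive1 phi).
  have [_ E] := lac_FTC acp x1 (ltW xb) b1.
  by rewrite pb sub0r in E; rewrite -sqrrN E; exact: cs x1 (ltW xb) b1.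
rewrite /rho; move: L Rr D0; move: (dot _ _) (phi x ^+ 2) => n p L Rr D0.
(* For 0 <= x, the distance 1 - x to the right end is at most (1 - x) (1 + x). *)
have [x0|x0] := leP 0 x.
  by apply: (le_trans Rr); rewrite ler_wpM2r//; nra.
by apply: (le_trans L); rewrite ler_wpM2r//; nra.
Qed.

Lemma C1_sub phi psi : C1_compact I phi -> C1_compact I psi ->
  C1_compact I (phi - psi) /\ derive1 (phi - psi) = derive1 phi - derive1 psi.
Proof.
move=> [d1 c1 [K1 [cK1 K1I] K10]] [d2 c2 [K2 [cK2 K2I] K20]].
have E : derive1 (phi - psi) = derive1 phi - derive1 psi.
  apply/funext => x; rewrite -[RHS]/(derive1 phi x - derive1 psi x) !derive1E.
  exact: (deriveB (d1 x) (d2 x)).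
split; last exact: E.
split.
- by move=> x; exact: (derivableB (d1 x) (d2 x)).
- by rewrite E => x; apply: cvgB; [exact: c1|exact: c2].
exists (K1 `|` K2); first by split; [exact: compactU|rewrite subUset].
by move=> x /not_orP[/K10 h1 /K20 h2]; rewrite -[LHS]/(phi x - psi x) h1 h2 subr0.
Qed.

Lemma halving_bound (e D W : R) : 0 < e -> 0 <= W ->
  D <= 2 * (e / (2 * (W + 1))) -> D * W <= e.
Proof.
move=> e0 W0 H; apply: (@le_trans _ _ (2 * (e / (2 * (W + 1))) * W)).
  by rewrite ler_wpM2r.
have -> : 2 * (e / (2 * (W + 1))) * W = e * W / (W + 1) by field; rewrite gt_eqF//; lra.
by rewrite ler_pdivrMr; [rewrite ler_pM2l//; lra|lra].
Qed.

(** Let phi_n be test functions that approximate z = rho v' in H^1. The pointwise Hardy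
inequality makes phi_n / sqrt(rho) converge uniformly, so that z / sqrt(rho), which is the weighted
derivative of v, is bounded. Integrating phi_n' w by parts and passing to the limit, by uniform
convergence on one side and in L^2 on the other, yields the formula. *)
Lemma A_graph_green u g : A_graph u g -> exists2 v, in_V v &
  eq_L2 u v /\ forall w, in_V w -> dot g w = - dot (wder v) (wder w).
Proof.
move=> [v uv [Lv acv [Lz Lg [phi [hp pz dg]]]]]; set z := fun x => _ in Lz pz.
have Ldp n : in_L2 (derive1 (phi n)).
  by apply/in_L2P; apply: continuous_sqint; have [] := hp n.
have Lp n : in_L2 (phi n).
  by apply/in_L2P; apply: continuous_sqint; exact: (C1_continuous (hp n)).
have pdiff n m x : I x -> `|phi n x - phi m x| <=
    Num.sqrt (rho x) * norm_L2 (derive1 (phi n) - derive1 (phi m)).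
  move=> Ix; have [hd dE] := C1_sub (hp n) (hp m).
  have := C1_pointwise hd Ix; rewrite dE -[(phi n - phi m) x]/(phi n x - phi m x) => H.
  rewrite -(@ler_pXn2r _ 2) ?nnegrE ?mulr_ge0 ?norm_L2_ge0 ?sqrtr_ge0//.
  by rewrite exprMn sqr_sqrtr ?(ltW (rho_gt0 Ix))// real_normK ?num_real.
have small e : 0 < e -> exists N, forall n m, (N <= n)%N -> (N <= m)%N ->
    norm_L2 (derive1 (phi n) - derive1 (phi m)) <= e.
  move=> e0; have e20 : 0 < e / 2 by rewrite divr_gt0.
  have [N _ NP] : \forall n \near \oo, norm_L2 (derive1 (phi n) - g) < e / 2.
    by move/cvgr_lt : dg; apply.
  exists N => n m Nn Nm; rewrite [e]splitr.
  have -> : derive1 (phi n) - derive1 (phi m) =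
    (derive1 (phi n) - g) + (g - derive1 (phi m)) by rewrite addrA subrK.
  apply: (le_trans (norm_L2D _ _)); [exact: in_L2B|exact: in_L2B|].
  by rewrite (norm_L2_dist Lg)// lerD// ltW//; apply: NP.
have pcvg x : I x -> cvgn (fun n => phi n x).
  move=> Ix; apply/cauchy_cvgP; apply/cauchy_exP => e e0.
  have e20 : 0 < e / 2 by rewrite divr_gt0.
  have [N NP] := small _ e20.
  exists (phi N x); exists N => // n /= Nn; rewrite /ball/=.
  apply: le_lt_trans (pdiff N n x Ix) _.
  apply: (@le_lt_trans _ _ (1 * (e / 2))).
    by apply: ler_pM; rewrite ?sqrtr_ge0 ?norm_L2_ge0 ?sqrt_rho_le1// NP.
  by rewrite mul1r; move: e0; lra.
pose Z : R -> R := fun x => limn (fun n => phi n x).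
have ZE x : I x -> phi n x @[n --> \oo] --> Z x by move=> /pcvg.
have mphi n : measurable_fun I (phi n) by have /in_L2P[] := Lp n.
have mZ : measurable_fun I Z.
  by apply: (measurable_fun_cvg mphi) => x Ix; exact: ZE.
have zZ : eq_L2 z Z.
  by apply: (L2_cvg_unique Lp Lz) => //; apply: ae_all => x; exact: ZE.
have Zdiff e : 0 < e -> exists N, forall n, (N <= n)%N -> forall x, I x ->
    `|phi n x - Z x| <= e * Num.sqrt (rho x).
  move=> e0; have [N NP] := small _ e0; exists N => n Nn x Ix.
  have cn : `|phi n x - phi m x| @[m --> \oo] --> `|phi n x - Z x|.
    by apply: cvg_norm; apply: cvgB; [exact: cvg_cst|exact: ZE].
  rewrite -(cvg_lim _ cn)//; apply: limr_le; first by apply/cvg_ex; eexists; exact: cn.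
  near=> m; apply: (le_trans (pdiff n m x Ix)); rewrite mulrC ler_wpM2r ?sqrtr_ge0//.
  by apply: NP => //; near: m; exact: nbhs_infty_ge.
have mir := @measurable_inv_sqrt_rho R.
pose y x := Z x * (Num.sqrt (rho x))^-1.
have my : measurable_fun I y by exact: measurable_funM.
have rr x : I x -> Num.sqrt (rho x) * (Num.sqrt (rho x))^-1 = 1.
  by move=> Ix; rewrite mulfV// gt_eqF// sqrt_rho_gt0.
have sy : sqint y.
  have [N NP] := Zdiff 1 ltr01.
  apply: (@sqint_bounded _ _ (cst (1 + norm_L2 (derive1 (phi N))))) => //; first exact: sqint_cst.
  move=> x Ix; rewrite /= [leRHS]ger0_norm ?addr_ge0 ?norm_L2_ge0//.
  rewrite /y normrM [X in _ * X]ger0_norm ?invr_ge0 ?sqrtr_ge0//.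
  rewrite ler_pdivrMr ?sqrt_rho_gt0//.
  have -> : Z x = phi N x - (phi N x - Z x) by rewrite subKr.
  apply: (le_trans (ler_normB _ _)); rewrite addrC mulrDl; apply: lerD; first exact: NP.
  rewrite -(@ler_pXn2r _ 2) ?nnegrE ?mulr_ge0 ?norm_L2_ge0 ?sqrtr_ge0//.
  rewrite exprMn sqr_sqrtr ?(ltW (rho_gt0 Ix))// real_normK ?num_real// mulrC.
  exact: C1_pointwise.
have yw : eq_L2 y (wder v).
  apply: (ae_imp zZ) => x H Ix; rewrite /y -H// /z /wder.
  rewrite -{1}(sqr_sqrtr (ltW (rho_gt0 Ix))) expr2.
  by field; rewrite gt_eqF// sqrt_rho_gt0.
have Lwv : in_L2 (wder v).
  by apply: (@eq_in_L2 _ y) => //; [exact: wder_measurable|exact/in_L2P].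
exists v; first by split.
split => // w [Lw acw Lww].
have sw := (in_L2P w).1 Lw; have sww := (in_L2P (wder w)).1 Lww.
have -> : dot (wder v) (wder w) = dot y (wder w).
  by apply: (eq_dot _ _ sww sww (eq_L2_sym yw) (eq_L2_refl _)) => //; exact/in_L2P.
have c1 : dot (derive1 (phi n)) w @[n --> \oo] --> dot g w.
  apply/cvgrPdist_le => e e0.
  have e' : 0 < e / (norm_L2 w + 1) by rewrite divr_gt0//; have := norm_L2_ge0 w; lra.
  have : \forall n \near \oo, norm_L2 (derive1 (phi n) - g) < e / (norm_L2 w + 1).
    by move/cvgr_lt : dg; apply.
  apply: filterS => n Hn; rewrite distrC.
  have -> : dot (derive1 (phi n)) w - dot g w = dot (derive1 (phi n) - g) w.
    have := dot_linl (-1) ((in_L2P g).1 Lg) ((in_L2P _).1 (Ldp n)) sw.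
    rewrite (_ : (fun x => -1 * g x + derive1 (phi n) x) = derive1 (phi n) - g).
      by move=> ->; ring.
    by apply/funext => x; rewrite mulN1r addrC.
  apply: (le_trans (dot_le_norm (in_L2B (Ldp n) Lg) Lw)).
  apply: (@le_trans _ _ (e / (norm_L2 w + 1) * norm_L2 w)).
    by rewrite ler_wpM2r ?norm_L2_ge0// ltW.
  have := norm_L2_ge0 w => nw; rewrite mulrAC ler_pdivrMr; last by lra.
  by rewrite ler_pM2l//; lra.
have c2 : dot (derive1 (phi n)) w @[n --> \oo] --> - dot y (wder w).
  have E n : dot (derive1 (phi n)) w = - dot (fun x => phi n x * (Num.sqrt (rho x))^-1) (wder w).
    rewrite [LHS](C1_by_parts (hp n) acw); congr (- _); apply: eq_Rintegral => x.
    by rewrite inE => Ix; rewrite /wder; field; rewrite gt_eqF// sqrt_rho_gt0.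
  under eq_fun do rewrite E.
  apply: cvgN; apply/cvgrPdist_le => e e0.
  have nw := norm_L2_ge0 (wder w).
  have e' : 0 < e / (2 * (norm_L2 (wder w) + 1)) by rewrite divr_gt0//; move: nw; lra.
  have [N NP] := Zdiff _ e'; exists N => // n /= Nn.
  have sq : sqint (fun x => phi n x * (Num.sqrt (rho x))^-1).
    apply: (@sqint_bounded _ _ (cst (norm_L2 (derive1 (phi n))))); last 1 first.
    - move=> x Ix; rewrite normrM [X in _ * X]ger0_norm ?invr_ge0 ?sqrtr_ge0//.
      rewrite ler_pdivrMr ?sqrt_rho_gt0// /= [X in X * _]ger0_norm ?norm_L2_ge0//.
      rewrite -(@ler_pXn2r _ 2) ?nnegrE ?mulr_ge0 ?norm_L2_ge0 ?sqrtr_ge0//.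
      rewrite exprMn sqr_sqrtr ?(ltW (rho_gt0 Ix))// real_normK ?num_real// mulrC.
      exact: C1_pointwise.
    - exact: measurable_funM.
    - exact: sqint_cst.
  set f := fun x => phi n x * _ in sq *.
  have -> : dot y (wder w) - dot f (wder w) = dot (fun x => -1 * f x + y x) (wder w).
    by rewrite dot_linl//; ring.
  have sd : sqint (fun x => -1 * f x + y x) by exact: sqint_lin.
  have Ld : in_L2 (fun x => -1 * f x + y x) by apply/in_L2P.
  apply: (le_trans (dot_le_norm Ld Lww)).
  have : norm_L2 (fun x => -1 * f x + y x) <= 2 * (e / (2 * (norm_L2 (wder w) + 1))).
    apply: norm_L2_le => //; first by rewrite mulr_ge0// ltW.
    set k := e / _ in e' NP *.
    have -> : (2 * k) ^+ 2 = (2 * k ^+ 2) * 2 by ring.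
    have i2 : \int[mu]_(x in I) (cst (k ^+ 2) x) = k ^+ 2 * 2.
      by rewrite Rintegral_cst// [X in fine X]measure_Iset.
    apply: (@le_trans _ _ (k ^+ 2 * 2)); last by rewrite mulrAC; have := sqr_ge0 k; lra.
    rewrite -i2; apply: le_Rintegral => //; first exact: sqint_mul.
      by have [_] := @sqint_cst R k.
    move=> x Ix; rewrite -expr2 -[X in X <= _]real_normK ?num_real//.
    rewrite ler_pXn2r ?nnegrE ?(ltW e')//.
    have -> : -1 * f x + y x = - ((phi n x - Z x) * (Num.sqrt (rho x))^-1).
      by rewrite /f /y; ring.
    rewrite normrN normrM [X in _ * X]ger0_norm ?invr_ge0 ?sqrtr_ge0//.
    by rewrite ler_pdivrMr ?sqrt_rho_gt0//; exact: NP.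
  exact: halving_bound.
exact: (cvg_unique _ c1 c2).
Unshelve. all: by end_near. Qed.

End GreenFormula.

(** * The form of the two-component operator *)

Section PairForm.
Context {R : realType} (ka ks : R).
Hypotheses (ka0 : 0 < ka) (ks0 : 0 < ks).
Implicit Types (u v w : state R) (x y z : hspace R).
Local Notation H := (hspace R).

Lemma in_V2_H2 u : in_V2 u -> in_H2 u.
Proof. by case=> [[h1 _ _] [h2 _ _]]; split. Qed.

Lemma in_V2_lin k u v : in_V2 u -> in_V2 v -> in_V2 (k *: u + v).
Proof. by case=> h1 h2 [h3 h4]; split; [exact: (in_V_lin k h1 h3)|exact: (in_V_lin k h2 h4)]. Qed.

Lemma in_H2B u v : in_H2 u -> in_H2 v -> in_H2 (u - v).
Proof. by move=> hu hv; rewrite -scaleN1r addrC; exact: in_H2_lin. Qed.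

(** The square roots put the diffusivities into the form. *)
Definition wder2 u : state R :=
  (Num.sqrt ka *: wder u.1, Num.sqrt ks *: wder u.2).

Lemma wder2_in u : in_V2 u -> in_H2 (wder2 u).
Proof. by case=> [[_ _ h1] [_ _ h2]]; split; [exact: (in_L2Z _ h1)|exact: (in_L2Z _ h2)]. Qed.

Lemma eq_wder (f g : R -> R) : in_V f -> in_V g -> eq_L2 f g -> eq_L2 (wder f) (wder g).
Proof.
move=> Vf Vg fg; have [_ E] := in_V_unique Vf Vg fg.
by apply: eq_L2_Iset => t It; rewrite /wder E.
Qed.

Lemma eq_L2Z k (f g : R -> R) : eq_L2 f g -> eq_L2 (k *: f) (k *: g).
Proof. by move=> fg; apply: (ae_imp fg) => t h It; rewrite -[LHS]/(k * f t) h. Qed.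

Lemma eq_wder2 u v : in_V2 u -> in_V2 v -> eq_H2 u v -> eq_H2 (wder2 u) (wder2 v).
Proof.
by case=> h1 h2 [h3 h4] [e1 e2]; split; apply: eq_L2Z; exact: eq_wder.
Qed.

Lemma wder2_lin k u v : in_V2 u -> in_V2 v ->
  eq_H2 (wder2 (k *: u + v)) (k *: wder2 u + wder2 v).
Proof.
case=> [[_ a1 _] [_ a2 _]] [[_ b1 _] [_ b2 _]]; split.
  apply: eq_L2_trans (eq_L2Z _ (wder_lin k a1 b1)) _.
  by rewrite scalerDr scalerA mulrC -scalerA; exact: eq_L2_refl.
apply: eq_L2_trans (eq_L2Z _ (wder_lin k a2 b2)) _.
by rewrite scalerDr scalerA mulrC -scalerA; exact: eq_L2_refl.
Qed.

Definition hV x := exists2 v, in_V2 v & eq_H2 (hrep x) v.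
(** The representative in V x V of a class, unique up to values outside the interval
([in_V_unique]). *)
Definition vrep x : state R := xget 0 [set v | in_V2 v /\ eq_H2 (hrep x) v].
Definition hD x : H := cls (wder2 (vrep x)).

Lemma vrepP x : hV x -> in_V2 (vrep x) /\ eq_H2 (hrep x) (vrep x).
Proof.
by move=> [v hv xv]; rewrite /vrep; case: xgetP => [w _ []//|/(_ v)] h; exfalso; exact: h.
Qed.

Lemma vrep_cls x : hV x -> cls (vrep x) = x.
Proof.
move=> hx; have [h1 h2] := vrepP hx; apply: cls_eq_hrep; first exact: in_V2_H2.
exact: eq_H2_sym.
Qed.

Lemma hV_cls v : in_V2 v -> hV (cls v).
Proof.
by move=> hv; exists v => //; apply: eq_H2_sym; apply: hrep_cls; exact: in_V2_H2.
Qed.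

Lemma eq_vrep v : in_V2 v -> eq_H2 (vrep (cls v)) v.
Proof.
move=> hv; have [_ h] := vrepP (hV_cls hv).
apply: eq_H2_trans (eq_H2_sym h) _; apply: eq_H2_sym; apply: hrep_cls; exact: in_V2_H2.
Qed.

Lemma hD_cls v : in_V2 v -> hD (cls v) = cls (wder2 v).
Proof.
move=> hv; have [h _] := vrepP (hV_cls hv).
apply/eq_cls; [exact: wder2_in|exact: wder2_in|].
by apply: eq_wder2 => //; exact: eq_vrep.
Qed.

Lemma hV_lin k x y : hV x -> hV y -> hV (k *: x + y).
Proof.
move=> hx hy; have [vx _] := vrepP hx; have [vy _] := vrepP hy.
rewrite -(vrep_cls hx) -(vrep_cls hy) -clsZ; last exact: in_V2_H2.
rewrite -clsD; [|apply: in_H2Z; exact: in_V2_H2|exact: in_V2_H2].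
by apply: hV_cls; exact: in_V2_lin.
Qed.

Lemma hD_lin k x y : hV x -> hV y -> hD (k *: x + y) = k *: hD x + hD y.
Proof.
move=> hx hy; have [vx _] := vrepP hx; have [vy _] := vrepP hy.
rewrite -{1}(vrep_cls hx) -{1}(vrep_cls hy) -clsZ; last exact: in_V2_H2.
rewrite -clsD; [|apply: in_H2Z; exact: in_V2_H2|exact: in_V2_H2].
rewrite hD_cls; last exact: in_V2_lin.
rewrite /hD -clsZ; last exact: wder2_in.
rewrite -clsD; [|apply: in_H2Z; exact: wder2_in|exact: wder2_in].
apply/eq_cls; last exact: wder2_lin.
  exact/wder2_in/in_V2_lin.
by apply: in_H2_lin; exact: wder2_in.
Qed.

Lemma cvg_components (u : nat -> state R) w : (forall n, in_H2 (u n)) -> in_H2 w ->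
  cls (u n) @[n --> \oo] --> cls w ->
  norm_L2 ((u n).1 - w.1) @[n --> \oo] --> (0 : R) /\
  norm_L2 ((u n).2 - w.2) @[n --> \oo] --> (0 : R).
Proof.
move=> hu hw uw.
have N0 : norm_H2 (u n - w) @[n --> \oo] --> (0 : R).
  have h : `|cls (u n) - cls w| @[n --> \oo] --> (0 : R).
    by rewrite -(normr0 H) -(subrr (cls w)); apply: cvg_norm; apply: cvgB uw _; exact: cvg_cst.
  apply: cvg_trans h; apply: near_eq_cvg; apply: nearW => n /=.
  rewrite -clsB// hnorm_cls// -scaleN1r addrC; exact: in_H2_lin.
by split; apply: (squeeze_cvgr _ (cvg_cst 0) N0); apply: nearW => n;
  rewrite norm_L2_ge0/=; have [] := norm_L2_le_H2 (u n - w).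
Qed.

Lemma wder_closedZ (k : R) (v : nat -> R -> R) (f g : R -> R) : 0 < k ->
  (forall n, in_V (v n)) -> in_L2 f -> in_L2 g ->
  norm_L2 (v n - f) @[n --> \oo] --> 0 -> norm_L2 (k *: wder (v n) - g) @[n --> \oo] --> 0 ->
  exists2 w, in_V w & eq_L2 f w /\ eq_L2 (k *: wder w) g.
Proof.
move=> k0 Vv Lf Lg vf vg.
have [w Vw [fw wg]] : exists2 w, in_V w & eq_L2 f w /\ eq_L2 (wder w) (k^-1 *: g).
  apply: (wder_closed Vv Lf) => //; first exact: in_L2Z.
  have h : k^-1 * norm_L2 (k *: wder (v n) - g) @[n --> \oo] --> (k^-1 * 0 : R).
    by apply: cvgMr.
  rewrite mulr0 in h; apply: cvg_trans h; apply: near_eq_cvg; apply: nearW => n.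
  have Lw : in_L2 (wder (v n)) by have [] := Vv n.
  rewrite -[k^-1 in LHS]gtr0_norm ?invr_gt0// -norm_L2Z.
    by rewrite scalerBr scalerA mulVf ?gt_eqF// scale1r.
  by apply: in_L2B => //; exact: in_L2Z.
exists w => //; split => //; apply: eq_L2_trans (eq_L2Z _ wg) _.
by rewrite scalerA mulfV ?gt_eqF// scale1r; exact: eq_L2_refl.
Qed.

Lemma hD_closed (x : nat -> H) y z : (forall n, hV (x n)) -> x n @[n --> \oo] --> y ->
  hD (x n) @[n --> \oo] --> z -> hV y /\ hD y = z.
Proof.
move=> hx xy xz; pose v n := vrep (x n).
have vV n : in_V2 (v n) by have [] := vrepP (hx n).
have hy := hrep_in y; have hz := hrep_in z.
have [c1 c2] : norm_L2 ((v n).1 - (hrep y).1) @[n --> \oo] --> (0 : R) /\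
  norm_L2 ((v n).2 - (hrep y).2) @[n --> \oo] --> (0 : R).
  apply: cvg_components => //; first by move=> n; exact: in_V2_H2.
  by rewrite hrepK; under eq_fun do rewrite vrep_cls//.
have [d1 d2] : norm_L2 ((wder2 (v n)).1 - (hrep z).1) @[n --> \oo] --> (0 : R) /\
  norm_L2 ((wder2 (v n)).2 - (hrep z).2) @[n --> \oo] --> (0 : R).
  apply: cvg_components => //; first by move=> n; exact: wder2_in.
  by rewrite hrepK.
have [hy1 hy2] := hy; have [hz1 hz2] := hz.
have ka' : 0 < Num.sqrt ka by rewrite sqrtr_gt0.
have ks' : 0 < Num.sqrt ks by rewrite sqrtr_gt0.
have [w1 Vw1 [e1 f1]] := wder_closedZ ka' (fun n => (vV n).1) hy1 hz1 c1 d1.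
have [w2 Vw2 [e2 f2]] := wder_closedZ ks' (fun n => (vV n).2) hy2 hz2 c2 d2.
have hw : in_V2 (w1, w2) := conj Vw1 Vw2.
have yE : y = cls (w1, w2).
  by rewrite -[LHS]hrepK; apply/eq_cls => //; exact: in_V2_H2.
split; first by rewrite yE; exact: hV_cls.
rewrite yE hD_cls// -[RHS]hrepK; apply/eq_cls => //; first exact: wder2_in.
Qed.

Lemma sqrt_wder_dot (k : R) (f g : R -> R) : 0 < k -> in_V f -> in_V g ->
  dot (Num.sqrt k *: wder f) (Num.sqrt k *: wder g) = k * dot (wder f) (wder g).
Proof.
move=> k0 [_ _ /in_L2P Lf] [_ _ /in_L2P Lg].
rewrite /dot -RintegralZl//; last by exact: (sqint_mul Lf Lg).
  apply: eq_Rintegral => t _.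
  rewrite -[(_ *: wder f) t]/(Num.sqrt k * wder f t) -[(_ *: wder g) t]/(Num.sqrt k * wder g t).
  by rewrite mulrACA -expr2 sqr_sqrtr// ltW.
exact: measurable_Iset.
Qed.

Lemma dotZl k (f g : R -> R) : in_L2 f -> in_L2 g -> dot (k *: f) g = k * dot f g.
Proof.
move=> /in_L2P Lf /in_L2P Lg; rewrite /dot -RintegralZl//.
- by apply: eq_Rintegral => t _; rewrite -[(k *: f) t]/(k * f t) mulrA.
- exact: measurable_Iset.
- exact: sqint_mul.
Qed.

Lemma A_graph_L2 (f g : R -> R) : A_graph f g -> in_L2 g.
Proof. by move=> [v _ [_ _ []]]. Qed.

Lemma A2_graph_green u w : in_H2 u -> in_H2 w -> A2_graph ka ks u w ->
  hV (cls u) /\ forall y, hV y -> hip (cls w) y = - hip (hD (cls u)) (hD y).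
Proof.
move=> hu hw [z [A1 A2 [wz1 wz2]]].
have Lz1 := A_graph_L2 A1; have Lz2 := A_graph_L2 A2.
have [v1 V1 [e1 g1]] := A_graph_green A1; have [v2 V2 [e2 g2]] := A_graph_green A2.
have hv : in_V2 (v1, v2) := conj V1 V2.
have uE : cls u = cls (v1, v2) by apply/eq_cls => //; exact: in_V2_H2.
split; first by rewrite uE; exact: hV_cls.
move=> y hy; have [Vy _] := vrepP hy; rewrite -{1}(vrep_cls hy) uE hD_cls// /hD.
have hVy := in_V2_H2 Vy.
rewrite !hip_cls//; [|exact: wder2_in|exact: wder2_in].
have [Vy1 Vy2] := Vy.
rewrite /dot2 /= !sqrt_wder_dot// opprD.
have [w1 w2] := hw; have [y1 y2] := hVy.
have c (k : R) (f g h : R -> R) : in_L2 f -> in_L2 g -> in_L2 h -> eq_L2 f (k *: g) ->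
    dot f h = k * dot g h.
  move=> Lf Lg Lh fg; rewrite -dotZl//.
  by apply: eq_dot => //; [exact/in_L2P|apply/in_L2P; exact: in_L2Z|exact/in_L2P|
    exact/in_L2P|exact: eq_L2_refl].
by rewrite (c ka _ _ _ w1 Lz1 y1 wz1) (c ks _ _ _ w2 Lz2 y2 wz2) g1// g2// !mulrN.
Qed.

End PairForm.

Section LiftedSemigroup.
Context {R : realType} {graph : state R -> state R -> Prop}
  {S : R -> state R -> state R}.
Hypothesis HS : semigroup_generated_by graph S.
Implicit Types (u v w : state R) (x y z : hspace R).
Local Notation H := (hspace R).

Lemma orbit_in t u : 0 <= t -> in_H2 u -> in_H2 (S t u).
Proof. by case: HS => [[h _] _ _ _ _]; exact: h. Qed.

Lemma eq_orbit t u v : 0 <= t -> in_H2 u -> in_H2 v -> eq_H2 u v -> eq_H2 (S t u) (S t v).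
Proof.
move=> t0 hu hv uv; have [[_ lin] bd _ _ _] := HS.
have hd : in_H2 ((-1) *: v + u) by exact: in_H2_lin.
have hSu := orbit_in t0 hu; have hSv := orbit_in t0 hv.
have [M MP] := bd t t0.
have d0 : cls ((-1) *: v + u) = 0.
  by rewrite clsD ?clsZ//; [rewrite ((eq_cls hu hv).2 uv) scaleN1r addNr|exact: in_H2Z].
have S0 : cls (S t ((-1) *: v + u)) = 0.
  apply/eqP; rewrite -normr_le0 hnorm_cls; last exact: orbit_in.
  by apply: (le_trans (MP _ hd)); rewrite -hnorm_cls// d0 normr0 mulr0.
have : cls (S t ((-1) *: v + u)) = cls ((-1) *: S t v + S t u).
  by apply/eq_cls; [exact: orbit_in|exact: in_H2_lin|exact: lin].
rewrite S0 clsD ?clsZ//; last exact: in_H2Z.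
move=> /esym/eqP; rewrite scaleN1r addrC subr_eq0 => /eqP E.
exact/eq_cls.
Qed.

(** The family S is constrained for nonnegative times only. *)
Definition lift_fun t x : H := if t <= 0 then x else cls (S t (hrep x)).

Lemma lift_fun_cls t u : 0 < t -> in_H2 u -> lift_fun t (cls u) = cls (S t u).
Proof.
move=> t0 hu; rewrite /lift_fun leNgt t0/=; have t0' := ltW t0.
have hr := hrep_in (cls u).
apply/eq_cls; [exact: orbit_in|exact: orbit_in|].
by apply: eq_orbit => //; apply: eq_H2_sym; exact: hrep_cls.
Qed.

Lemma lift_linear t : linear (lift_fun t).
Proof.
move=> k x y; rewrite /lift_fun; case: leP => // t0; have t0' := ltW t0.
have [[_ lin] _ _ _ _] := HS.
have hx := hrep_in x; have hy := hrep_in y.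
have hSx := orbit_in t0' hx; have hSy := orbit_in t0' hy.
rewrite -clsZ// -clsD//; last exact: in_H2Z.
apply/eq_cls; [apply: orbit_in => //; exact: hrep_in|exact: in_H2_lin|].
apply: eq_H2_trans (lin t k _ _ t0' hx hy).
by apply: eq_orbit => //; [exact: hrep_in|exact: in_H2_lin|exact: hrep_lin].
Qed.

Definition lift t : {linear H -> H} :=
  HB.pack (lift_fun t) (GRing.isLinear.Build R H H *:%R (lift_fun t) (lift_linear t)).

Lemma lift_neg t x : t <= 0 -> lift t x = x.
Proof. by move=> t0; rewrite /= /lift_fun t0. Qed.

Lemma lift_cls t u : 0 <= t -> in_H2 u -> lift t (cls u) = cls (S t u).
Proof.
move=> t0 hu; have [t00|tn0] := eqVneq t 0; last first.
  by apply: lift_fun_cls => //; rewrite lt_neqAle eq_sym tn0.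
rewrite lift_neg ?t00//; apply/eq_cls => //; first exact: orbit_in.
by apply: eq_H2_sym; have [_ _ [h _] _ _] := HS; exact: h.
Qed.

Lemma lift_semigroup : semigroup lift.
Proof.
have [_ bd [S0 SD] Sc _] := HS; split.
- move=> t; have [t0|t0] := leP t 0.
    by exists 1 => x; rewrite lift_neg// mul1r.
  have [M MP] := bd t (ltW t0); exists M => x; have hx := hrep_in x.
  have hS := orbit_in (ltW t0) hx.
  have -> : lift t x = cls (S t (hrep x)) by rewrite -{1}(hrepK x) lift_cls// ltW.
  by rewrite hnorm_cls// hnorm_rep; exact: MP.
- exact: lift_neg.
- move=> s t x s0 t0; have hx := hrep_in x; have hSx := orbit_in t0 hx.
  have st0 : 0 <= s + t by exact: addr_ge0.
  rewrite -(hrepK x) !lift_cls//.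
  by apply/eq_cls; [exact: orbit_in|exact: orbit_in|exact: SD].
- move=> x; have hx := hrep_in x.
  apply/cvgrPdist_lt => e e0; have := Sc _ hx; move/cvgrPdist_lt => /(_ e e0).
  apply: filter_app; near=> t; have t0 : 0 < t by near: t; exact: nbhs_right_gt.
  rewrite sub0r normrN ger0_norm ?norm_H2_ge0// => h.
  have hS := orbit_in (ltW t0) hx.
  rewrite distrC -{2}(hrepK x) -{1}(hrepK x) lift_cls ?ltW// -clsB// hnorm_cls//.
  exact: in_H2B.
Unshelve. all: by end_near. Qed.

Lemma lift_generator x y : generator lift x y -> graph (hrep x) (hrep y).
Proof.
move=> gxy; have [_ _ _ _ gen] := HS.
have hx := hrep_in x; have hy := hrep_in y.
apply/gen => //; apply/cvgrPdist_lt => e e0.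
move/cvgrPdist_lt : gxy => /(_ e e0); apply: filter_app; near=> t => h.
have t0 : 0 < t by near: t; exact: nbhs_right_gt.
rewrite sub0r normrN ger0_norm ?norm_H2_ge0//.
have hS := orbit_in (ltW t0) hx.
have hd : in_H2 (S t (hrep x) - hrep x) by exact: in_H2B.
have hq : in_H2 (t^-1 *: (S t (hrep x) - hrep x)) by exact: in_H2Z.
rewrite -hnorm_cls; last exact: in_H2B.
have E1 : lift t x = cls (S t (hrep x)) by rewrite -{1}(hrepK x) lift_cls// ltW.
rewrite (clsB hq hy) (clsZ _ hd) (clsB hS hx) !hrepK -E1 -normrN opprB; exact: h.
Unshelve. all: by end_near. Qed.

End LiftedSemigroup.

Lemma lift_form_semigroup (R : realType) (ka ks : R) (S : R -> state R -> state R)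
  (HS : semigroup_generated_by (A2_graph ka ks) S) : 0 < ka -> 0 < ks ->
  form_semigroup (@hip R) (lift HS) (@hV R) (hD ka ks).
Proof.
move=> ka0 ks0; split.
- exact: lift_semigroup.
- by move=> k x y; exact: hV_lin.
- by move=> k x y; exact: hD_lin.
- by move=> x_ x z Vx xx xz; exact: (hD_closed ka0 ks0 Vx xx xz).
- move=> x y /lift_generator gxy.
  have := A2_graph_green ka0 ks0 (hrep_in x) (hrep_in y) gxy.
  by rewrite !hrepK.
Qed.

(** * The nonlinearity *)

Section Weight.
Context {R : realType}.
Local Notation mu := (@lebesgue_measure R).
Local Notation I := (@Iset R).

Let mI : measurable I := @measurable_Iset R.

Lemma expR_artanh (x : R) : I x ->
  expR (artanh x) + expR (- artanh x) = 2 / Num.sqrt (rho x).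
Proof.
move=> Ix; have /IsetE[x1 x2] := Ix; have r0 := rho_gt0 Ix.
have h1 : 0 < 1 + x by lra.
have h2 : 0 < 1 - x by lra.
have E : expR (artanh x) ^+ 2 = (1 + x) / (1 - x).
  rewrite expr2 -expRD (_ : artanh x + artanh x = ln (1 + x) - ln (1 - x)); last first.
    by rewrite /artanh; field.
  by rewrite expRB !lnK ?posrE.
have P0 := expR_gt0 (artanh x).
rewrite expRN -[LHS]ger0_norm ?addr_ge0 ?invr_ge0 ?(ltW P0)// -sqrtr_sqr.
have -> : (expR (artanh x) + (expR (artanh x))^-1) ^+ 2 = 2 ^+ 2 / rho x.
  rewrite sqrrD exprVn E mulfV ?gt_eqF// /rho; field.
  by rewrite !gt_eqF// subr_gt0; nra.
by rewrite sqrtrM ?sqr_ge0// sqrtr_sqr ger0_norm// sqrtrV// ltW.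
Qed.

(** Since 1 + y/4 <= exp(y/4), the fourth power of the weight is at most 256 times
exp |artanh x|, and exp(artanh x) + exp(- artanh x) = 2 / sqrt(rho). *)
Lemma weight_bound (x : R) : I x -> (1 + `|artanh x|) ^+ 4 <= 512 * (Num.sqrt (rho x))^-1.
Proof.
move=> Ix; set A := artanh x.
have -> : 512 * (Num.sqrt (rho x))^-1 = 256 * (expR A + expR (- A)).
  by rewrite expR_artanh//; ring.
have E : expR `|A| <= expR A + expR (- A).
  by case: (ger0P A) => _; [rewrite lerDl|rewrite lerDr]; exact: expR_ge0.
apply: le_trans (_ : 256 * expR `|A| <= _); last by exact: (ler_wpM2l (ler0n R 256) E).
have h : 1 + `|A| / 4 <= expR (`|A| / 4) by exact: expR_ge1Dx.
have -> : expR `|A| = expR (`|A| / 4) ^+ 4 by rewrite -expRM_natl; congr expR; field.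
have -> : 256 * expR (`|A| / 4) ^+ 4 = (4 * expR (`|A| / 4)) ^+ 4 by rewrite exprMn; congr (_ * _); ring.
rewrite ler_pXn2r ?nnegrE ?addr_ge0 ?mulr_ge0 ?expR_ge0//.
by have := normr_ge0 A; move: (expR _) h => e h; lra.
Qed.

Lemma integral_inv_sqrt_rho (r : R) : 0 < r -> r < 1 ->
  (\int[mu]_(x in `[(- r)%R, r]) (Num.sqrt (rho x))^-1%:E <= (pi : R)%:E)%E.
Proof.
move=> r0 r1; have rr : - r < r by lra.
have sub t : - r <= t <= r -> I t by move=> /andP[a b]; apply/IsetE; split; lra.
have dasin t : I t -> is_derive t 1 (@asin R) (Num.sqrt (rho t))^-1.
  by move=> /IsetE[t1 t2]; apply: is_derive1_asin; rewrite t1.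
have casin t : I t -> {for t, continuous (@asin R)}.
  by move=> It; apply: differentiable_continuous; apply/derivable1_diffP; have [] := dasin t It.
rewrite (@continuous_FTC2 _ (fun t => (Num.sqrt (rho t))^-1) (@asin R) (- r) r)//.
- have : asin r <= pi / 2 :> R by apply: asin_lepi2; lra.
  have : - (pi / 2) <= asin (- r) :> R by apply: asin_geNpi2; lra.
  by move=> h1 h2; rewrite -EFinB lee_fin; lra.
- apply/continuous_within_itvP => //; split.
  + by move=> t; rewrite in_itv/= => /andP[h1 h2]; apply: inv_sqrt_rho_continuous; apply: sub; rewrite !ltW.
  + by apply: cvg_at_right_filter; apply: inv_sqrt_rho_continuous; apply: sub; rewrite lexx ltW.
  + by apply: cvg_at_left_filter; apply: inv_sqrt_rho_continuous; apply: sub; rewrite lexx ltW.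
- split.
  + move=> t; rewrite in_itv/= => /andP[h1 h2].
    by have [] : is_derive t 1 (@asin R) (Num.sqrt (rho t))^-1 by apply: dasin; apply: sub; rewrite !ltW.
  + by apply: cvg_at_right_filter; apply: casin; apply: sub; rewrite lexx ltW.
  + by apply: cvg_at_left_filter; apply: casin; apply: sub; rewrite lexx ltW.
- move=> t; rewrite in_itv/= => /andP[h1 h2]; rewrite derive1E.
  by apply: derive_val; apply: dasin; apply: sub; rewrite !ltW.
Qed.

(** The fourth power of the weight is at most a multiple of 1/sqrt(rho), the derivative of
the arc sine, which is bounded. *)
Lemma weight_sqint : sqint (fun x : R => (1 + `|artanh x|) ^+ 2).
Proof.
have ma : measurable_fun I (fun x : R => 1 + `|artanh x|).
  apply: open_continuous_measurable_fun; first exact: open_Iset.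
  move=> x; rewrite inE => Ix; apply: cvgD; first exact: cvg_cst.
  by apply: cvg_norm; exact: artanh_continuous.
have mir := @measurable_inv_sqrt_rho R.
have i512 : mu.-integrable I (EFin \o (fun x : R => 512 * (Num.sqrt (rho x))^-1)).
  apply: integrable_mulr => //; apply/integrableP; split; first exact/measurable_EFinP.
  pose F n : set R := `[- (1 - n.+2%:R^-1), 1 - n.+2%:R^-1].
  have q0 n : 0 < n.+2%:R^-1 :> R by rewrite invr_gt0.
  have q1 n : n.+2%:R^-1 <= 2^-1 :> R by rewrite lef_pV2 ?posrE// ler_nat.
  have FI : I = \bigcup_n F n.
    apply/seteqP; split=> x.
      move=> /Iset_exhaust[n [n1 n2]]; exists n => //=; rewrite /F/= in_itv/=.
      by rewrite opprB addrC !ltW// addrC.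
    move=> [n _]; rewrite /F/= in_itv/= => /andP[h1 h2]; apply/IsetE.
    by have := q0 n; move: (n.+2%:R^-1) h1 h2 => p h1 h2 p0; split; lra.
  have FsI n : F n `<=` I by rewrite FI => x Fx; exists n.
  under eq_integral => x xI.
    rewrite /= ger0_norm ?invr_ge0 ?sqrtr_ge0//.
    over.
  rewrite /= FI.
  have cF : (\int[mu]_(x in F n) (Num.sqrt (rho x))^-1%:E)%E @[n --> \oo] -->
      (\int[mu]_(x in \bigcup_n F n) (Num.sqrt (rho x))^-1%:E)%E.
    apply: ge0_nondecreasing_set_cvg_integral.
    - move=> n m nm; apply/subsetPset => x; rewrite /F/= !in_itv/= => /andP[h1 h2].
      have : m.+2%:R^-1 <= n.+2%:R^-1 :> R by rewrite lef_pV2 ?posrE// ler_nat.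
      move: (m.+2%:R^-1) (n.+2%:R^-1) h1 h2 => p p' h1 h2 pp.
      by apply/andP; split; lra.
    - by move=> n; exact: measurable_itv.
    - move=> n; apply/measurable_EFinP; apply: measurable_funS mir => //; exact: FsI.
    - by move=> n x _; rewrite lee_fin invr_ge0 sqrtr_ge0.
  apply: (@le_lt_trans _ _ (pi : R)%:E); last exact: ltry.
  rewrite -(cvg_lim _ cF)//; apply: lime_le; first by apply/cvg_ex; eexists; exact: cF.
  apply: nearW => n; apply: integral_inv_sqrt_rho.
    by have := q1 n; move: (n.+2%:R^-1) => p; lra.
  by have := q0 n; move: (n.+2%:R^-1) => p; lra.
split; first exact: measurable_funX.
apply: (@integrable_bounded _ _ _ (fun x => 512 * (Num.sqrt (rho x))^-1)) => //.
  by do 2 apply: measurable_funX.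
move=> x Ix; rewrite ger0_norm ?sqr_ge0// -exprM; exact: weight_bound.
Qed.

End Weight.

Section BoundedFactor.
Context {R : realType}.
Local Notation mu := (@lebesgue_measure R).
Local Notation I := (@Iset R).

Let mI : measurable I := @measurable_Iset R.

Lemma in_LinftyP (J : set R) (f : R -> R) : measurable J -> in_Linfty J f ->
  measurable_fun J f /\ exists2 M : R, 0 <= M & \forall x \ae mu, J x -> `|f x| <= M.
Proof.
move=> mJ Lf; split.
  apply/(measurable_restrictT _ _).2 => //.
  by move: Lf => /sub_Lfun_mfun; rewrite inE.
move: Lf; rewrite /in_Linfty inE => /andP[_]; rewrite inE/= /finite_norm unlock.
have -> : (0 < mu [set: R])%E.
  apply: (@lt_le_trans _ _ (mu I)); first by rewrite [X in (_ < X)%E]measure_Iset lte_fin.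
  by apply: le_measure => //; rewrite inE.
move=> efin.
have [M M0 eM] : exists2 M : R, 0 <= M & (ess_sup_inf.ess_sup mu (abse \o (EFin \o (f \_ J))) <= M%:E)%E.
  move: efin; case: (ess_sup_inf.ess_sup _ _) => [r _|//|_].
    by exists `|r|; rewrite // lee_fin ler_norm.
  by exists 0; rewrite // leNye.
exists M => //; move/ess_sup_inf.ess_supP : eM => eM; apply: (ae_imp eM) => x /= + Jx.
by rewrite patchE mem_set// lee_fin.
Qed.

Lemma norm_L2_bounded_mul (q f : R -> R) (Q : R) : 0 <= Q -> measurable_fun I q ->
  (\forall x \ae mu, I x -> `|q x| <= Q) -> in_L2 f ->
  in_L2 (fun x => q x * f x) /\ norm_L2 (fun x => q x * f x) <= Q * norm_L2 f.
Proof.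
move=> Q0 mq qQ Lf; have [mf fi] := (in_L2P f).1 Lf.
pose p x := clamp (- Q) Q (q x).
have mp : measurable_fun I p.
  by apply: measurable_maxr => //; exact: measurable_minr.
have QQ : - Q <= Q by lra.
have pQ x : `|p x| <= Q by rewrite ler_norml; exact: clamp_itv.
have pf : eq_L2 (fun x => p x * f x) (fun x => q x * f x).
  by apply: (ae_imp qQ) => x h Ix; rewrite /p clamp_id// -ler_norml h.
have Lpf : in_L2 (fun x => p x * f x).
  by apply/in_L2P; apply: (@sqint_bounded_mul _ Q) => //; exact/in_L2P.
have Lqf : in_L2 (fun x => q x * f x).
  by apply: (eq_in_L2 _ pf Lpf); exact: measurable_funM.
split => //; rewrite -(eq_norm_L2 Lpf Lqf pf) -{1}(ger0_norm Q0) -norm_L2Z//.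
apply: le_norm_L2 => //; first exact: in_L2Z.
move=> x _; rewrite -[(Q *: f) x]/(Q * f x) !normrM ler_wpM2r//.
by rewrite [leRHS]ger0_norm.
Qed.

End BoundedFactor.

Section Smoothstep.
Context {R : realType}.
Local Notation mu := (@lebesgue_measure R).

(** Combinations of shifted squared positive parts are continuously differentiable splines. *)
Definition pos_sqr (x : R) : R := Num.max x 0 ^+ 2.

Lemma pos_sqr_derive (x : R) : is_derive x (1 : R) pos_sqr (2 * Num.max x 0).
Proof.
apply/is_derive1_caratheodory.
exists (fun z => Num.max z 0 + (if z == x then Num.max x 0 else
  (pos_sqr z - pos_sqr x) / (z - x) - Num.max z 0)); split.
- move=> z; case: eqP => [->|/eqP zx]; first by rewrite !subrr mulr0.
  by rewrite addrCA subrr addr0 divfK// subr_eq0.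
- suff c : {for x, continuous (fun z => if z == x then Num.max x 0 else
      (pos_sqr z - pos_sqr x) / (z - x) - Num.max z 0)}.
    by apply: cvgD c; apply: continuous_max; [exact: cvg_id|exact: cvg_cst].
  rewrite /prop_for /continuous_at /= eqxx; apply/cvgrPdist_le => e e0.
  near=> z; case: eqP => [_|/eqP zx]; first by rewrite subrr normr0 ltW.
  have zxe : `|z - x| <= e.
    by rewrite distrC; near: z; move/cvgrPdist_le : (@cvg_id _ (nbhs x)) => /(_ e e0).
  have key : `|Num.max x 0 * (z - x) - (pos_sqr z - pos_sqr x) + Num.max z 0 * (z - x)| <= `|z - x| ^+ 2.
    rewrite real_normK ?num_real// /pos_sqr ler_norml.
    by apply/andP; split; case: (leP z 0) => ?; case: (leP x 0) => ?; nra.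
  have -> : Num.max x 0 - ((pos_sqr z - pos_sqr x) / (z - x) - Num.max z 0) =
      (Num.max x 0 * (z - x) - (pos_sqr z - pos_sqr x) + Num.max z 0 * (z - x)) / (z - x).
    by field; rewrite subr_eq0.
  rewrite normrM normfV ler_pdivrMr ?normr_gt0 ?subr_eq0//.
  by apply: (le_trans key); rewrite expr2 ler_wpM2r.
- by rewrite eqxx -mulr2n mulr_natl.
Unshelve. all: by end_near. Qed.

Lemma max0_continuous : continuous (fun x : R => Num.max x 0).
Proof. by move=> x; apply: continuous_max; [exact: cvg_id|exact: cvg_cst]. Qed.

(** The primitive of [tent]: it rises from 0 to 1 on the unit interval and is constant
outside. *)
Definition smoothstep (t : R) : R :=
  2 * pos_sqr t - 4 * pos_sqr (t - 2^-1) + 2 * pos_sqr (t - 1).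

(** The piecewise linear hat function on [0, 1] with integral 1. *)
Definition tent (t : R) : R :=
  4 * Num.max t 0 - 8 * Num.max (t - 2^-1) 0 + 4 * Num.max (t - 1) 0.

Lemma pos_sqr_shift_derive (c x : R) :
  is_derive x (1 : R) (fun y => pos_sqr (y - c)) (2 * Num.max (x - c) 0).
Proof.
have d : is_derive x (1 : R) (fun y : R => y - c) 1.
  by have := is_deriveB (is_derive_id x (1 : R)) (is_derive_cst c x (1 : R)); rewrite subr0.
by have := @is_derive1_comp _ pos_sqr (fun y => y - c) x _ _ (pos_sqr_derive (x - c)) d; rewrite mulr1.
Qed.

Lemma smoothstep_derive (x : R) : is_derive x (1 : R) smoothstep (tent x).
Proof.
have d0 := pos_sqr_derive x.
have d1 := pos_sqr_shift_derive 2^-1 x.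
have d2 := pos_sqr_shift_derive 1 x.
have E : tent x = 2 * (2 * Num.max x 0) - 4 * (2 * Num.max (x - 2^-1) 0) +
    2 * (2 * Num.max (x - 1) 0) by rewrite /tent; ring.
rewrite E.
exact: (is_deriveD (is_deriveB (is_deriveZ (2 : R) d0) (is_deriveZ (4 : R) d1)) (is_deriveZ (2 : R) d2)).
Qed.

Lemma tent_continuous : continuous tent.
Proof.
have sh c : continuous (fun x : R => Num.max (x - c) 0).
  move=> x; apply: (@continuous_comp _ _ _ (fun x : R => x - c) (fun x => Num.max x 0)).
    by apply: cvgB; [exact: cvg_id|exact: cvg_cst].
  exact: max0_continuous.
move=> x; apply: cvgD; first apply: cvgB.
- by apply: cvgMr; exact: max0_continuous.
- by apply: cvgMr; exact: sh.
- by apply: cvgMr; exact: sh.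
Qed.

Ltac max_cases := repeat match goal with
  |- context [Num.max ?u ?v] => case: (leP u v) => ? end.

Lemma tent_ge0 t : 0 <= tent t.
Proof. by rewrite /tent; max_cases; lra. Qed.

Lemma tent_eq0 t : t <= 0 \/ 1 <= t -> tent t = 0.
Proof. by rewrite /tent => -[h|h]; max_cases; lra. Qed.

Lemma smoothstep_le0 t : t <= 0 -> smoothstep t = 0.
Proof. by rewrite /smoothstep /pos_sqr => h; max_cases; rewrite ?expr0n /=; lra. Qed.

Lemma smoothstep_ge1 t : 1 <= t -> smoothstep t = 1.
Proof.
move=> h; rewrite /smoothstep /pos_sqr !max_l; first by field.
all: by move: h; lra.
Qed.

Lemma smoothstep_itv t : 0 <= smoothstep t <= 1.
Proof.
by rewrite /smoothstep /pos_sqr; apply/andP; split; max_cases; rewrite ?expr0n /=; nra.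
Qed.

Definition ramp (x h t : R) : R := smoothstep ((t - x) / h).
Definition ramp' (x h t : R) : R := tent ((t - x) / h) / h.

Lemma ramp_derive (x h t : R) : is_derive t (1 : R) (ramp x h) (ramp' x h t).
Proof.
have d : is_derive t (1 : R) (fun y : R => (y - x) / h) h^-1.
  have d1 : is_derive t (1 : R) (fun y : R => y - x) 1.
    by have := is_deriveB (is_derive_id t (1 : R)) (is_derive_cst x t (1 : R)); rewrite subr0.
  have := is_deriveZ (h^-1 : R) d1.
  rewrite (_ : h^-1 \*: (fun y : R => y - x) = (fun y : R => (y - x) / h)); last first.
    by apply/funext => y; rewrite -[LHS]/(h^-1 * (y - x)) mulrC.
  by rewrite -[h^-1 *: 1]/(h^-1 * 1) mulr1.
exact: (@is_derive1_comp _ smoothstep (fun y => (y - x) / h) t _ _ (smoothstep_derive _) d).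
Qed.

Lemma ramp'_continuous (x h : R) : continuous (ramp' x h).
Proof.
move=> t; apply: cvgMl; apply: (@continuous_comp _ _ _ (fun t : R => (t - x) / h) tent).
  by apply: cvgMl; apply: cvgB; [exact: cvg_id|exact: cvg_cst].
exact: tent_continuous.
Qed.

Lemma ramp'_ge0 (x h t : R) : 0 < h -> 0 <= ramp' x h t.
Proof. by move=> h0; rewrite mulr_ge0 ?tent_ge0// invr_ge0 ltW. Qed.

Lemma ramp'_eq0 (x h t : R) : 0 < h -> t <= x \/ x + h <= t -> ramp' x h t = 0.
Proof.
move=> h0 H; rewrite /ramp' tent_eq0 ?mul0r//; case: H => H.
  by left; rewrite pmulr_lle0 ?invr_gt0// subr_le0.
by right; rewrite ler_pdivlMr// mul1r lerBrDl.
Qed.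

Lemma C1_FTC (f f' : R -> R) (a b : R) : a < b ->
  (forall x, is_derive x (1 : R) f (f' x)) -> continuous f' ->
  \int[mu]_(x in `[a, b]) f' x = f b - f a.
Proof.
move=> ab df cf'; rewrite /Rintegral (@continuous_FTC2 _ f' f a b)//.
- exact: continuous_subspaceT.
- have cf : continuous f.
    by move=> x; apply: differentiable_continuous; apply/derivable1_diffP; have [] := df x.
  split; [by move=> x _; have [] := df x| |].
    by apply: cvg_at_right_filter; exact: cf.
  by apply: cvg_at_left_filter; exact: cf.
- by move=> x _; rewrite derive1E; apply: derive_val; exact: df.
Qed.

Lemma Rintegral_setT_support (a b : R) (f : R -> R) :
  (forall x, ~ (a <= x <= b) -> f x = 0) ->
  \int[mu]_x f x = \int[mu]_(x in `[a, b]) f x.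
Proof.
move=> f0; rewrite /Rintegral; congr fine.
rewrite [RHS]integral_mkcond; apply: eq_integral => x _.
rewrite patchE; case: ifPn => // /negP xab; rewrite f0// => h.
by apply: xab; apply/mem_set; rewrite /= in_itv.
Qed.

(** For x <= y take as test function the indicator function of [x, y] with edges smoothed
outwards over a length h. Its derivative is a bump before x minus a bump after y, so by
monotonicity the weak derivative formula bounds the increment of beta between x and y by the
supremum of the weak derivative times y - x + 2 h, where h is arbitrary. *)
Lemma W1infty_lipschitz (beta : R -> R) : in_W1infty beta ->
  {homo beta : x y / x <= y} ->
  exists2 L, 0 <= L & forall x y, `|beta x - beta y| <= L * `|x - y|.
Proof.
move=> [_ [g Lg gP]] nd.
have [mg [G G0 gG]] := in_LinftyP measurableT Lg.
exists G => //.
suff H x y h : x <= y -> 0 < h -> beta y - beta x <= G * (y - x + 2 * h).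
  have H' x y : x <= y -> beta y - beta x <= G * (y - x).
    move=> xy; apply/ler_addgt0Pl => e e0.
    have h0 : 0 < e / (2 * (G + 1)) by rewrite divr_gt0//; lra.
    apply: (le_trans (H _ _ _ xy h0)); rewrite mulrDr addrC lerD2r.
    have -> : G * (2 * (e / (2 * (G + 1)))) = e * G / (G + 1) by field; rewrite gt_eqF//; lra.
    by rewrite ler_pdivrMr; [rewrite ler_pM2l//; lra|lra].
  move=> x y; have [xy|/ltW yx] := leP x y.
    by rewrite distrC (distrC x) !ger0_norm ?subr_ge0 ?nd// H'.
  by rewrite !ger0_norm ?subr_ge0 ?nd// H'.
move=> xy h0.
pose phi t := ramp (x - h) h t - ramp y h t.
pose phi' t := ramp' (x - h) h t - ramp' y h t.
have dphi t : is_derive t (1 : R) phi (phi' t) by exact: (is_deriveB (ramp_derive _ _ _) (ramp_derive _ _ _)).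
have dE : derive1 phi = phi' by apply/funext => t; rewrite derive1E; apply: derive_val.
have cphi' : continuous phi'.
  by move=> t; apply: cvgB; exact: ramp'_continuous.
pose a := x - h; pose b := y + h.
have ab : a < b by rewrite /a /b; lra.
have phi0 t : ~ (a <= t <= b) -> phi t = 0.
  move=> tab; have [ta|at_] := ltP t a.
    rewrite /phi /ramp !smoothstep_le0 ?subrr// pmulr_lle0 ?invr_gt0// subr_le0.
      by rewrite (le_trans (ltW ta))// /a; lra.
    exact: ltW.
  have bt : b < t by rewrite ltNge; apply/negP => tb; apply: tab; rewrite at_.
  rewrite /phi /ramp !smoothstep_ge1 ?subrr// ler_pdivlMr// mul1r.
    by move: bt; rewrite /b; lra.
  by move: bt; rewrite /b; lra.
have phi'0 t : ~ (a <= t <= b) -> phi' t = 0.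
  move=> tab; have [ta|at_] := ltP t a.
    rewrite /phi' !ramp'_eq0 ?subrr//; left; first by move: ta; rewrite /a; lra.
    exact: ltW.
  have bt : b < t by rewrite ltNge; apply/negP => tb; apply: tab; rewrite at_.
  rewrite /phi' !ramp'_eq0 ?subrr//; right; first by move: bt; rewrite /b; lra.
  by move: bt; rewrite /b; lra.
have C1 : C1_compact setT phi.
  split; [by move=> t; have [] := dphi t|by rewrite dE|].
  exists `[a, b]; first by split => //; exact: segment_compact.
  move=> t tab; apply: phi0 => h1; apply: tab; by rewrite /= in_itv.
have := gP _ C1; rewrite dE.
rewrite (@Rintegral_setT_support a b (fun t => beta t * phi' t)); last first.
  by move=> t tab; rewrite phi'0 ?mulr0.
rewrite (@Rintegral_setT_support a b (fun t => g t * phi t)); last first.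
  by move=> t tab; rewrite phi0 ?mulr0.
have mab : measurable (`[a, b]%classic : set R) by exact: measurable_itv.
have mbeta : measurable_fun setT beta by exact: nondecreasing_measurable.
have mphi : measurable_fun setT phi.
  apply: continuous_measurable_fun => t; apply: differentiable_continuous.
  by apply/derivable1_diffP; have [] := dphi t.
have mphi' : measurable_fun setT phi' by exact: continuous_measurable_fun.
have phi1 t : `|phi t| <= 1.
  have /andP[h1 h2] := smoothstep_itv ((t - (x - h)) / h).
  have /andP[h3 h4] := smoothstep_itv ((t - y) / h).
  by rewrite ler_norml /phi /ramp; apply/andP; split; lra.
have gphi : `|\int[mu]_(t in `[a, b]) (g t * phi t)| <= G * (y - x + 2 * h).
  pose p t := clamp (- G) G (g t).
  have mp : measurable_fun setT p by apply: measurable_maxr => //; exact: measurable_minr.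
  have GG : - G <= G by lra.
  have pG t : `|p t| <= G by rewrite ler_norml; exact: clamp_itv.
  rewrite (@ae_eq_Rintegral _ _ _ (fun t => p t * phi t))//; last 3 first.
  - by apply: measurable_funTS; exact: measurable_funM.
  - by apply: measurable_funTS; exact: measurable_funM.
  - by apply: (ae_imp gG) => t ht _; rewrite /p clamp_id// -ler_norml ht.
  have ppG t : `|p t * phi t| <= G.
    by rewrite normrM -[leRHS]mulr1 ler_pM.
  have ip : mu.-integrable `[a, b] (EFin \o (fun t => p t * phi t)).
    by apply: (@integrable_itv_bounded _ _ _ G) => //; apply: measurable_funTS; exact: measurable_funM.
  apply: (le_trans (le_normr_Rintegral _ ip)) => //.
  have -> : G * (y - x + 2 * h) = \int[mu]_(t in `[a, b]) (cst G t).
    by rewrite Rintegral_itv_cst ?(ltW ab)// /a /b; congr (_ * _); ring.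
  apply: le_Rintegral => //; [exact: integrable_normr|exact: integrable_itv_cst].
have ir c : mu.-integrable `[a, b] (EFin \o ramp' c h).
  by apply: within_continuous_integrable; apply: continuous_subspaceT; exact: ramp'_continuous.
have r1 c : a <= c -> c + h <= b -> \int[mu]_(t in `[a, b]) ramp' c h t = 1.
  move=> ac cb; rewrite (C1_FTC ab (ramp_derive c h) (@ramp'_continuous c h)).
  rewrite /ramp smoothstep_ge1; last by rewrite ler_pdivlMr// mul1r; move: cb; lra.
  by rewrite smoothstep_le0 ?subr0// pmulr_lle0 ?invr_gt0// subr_le0.
have low : \int[mu]_(t in `[a, b]) (beta t * phi' t) <=
    \int[mu]_(t in `[a, b]) (beta x * ramp' (x - h) h t - beta y * ramp' y h t).
  apply: le_Rintegral => //.
  - have cn : {within `[a, b], continuous (fun t => `|phi' t|)}.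
      by apply: continuous_subspaceT => t; apply: cvg_norm; exact: cphi'.
    have [c _ cP] := EVT_max (ltW ab) cn.
    apply: (@integrable_itv_bounded _ _ _ ((`|beta a| + `|beta b|) * `|phi' c|)).
      by apply: measurable_funTS; exact: measurable_funM.
    move=> t /andP[at_ tb]; rewrite normrM ler_pM//; last by apply: cP; rewrite in_itv/= at_.
    have h1 := nd _ _ at_; have h2 := nd _ _ tb.
    have := ler_norm (beta b); have := ler_norm (- beta a); rewrite normrN.
    rewrite ler_norml; move: (normr_ge0 (beta b)) (normr_ge0 (beta a)).
    by move: (`|beta a|) (`|beta b|) => A B; move=> *; apply/andP; split; lra.
  - apply: (@integrable_subr _ _ (fun t => beta x * ramp' (x - h) h t) (fun t => beta y * ramp' y h t)) => //.
      by apply: integrable_mulr => //; exact: ir.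
    by apply: integrable_mulr => //; exact: ir.
  - move=> t _; rewrite /phi' mulrBr; apply: lerB.
      have [tx|xt] := leP t x.
        by rewrite ler_wpM2r ?ramp'_ge0// nd.
      by rewrite ramp'_eq0 ?mulr0//; right; rewrite subrK ltW.
    have [yt|ty] := leP y t.
      by rewrite ler_wpM2r ?ramp'_ge0// nd.
    by rewrite ramp'_eq0 ?mulr0//; left; exact: ltW.
have hE : \int[mu]_(t in `[a, b]) (beta x * ramp' (x - h) h t - beta y * ramp' y h t) = beta x - beta y.
  rewrite RintegralB//; [|by apply: integrable_mulr => //; exact: ir|by apply: integrable_mulr => //; exact: ir].
  rewrite !RintegralZl//.
  rewrite !r1 ?mulr1//; rewrite /a /b; lra.
rewrite hE in low => E; move: gphi low; rewrite E.
move: (Rintegral _ _ _) => i hi low.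
by move: hi; rewrite ler_norml => /andP[h1 h2]; lra.
Qed.

End Smoothstep.

Section Quartic.
Context {R : realType}.
Implicit Types (u v w : R -> R) (M : R).
Local Notation mu := (@lebesgue_measure R).
Local Notation I := (@Iset R).

Definition quart u (x : R) : R := `|u x| ^+ 3 * u x.

(** Write |a|^3 a - |b|^3 b = |a|^3 (a - b) + (|a| - |b|) (|a|^2 + |a| |b| + |b|^2) b. *)
Lemma quart_increment (a b : R) :
  `| `|a| ^+ 3 * a - `|b| ^+ 3 * b| <= (`|a| + `|b|) ^+ 3 * `|a - b|.
Proof.
have -> : `|a| ^+ 3 * a - `|b| ^+ 3 * b =
    `|a| ^+ 3 * (a - b) + (`|a| - `|b|) * (`|a| ^+ 2 + `|a| * `|b| + `|b| ^+ 2) * b by ring.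
apply: (le_trans (ler_normD _ _)); rewrite !normrM.
have h := ler_dist_dist a b; have A0 := normr_ge0 a; have B0 := normr_ge0 b.
have Q0 : 0 <= `|a| ^+ 2 + `|a| * `|b| + `|b| ^+ 2 by rewrite !addr_ge0 ?sqr_ge0 ?mulr_ge0.
rewrite !normr_id (ger0_norm Q0).
have : `| `|a| - `|b| | * (`|a| ^+ 2 + `|a| * `|b| + `|b| ^+ 2) * `|b| <=
    `|a - b| * (`|a| ^+ 2 + `|a| * `|b| + `|b| ^+ 2) * `|b|.
  by rewrite ler_wpM2r// ler_wpM2r.
have d0 := normr_ge0 (a - b).
move=> h1; apply: le_trans (_ : `|a| ^+ 3 * `|a - b| + `|a - b| * (`|a| ^+ 2 + `|a| * `|b| + `|b| ^+ 2) * `|b| <= _); first by rewrite lerD2l.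
rewrite -subr_ge0.
have -> : (`|a| + `|b|) ^+ 3 * `|a - b| - (`|a| ^+ 3 * `|a - b| + `|a - b| * (`|a| ^+ 2 + `|a| * `|b| + `|b| ^+ 2) * `|b|) = `|a - b| * (2 * `|a| ^+ 2 * `|b| + 2 * `|a| * `|b| ^+ 2) by ring.
by rewrite mulr_ge0// addr_ge0// !mulr_ge0.
Qed.

Lemma V_pointwise u : in_V u -> forall x, I x ->
  `|u x| <= Num.sqrt (@embedding_cst R * (1 + `|artanh x|)) * norm_V u.
Proof.
move=> Vu x Ix; have := V_embedding Vu Ix.
have c0 : 0 <= @embedding_cst R * (1 + `|artanh x|).
  by rewrite mulr_ge0 ?embedding_cst_ge0 ?addr_ge0.
rewrite -[X in _ <= X * _](sqr_sqrtr c0) -exprMn -[u x ^+ 2]real_normK ?num_real//.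
by rewrite ler_pXn2r ?nnegrE ?mulr_ge0 ?sqrtr_ge0 ?norm_V_ge0.
Qed.

Let quart_cst := 8 * @embedding_cst R ^+ 2.

Let quart_cst_ge0 : 0 <= quart_cst.
Proof. by rewrite mulr_ge0// sqr_ge0. Qed.

(** Each of the four factors is at most the square root of the weight times a norm in V; the
product of the four square roots is the square of the weight. *)
Lemma quart_bound u v w M x : in_V u -> in_V v -> in_V w -> norm_V u <= M -> norm_V v <= M ->
  I x -> (`|u x| + `|v x|) ^+ 3 * `|w x| <=
    quart_cst * M ^+ 3 * norm_V w * (1 + `|artanh x|) ^+ 2.
Proof.
move=> Vu Vv Vw uM vM Ix.
have c0 : 0 <= @embedding_cst R * (1 + `|artanh x|).
  by rewrite mulr_ge0 ?embedding_cst_ge0 ?addr_ge0.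
have -> : quart_cst * M ^+ 3 * norm_V w * (1 + `|artanh x|) ^+ 2 =
   (2 * (Num.sqrt (@embedding_cst R * (1 + `|artanh x|)) * M)) ^+ 3 *
   (Num.sqrt (@embedding_cst R * (1 + `|artanh x|)) * norm_V w).
  have E := sqr_sqrtr c0; rewrite /quart_cst.
  transitivity (8 * (@embedding_cst R * (1 + `|artanh x|)) ^+ 2 * M ^+ 3 * norm_V w); first by ring.
  by rewrite -{1}E; ring.
have hu := V_pointwise Vu Ix; have hv := V_pointwise Vv Ix.
have hw := V_pointwise Vw Ix.
have s0 := sqrtr_ge0 (@embedding_cst R * (1 + `|artanh x|)).
have uM' := ler_wpM2l s0 uM; have vM' := ler_wpM2l s0 vM.
have M0 := le_trans (norm_V_ge0 u) uM.
rewrite ler_pM ?exprn_ge0 ?addr_ge0// ler_pXn2r ?nnegrE ?addr_ge0 ?mulr_ge0//.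
by rewrite mulr_natl mulr2n; apply: lerD; [exact: le_trans hu uM'|exact: le_trans hv vM'].
Qed.

Lemma norm_L2_majorized u (c : R) : 0 <= c -> measurable_fun I u ->
  (forall x, I x -> `|u x| <= c * (1 + `|artanh x|) ^+ 2) ->
  in_L2 u /\ norm_L2 u <= c * norm_L2 (fun x : R => (1 + `|artanh x|) ^+ 2).
Proof.
move=> c0 mu_ h.
have Lw : in_L2 (fun x : R => (1 + `|artanh x|) ^+ 2) by apply/in_L2P; exact: weight_sqint.
have Lc : in_L2 (c *: (fun x : R => (1 + `|artanh x|) ^+ 2)) by exact: in_L2Z.
have h' x : I x -> `|u x| <= `|(c *: (fun x : R => (1 + `|artanh x|) ^+ 2)) x|.
  by move=> Ix; apply: (le_trans (h x Ix)); exact: ler_norm.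
have Lu : in_L2 u by apply/in_L2P; apply: (sqint_bounded mu_ _ h'); exact/in_L2P.
by split => //; rewrite -{1}(ger0_norm c0) -norm_L2Z//; exact: le_norm_L2.
Qed.

Lemma quart_measurable u : in_V u -> measurable_fun I (quart u).
Proof.
move=> [/in_L2P[mu_ _] _ _]; apply: measurable_funM => //.
by apply: measurable_funX; exact: measurableT_comp.
Qed.

Lemma quart_in u : in_V u -> in_L2 (quart u).
Proof.
move=> Vu.
have := @norm_L2_majorized (quart u) (quart_cst * norm_V u ^+ 3 * norm_V u).
case => //; last 1 first.
- move=> x Ix; apply: le_trans (quart_bound Vu Vu Vu (lexx _) (lexx _) Ix).
  rewrite /quart normrM ler_wpM2r// ger0_norm ?exprn_ge0// ler_pXn2r ?nnegrE ?addr_ge0//.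
  by rewrite lerDl.
- by apply: mulr_ge0 (norm_V_ge0 _); apply: mulr_ge0 quart_cst_ge0 (exprn_ge0 _ (norm_V_ge0 _)).
- exact: quart_measurable.
Qed.

Lemma quart_lipschitz M : 0 <= M -> exists2 L, 0 <= L & forall u v, in_V u -> in_V v ->
  norm_V u <= M -> norm_V v <= M ->
  norm_L2 (quart u - quart v) <= L * norm_V (u - v).
Proof.
move=> M0; pose W := norm_L2 (fun x : R => (1 + `|artanh x|) ^+ 2).
exists (quart_cst * M ^+ 3 * W).
  by apply: mulr_ge0 (norm_L2_ge0 _); apply: mulr_ge0 quart_cst_ge0 (exprn_ge0 _ M0).
move=> u v Vu Vv uM vM.
have Vuv : in_V (u - v) by rewrite -scaleN1r addrC; exact: in_V_lin.
have := @norm_L2_majorized (quart u - quart v) (quart_cst * M ^+ 3 * norm_V (u - v)).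
rewrite -/W (mulrAC _ W); case => //.
- by apply: mulr_ge0 (norm_V_ge0 _); apply: mulr_ge0 quart_cst_ge0 (exprn_ge0 _ M0).
- by apply: measurable_funB; exact: quart_measurable.
- move=> x Ix; apply: le_trans (quart_bound Vu Vv Vuv uM vM Ix).
  exact: quart_increment.
Qed.

End Quartic.

Section Superposition.
Context {R : realType} (beta : R -> R) (L : R).
Hypotheses (L0 : 0 <= L) (beta_lip : forall x y, `|beta x - beta y| <= L * `|x - y|).
Hypothesis beta_nd : {homo beta : x y / x <= y}.
Implicit Types (u v : R -> R).
Local Notation I := (@Iset R).

Lemma superposition_measurable u : in_L2 u -> measurable_fun I (beta \o u).
Proof.
move=> /in_L2P[mu_ _]; apply: (measurableT_comp _ mu_).
exact: nondecreasing_measurable.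
Qed.

Lemma superposition_in u : in_L2 u -> in_L2 (beta \o u).
Proof.
move=> Lu; apply/in_L2P.
apply: (@sqint_bounded _ _ (fun x => L * `|u x| + `|beta 0|)).
- exact: superposition_measurable.
- apply: sqintD; last exact: sqint_cst.
  apply: sqintZ; move/in_L2P: Lu => su; apply: (sqint_bounded _ su) => [|x _].
    by case: su => mu_ _; exact: measurableT_comp.
  by rewrite normr_id.
move=> x _ /=; rewrite [leRHS]ger0_norm ?addr_ge0 ?mulr_ge0//.
have := beta_lip (u x) 0; rewrite subr0 => h.
by rewrite -[beta (u x)](subrK (beta 0)) (le_trans (ler_normD _ _))// lerD2r.
Qed.

Lemma superposition_lipschitz u v : in_L2 u -> in_L2 v ->
  norm_L2 ((beta \o u) - (beta \o v)) <= L * norm_L2 (u - v).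
Proof.
move=> Lu Lv; have Luv := in_L2B Lu Lv.
rewrite -{1}(ger0_norm L0) -norm_L2Z//; apply: le_norm_L2.
- by apply: in_L2B; exact: superposition_in.
- exact: in_L2Z.
move=> x _; rewrite -[(L *: (u - v)) x]/(L * (u x - v x)) normrM (ger0_norm L0).
exact: beta_lip.
Qed.

Lemma superposition_bound u : in_L2 u ->
  norm_L2 (beta \o u) <= L * norm_L2 u + norm_L2 (cst (beta 0)).
Proof.
move=> Lu; have L00 := @in_L2_0 R.
have Lb : in_L2 (cst (beta 0) : R -> R) by apply/in_L2P; exact: sqint_cst.
have h := superposition_lipschitz Lu L00.
have E : (beta \o u) - (beta \o 0) + cst (beta 0) = beta \o u.
  by apply/funext => x; rewrite -[LHS]/(beta (u x) - beta 0 + beta 0) subrK.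
have Lc : in_L2 ((beta \o u) - (beta \o 0)) by apply: in_L2B; exact: superposition_in.
rewrite -E; apply: (le_trans (norm_L2D Lc Lb)); rewrite lerD2r.
by move: h; rewrite subr0.
Qed.

End Superposition.

Section Extension.
Context {R : realType}.

(** The limit at 0 exists because r(t) + k t is nondecreasing for a Lipschitz constant k, and
the Lipschitz estimate passes to the limit. *)
Lemma ext0_lipschitz (r : R -> R) : [lipschitz r t | t in `]0, +oo[%classic] ->
  exists2 k : R, 0 <= k & forall s t, 0 <= s -> 0 <= t ->
    `|ext0 r s - ext0 r t| <= k * `|s - t|.
Proof.
move=> [k0 [_ kP]]; pose k := Num.max 0 k0 + 1.
have k_ge0 : 0 <= k by rewrite addr_ge0// le_max lexx.
have rk s t : 0 < s -> 0 < t -> `|r s - r t| <= k * `|s - t|.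
  move=> s0 t0; apply: (kP k _ (s, t)).
    by rewrite /k ltr_pwDr// le_max lexx orbT.
  by split; rewrite /= in_itv/= andbT.
have cv : cvg (r s @[s --> 0^'+]).
  pose f s := r s + k * s.
  have fc : f s @[s --> 0^'+] --> inf [set f x | x in `]0, 1[].
    apply: (@nondecreasing_at_right_cvgr _ _ _ (BLeft (1 : R))).
    - by rewrite bnd_simp.
    - move=> s t + + st; rewrite !in_itv/= => /andP[s0 _] /andP[t0 _].
      have := rk s t s0 t0; rewrite ler_norml distrC ger0_norm ?subr_ge0// => /andP[h1 h2].
      by rewrite /f; nra.
    - exists (r 1 - k) => z [s /=]; rewrite in_itv/= => /andP[s0 s1] <-.
      have := rk s 1 s0 ltr01; rewrite ler_norml distrC ger0_norm ?subr_ge0; last exact: ltW.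
      move=> /andP[h1 h2]; by rewrite /f; nra.
  have : (fun s => f s - k * s) @ 0^'+ --> inf [set f x | x in `]0, 1[] - k * 0.
    apply: cvgB; first exact: fc.
    by apply: cvgMr; apply: cvg_at_right_filter; exact: cvg_id.
  have -> : (fun s => f s - k * s) = r by apply/funext => s; rewrite /f addrK.
  by move=> h; apply/cvg_ex; eexists; exact: h.
set l := lim _ in cv.
have lk t : 0 < t -> `|l - r t| <= k * `|0 - t|.
  move=> t0.
  have c1 : (fun s => `|r s - r t|) @ 0^'+ --> `|l - r t|.
    by apply: cvg_norm; apply: cvgB; [exact: cv|exact: cvg_cst].
  have c2 : (fun s => k * `|s - t|) @ 0^'+ --> k * `|0 - t|.
    apply: cvgMr; apply: cvg_norm; apply: cvgB; last exact: cvg_cst.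
    by apply: cvg_at_right_filter; exact: cvg_id.
  by apply: (ler_cvg_to c1 c2); apply: filterS (nbhs_right_gt 0) => s s0; exact: rk.
exists k => // s t s0 t0; rewrite /ext0 -/l.
have [->|sn] := eqVneq s 0; have [->|tn] := eqVneq t 0.
- by rewrite !subrr normr0 mulr0.
- by apply: lk; rewrite lt_def tn.
- by rewrite distrC [X in _ <= _ * X]distrC; apply: lk; rewrite lt_def sn.
- by apply: rk; rewrite lt_def ?sn ?tn.
Qed.

End Extension.

(** Both components of the nonlinearity have this form, with the two unknowns
exchanged. *)
Section Component.
Context {R : realType} (g k c d : R) (rr : R -> R) (q beta : R -> R).
Context (kr Q L : R).
Hypotheses (kr0 : 0 <= kr) (rr_lip : forall s t : R, 0 <= s -> 0 <= t ->
  `|rr s - rr t| <= kr * `|s - t|).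
Hypotheses (Q0 : 0 <= Q) (mq : measurable_fun (@Iset R) q)
  (qQ : \forall x \ae @lebesgue_measure R, Iset x -> `|q x| <= Q).
Hypotheses (L0 : 0 <= L) (beta_lip : forall x y : R, `|beta x - beta y| <= L * `|x - y|)
  (beta_nd : {homo beta : x y / x <= y}).
Implicit Types (u v : R -> R) (s t M K : R).

Definition component t u v : R -> R := fun x =>
  g * (k * (u x - v x) + c * quart v x + d * quart u x + rr t * (q x * beta (u x))).

Lemma componentE t u v : component t u v = g *: (k *: (u - v) + c *: quart v + d *: quart u +
  rr t *: (fun x => q x * (beta \o u) x)).
Proof. by []. Qed.

Lemma source_in u : in_L2 u -> in_L2 (fun x => q x * (beta \o u) x).
Proof. by move=> Lu; have [] := norm_L2_bounded_mul Q0 mq qQ (superposition_in L0 beta_lip beta_nd Lu). Qed.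

Lemma component_in t u v : in_V u -> in_V v -> in_L2 (component t u v).
Proof.
move=> Vu Vv; have [Lu _ _] := Vu; have [Lv _ _] := Vv; rewrite componentE.
apply: (in_L2Z g); apply: in_L2D; last exact: (in_L2Z (rr t) (source_in Lu)).
apply: in_L2D; last exact: (in_L2Z d (quart_in Vu)).
by apply: in_L2D; [exact: (in_L2Z k (in_L2B Lu Lv))|exact: (in_L2Z c (quart_in Vv))].
Qed.

Lemma source_bound u M : in_L2 u -> norm_L2 u <= M ->
  norm_L2 (fun x => q x * (beta \o u) x) <= Q * (L * M + norm_L2 (cst (beta 0))).
Proof.
move=> Lu uM.
have [_ h] := norm_L2_bounded_mul Q0 mq qQ (superposition_in L0 beta_lip beta_nd Lu).
apply: (le_trans h); rewrite ler_wpM2l//.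
apply: (le_trans (superposition_bound L0 beta_lip beta_nd Lu)).
by rewrite lerD2r ler_wpM2l.
Qed.

Lemma source_lipschitz u v : in_L2 u -> in_L2 v ->
  norm_L2 ((fun x => q x * (beta \o u) x) - (fun x => q x * (beta \o v) x)) <=
  Q * (L * norm_L2 (u - v)).
Proof.
move=> Lu Lv.
have Lb : in_L2 ((beta \o u) - (beta \o v)).
  by apply: in_L2B; exact: (superposition_in L0 beta_lip beta_nd).
have [_ h] := norm_L2_bounded_mul Q0 mq qQ Lb.
have -> : (fun x => q x * (beta \o u) x) - (fun x => q x * (beta \o v) x) =
    (fun x => q x * ((beta \o u) - (beta \o v)) x) :> (R -> R).
  by apply/funext => x; rewrite -[LHS]/(q x * beta (u x) - q x * beta (v x)) -mulrBr.
apply: (le_trans h); rewrite ler_wpM2l//.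
exact: superposition_lipschitz.
Qed.

Lemma norm_L2_triangle4 (f1 f2 f3 f4 : R -> R) : in_L2 f1 -> in_L2 f2 -> in_L2 f3 -> in_L2 f4 ->
  norm_L2 (f1 + f2 + f3 + f4) <= norm_L2 f1 + norm_L2 f2 + norm_L2 f3 + norm_L2 f4.
Proof.
move=> h1 h2 h3 h4; have h12 := in_L2D h1 h2; have h123 := in_L2D h12 h3.
apply: (le_trans (norm_L2D h123 h4)); rewrite lerD2r.
apply: (le_trans (norm_L2D h12 h3)); rewrite lerD2r.
exact: norm_L2D.
Qed.

Let norm_scale a (f : R -> R) n : in_L2 f -> norm_L2 f <= n -> norm_L2 (a *: f) <= `|a| * n.
Proof. by move=> Lf fn; rewrite (norm_L2Z _ Lf) ler_wpM2l. Qed.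

Let component_arith (a1 a2 a3 a4 a5 x y z : R) : 0 <= a1 -> 0 <= a2 -> 0 <= a3 ->
  0 <= a4 -> 0 <= a5 -> 0 <= x -> 0 <= y -> 0 <= z ->
  a1 * (x + y) + a2 * y + a3 * x + (a4 * x + a5 * z) <=
  (a1 + a2 + a3 + a4 + a5) * (z + x + y).
Proof.
move=> *; rewrite -subr_ge0.
have -> : (a1 + a2 + a3 + a4 + a5) * (z + x + y) -
  (a1 * (x + y) + a2 * y + a3 * x + (a4 * x + a5 * z)) =
  a1 * z + a2 * (z + x) + a3 * (z + y) + a4 * (z + y) + a5 * (x + y) by ring.
by rewrite !addr_ge0 ?mulr_ge0 ?addr_ge0.
Qed.

(** The difference is split into the linear term, the two quartic terms and the source,
whose difference is r(s) (source u - source u') + (r(s) - r(t)) source u'. *)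
Lemma component_lipschitz K M : exists2 C : R, 0 <= C & forall s t u v u' v',
  0 <= s <= K -> 0 <= t <= K -> in_V u -> in_V v -> in_V u' -> in_V v' ->
  norm_V u <= M -> norm_V v <= M -> norm_V u' <= M -> norm_V v' <= M ->
  norm_L2 (component s u v - component t u' v') <=
    C * (`|s - t| + norm_V (u - u') + norm_V (v - v')).
Proof.
have [M0|M0] := ltP M 0.
  by exists 0 => // s t u v u' v' _ _ _ _ _ _ h; have := le_trans (norm_V_ge0 u) h; rewrite leNgt M0.
have [K0|K0] := ltP K 0.
  by exists 0 => // s t u v u' v' /andP[h1 h2]; have := le_trans h1 h2; rewrite leNgt K0.
have [P P0 hP] := quart_lipschitz M0.
pose B := `|rr 0| + kr * K; pose N := norm_L2 (cst (beta 0) : R -> R).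
have B0 : 0 <= B by rewrite addr_ge0 ?mulr_ge0.
have N0 : 0 <= N by exact: norm_L2_ge0.
pose C1 := `|k| + `|c| * P + `|d| * P + B * (Q * L) + kr * (Q * (L * M + N)).
have C10 : 0 <= C1 by rewrite !addr_ge0 ?mulr_ge0 ?addr_ge0 ?mulr_ge0.
exists (`|g| * C1) => [|s t u v u' v' /andP[s0 sK] /andP[t0 tK] Vu Vv Vu' Vv' uM vM uM' vM'].
  by rewrite mulr_ge0.
have [Lu _ _] := Vu; have [Lv _ _] := Vv; have [Lu' _ _] := Vu'; have [Lv' _ _] := Vv'.
pose su := (fun x => q x * (beta \o u) x) : R -> R; pose su' := (fun x => q x * (beta \o u') x) : R -> R.
have Lsu : in_L2 su by exact: source_in.
have Lsu' : in_L2 su' by exact: source_in.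
pose f1 := k *: ((u - u') - (v - v')) : R -> R.
pose f2 := c *: (quart v - quart v') : R -> R.
pose f3 := d *: (quart u - quart u') : R -> R.
pose f4 := rr s *: (su - su') + (rr s - rr t) *: su' : R -> R.
have -> : component s u v - component t u' v' = g *: (f1 + f2 + f3 + f4).
  apply/funext => x.
  rewrite -[LHS]/(component s u v x - component t u' v' x) /component.
  rewrite -[RHS]/(g * (k * ((u x - u' x) - (v x - v' x)) + c * (quart v x - quart v' x) +
    d * (quart u x - quart u' x) + (rr s * (q x * beta (u x) - q x * beta (u' x)) +
    (rr s - rr t) * (q x * beta (u' x))))).
  by move: (quart v x) (quart v' x) (quart u x) (quart u' x) => *; ring.
have Luu := in_L2B Lu Lu'; have Lvv := in_L2B Lv Lv'.
have Lqu := in_L2B (quart_in Vu) (quart_in Vu'); have Lqv := in_L2B (quart_in Vv) (quart_in Vv').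
have Lss := in_L2B Lsu Lsu'.
have L1 : in_L2 f1 by exact: (in_L2Z k (in_L2B Luu Lvv)).
have L2 : in_L2 f2 by exact: (in_L2Z c).
have L3 : in_L2 f3 by exact: (in_L2Z d).
have L4 : in_L2 f4 by exact: (in_L2D (in_L2Z _ Lss) (in_L2Z _ Lsu')).
have L123 := in_L2D (in_L2D (in_L2D L1 L2) L3) L4.
rewrite (norm_L2Z _ L123) -mulrA ler_wpM2l//.
apply: (le_trans (norm_L2_triangle4 L1 L2 L3 L4)).
have nuu := (norm_L2_le_V (u - u')).1; have nvv := (norm_L2_le_V (v - v')).1.
have b1 : norm_L2 f1 <= `|k| * (norm_V (u - u') + norm_V (v - v')).
  rewrite (norm_L2Z _ (in_L2B Luu Lvv)) ler_wpM2l//.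
  have := norm_L2D Luu (in_L2Z (-1) Lvv); rewrite scaleN1r norm_L2N// => h.
  exact: (le_trans h (lerD nuu nvv)).
have b2 : norm_L2 f2 <= `|c| * P * norm_V (v - v').
  by rewrite -mulrA; exact: (norm_scale c Lqv (hP _ _ Vv Vv' vM vM')).
have b3 : norm_L2 f3 <= `|d| * P * norm_V (u - u').
  by rewrite -mulrA; exact: (norm_scale d Lqu (hP _ _ Vu Vu' uM uM')).
have rsB : `|rr s| <= B.
  have := rr_lip s0 (lexx 0); rewrite subr0 (ger0_norm s0) => h.
  rewrite -[rr s](subrK (rr 0)) (le_trans (ler_normD _ _))// addrC lerD2l (le_trans h)//.
  by rewrite ler_wpM2l.
have b4 : norm_L2 f4 <= B * (Q * L) * norm_V (u - u') + kr * (Q * (L * M + N)) * `|s - t|.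
  have -> : B * (Q * L) * norm_V (u - u') = B * (Q * (L * norm_V (u - u'))) by rewrite !mulrA.
  rewrite [kr * _ * _]mulrAC.
  apply: (le_trans (norm_L2D (in_L2Z _ Lss) (in_L2Z _ Lsu'))).
  rewrite (norm_L2Z _ Lss) (norm_L2Z _ Lsu').
  have x1 := source_lipschitz Lu Lu'.
  have x2 := source_bound Lu' (le_trans (norm_L2_le_V _).1 uM').
  have x3 := rr_lip s0 t0.
  have x4 : Q * (L * norm_L2 (u - u')) <= Q * (L * norm_V (u - u')).
    exact: (ler_wpM2l Q0 (ler_wpM2l L0 nuu)).
  have x5 := norm_L2_ge0 (su - su'); have x6 := norm_L2_ge0 su'.
  have x7 := le_trans x1 x4.
  have y1 := ler_pM (normr_ge0 _) x5 rsB x7.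
  have y2 := ler_pM (normr_ge0 _) x6 x3 x2.
  exact: lerD y1 y2.
apply: (le_trans (lerD (lerD (lerD b1 b2) b3) b4)).
have n1 := norm_V_ge0 (u - u'); have n2 := norm_V_ge0 (v - v'); have n3 := normr_ge0 (s - t).
have c2 : 0 <= `|c| * P by exact: mulr_ge0.
have c3 : 0 <= `|d| * P by exact: mulr_ge0.
have c4 : 0 <= B * (Q * L) by apply: mulr_ge0 B0 (mulr_ge0 Q0 L0).
have c5 : 0 <= kr * (Q * (L * M + N)).
  exact: mulr_ge0 kr0 (mulr_ge0 Q0 (addr_ge0 (mulr_ge0 L0 M0) N0)).
exact: (component_arith (normr_ge0 k) c2 c3 c4 c5 n1 n2 n3).
Qed.

End Component.

Section Reaction.
Context {R : realType} (gamma_a gamma_s lambda sigma_B eps_a : R).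
Context (beta_a beta_s q r : R -> R).
Hypotheses (W_a : in_W1infty beta_a) (W_s : in_W1infty beta_s).
Hypotheses (nd_a : {homo beta_a : x y / x <= y}) (nd_s : {homo beta_s : x y / x <= y}).
Hypotheses (q_bd : in_Linfty Iset q) (r_lip : [lipschitz r t | t in `]0, +oo[%classic]).
Implicit Types (u v : state R) (s t M K : R).
Local Notation G := (reaction gamma_a gamma_s lambda sigma_B eps_a beta_a beta_s q r).

Lemma reactionE t u : G t u =
  (component gamma_a^-1 (- lambda) (eps_a * sigma_B) (- (2 * eps_a * sigma_B)) (ext0 r) q beta_a t u.1 u.2,
   component gamma_s^-1 (- lambda) (eps_a * sigma_B) (- sigma_B) (ext0 r) q beta_s t u.2 u.1).
Proof. by rewrite /reaction /component /quart; congr pair; apply/funext => x; ring. Qed.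

Lemma reaction_in t u : in_V2 u -> in_H2 (G t u).
Proof.
move=> [V1 V2]; have [k k0 rk] := ext0_lipschitz r_lip.
have [mq [Q Q0 qQ]] := in_LinftyP (@measurable_Iset R) q_bd.
have [La La0 hLa] := W1infty_lipschitz W_a nd_a.
have [Ls Ls0 hLs] := W1infty_lipschitz W_s nd_s.
by rewrite reactionE; split; [exact: (component_in _ _ _ _ _ Q0 mq qQ La0 hLa)|
  exact: (component_in _ _ _ _ _ Q0 mq qQ Ls0 hLs)].
Qed.

Lemma eq_reaction t u v : eq_H2 u v -> eq_H2 (G t u) (G t v).
Proof.
by move=> [e1 e2]; split; apply: (ae_imp2 e1 e2) => x h1 h2 Ix;
  rewrite /reaction/= (h1 Ix) (h2 Ix).
Qed.

Lemma norm_V2_ge0 u : 0 <= norm_V2 u. Proof. exact: sqrtr_ge0. Qed.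

Lemma norm_V_le_V2 u : norm_V u.1 <= norm_V2 u /\ norm_V u.2 <= norm_V2 u.
Proof.
have E : norm_V2 u ^+ 2 = norm_V u.1 ^+ 2 + norm_V u.2 ^+ 2.
  by rewrite [LHS]sqr_sqrtr// addr_ge0 ?sqr_ge0.
have h a : 0 <= a -> a ^+ 2 <= norm_V2 u ^+ 2 -> a <= norm_V2 u.
  by move=> a0; rewrite ler_pXn2r// nnegrE norm_V2_ge0.
split; apply: (h _ (norm_V_ge0 _)); rewrite E; [rewrite lerDl|rewrite lerDr]; exact: sqr_ge0.
Qed.

Let double_sum_arith (c c' a x y e : R) : 0 <= c -> 0 <= c' -> 0 <= a -> 0 <= x -> 0 <= y ->
  x <= e -> y <= e -> c * (a + x + y) + c' * (a + y + x) <= 2 * (c + c') * (a + e).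
Proof. by move=> *; nra. Qed.

Lemma reaction_lipschitz K M : exists2 C : R, 0 <= C & forall s t u v,
  0 <= s <= K -> 0 <= t <= K -> in_V2 u -> in_V2 v ->
  norm_V2 u <= M -> norm_V2 v <= M ->
  norm_H2 (G s u - G t v) <= C * (`|s - t| + norm_V2 (u - v)).
Proof.
have [k k0 rk] := ext0_lipschitz r_lip.
have [mq [Q Q0 qQ]] := in_LinftyP (@measurable_Iset R) q_bd.
have [La La0 hLa] := W1infty_lipschitz W_a nd_a.
have [Ls Ls0 hLs] := W1infty_lipschitz W_s nd_s.
have [Ca Ca0 hCa] := component_lipschitz gamma_a^-1 (- lambda) (eps_a * sigma_B)
  (- (2 * eps_a * sigma_B)) k0 rk Q0 mq qQ La0 hLa nd_a K M.
have [Cs Cs0 hCs] := component_lipschitz gamma_s^-1 (- lambda) (eps_a * sigma_B)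
  (- sigma_B) k0 rk Q0 mq qQ Ls0 hLs nd_s K M.
exists (2 * (Ca + Cs)); first by rewrite mulr_ge0// addr_ge0.
move=> s t u v sK tK [Vu1 Vu2] [Vv1 Vv2] uM vM.
have [u1 u2] := norm_V_le_V2 u; have [v1 v2] := norm_V_le_V2 v.
have [d1 d2] := norm_V_le_V2 (u - v).
apply: (le_trans (norm_H2_le_L2 _)); rewrite !reactionE.
have ha := hCa s t _ _ _ _ sK tK Vu1 Vu2 Vv1 Vv2 (le_trans u1 uM) (le_trans u2 uM)
  (le_trans v1 vM) (le_trans v2 vM).
have hs := hCs s t _ _ _ _ sK tK Vu2 Vu1 Vv2 Vv1 (le_trans u2 uM) (le_trans u1 uM)
  (le_trans v2 vM) (le_trans v1 vM).
apply: (le_trans (lerD ha hs)).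
exact: (double_sum_arith Ca0 Cs0 (normr_ge0 (s - t)) (norm_V_ge0 _) (norm_V_ge0 _) d1 d2).
Qed.

End Reaction.

Section Forcing.
Context {R : realType} (ka ks : R) (G : R -> state R -> state R).
Implicit Types (u v : state R) (x y : hspace R) (s t K M : R).
Hypotheses (ka0 : 0 < ka) (ks0 : 0 < ks).
Hypothesis G_in : forall t u, in_V2 u -> in_H2 (G t u).
Hypothesis eq_G : forall t u v, eq_H2 u v -> eq_H2 (G t u) (G t v).
Hypothesis G_lip : forall K M, exists2 C : R, 0 <= C & forall s t u v,
  0 <= s <= K -> 0 <= t <= K -> in_V2 u -> in_V2 v ->
  norm_V2 u <= M -> norm_V2 v <= M ->
  norm_H2 (G s u - G t v) <= C * (`|s - t| + norm_V2 (u - v)).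
Local Notation nV := (formnorm (@hD R ka ks)).

Lemma formnorm_cls u : in_V2 u -> nV (cls u) = norm_H2 u + norm_H2 (wder2 ka ks u).
Proof.
move=> Vu; rewrite /formnorm (hnorm_cls (in_V2_H2 Vu)) hD_cls// hnorm_cls//.
exact: wder2_in.
Qed.

Let norm_V2_le u : norm_V2 u <= norm_V u.1 + norm_V u.2.
Proof.
rewrite -(@ler_pXn2r _ 2) ?nnegrE ?addr_ge0 ?norm_V_ge0 ?norm_V2_ge0//.
rewrite [leLHS]sqr_sqrtr; last by apply: addr_ge0; exact: sqr_ge0.
rewrite sqrrD.
have := norm_V_ge0 u.1; have := norm_V_ge0 u.2.
by move: (norm_V u.1) (norm_V u.2) => a b; nra.
Qed.

Let wder_le (k : R) (w : R -> R) (n : R) : 0 < k -> in_L2 w -> norm_L2 (Num.sqrt k *: w) <= n ->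
  norm_L2 w <= (Num.sqrt k)^-1 * n.
Proof.
move=> k0 Lw; have s0 : 0 < Num.sqrt k by rewrite sqrtr_gt0.
by rewrite (norm_L2Z _ Lw) gtr0_norm// => h; rewrite mulrC ler_pdivlMr// mulrC.
Qed.

(** The diffusivities enter the form norm only; they are bounded below by a positive
constant. *)
Lemma norm_V2_le_formnorm : exists2 c : R, 0 <= c & forall u, in_V2 u ->
  norm_V2 u <= c * nV (cls u).
Proof.
have a0 : 0 <= (Num.sqrt ka)^-1 by rewrite invr_ge0 sqrtr_ge0.
have s0 : 0 <= (Num.sqrt ks)^-1 by rewrite invr_ge0 sqrtr_ge0.
exists (2 + (Num.sqrt ka)^-1 + (Num.sqrt ks)^-1); first by rewrite !addr_ge0.
move=> u Vu; have [[_ _ L1] [_ _ L2]] := Vu.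
apply: (le_trans (norm_V2_le u)); rewrite (formnorm_cls Vu).
have [h1 h2] := norm_L2_le_H2 u; have [h3 h4] := norm_L2_le_H2 (wder2 ka ks u).
have h5 := wder_le ka0 L1 h3; have h6 := wder_le ks0 L2 h4.
have h7 := norm_V_le u.1; have h8 := norm_V_le u.2.
have n0 := norm_H2_ge0 u; have m0 := norm_H2_ge0 (wder2 ka ks u).
move: (_^-1) (_^-1) a0 s0 h5 h6 n0 m0 h1 h2 h7 h8 => a b a0 b0.
rewrite -/(wder u.1) -/(wder u.2).
move: (norm_L2 u.1) (norm_L2 u.2) (norm_L2 (wder u.1)) (norm_L2 (wder u.2))
  (norm_V u.1) (norm_V u.2) (norm_H2 u) (norm_H2 _) => n1 n2 w1 w2 v1 v2 n m.
by move=> h5 h6 n0 m0 h1 h2 h7 h8; clear h3 h4; nra.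
Qed.

Lemma formnorm_le_norm_V2 : exists2 c : R, 0 <= c & forall u, in_V2 u ->
  nV (cls u) <= c * norm_V2 u.
Proof.
have a0 : 0 <= Num.sqrt ka by exact: sqrtr_ge0.
have s0 : 0 <= Num.sqrt ks by exact: sqrtr_ge0.
exists (2 + Num.sqrt ka + Num.sqrt ks); first by rewrite !addr_ge0.
move=> u Vu; have [[_ _ L1] [_ _ L2]] := Vu.
rewrite (formnorm_cls Vu).
have h1 := norm_H2_le_L2 u; have h2 := norm_H2_le_L2 (wder2 ka ks u).
have [v1 v2] := norm_V_le_V2 u.
have [h3 h4] := norm_L2_le_V u.1; have [h5 h6] := norm_L2_le_V u.2.
have h7 := ler_wpM2l a0 (le_trans h4 v1); have h8 := ler_wpM2l s0 (le_trans h6 v2).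
have E1 : norm_L2 (wder2 ka ks u).1 = Num.sqrt ka * norm_L2 (wder u.1).
  by rewrite -[X in X * _](ger0_norm a0); exact: norm_L2Z.
have E2 : norm_L2 (wder2 ka ks u).2 = Num.sqrt ks * norm_L2 (wder u.2).
  by rewrite -[X in X * _](ger0_norm s0); exact: norm_L2Z.
rewrite E1 E2 in h2.
have h9 := lerD (le_trans h3 v1) (le_trans h5 v2).
apply: (le_trans (lerD (le_trans h1 h9) (le_trans h2 (lerD h7 h8)))).
by rewrite -!mulrDl -addrA !mulrDl mul1r !addrA.
Qed.

Definition forcing t x : hspace R := cls (G t (vrep x)).

Lemma forcing_cls t u : in_V2 u -> forcing t (cls u) = cls (G t u).
Proof.
move=> Vu; have [Vr _] := vrepP (hV_cls Vu).
by apply/eq_cls; [exact: G_in|exact: G_in|apply: eq_G; exact: eq_vrep].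
Qed.

Lemma forcing_lipschitz K M : exists2 L : R, 0 <= L & forall s t x y,
  0 <= s <= K -> 0 <= t <= K -> hV x -> hV y -> nV x <= M -> nV y <= M ->
  `|forcing s x - forcing t y| <= L * (`|s - t| + nV (x - y)).
Proof.
have [c c0 hc] := norm_V2_le_formnorm; have [C C0 hC] := G_lip K (c * M).
exists (C * (1 + c)); first by rewrite mulr_ge0// addr_ge0.
move=> s t x y sK tK Vx Vy xM yM.
have [Vu _] := vrepP Vx; have [Vv _] := vrepP Vy.
have Vuv : in_V2 (vrep x - vrep y) by rewrite -scaleN1r addrC; exact: in_V2_lin.
rewrite /forcing -clsB; [|exact: G_in|exact: G_in].
rewrite hnorm_cls; last by apply: in_H2B; exact: G_in.
have hx := hc _ Vu; have hy := hc _ Vv; have hxy := hc _ Vuv.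
rewrite (vrep_cls Vx) in hx; rewrite (vrep_cls Vy) in hy.
rewrite clsB ?vrep_cls// in hxy; [|exact: in_V2_H2|exact: in_V2_H2].
have hM := hC s t _ _ sK tK Vu Vv (le_trans hx (ler_wpM2l c0 xM)) (le_trans hy (ler_wpM2l c0 yM)).
apply: (le_trans hM); rewrite -mulrA ler_wpM2l//.
have n0 : 0 <= nV (x - y) by exact: addr_ge0.
apply: (le_trans (lerD (lexx _) hxy)); move: (nV (x - y)) n0 (`|s - t|) (normr_ge0 (s - t)).
by move=> d d0 e e0; rewrite mulrDl mul1r lerD// ?lerDl// ler_wpM2l// lerDr.
Qed.

End Forcing.

(** * Bochner integrals *)

Section WeakIntegralNorm.
Context {R : realType} {H : completeNormedModType R} {ip : H -> H -> R}.
Context (HI : inner_product ip).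
Implicit Types (f : R -> H) (a b : R).
Local Notation mu := (@lebesgue_measure R).

(** Testing against w bounds |w|^2 by |w| times the integral of |f|, with values in the
extended reals. *)
Lemma wint_norm_le a b f w : measurable_fun `[a, b] (fun s => `|f s|) ->
  wint ip a b f w -> (`|w|%:E <= \int[mu]_(s in `[a, b]) (`|f s|)%:E)%E.
Proof.
move=> mf fw; have [fi fE] := fw w.
have [->|w0] := eqVneq w 0.
  by rewrite normr0; apply: integral_ge0 => s _; rewrite lee_fin.
have W0 : 0 < `|w| by rewrite normr_gt0.
have mi := measurable_int _ fi.
have E : ((`|w| * `|w|)%:E <= \int[mu]_(s in `[a, b]) (`|w| * `|f s|)%:E)%E.
  rewrite -expr2 -(ipxx HI) fE /Rintegral fineK; last exact: integrable_fin_num.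
  apply: (le_trans (lee_abs _)); apply: (le_trans (le_abse_integral _ _ mi)) => //.
  apply: ge0_le_integral => //.
  - exact: measurableT_comp.
  - by apply/measurable_EFinP; exact: measurable_funM.
  - by move=> s _; rewrite /= lee_fin mulrC; exact: cauchy_schwarz.
rewrite (_ : (fun s => (`|w| * `|f s|)%:E) = (fun s => `|w|%:E * (`|f s|)%:E)%E) // in E.
rewrite ge0_integralZl// in E; last exact/measurable_EFinP.
by rewrite EFinM lee_pmul2l in E.
Qed.

(** The square expands into scalar products of f with fixed vectors and indicator
functions. *)
Lemma measurable_norm_sub_simple a b f k (A : 'I_k -> set R) (h : 'I_k -> H) :
  {within `[a, b], continuous f} -> (forall i, measurable (A i)) ->
  measurable_fun `[a, b] (fun s => `|f s - \sum_(i < k) (\1_(A i) s : R) *: h i|).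
Proof.
move=> fc mA.
have mab : measurable (`[a, b]%classic : set R) by exact: measurable_itv.
have m1 i : measurable_fun `[a, b] (\1_(A i) : R -> R).
  by apply: measurable_funTS; exact: measurable_indic.
have mf : measurable_fun `[a, b] (fun s => `|f s|).
  apply: subspace_continuous_measurable_fun => // s.
  by apply: cvg_norm; exact: fc.
have mfh i : measurable_fun `[a, b] (fun s => ip (f s) (h i)).
  apply: subspace_continuous_measurable_fun => // s.
  by apply: (cvg_ip HI); [exact: fc|exact: cvg_cst].
have -> : (fun s => `|f s - \sum_(i < k) (\1_(A i) s : R) *: h i|) =
  (fun s => Num.sqrt (`|f s| ^+ 2 - 2 * (\sum_(i < k) (\1_(A i) s : R) * ip (f s) (h i)) +
    \sum_(i < k) (\1_(A i) s : R) * \sum_(j < k) (\1_(A j) s : R) * ip (h i) (h j))).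
  apply/funext => s; set g := \sum_(i < k) _ *: _.
  have E x : ip g x = \sum_(i < k) (\1_(A i) s : R) * ip (h i) x.
    by rewrite (ip_suml HI); apply: eq_bigr => i _; rewrite (ipZl HI).
  have -> : \sum_(i < k) (\1_(A i) s : R) * ip (f s) (h i) = ip g (f s).
    by rewrite E; apply: eq_bigr => i _; rewrite (ipC HI).
  have -> : \sum_(i < k) (\1_(A i) s : R) * \sum_(j < k) (\1_(A j) s : R) * ip (h i) (h j) = ip g g.
    by rewrite E; apply: eq_bigr => i _; rewrite (ipC HI _ g) E; congr (_ * _);
      apply: eq_bigr => j _; rewrite (ipC HI).
  have -> : `|f s| ^+ 2 - 2 * ip g (f s) + ip g g = `|f s - g| ^+ 2.
    by rewrite -!(ipxx HI) (ipBl HI) !(ipBr HI) (ipC HI (f s) g); ring.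
  by rewrite sqrtr_sqr normr_id.
apply: (@measurableT_comp _ _ _ _ _ _ (@Num.sqrt R)); first exact: (continuous_measurable_fun (@sqrt_continuous R)).
apply: measurable_funD.
  apply: measurable_funB; first exact: measurable_funX.
  apply: measurable_funM => //; apply: measurable_sum => i.
  exact: measurable_funM.
apply: measurable_sum => i; apply: measurable_funM => //.
by apply: measurable_sum => j; exact: measurable_funM.
Qed.

End WeakIntegralNorm.

Section BochnerWeak.
Context {R : realType}.
Implicit Types (f : R -> state R) (w : state R) (t : R).
Local Notation mu := (@lebesgue_measure R).
Local Notation H := (hspace R).
Let HI := @hip_inner_product R.

Let sub_split (V : zmodType) (x y z : V) : x - y = - ((z - x) + (y - z)).
Proof. by rewrite [z - x + _]addrC addrA subrK opprB. Qed.

Let half_sum (x y e : R) : x < e / 2 -> y < e / 2 -> x + y <= e.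
Proof. lra. Qed.

Lemma cls_sum k (a : 'I_k -> R) (h : 'I_k -> state R) : (forall i, in_H2 (h i)) ->
  in_H2 (\sum_(i < k) a i *: h i) /\
  cls (\sum_(i < k) a i *: h i) = \sum_(i < k) a i *: cls (h i).
Proof.
move=> Hh; apply: (big_rec2 (fun (u : state R) (x : H) => in_H2 u /\ cls u = x)).
  by split; [exact: in_H2_0|exact: cls0].
move=> i x u _ [Hu <-]; split; first exact: in_H2_lin.
by rewrite clsD ?clsZ//; exact: in_H2Z.
Qed.

Section Fixed.
Context {t : R} {f : R -> state R} {fX : R -> H}.
Hypotheses (t0 : 0 <= t) (f_in : forall s : R, 0 <= s <= t -> in_H2 (f s)).
Hypothesis fXE : forall s : R, 0 <= s <= t -> fX s = cls (f s).
Hypothesis fXc : {within `[0, t], continuous fX}.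

Let norm_sub_simple k (A : 'I_k -> set R) (h : 'I_k -> state R) (s : R) : 0 <= s <= t ->
  (forall i, in_H2 (h i)) ->
  norm_H2 (f s - \sum_(i < k) (\1_(A i) s : R) *: h i) =
    `|fX s - \sum_(i < k) (\1_(A i) s : R) *: cls (h i)|.
Proof.
move=> st Hh; have [Hs <-] := cls_sum (fun i => \1_(A i) s : R) Hh.
have fs := f_in st; rewrite (fXE st) -(clsB fs Hs) hnorm_cls//.
exact: in_H2B.
Qed.

(** Uniform approximation by step functions gives all the required convergences at once. *)
Lemma wint_bochner w : in_H2 w -> wint (@hip R) 0 t fX (cls w) -> is_bochner_integral t f w.
Proof.
move=> Hw fw; split => //.
pose e n : R := n.+1%:R^-1.
have e0 n : 0 < e n by rewrite invr_gt0.
have h1 n : exists p : {k : nat & (('I_k -> set R) * ('I_k -> R))%type},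
    [/\ forall i, measurable ((projT2 p).1 i) /\ (projT2 p).1 i `<=` `[0, t],
        forall i, 0 <= (projT2 p).2 i <= t &
        forall s : R, 0 <= s <= t ->
          `|fX s - \sum_(i < projT1 p) (\1_((projT2 p).1 i) s : R) *: fX ((projT2 p).2 i)| <= e n].
  have [k [A [c h]]] := step_approximation t0 fXc (e0 n).
  by exists (existT _ k (A, c)).
have [p hp] := choice h1.
pose k n := projT1 (p n).
pose A n : 'I_(k n) -> set R := (projT2 (p n)).1.
pose c n : 'I_(k n) -> R := (projT2 (p n)).2.
pose h n i := f (c n i).
have Hh n i : in_H2 (h n i) by apply: f_in; have [_ + _] := hp n; exact.
have ec : e @ \oo --> 0 by exact: cvg_harmonic.
have cl n i : cls (h n i) = fX (c n i) by rewrite fXE//; have [_ + _] := hp n; exact.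
have ap n (s : R) : 0 <= s <= t -> norm_H2 (f s - \sum_(i < k n) (\1_(A n i) s : R) *: h n i) <= e n.
  move=> st; rewrite norm_sub_simple//; under eq_bigr do rewrite cl.
  by have [_ _] := hp n; exact.
have mA n i : measurable (A n i) /\ A n i `<=` `[0, t] by have [+ _ _] := hp n; exact.
exists k, A, h; split.
- by move=> n i; have [? ?] := mA n i; split.
- apply: ae_all => s st; apply: (squeeze_cvgr _ (cvg_cst 0) ec).
  by apply: nearW => n; rewrite norm_H2_ge0 ap.
- apply: (@squeeze_cvge _ _ _ _ (cst 0%E) _ (fun n => (e n * t)%:E)); last 2 first.
  + exact: cvg_cst.
  + apply: cvg_EFin; first by apply: nearW.
    by rewrite -[X in _ --> X](mul0r t); exact: cvgMl.
  apply: nearW => n; apply/andP; split.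
    by apply: integral_ge0 => s _; rewrite lee_fin norm_H2_ge0.
  have mg : measurable_fun `[0, t] (fun s => `|fX s - \sum_(i < k n) (\1_(A n i) s : R) *: cls (h n i)|).
    by apply: (measurable_norm_sub_simple HI) => // i; have [] := mA n i.
  have -> : (\int[mu]_(s in `[0%R, t]) (norm_H2 (f s - \sum_(i < k n) (\1_(A n i) s : R) *: h n i))%:E =
    \int[mu]_(s in `[0%R, t]) (`|fX s - \sum_(i < k n) (\1_(A n i) s : R) *: cls (h n i)|)%:E)%E.
    by apply: eq_integral => s; rewrite inE /= in_itv/= => st; rewrite norm_sub_simple.
  have -> : (e n * t)%:E = (\int[mu]_(s in `[0%R, t]) (cst (e n)%:E s))%E.
    rewrite integral_cst// EFinM; congr (_ * _)%E; apply: esym.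
    apply: etrans (lebesgue_measure_itv _) _; rewrite /= lte_fin.
    by move: t0; rewrite le_eqVlt => /predU1P[<-|->]; rewrite ?ltxx// sube0.
  apply: ge0_le_integral => //.
  + exact/measurable_EFinP.
  + by move=> s; rewrite /= in_itv/= => st; rewrite lee_fin -norm_sub_simple// ap.
- have lim : (fun n => t * e n) @ \oo --> 0.
    by rewrite -[X in _ --> X](mulr0 t); exact: cvgMr.
  apply: (squeeze_cvgr _ (cvg_cst 0) lim); apply: nearW => n; rewrite norm_H2_ge0/=.
  have [Hs cE] := cls_sum (fun i => fine (mu (A n i))) (Hh n).
  rewrite -hnorm_cls; last exact: in_H2B.
  rewrite clsB// cE -[X in X * _]subr0.
  apply: (wint_le HI t0 (wint_simple HI (fun i => cls (h n i)) (mA n)) fw) => s st.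
  by rewrite distrC -norm_sub_simple// ap.
Qed.

(** The integral of each simple function differs from the weak integral by at most the mean
error, which tends to 0. *)
Lemma bochner_wint w x : is_bochner_integral t f w -> wint (@hip R) 0 t fX x -> cls w = x.
Proof.
move=> [_ Hw [k [A [h [hA _ hint hlim]]]]] fx.
have Hh n i : in_H2 (h n i) by have [] := hA n i.
have mA n i : measurable (A n i) /\ A n i `<=` `[0, t] by have [] := hA n i.
apply/eqP; rewrite -subr_eq0 -normr_le0; apply/ler_addgt0Pl => e e0; rewrite addr0.
have e2 : 0 < e / 2 by rewrite divr_gt0.
have n1 : \forall n \near \oo, (\int[mu]_(s in `[0%R, t]) (norm_H2 (f s -
    \sum_(i < k n) (\1_(A n i) s : R) *: h n i))%:E < (e / 2)%:E)%E.
  by apply: (hint _ (open_ereal_lt' _)); rewrite lte_fin.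
have n2 : \forall n \near \oo, norm_H2 (\sum_(i < k n) fine (mu (A n i)) *: h n i - w) < e / 2.
  by apply: (cvgr_lt _ hlim).
have [n [/= h1 h2]] := filter_ex (filterI n1 n2).
have [Hs cE] := cls_sum (fun i => fine (mu (A n i))) (Hh n).
rewrite -hnorm_cls in h2; last exact: in_H2B.
rewrite (clsB Hs Hw) cE in h2.
have mg : measurable_fun `[0, t] (fun s => `|fX s - \sum_(i < k n) (\1_(A n i) s : R) *: cls (h n i)|).
  by apply: (measurable_norm_sub_simple HI) => // i; have [] := mA n i.
have ws := wint_simple HI (fun i => cls (h n i)) (mA n).
have h3 := wint_norm_le HI mg (wintB HI fx ws).
have E : (\int[mu]_(s in `[0%R, t]) (norm_H2 (f s - \sum_(i < k n) (\1_(A n i) s : R) *: h n i))%:E =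
    \int[mu]_(s in `[0%R, t]) (`|fX s - \sum_(i < k n) (\1_(A n i) s : R) *: cls (h n i)|)%:E)%E.
  by apply: eq_integral => s; rewrite inE /= in_itv/= => st; rewrite norm_sub_simple.
rewrite E in h1; have := le_lt_trans h3 h1; rewrite lte_fin.
move: h2; set y := \sum_(i < k n) _ => h2 h4.
rewrite (sub_split _ _ y) normrN; apply: (le_trans (ler_normD _ _)).
exact: half_sum h2 h4.
Qed.

End Fixed.

End BochnerWeak.

(** * Representatives and classes of mild solutions *)

Section EqMild.
Context {R : realType} {H : completeNormedModType R} {ip : H -> H -> R}.
Context {S : R -> {linear H -> H}} {V : H -> Prop} {D : H -> H} {F : R -> H -> H}.
Implicit Types (a b t : R) (T : R -> H).
Local Notation mild := (@mild R H ip S V D).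

Lemma eq_mild a b x T T' : (forall t, a <= t <= b -> T t = T' t) ->
  mild F a b x T -> mild F a b x T'.
Proof.
move=> E [TV Tc Td]; split.
- by move=> t tab; rewrite -E//; exact: TV.
- move=> t tab; have Tct := Tc t tab.
  apply: cvg_trans Tct; apply: near_eq_cvg; rewrite near_withinE.
  apply: nearW => s; rewrite /= in_itv/= => sab.
  by rewrite !E.
- move=> t tab; rewrite -E//; apply: eq_wint (Td t tab) => s /andP[as_ st].
  by rewrite E// as_ (le_trans st)//; case/andP: tab.
Qed.

End EqMild.

Section Correspondence.
Context {R : realType} {ka ks : R} {S G : R -> state R -> state R}.
Implicit Types (s t b : R) (T : R -> state R) (u v w : state R).
Context (HS : semigroup_generated_by (A2_graph ka ks) S).
Hypotheses (ka0 : 0 < ka) (ks0 : 0 < ks).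
Hypothesis G_in : forall t u, in_V2 u -> in_H2 (G t u).
Hypothesis eq_G : forall t u v, eq_H2 u v -> eq_H2 (G t u) (G t v).
Hypothesis G_lip : forall K M : R, exists2 C : R, 0 <= C & forall s t u v,
  0 <= s <= K -> 0 <= t <= K -> in_V2 u -> in_V2 v ->
  norm_V2 u <= M -> norm_V2 v <= M ->
  norm_H2 (G s u - G t v) <= C * (`|s - t| + norm_V2 (u - v)).
Local Notation H := (hspace R).
Local Notation nV := (formnorm (@hD R ka ks)).
Let HI := @hip_inner_product R.
Let FS := lift_form_semigroup HS ka0 ks0.
Let FL := forcing_lipschitz ka0 ks0 G_in G_lip.
Local Notation mild := (@mild R H (@hip R) (lift HS) (@hV R) (hD ka ks) (forcing G)).

Lemma squeeze_within (D : set R) t (f g : R -> R) (c : R) :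
  (forall s, D s -> 0 <= f s <= c * g s) ->
  g s @[s --> within D (nbhs t)] --> 0 -> f s @[s --> within D (nbhs t)] --> 0.
Proof.
move=> fg g0; have h : (fun s => c * g s) @ within D (nbhs t) --> 0.
  by rewrite -[X in _ --> X](mulr0 c); apply: cvgMr.
apply: (squeeze_cvgr _ (cvg_cst 0) h); rewrite near_withinE; apply: nearW => s.
exact: fg.
Qed.

Lemma V_continuous_cls b T : (forall t, 0 <= t <= b -> in_V2 (T t)) ->
  (forall t, 0 <= t <= b -> norm_V2 (T s - T t) @[s --> within `[0, b] (nbhs t)] --> 0) <->
  V_continuous (hD ka ks) 0 b (cls \o T).
Proof.
move=> TV.
have VB s t : 0 <= s <= b -> 0 <= t <= b -> in_V2 (T s - T t).
  by move=> hs ht; rewrite -scaleN1r addrC; apply: in_V2_lin; exact: TV.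
have E s t : 0 <= s <= b -> 0 <= t <= b -> cls (T s) - cls (T t) = cls (T s - T t).
  by move=> hs ht; rewrite clsB//; apply: in_V2_H2; exact: TV.
split=> h t tb.
- have [c c0 hc] := formnorm_le_norm_V2 ka ks.
  apply: (squeeze_within (c := c) _ (h t tb)) => s; rewrite /= in_itv/= => sb.
  by rewrite E// hc ?andbT; [exact: addr_ge0|exact: VB].
- have [c c0 hc] := norm_V2_le_formnorm ka0 ks0.
  apply: (squeeze_within (c := c) _ (h t tb)) => s; rewrite /= in_itv/= => sb.
  by rewrite norm_V2_ge0 E// hc//; exact: VB.
Qed.

Lemma path_in t T : (forall s, 0 <= s <= t -> in_V2 (T s)) ->
  forall s, 0 <= s <= t -> in_H2 (S (t - s) (G s (T s))).
Proof.
move=> TV s st; apply: (orbit_in HS); first by rewrite subr_ge0; case/andP: st.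
by apply: G_in; exact: TV.
Qed.

Lemma path_cls t T : (forall s, 0 <= s <= t -> in_V2 (T s)) ->
  forall s, 0 <= s <= t ->
  lift HS (t - s) (forcing G s (cls (T s))) = cls (S (t - s) (G s (T s))).
Proof.
move=> TV s st; rewrite forcing_cls//; last exact: TV.
by rewrite lift_cls//; [rewrite subr_ge0; case/andP: st|apply: G_in; exact: TV].
Qed.

Lemma path_continuous t T : (forall s, 0 <= s <= t -> in_V2 (T s)) ->
  V_continuous (hD ka ks) 0 t (cls \o T) ->
  {within `[0, t], continuous (fun s => lift HS (t - s) (forcing G s (cls (T s))))}.
Proof.
move=> TV Tc; apply: (sg_path_continuous HI FS).
apply: (forcing_continuous FS FL (lexx 0) _ Tc) => s st.
by apply: hV_cls; exact: TV.
Qed.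

(** Passing to classes turns almost everywhere identities in the Duhamel formula into
equations, and Bochner integrals into weak ones. *)
Lemma mild_cls b T u : in_V2 u ->
  mild_solution S G u b T <->
  (forall t, 0 <= t <= b -> in_V2 (T t)) /\ mild 0 b (cls u) (cls \o T).
Proof.
move=> Vu; have Hu := in_V2_H2 Vu.
have sub t : 0 <= t <= b -> forall s, 0 <= s <= t -> 0 <= s <= b.
  by move=> /andP[_ tb] s /andP[-> st]; rewrite (le_trans st).
split=> [[TV Tc Td]|[TV [_ Tc Td]]].
- split => //; have Tc' := (V_continuous_cls TV).1 Tc.
  split => // [t tb|t tb]; first by apply: hV_cls; exact: TV.
  have TVt s st := TV s (sub t tb s st).
  have /andP[t0 tb'] := tb.
  have [w [wB Tw]] : exists w, is_bochner_integral t (fun s => S (t - s) (G s (T s))) w /\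
    eq_H2 (T t) (S t u + w) by have [w] := Td t tb; exists w.
  have [W WW] := wint_exists HI t0 (path_continuous TVt (V_continuousS (lexx 0) tb' Tc')).
  have wW := bochner_wint (path_in TVt) (path_cls TVt)
    (path_continuous TVt (V_continuousS (lexx 0) tb' Tc')) wB WW.
  have Hw : in_H2 w by case: wB.
  have HSt : in_H2 (S t u) by exact: (orbit_in HS).
  have E : cls (T t) = cls (S t u + w).
    by apply/eq_cls => //; [apply: in_V2_H2; exact: TV|exact: in_H2D].
  by rewrite subr0 lift_cls// [(cls \o T) t]E clsD// addrAC subrr add0r wW.
- split => // [|t tb]; first exact/V_continuous_cls.
  have TVt s st := TV s (sub t tb s st).
  have /andP[t0 tb'] := tb.
  have HSt : in_H2 (S t u) by exact: (orbit_in HS).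
  have WW := Td t tb; rewrite subr0 lift_cls//= in WW.
  have HT : in_H2 (T t) by apply: in_V2_H2; exact: TV.
  have HW : in_H2 (T t - S t u) by exact: in_H2B.
  rewrite -clsB// in WW.
  exists (T t - S t u); last by rewrite addrC subrK; exact: eq_H2_refl.
  exact: (wint_bochner t0 (path_in TVt) (path_cls TVt)
    (path_continuous TVt (V_continuousS (lexx 0) tb' Tc)) HW WW).
Qed.

End Correspondence.

(** * The maximal solution *)

Section Maximal.
Context {R : realType} {ka ks : R} {S G : R -> state R -> state R}.
Implicit Types (s t b : R) (tau : \bar R) (T : R -> state R) (u v w : state R).
Context (HS : semigroup_generated_by (A2_graph ka ks) S).
Hypotheses (ka0 : 0 < ka) (ks0 : 0 < ks).
Hypothesis G_in : forall t u, in_V2 u -> in_H2 (G t u).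
Hypothesis eq_G : forall t u v, eq_H2 u v -> eq_H2 (G t u) (G t v).
Hypothesis G_lip : forall K M : R, exists2 C : R, 0 <= C & forall s t u v,
  0 <= s <= K -> 0 <= t <= K -> in_V2 u -> in_V2 v ->
  norm_V2 u <= M -> norm_V2 v <= M ->
  norm_H2 (G s u - G t v) <= C * (`|s - t| + norm_V2 (u - v)).
Local Notation H := (hspace R).
Local Notation nV := (formnorm (@hD R ka ks)).
Let HI := @hip_inner_product R.
Let FS := lift_form_semigroup HS ka0 ks0.
Let FL := forcing_lipschitz ka0 ks0 G_in G_lip.
Local Notation mild := (@mild R H (@hip R) (lift HS) (@hV R) (hD ka ks) (forcing G)).

Lemma time_between tau t : (t%:E < tau)%E -> exists2 b, t < b & (b%:E < tau)%E.
Proof.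
case: tau => [z|_|//]; last by exists (t + 1); rewrite ?ltrDl// ltry.
rewrite lte_fin => tz; exists ((t + z) / 2); rewrite ?lte_fin; first exact: (midf_lt tz).1.
exact: (midf_lt tz).2.
Qed.

Lemma local_solution_le u tau tau' T : (tau <= tau')%E ->
  local_solution S G u tau' T -> local_solution S G u tau T.
Proof. by move=> le_tau h b b0 bt; apply: h => //; exact: lt_le_trans bt le_tau. Qed.

Lemma local_solution_unique u tau T T' : in_V2 u ->
  local_solution S G u tau T -> local_solution S G u tau T' -> agree_on tau T T'.
Proof.
move=> Vu lT lT' t t0 tt; have [b tb bt] := time_between tt.
have b0 : 0 < b by exact: le_lt_trans t0 tb.
have [TV Tm] := (mild_cls HS ka0 ks0 G_in eq_G G_lip b T Vu).1 (lT b b0 bt).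
have [TV' Tm'] := (mild_cls HS ka0 ks0 G_in eq_G G_lip b T' Vu).1 (lT' b b0 bt).
have tb' : 0 <= t <= b by rewrite t0 ltW.
apply/(eq_cls (in_V2_H2 (TV t tb')) (in_V2_H2 (TV' t tb'))).
exact: (mild_unique HI FS FL (ltW b0) Tm Tm' tb').
Qed.

Lemma limsup_left_infty (f : R -> R) (z : R) :
  (forall M b, b < z -> exists t, [/\ b < t, t < z & M < f t]) ->
  limf_esup (fun t => (f t)%:E) (z^'-) = +oo%E.
Proof.
move=> h; rewrite limf_esupE; apply/eqP; rewrite -leye_eq; apply: le_ereal_inf_tmp.
move=> _ [A [d /= d0 hA] <-]; rewrite leye_eq; apply/eqP/eqyP => M _.
have zd : z - d < z by rewrite ltrBlDr ltrDl.
have [t [t1 t2 t3]] := h M _ zd.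
apply: (@le_trans _ _ (f t)%:E); first by rewrite lee_fin ltW.
apply: ereal_sup_ubound; exists t => //; apply: hA => //=.
by rewrite gtr0_norm ?subr_gt0// ltrBlDr -ltrBlDl.
Qed.

(** The maximal solution consists of the representatives in V x V of the abstract one. A
maximal solution with another time would either be defined at [tau] itself, where no mild solution
exists, or be extended by T. *)
Theorem semilinear_maximal_solution u : in_V2 u -> exists tau T,
  [/\ maximal_solution S G u tau T,
      forall tau' T', maximal_solution S G u tau' T' -> tau' = tau /\ agree_on tau T T' &
      tau = +oo%E \/ (tau < +oo)%E /\
      limf_esup (fun t => (norm_V2 (T t))%:E) ((fine tau)^'-) = +oo%E].
Proof.
move=> Vu.
have [tau [X [tau0 Xm Xmax Xblow]]] := mild_maximal HI FS FL (hV_cls Vu).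
have XV t : 0 <= t -> (t%:E < tau)%E -> hV (X t).
  move=> t0 tt; have [b tb bt] := time_between tt.
  by have [VX _ _] := Xm b (le_lt_trans t0 tb) bt; apply: VX; rewrite t0 ltW.
pose T t := vrep (X t).
have TE t : 0 <= t -> (t%:E < tau)%E -> cls (T t) = X t.
  by move=> t0 tt; apply: vrep_cls; exact: XV.
have TV t : 0 <= t -> (t%:E < tau)%E -> in_V2 (T t).
  by move=> t0 tt; have [] := vrepP (XV t t0 tt).
have lT : local_solution S G u tau T.
  move=> b b0 bt.
  have tt t : 0 <= t <= b -> 0 <= t /\ (t%:E < tau)%E.
    by move=> /andP[t0 tb]; split => //; apply: le_lt_trans bt; rewrite lee_fin.
  apply/(mild_cls HS ka0 ks0 G_in eq_G G_lip b T Vu); split.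
    by move=> t /tt[t0 h]; exact: TV.
  by apply: eq_mild (Xm b b0 bt) => t /tt[t0 h]; rewrite /= TE.
have maxT tau' T' : (tau < tau')%E -> ~ local_solution S G u tau' T'.
  move: tau tau0 Xmax {Xm Xblow XV T TE TV lT} => [z|_ _|//]; last by case: tau' => // ? /=.
  rewrite lte_fin => z0 Xmax zt lT'.
  have [_ Tm] := (mild_cls HS ka0 ks0 G_in eq_G G_lip z T' Vu).1 (lT' z z0 zt).
  by have := Xmax z _ (ltW z0) Tm; rewrite ltxx.
exists tau, T; split.
- by split => // tau' T' lt_tau _; exact: maxT.
- move=> tau' T' [tau'0 lT' maxT'].
  have E : tau' = tau.
    apply/eqP; rewrite eq_le; apply/andP; split; rewrite leNgt; apply/negP => lt_tau.
      exact: maxT lt_tau lT'.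
    apply: (maxT' tau T lt_tau _ lT).
    exact: (local_solution_unique Vu lT' (local_solution_le (ltW lt_tau) lT)).
  by split => //; apply: (local_solution_unique Vu lT); rewrite -E.
- case: (ltP tau +oo%E) => [tauy|]; last by rewrite leye_eq => /eqP; left.
  have tauE : ((fine tau)%:E = tau)%E by rewrite fineK// ge0_fin_numE// ltW.
  right; split => //; apply: limsup_left_infty => M b; rewrite -lte_fin tauE => bz.
  have [c c0 hc] := formnorm_le_norm_V2 ka ks.
  have [t [bt t0 tz hM]] := Xblow tauy (c * M) b bz.
  exists t; split => //; first by rewrite -lte_fin tauE.
  rewrite ltNge; apply/negP => TM.
  have := hc _ (TV t (ltW t0) tz); rewrite TE ?(ltW t0)// => h.
  by have := lt_le_trans hM (le_trans h (ler_wpM2l c0 TM)); rewrite ltxx.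
Qed.

End Maximal.

Theorem proposition2p14 (R : realType)
  (gamma_a gamma_s kappa_a kappa_s sigma_B eps_a lambda theta0 : R)
  (beta_a beta_s q r : R -> R) (S : R -> state R -> state R) (T0 : state R) :
  0 < gamma_a -> 0 < gamma_s -> 0 < kappa_a -> 0 < kappa_s ->
  0 < sigma_B -> 0 < eps_a -> 0 <= lambda ->
  in_W1infty beta_a -> in_W1infty beta_s ->
  {homo beta_a : x y / x <= y} -> {homo beta_s : x y / x <= y} ->
  0 < theta0 < 1 -> loc_holder theta0 q -> in_Linfty Iset q ->
  (forall x : R, Iset x -> 0 <= q x) ->
  (forall t : R, 0 < t -> 0 < r t) ->
  [bounded r t | t in `]0, +oo[] -> [lipschitz r t | t in `]0, +oo[] ->
  semigroup_generated_by (A2_graph kappa_a kappa_s) S ->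
  in_V2 T0 ->
  let G := reaction gamma_a gamma_s lambda sigma_B eps_a beta_a beta_s q r in
  exists (tau : \bar R) (T : R -> state R),
    [/\ maximal_solution S G T0 tau T,
        forall (tau' : \bar R) (T' : R -> state R),
          maximal_solution S G T0 tau' T' -> tau' = tau /\ agree_on tau T T' &
        tau = +oo%E \/
        (tau < +oo)%E /\
        limf_esup (fun t => (norm_V2 (T t))%:E) ((fine tau)^'-) = +oo%E].
Proof.
move=> _ _ ka0 ks0 _ _ _ Wa Ws nda nds _ _ q_bd _ _ _ r_lip HS VT0 G.
apply: (semilinear_maximal_solution HS ka0 ks0 _ _ _ VT0).
- by move=> t u; exact: reaction_in.
- by move=> t u v; exact: eq_reaction.
- by move=> K M; exact: reaction_lipschitz.
Qed.
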